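(* Let $c>0$, let $P_0$ be a non-atomic probability measure on a complete separable metric space $\mathcal X$ with Borel $\sigma$-algebra $\mathscr X$, and let $(\tilde\mu_1,\tilde\mu_2)$ be a pair of gamma random measures, each marginally a gamma completely random measure with parameter $(c,P_0)$, in canonical correlation. Then $(\tilde\mu_1,\tilde\mu_2)$ has independent increments if and only if there exists a (deterministic) probability kernel $Q$ from $\mathcal X$ to $\mathcal B([0,1])$ such that, for every $A\in\mathscr X$ with $P_0(A)>0$, the canonical correlation coefficients of $(\tilde\mu_1(A),\tilde\mu_2(A))$ are the moments $\rho_n(A)=\mathbb E[Z_A^n]$, $n\in\mathbb Z_+$, where $$Z_A\overset{d}{=}\int_0^1 s\,\tilde p_A(\mathrm ds),$$ with $\tilde p_A$ a Dirichlet process on $[0,1]$ with parameters $(cP_0(A),G_A)$ and $$G_A(\mathrm ds):=\frac{\int_A Q(x;\mathrm ds)\,P_0(\mathrm dx)}{P_0(A)}.$$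
   Context: A completely random measure (CRM) is a random boundedly finite measure whose values on disjoint sets are independent. A gamma CRM with parameter $(c,P_0)$ is the CRM $\tilde\mu$ with $\mathbb E[e^{-\int f\,\mathrm d\tilde\mu}]=\exp\{-c\int\log(1+f)\,\mathrm dP_0\}$ for measurable $f\ge0$ with $\int\log(1+f)\,\mathrm dP_0<\infty$. A Dirichlet process with parameters $(a,G)$, $a>0$ and $G$ a probability measure, is the random probability measure obtained by normalising a gamma CRM with parameter $(a,G)$ by its total mass (Dirichlet process with base measure $aG$). For $\alpha>0$, $\tilde L_{n,\alpha}(x)=(-1)^n(\alpha)_n\,{}_1F_1(-n;\alpha;x)$ is the monic Laguerre polynomial, orthogonal for $\Gamma_{\alpha,1}(\mathrm dx)=\Gamma(\alpha)^{-1}x^{\alpha-1}e^{-x}\mathrm dx$ on $(0,\infty)$ with squared norm $c_{n,\alpha}=n!(\alpha)_n$, $(\alpha)_n=\Gamma(\alpha+n)/\Gamma(\alpha)$. Random vectors $\boldsymbol X,\boldsymbol Y$ in $[0,\infty)^d$ with common law $\times_{i=1}^d\Gamma_{\alpha_i,1}$ are canonically correlated with canonical correlation coefficients $(\rho_{\boldsymbol n})_{\boldsymbol n\in\mathbb Z_+^d}$ if $\mathbb E\big[\prod_i\tilde L_{n_i,\alpha_i}(X_i)\prod_i\tilde L_{m_i,\alpha_i}(Y_i)\big]=\rho_{\boldsymbol n}\delta_{\boldsymbol n,\boldsymbol m}\prod_ic_{n_i,\alpha_i}$ for all $\boldsymbol n,\boldsymbol m$. The pair $(\tilde\mu_1,\tilde\mu_2)$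 is in canonical correlation if for every finite collection $\{A_1,\dots,A_d\}$ of pairwise disjoint Borel sets (it suffices to take $P_0(A_i)>0$) the vectors $(\tilde\mu_1(A_i))_i$ and $(\tilde\mu_2(A_i))_i$ are canonically correlated, with $\alpha_i=cP_0(A_i)$; the coefficients are denoted $\rho_{\boldsymbol n}(A_1,\dots,A_d)$. $(\tilde\mu_1,\tilde\mu_2)$ has independent increments if the pairs $(\tilde\mu_1(A_i),\tilde\mu_2(A_i))$, $i=1,\dots,d$, are independent for all pairwise disjoint Borel $A_1,\dots,A_d$. *)

(* Defs.v *)
From HB Require Import structures.
From mathcomp Require Import all_boot all_order all_algebra.
From mathcomp Require Import all_classical all_reals all_analysis.
From mathcomp Require Import measurable_realfun.

Set Implicit Arguments.
Unset Strict Implicit.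
Unset Printing Implicit Defensive.

Import Order.TTheory GRing.Theory Num.Theory.
Import numFieldNormedType.Exports.

Local Open Scope classical_set_scope.
Local Open Scope ring_scope.

(* Measurable types of the library are pointed, so nonempty spaces only. *)
#[short(type="pmetricType")]
HB.structure Definition PointedMetric (K : numDomainType) :=
  { M of Metric K M & isPointed M }.

#[short(type="completePMetricType")]
HB.structure Definition CompletePMetric (K : numDomainType) :=
  { M of PointedMetric K M & Uniform_isComplete M }.

Definition separable_space (X : topologicalType) :=
  exists2 D : set X, countable D & dense D.

Definition borel (X : ptopologicalType) := g_sigma_algebraType (@open X).


Section unit_interval.
Context (R : realType).

Definition unit_itv := {x : R | 0 <= x <= 1}.

HB.instance Definition _ := Choice.on unit_itv.

Let unit_itv0 : unit_itv := exist _ 0 (introT andP (conj (lexx 0) ler01)).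

HB.instance Definition _ := isPointed.Build unit_itv unit_itv0.

Let dist (x y : unit_itv) : R := `|sval x - sval y|.

Let distxx x : dist x x = 0.
Proof. by rewrite /dist subrr normr0. Qed.

Let dist_positivity x y : dist x y = 0 -> x = y.
Proof. by move/normr0_eq0/eqP; rewrite subr_eq0 => /eqP /val_inj. Qed.

Let dist_sym x y : dist x y = dist y x.
Proof. exact: distrC. Qed.

Let dist_triangle y x z : dist x z <= dist x y + dist y z.
Proof. exact: ler_distD. Qed.

HB.instance Definition _ :=
  isMetric.Build R unit_itv distxx dist_positivity dist_sym dist_triangle.

End unit_interval.

Section generalities.
Local Open Scope ereal_scope.
Context d (T : measurableType d) (R : realType) (P : probability T R).

Definition atom (A : set T) :=
  [/\ measurable A, 0 < P A &
      forall B, measurable B -> B `<=` A -> P B = 0 \/ P B = P A].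

Definition nonatomic := forall A, ~ atom A.

Definition independent_rvs d' (T' : measurableType d') k
    (X : 'I_k -> T -> T') :=
  forall B : 'I_k -> set T', (forall i, measurable (B i)) ->
    P (\bigcap_(i in [set: 'I_k]) (X i @^-1` B i)) =
    \prod_(i < k) P (X i @^-1` B i).

End generalities.

Section random_measures.
Local Open Scope ereal_scope.
Context d (Omega : measurableType d) (R : realType) (P : probability Omega R)
  (X : pmetricType R).

Definition metric_bounded (B : set X) := exists x r, B `<=` ball x r.

(* A kernel from Omega to X is a random element of the space of measures on X
   with the sigma-algebra generated by the evaluations; boundedly finite
   measures are those finite on bounded Borel sets. *)
Definition boundedly_finite (mu : R.-ker Omega ~> borel X) :=
  forall w (B : set (borel X)),
    measurable B -> metric_bounded B -> mu w B < +oo.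

Definition completely_random (mu : R.-ker Omega ~> borel X) :=
  boundedly_finite mu /\
  forall k (A : 'I_k -> set (borel X)), (forall i, measurable (A i)) ->
    trivIset [set: 'I_k] A -> independent_rvs (T' := \bar R) P (fun i w => mu w (A i)).

Definition gamma_crm (c : R) (P0 : probability (borel X) R)
    (mu : R.-ker Omega ~> borel X) :=
  completely_random mu /\
  forall f : borel X -> R, measurable_fun [set: borel X] f ->
    (forall x, (0 <= f x)%R) ->
    \int[P0]_x (ln (1 + f x))%:E < +oo ->
    \int[P]_w expeR (- \int[mu w]_x (f x)%:E) =
    expeR (- (c%:E * \int[P0]_x (ln (1 + f x))%:E)).

(* The total mass is in ]0, +oo[ almost surely. *)
Definition dirichlet_process (a : R) (G : probability (borel X) R)
    (p : R.-pker Omega ~> borel X) :=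
  exists2 mu : R.-ker Omega ~> borel X, gamma_crm a G mu &
    {ae P, forall w, forall U, measurable U ->
      p w U = (fine (mu w U) / fine (mu w [set: borel X]))%:E}.

Definition independent_increments (mu1 mu2 : R.-ker Omega ~> borel X) :=
  forall k (A : 'I_k -> set (borel X)), (forall i, measurable (A i)) ->
    trivIset [set: 'I_k] A ->
    independent_rvs (T' := (\bar R * \bar R)%type) P
      (fun i w => (mu1 w (A i), mu2 w (A i))).

End random_measures.

Definition dirichlet_mean (R : realType) (a : R)
    (G : probability (borel (unit_itv R)) R) d (T : measurableType d)
    (PT : probability T R) (Z : {RV PT >-> R}) :=
  exists d' (T' : measurableType d') (PT' : probability T' R)
    (p : R.-pker T' ~> borel (unit_itv R)),
    dirichlet_process PT' a G p /\
    forall B : set R, measurable B ->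
      PT (Z @^-1` B) =
      PT' ((fun w => \int[p w]_(s in [set: borel (unit_itv R)]) sval s)
             @^-1` B).

Section laguerre.
Context (R : realType).
Implicit Types (a b x : R) (n k : nat).

Definition Gamma_fun a : R :=
  \int[lebesgue_measure]_(x in `]0, +oo[) (x `^ (a - 1) * expR (- x)).

Definition gamma_law a (B : set R) : \bar R :=
  (\int[lebesgue_measure]_(x in B `&` `]0%R, +oo[)
     ((Gamma_fun a)^-1 * x `^ (a - 1) * expR (- x))%:E)%E.

(* Pochhammer symbol of a positive a *)
Definition pochhammer a n : R := Gamma_fun (a + n%:R) / Gamma_fun a.

(* Pochhammer symbol of an arbitrary a, where the quotient of Gamma values
   need not be defined *)
Definition rising a k : R := \prod_(i < k) (a + i%:R).

Definition hypergeo1F1 a b x : R :=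
  limn (series (fun k => rising a k / rising b k * (x ^+ k / k`!%:R))).

Definition laguerre n a x : R :=
  (-1) ^+ n * pochhammer a n * hypergeo1F1 (- n%:R) a x.

Definition laguerre_sqnorm n a : R := n`!%:R * pochhammer a n.

End laguerre.

Section canonical_correlation.
Context d (Omega : measurableType d) (R : realType) (P : probability Omega R).

Definition nneg_random_vector k (X : 'I_k -> Omega -> R) :=
  forall i, measurable_fun [set: Omega] (X i) /\ forall w, 0 <= X i w.

Definition has_product_gamma_law k (alpha : 'I_k -> R)
    (X : 'I_k -> Omega -> R) :=
  forall B : 'I_k -> set R, (forall i, measurable (B i)) ->
    P (\bigcap_(i in [set: 'I_k]) (X i @^-1` B i)) =
    (\prod_(i < k) gamma_law (alpha i) (B i))%E.

Definition canonically_correlated k (alpha : 'I_k -> R)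
    (X Y : 'I_k -> Omega -> R) (rho : {ffun 'I_k -> nat} -> R) :=
  [/\ nneg_random_vector X, nneg_random_vector Y,
      has_product_gamma_law alpha X, has_product_gamma_law alpha Y &
      forall n m : {ffun 'I_k -> nat},
        ('E_P[fun w => (\prod_(i < k) laguerre (n i) (alpha i) (X i w) *
                       \prod_(i < k) laguerre (m i) (alpha i) (Y i w))%R])%E =
        (rho n * (n == m)%:R *
          \prod_(i < k) laguerre_sqnorm (n i) (alpha i))%:E].

(* A gamma CRM has finite total mass almost surely, not surely; [fine] sends
   the value +oo to 0. *)
Definition increments (X : pmetricType R) (mu : R.-ker Omega ~> borel X) k
    (A : 'I_k -> set (borel X)) : 'I_k -> Omega -> R :=
  fun i w => fine (mu w (A i)).

Definition increment_shapes (X : pmetricType R) (c : R)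
    (P0 : probability (borel X) R) k (A : 'I_k -> set (borel X)) : 'I_k -> R :=
  fun i => c * fine (P0 (A i)).

Definition canonical_coefficients (X : pmetricType R) (c : R)
    (P0 : probability (borel X) R) (mu1 mu2 : R.-ker Omega ~> borel X) k
    (A : 'I_k -> set (borel X)) (rho : {ffun 'I_k -> nat} -> R) :=
  canonically_correlated (increment_shapes c P0 A)
    (increments mu1 A) (increments mu2 A) rho.

(* alpha > 0 is needed, whence the restriction to sets of positive measure *)
Definition in_canonical_correlation (X : pmetricType R) (c : R)
    (P0 : probability (borel X) R) (mu1 mu2 : R.-ker Omega ~> borel X) :=
  forall k (A : 'I_k -> set (borel X)), (forall i, measurable (A i)) ->
    trivIset [set: 'I_k] A -> (forall i, (0 < P0 (A i))%E) ->
    exists rho, canonical_coefficients c P0 mu1 mu2 A rho.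

End canonical_correlation.

Section mixture.
Local Open Scope ereal_scope.
Context d d' (X : measurableType d) (Y : measurableType d') (R : realType)
  (P0 : probability X R) (Q : R.-pker X ~> Y) (A : set X).

Definition mixture (mA : measurable A) (PA0 : 0 < P0 A) (U : set Y) : \bar R :=
  (\int[P0]_(x in A) Q x U) * (fine (P0 A))^-1%:E.

Hypotheses (mA : measurable A) (PA0 : 0 < P0 A).

Let mixture0 : mixture mA PA0 set0 = 0.
Proof.
rewrite /mixture (eq_integral (cst 0)) ?integral0 ?mul0e// => x _.
by rewrite measure0.
Qed.

Let invPA_ge0 : 0 <= (fine (P0 A))^-1%:E.
Proof. by rewrite lee_fin invr_ge0 fine_ge0. Qed.

Let mixture_ge0 U : 0 <= mixture mA PA0 U.
Proof. by apply: mule_ge0 => //; apply: integral_ge0. Qed.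

Let mixture_sigma_additive : semi_sigma_additive (mixture mA PA0).
Proof.
move=> F mF tF mUF; rewrite /mixture.
have mQ U : measurable U -> measurable_fun A (Q ^~ U).
  by move=> mU; apply: measurable_funTS; exact: measurable_kernel.
rewrite (eq_integral (fun x => \sum_(i <oo) Q x (F i))); last first.
  by move=> x _; apply/esym/cvg_lim => //; exact: measure_semi_sigma_additive.
rewrite integral_nneseries//; last by move=> n; exact: mQ.
rewrite [X in X @ _ --> _](_ : _ =
    (fun n => \sum_(0 <= i < n) \int[P0]_(x in A) Q x (F i)) \*
    cst (fine (P0 A))^-1%:E); last first.
  apply/funext => n; rewrite /= ge0_sume_distrl// => i _.
  exact: integral_ge0.
apply: cvgeZr => //; apply: is_cvg_nneseries => n _ _.
exact: integral_ge0.
Qed.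

HB.instance Definition _ := isMeasure.Build _ _ _ (mixture mA PA0)
  mixture0 mixture_ge0 mixture_sigma_additive.

Let mixture_setT : mixture mA PA0 [set: Y] = 1.
Proof.
rewrite /mixture (eq_integral (cst 1)); last by move=> x _; exact: prob_kernel.
have PAfin : P0 A \is a fin_num by exact: fin_num_measure.
rewrite integral_cst// mul1e -[X in X * _]fineK// -EFinM divff//.
by rewrite gt_eqF// fine_gt0// PA0 ltey_eq PAfin.
Qed.

HB.instance Definition _ := Measure_isProbability.Build _ _ _
  (mixture mA PA0) mixture_setT.

End mixture.

(* Main.v *)
(** Write [U_i = mu1(A_i)], [V_i = mu2(A_i)] and [ell_n] for the monic Laguerre polynomial
    divided by [n!].  Under the tilted laws with density proportional to [prod_i U_i^M], the
    moments of [V_i / U_i] converge, as [M] goes to infinity, to the canonical correlation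
    coefficients.  The latter are therefore the moments of a positive functional [Lam] on
    polynomials, for which each coordinate behaves as a [[0,1]]-valued variable.

    Let [c_n(A) = E(ell_n(mu1 A) ell_n(mu2 A))] and let [kap_l(A)] be its cumulants,
    [n c_n = sum_l kap_l c_(n-l)].  If [rho_n(A)] are the moments of the mean of a Dirichlet
    process with base measure [c P0(A) G_A], then [kap_l(A) = c P0(A) int s^l G_A(ds)], which is
    additive in [A].  Split one set [B] into [m] pieces [B_i] of equal measure: by Newton's
    identities and additivity the power sums [sum_i a_i v_i^l] converge to [kap_l(B)] in
    [L^2(Lam)], hence decorrelate from everything else.  So the joint coefficients factorize,
    then the joint moments, and gamma laws are determined by their moments.

    Conversely, independent increments make [kap_l] additive.  As [kap_l(A)] is equivalent to
    [c P0(A) rho_l(A)] when [P0(A)] is small and [rho(A)] is completely monotone, so is [kap(A)];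
    Radon-Nikodym densities of the [kap_l] and the Hausdorff moment problem then give [Q].  The
    required Dirichlet process exists on the given probability space: push [mu1] restricted to
    [A] forward by a map that sends [P0(. | A)] to [G_A], and normalize. *)

Require Import Defs.
From HB Require Import structures.
From mathcomp Require Import all_boot all_order all_algebra.
From mathcomp Require Import all_classical all_reals all_analysis.
From mathcomp Require Import measurable_realfun.
From mathcomp Require Import ring lra zify.

Set Implicit Arguments.
Unset Strict Implicit.
Unset Printing Implicit Defensive.

Import Order.TTheory GRing.Theory Num.Theory.
Import numFieldNormedType.Exports.

Local Open Scope classical_set_scope.
Local Open Scope ring_scope.

(** * Cumulants of sequences and Laguerre polynomials *)

Section convolution.
Context {R : realType}.
Implicit Types (u v w kap : nat -> R) (a b x y : R).

(** The obstacle: the condition on [Q] fixes coefficients of single sets and says nothing about how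
    disjoint sets interact. Refinement supplies this: a small piece has cumulants [a_i rho_l] up to
    an error quadratic in [a_i], so the means of the power sums are known in the limit, and Newton's
    identities then force their second moments.

    Division by [n!] is chosen for the generating function [(1 + t)^(-a) exp (x t / (1 + t))], which
    is multiplicative in [(a, x)]: disjoint union becomes convolution and cumulants add. Identities
    between such series are checked coefficientwise, by uniqueness of the solution of a linear
    recursion.

    [Lam] is never represented by a measure on [[0,1]^d]. Positivity, Cauchy-Schwarz and contraction
    by each coordinate carry the whole [L^2] argument. Large powers of [U] single out one
    coefficient because the term of index [k < n] loses a factor of order [L^(n - k)].

    The passage from moments to laws treats one real variable at a time, the other factors being
    kept as a weight, so that determinacy on the half-line suffices. *)

Definition conv u v n : R := \sum_(k < n.+1) u k * v (n - k)%N.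

(* [t U'(t) = K(t) U(t)] for the generating functions of [u] and [kap]; when [u 0 = 1], the
   generating function of [u] is [exp (sum_l kap_l t^l / l)]. *)
Definition logderiv kap u :=
  forall n, n%:R * u n = \sum_(l < n) kap l.+1 * u (n - l.+1)%N.

(** Below degree [N] the coefficients of a product depend only on those of the factors, so [conv]
    inherits its algebra from polynomial multiplication. *)
Let trunc N u : {poly R} := \poly_(k < N) u k.

Let conv_coef N u v n : (n < N)%N -> conv u v n = (trunc N u * trunc N v)`_n.
Proof.
move=> nN; rewrite coefM; apply: eq_bigr => i _; rewrite !coef_poly.
rewrite (leq_trans (ltn_ord i) nN).
by rewrite (leq_ltn_trans (leq_subr i n) nN).
Qed.

Let coef_trunc N u n : (n < N)%N -> (trunc N u)`_n = u n.
Proof. by move=> nN; rewrite coef_poly nN. Qed.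

Let coefM_eq (p q p' : {poly R}) N : (forall n, (n < N)%N -> p`_n = p'`_n) ->
  forall n, (n < N)%N -> (p * q)`_n = (p' * q)`_n.
Proof.
move=> pp' n nN; rewrite !coefM; apply: eq_bigr => i _.
by rewrite pp'// (leq_trans (ltn_ord i) nN).
Qed.

Lemma convC u v n : conv u v n = conv v u n.
Proof. by rewrite !(@conv_coef n.+1)// mulrC. Qed.

Lemma eq_conv u u' v v' n : (forall k, (k <= n)%N -> u k = u' k) ->
  (forall k, (k <= n)%N -> v k = v' k) -> conv u v n = conv u' v' n.
Proof.
move=> uu' vv'; apply: eq_bigr => i _.
by rewrite uu' ?vv'// ?leq_subr// -ltnS.
Qed.

Lemma convA u v w n : conv u (conv v w) n = conv (conv u v) w n.
Proof.
rewrite !(@conv_coef n.+1)//.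
have h1 : (trunc n.+1 (conv v w) * trunc n.+1 u)`_n =
    (trunc n.+1 v * trunc n.+1 w * trunc n.+1 u)`_n.
  apply: (@coefM_eq _ _ _ n.+1) => // k kn.
  by rewrite coef_trunc// (@conv_coef n.+1).
have h2 : (trunc n.+1 (conv u v) * trunc n.+1 w)`_n =
    (trunc n.+1 u * trunc n.+1 v * trunc n.+1 w)`_n.
  apply: (@coefM_eq _ _ _ n.+1) => // k kn.
  by rewrite coef_trunc// (@conv_coef n.+1).
by rewrite h2 mulrC h1 mulrC mulrA.
Qed.

Lemma convDl u u' v n : conv (fun k => u k + u' k) v n = conv u v n + conv u' v n.
Proof. by rewrite -big_split; apply: eq_bigr => i _; rewrite mulrDl. Qed.

Lemma conv0 u v : conv u v 0%N = u 0%N * v 0%N.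
Proof. by rewrite /conv big_ord1. Qed.

(** With the value [0] at index [0], the recursion of [logderiv] becomes a full convolution, to
    which [convA] and [convC] apply. *)
Let pos kap l := if l is 0%N then 0 else kap l.

Let logderivE kap u : logderiv kap u <->
  forall n, n%:R * u n = conv (pos kap) u n.
Proof.
split=> h n; have := h n; rewrite /conv big_ord_recl mul0r add0r.
  by move=> ->; apply: eq_bigr.
by move=> ->; apply: eq_bigr.
Qed.

(** Leibniz rule: [conv] multiplies generating functions, so their logarithmic derivatives add. *)
Lemma logderiv_conv kap kap' u v : logderiv kap u -> logderiv kap' v ->
  logderiv (fun l => kap l + kap' l) (conv u v).
Proof.
move=> /logderivE hu /logderivE hv; apply/logderivE => n.
have posD k : pos (fun l => kap l + kap' l) k = pos kap k + pos kap' k.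
  by case: k => //=; rewrite addr0.
have h1 : conv (pos kap) (conv u v) n = conv (fun k => k%:R * u k) v n.
  by rewrite convA; apply: eq_conv => // k _; rewrite hu.
have h2 : conv (pos kap') (conv u v) n = conv u (fun k => k%:R * v k) n.
  rewrite convA (@eq_conv _ (conv u (pos kap')) v v)//; last first.
    by move=> k _; rewrite convC.
  by rewrite -convA; apply: eq_conv => // k _; rewrite hv.
have -> : conv (pos (fun l => kap l + kap' l)) (conv u v) n =
    conv (fun k => pos kap k + pos kap' k) (conv u v) n by apply: eq_conv.
rewrite convDl h1 h2.
rewrite /conv mulr_sumr -big_split; apply: eq_bigr => i _ /=.
have : n%:R = i%:R + (n - i)%:R :> R by rewrite -natrD subnKC// -ltnS.
by move=> ->; ring.
Qed.

Lemma eq_logderiv kap kap' u : (forall l, (0 < l)%N -> kap l = kap' l) ->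
  logderiv kap u -> logderiv kap' u.
Proof. by move=> kk h n; rewrite h; apply: eq_bigr => i _; rewrite kk. Qed.

Lemma logderiv_uniq kap u v : u 0%N = v 0%N ->
  logderiv kap u -> logderiv kap v -> forall n, u n = v n.
Proof.
move=> uv0 hu hv n; elim/ltn_ind: n => -[//|n] IH.
apply: (@mulfI _ n.+1%:R); first by rewrite pnatr_eq0.
by rewrite hu hv; apply: eq_bigr => i _; rewrite IH// subSS ltnS leq_subr.
Qed.

(** The recursion uses all earlier cumulants, hence a growing list. Each step solves the identity of
    index [n] for its last term when [u 0 = 1]; the initial [0] is a placeholder that aligns
    positions with indices. *)
Fixpoint cumulant_seq u n : seq R :=
  if n is n'.+1 then
    let s := cumulant_seq u n' in
    rcons s (n%:R * u n - \sum_(l < n') s`_(l.+1) * u (n - l.+1)%N)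
  else [:: 0].

Definition cumulant u n : R := (cumulant_seq u n)`_n.

Let size_cumulant u n : size (cumulant_seq u n) = n.+1.
Proof. by elim: n => //= n IH; rewrite size_rcons IH. Qed.

Let nth_cumulant u n k : (k <= n)%N -> (cumulant_seq u n)`_k = cumulant u k.
Proof.
elim: n => [|n IH]; first by rewrite leqn0 => /eqP ->.
rewrite leq_eqVlt => /predU1P[->//|kn].
by rewrite /= nth_rcons size_cumulant kn IH.
Qed.

Lemma logderiv_cumulant u : u 0%N = 1 -> logderiv (cumulant u) u.
Proof.
move=> u0 [|n]; first by rewrite big_ord0 mul0r.
rewrite big_ord_recr /= subnn u0 mulr1 {2}/cumulant /= nth_rcons.
rewrite size_cumulant ltnn eqxx.
under [in X in _ = _ + (_ - X)]eq_bigr => l _ do rewrite nth_cumulant//.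
by rewrite addrC subrK.
Qed.

Lemma cumulant_uniq kap u : u 0%N = 1 -> logderiv kap u ->
  forall n, (0 < n)%N -> cumulant u n = kap n.
Proof.
move=> u0 h n; elim/ltn_ind: n => -[//|n] IH _.
have := h n.+1; rewrite (logderiv_cumulant u0) !big_ord_recr /= !subnn u0 !mulr1.
rewrite (eq_bigr (fun l : 'I_n => kap l.+1 * u (n.+1 - l.+1)%N)); last first.
  by move=> i _; rewrite IH// ltnS.
by move=> /addrI.
Qed.

End convolution.

(** * Rising factorials and normalized Laguerre polynomials *)

Section rising_seq.
Context {R : realType}.
Implicit Types (a b x y z : R).

Lemma rising0 a : rising a 0 = 1. Proof. by rewrite /rising big_ord0. Qed.

Lemma risingS a n : rising a n.+1 = rising a n * (a + n%:R).
Proof. by rewrite /rising big_ord_recr. Qed.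

Lemma risingD a m n : rising a (m + n) = rising a m * rising (a + m%:R) n.
Proof.
elim: n => [|n IH]; first by rewrite addn0 rising0 mulr1.
by rewrite addnS !risingS IH natrD; ring.
Qed.

Lemma rising_gt0 a n : 0 < a -> 0 < rising a n.
Proof. by move=> a0; apply: prodr_gt0 => i _; rewrite ltr_wpDr. Qed.

Lemma rising_ge0 a n : 0 <= a -> 0 <= rising a n.
Proof. by move=> a0; apply: prodr_ge0 => i _; rewrite addr_ge0. Qed.

Lemma rising_at0 n : rising 0 n = (n == 0)%:R :> R.
Proof. by case: n => [|n]; rewrite ?rising0// /rising big_ord_recl addr0 mul0r. Qed.

(** The coefficient of [t^n] in [(1 - t)^(-a)]. *)
Definition risq a n : R := rising a n / n`!%:R.

Lemma fact_neq0 n : n`!%:R != 0 :> R.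
Proof. by rewrite pnatr_eq0 -lt0n fact_gt0. Qed.

Lemma factS_neq0 n : n.+1%:R != 0 :> R.
Proof. by rewrite pnatr_eq0. Qed.

Lemma risq0 a : risq a 0 = 1. Proof. by rewrite /risq rising0 divr1. Qed.

Lemma risqS a n : n.+1%:R * risq a n.+1 = (a + n%:R) * risq a n.
Proof.
rewrite /risq risingS factS natrM.
by field; rewrite fact_neq0 nat1r factS_neq0.
Qed.

Lemma risq_ge0 a n : 0 <= a -> 0 <= risq a n.
Proof. by move=> a0; rewrite divr_ge0// rising_ge0. Qed.

Lemma risq_gt0 a n : 0 < a -> 0 < risq a n.
Proof. by move=> a0; rewrite divr_gt0 ?rising_gt0// ltr0n fact_gt0. Qed.

Lemma risq_at0 n : risq 0 n = (n == 0)%:R.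
Proof. by rewrite /risq rising_at0; case: n => [|n]; rewrite ?divr1// mul0r. Qed.

(** Compare coefficients in [t F' = a t F / (1 - t)] for [F = (1 - t)^(-a)]. *)
Lemma sum_risq a n : n%:R * risq a n = a * \sum_(k < n) risq a k.
Proof.
elim: n => [|n IH]; first by rewrite mul0r big_ord0 mulr0.
by rewrite risqS big_ord_recr/= mulrDr -IH mulrDl addrC.
Qed.

Lemma logderiv_risq a w :
  logderiv (fun l => a * w ^+ l) (fun n => risq a n * w ^+ n).
Proof.
move=> n; rewrite mulrA sum_risq mulr_sumr mulr_suml.
rewrite (reindex_inj rev_ord_inj) /=; apply: eq_bigr => i _.
have -> : w ^+ n = w ^+ i.+1 * w ^+ (n - i.+1) by rewrite -exprD subnKC.
by ring.
Qed.

Lemma conv_risq a b n : conv (risq a) (risq b) n = risq (a + b) n.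
Proof.
have lr z : logderiv (fun=> z) (risq z).
  have := logderiv_risq z 1 => h n'.
  have := h n'; rewrite expr1n mulr1 => ->.
  by apply: eq_bigr => i _; rewrite !expr1n !mulr1.
apply: (@logderiv_uniq _ (fun=> a + b)); first by rewrite conv0 !risq0 mulr1.
  exact: logderiv_conv.
exact: lr.
Qed.

(** Both sides equal [rising a m] divided by [i! (m - i)!]. *)
Lemma risqM a i m : (i <= m)%N ->
  risq a i * risq (a + i%:R) (m - i) = risq a m * 'C(m, i)%:R.
Proof.
move=> im; rewrite /risq -{3}(subnKC im) risingD.
have e : 'C(m, i)%:R * (i`!%:R * (m - i)`!%:R) = m`!%:R :> R.
  by rewrite -!natrM bin_fact.
have C0 : 'C(m, i)%:R != 0 :> R by rewrite pnatr_eq0 -lt0n bin_gt0.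
by rewrite -e; field; rewrite ?C0 ?fact_neq0.
Qed.

(* The monic Laguerre polynomial divided by [n!].  Its generating function
   [(1 + t)^(-a) exp (x t / (1 + t))] makes it additive in [(a, x)]. *)
Definition ell a n x : R :=
  \sum_(k < n.+1) (-1) ^+ (n - k) * risq (a + k%:R) (n - k) * (x ^+ k / k`!%:R).

Lemma ell0 a x : ell a 0 x = 1.
Proof. by rewrite /ell big_ord1 risq0 expr0 divr1 !mulr1. Qed.

Lemma sum_alt_bin m :
  \sum_(i < m.+1) (-1) ^+ i * 'C(m, i)%:R = (m == 0)%:R :> R.
Proof.
have := exprBn (1 : R) 1 m; rewrite subrr expr0n => ->.
by apply: eq_bigr => i _; rewrite !expr1n !mulr1 mulr_natr.
Qed.

Lemma sum_ord_shift (F : nat -> R) j n : (j <= n)%N ->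
  \sum_(k < n.+1) (j <= k)%:R * F k = \sum_(i < (n - j).+1) F (j + i)%N.
Proof.
move=> jn; rewrite -(big_mkord xpredT (fun k => (j <= k)%:R * F k)).
rewrite (@big_cat_nat _ _ _ j)//=; last exact: leqW.
rewrite big1_seq ?add0r; last first.
  by move=> k /andP[_]; rewrite mem_index_iota => /andP[_ kj]; rewrite leqNgt kj mul0r.
rewrite -{1}[j]add0n big_addn -subSn// big_mkord.
by apply: eq_bigr => i _; rewrite leq_addl mul1r addnC.
Qed.

Let ellE a n x N : (n < N)%N -> ell a n x =
  \sum_(k < N) (k <= n)%:R *
    ((-1) ^+ (n - k) * risq (a + k%:R) (n - k) * (x ^+ k / k`!%:R)).
Proof.
move=> nN; rewrite /ell (big_ord_widen N (fun k => (-1) ^+ (n - k) *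
  risq (a + k%:R) (n - k) * (x ^+ k / k`!%:R)))// big_mkcond.
by apply: eq_bigr => i _; rewrite ltnS; case: ifP; rewrite ?mul1r ?mul0r.
Qed.

(** Inverts the triangular system that defines [ell]: the coefficient of [x^j] is an alternating
    binomial sum of order [n - j], which vanishes unless [j = n]. *)
Lemma expr_ell a n x :
  x ^+ n / n`!%:R = \sum_(k < n.+1) risq (a + k%:R) (n - k) * ell a k x.
Proof.
under eq_bigr => k _.
  rewrite (@ellE _ _ _ n.+1)// mulr_sumr.
  under eq_bigr => j _ do rewrite mulrCA.
  over.
rewrite exchange_big /=.
transitivity (\sum_(j < n.+1) x ^+ j / j`!%:R * (risq (a + j%:R) (n - j) *
    ((n - j)%N == 0%N)%:R)).
  rewrite big_ord_recr /= subnn risq0 eqxx !mulr1 big1 ?add0r// => i _.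
  by rewrite subn_eq0 leqNgt ltn_ord/= !mulr0.
apply: eq_bigr => j _; have jn : (j <= n)%N by rewrite -ltnS.
rewrite (sum_ord_shift (fun k => risq (a + k%:R) (n - k) * ((-1) ^+ (k - j) *
  risq (a + j%:R) (k - j) * (x ^+ j / j`!%:R))))//.
rewrite -sum_alt_bin !mulr_sumr; apply: eq_bigr => i _.
have := @risqM (a + j%:R) i (n - j); rewrite -ltnS => /(_ (ltn_ord i)) e.
rewrite addKn subnDA natrD addrA.
transitivity ((-1) ^+ i * (x ^+ j / j`!%:R) *
  (risq (a + j%:R) (n - j) * 'C(n - j, i)%:R)); first by ring.
by rewrite -e; ring.
Qed.

Let risq2 n : risq 2 n = n.+1%:R.
Proof.
elim: n => [|n IH]; first by rewrite risq0.
apply: (@mulfI _ n.+1%:R); first exact: factS_neq0.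
by rewrite risqS IH -[n.+2]addn2 -[n.+1]addn1 !natrD; ring.
Qed.

Let risq1 n : risq 1 n = 1.
Proof.
elim: n => [|n IH]; first by rewrite risq0.
apply: (@mulfI _ n.+1%:R); first exact: factS_neq0.
by rewrite risqS IH -[n.+1]addn1 !natrD; ring.
Qed.

Let risq_succ b n : risq (b + 1) n = \sum_(k < n.+1) risq b k.
Proof. by rewrite -conv_risq; apply: eq_bigr => i _; rewrite risq1 mulr1. Qed.

Let sum_ord_trunc (F : nat -> R) k n : (k <= n)%N ->
  \sum_(l < n) (k <= n - l.+1)%:R * F l = \sum_(l < n - k) F l.
Proof.
move=> kn; rewrite (big_ord_widen n) ?leq_subr// [RHS]big_mkcond.
apply: eq_bigr => i _; have -> : (k <= n - i.+1)%N = (i < n - k)%N.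
  by have := ltn_ord i; lia.
by case: ifP; rewrite ?mul1r ?mul0r.
Qed.

(** For the generating function [(1 + t)^(-a) exp (x t / (1 + t))], [t] times the logarithmic
    derivative is [- a t / (1 + t) + x t / (1 + t)^2], whose coefficients are these. *)
Lemma logderiv_ell a x :
  logderiv (fun l => (-1) ^+ l * (a - l%:R * x)) (fun n => ell a n x).
Proof.
move=> n.
pose s k : R := (-1) ^+ (n - k) * (x ^+ k / k`!%:R).
(* Write [n = (n - k) + k]. By [sum_risq] the part [n - k] gives [a + k] times a partial sum; its
   share [k] joins the second part to make [risq (a + k + 1)]. *)
transitivity (\sum_(k < n.+1) (s k * (a * \sum_(j < n - k) risq (a + k%:R) j)
   + s k * (k%:R * risq (a + k%:R + 1) (n - k)))).
  rewrite /ell mulr_sumr; apply: eq_bigr => k _.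
  have kn : (k <= n)%N by rewrite -ltnS.
  have := sum_risq (a + k%:R) (n - k).
  rewrite risq_succ big_ord_recr /= natrB// /s => e.
  set A := \sum_(j < _) _ in e *; set B := risq _ _ in e *.
  have -> : n%:R * ((-1) ^+ (n - k) * B * (x ^+ k / k`!%:R)) =
    (-1) ^+ (n - k) * (x ^+ k / k`!%:R) * ((n%:R - k%:R) * B + k%:R * B) by ring.
  by rewrite e; ring.
rewrite big_split/= [in X in X + _]big_ord_recr [in X in _ + X]big_ord_recl /=.
rewrite subnn big_ord0 !mulr0 addr0 mul0r mulr0 add0r.
pose F k l := ((-1) ^+ (n - k) * (x ^+ k / k`!%:R)) * ((a - l.+1%:R * x) *
  risq (a + k%:R) ((n - k).-1 - l)).
transitivity (\sum_(k < n) \sum_(l < n - k) F k l); last first.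
  transitivity (\sum_(l < n) \sum_(k < n) (k <= n - l.+1)%:R * F k l).
    rewrite exchange_big /=; apply: eq_bigr => k _.
    by rewrite (sum_ord_trunc (F k))// ltnW.
  apply: eq_bigr => l _; rewrite (@ellE _ _ _ n); last by have := ltn_ord l; lia.
  rewrite mulr_sumr; apply: eq_bigr => k _.
  case: (leqP k (n - l.+1)) => kl; last by rewrite !mul0r mulr0.
  rewrite !mul1r /F.
  have -> : ((n - k).-1 - l = n - l.+1 - k)%N by lia.
  case: (ltnP l (n - k)) => [lk|]; last by have := ltn_ord l; have := ltn_ord k; lia.
  have -> : (n - k = l.+1 + (n - l.+1 - k))%N by lia.
  by rewrite exprD; ring.
rewrite -big_split /=; apply: eq_bigr => k _.
rewrite /s /F; have := ltn_ord k; move: (nat_of_ord k) => {}k kn.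
have [m nk] : exists m, (n - k = m.+1)%N by exists (n - k).-1; lia.
have -> : (n - bump 0 k = m)%N by rewrite /bump; lia.
rewrite /bump leq0n add1n nk /=.
(* [risq (b + 2)] is the convolution of [risq b] with [risq 2 l = l + 1], the source of the factor
   [l] in the cumulants. *)
rewrite -[k.+1]addn1 natrD addrA -[_ + 1 + 1]addrA -conv_risq convC.
rewrite -mulr_sumr /conv.
under [in X in _ = _ * X]eq_bigr => l _ do rewrite mulrBl.
rewrite sumrB [in X in X + _](reindex_inj rev_ord_inj) /= -mulr_sumr.
have -> : \sum_(l < m.+1) risq (a + k%:R) (m.+1 - l.+1) = \sum_(l < m.+1) risq (a + k%:R) (m - l).
  by apply: eq_bigr => i _; rewrite subSS.
have -> : \sum_(l < m.+1) l.+1%:R * x * risq (a + k%:R) (m - l) =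
    x * \sum_(k0 < m.+1) risq (1 + 1) k0 * risq (a + k%:R) (m - k0).
  by rewrite mulr_sumr; apply: eq_bigr => l _; rewrite risq2; ring.
set A := \sum_(l < _) _; set B := \sum_(l < _) _.
rewrite addn1 factS exprS natrM -nat1r exprS.
by field; rewrite fact_neq0 nat1r factS_neq0.
Qed.

Lemma ell_add a b x y n :
  ell (a + b) n (x + y) = conv (fun k => ell a k x) (fun k => ell b k y) n.
Proof.
apply: (@logderiv_uniq _ (fun l => (-1) ^+ l * (a - l%:R * x) +
  (-1) ^+ l * (b - l%:R * y)) (fun n => ell (a + b) n (x + y)) (conv _ _)).
- by rewrite conv0 !ell0 mulr1.
- apply: eq_logderiv; last exact: logderiv_ell.
  by move=> l _; ring.
- by apply: logderiv_conv; exact: logderiv_ell.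
Qed.

Lemma ell_at0 n : ell 0 n 0 = (n == 0%N)%:R.
Proof.
rewrite /ell big_ord_recl big1 => [|i _]; last by rewrite expr0n mul0r mulr0.
by rewrite /= subn0 addr0 add0r risq_at0 expr0 divr1 mulr1; case: n => [|n]; rewrite ?mulr0 ?mulr1.
Qed.

End rising_seq.

(** * Determinacy by Laplace transforms and moments *)

Section weighted_change_of_variables.
Local Open Scope ereal_scope.
Import HBNNSimple.

Let integral_comp_nnsfun d d' (T : measurableType d) (S : measurableType d')
    (R : realType) (mu : {measure set T -> \bar R}) (X : T -> S)
    (mX : measurable_fun setT X) (H : T -> \bar R) (mH : measurable_fun setT H)
    (H0 : forall t, 0 <= H t) (g : {nnsfun S >-> R}) :
  \int[mu]_t ((g (X t))%:E * H t) =
  \sum_(r \in range g) (r%:E * \int[mu]_(t in X @^-1` (g @^-1` [set r])) H t).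
Proof.
pose F r t := r%:E * (\1_(X @^-1` (g @^-1` [set r])) t)%:E * H t.
have mgr r : measurable (X @^-1` (g @^-1` [set r])).
  by rewrite -[X in measurable X]setTI; apply: mX.
have F0 r t : 0 <= F r t.
  have [r0|r0] := leP 0%R r; first by rewrite /F !mule_ge0// lee_fin.
  by rewrite /F preimage_nnfun0// preimage_set0 indic0 mule0 mul0e.
transitivity (\int[mu]_t (\sum_(r \in range g) F r t)).
  apply: eq_integral => t _; rewrite fimfunE -fsumEFin//.
  rewrite ge0_mule_fsuml; first by apply: eq_fsbigr => r _; rewrite EFinM.
  by move=> r; rewrite EFinM; exact: nnfun_muleindic_ge0.
rewrite ge0_integral_fsum//; last first.
  move=> r; apply: emeasurable_funM => //.
  by apply/measurable_EFinP/measurable_funM => //; exact: measurable_indic.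
apply: eq_fsbigr => r; rewrite inE => -[s _ gsr].
have r0 : (0 <= r)%R by rewrite -gsr.
under eq_integral => t _ do rewrite /F -muleA.
rewrite ge0_integralZl//; last 2 first.
- apply: emeasurable_funM => //; apply/measurable_EFinP.
  exact: measurable_indic.
- by move=> t _; rewrite mule_ge0// lee_fin.
congr (_ * _); rewrite [RHS]integral_mkcond; apply: eq_integral => t _.
by rewrite patchE indicE; case: ifP; rewrite ?mul1e ?mul0e.
Qed.

(** Equality of two laws under densities extends from indicators to [f] through one sequence of
    simple functions that serves both sides. The densities need not be functions of [X1] and [X2],
    which is how further variables enter later. *)
Lemma ge0_integral_comp_weight d1 d2 d (T1 : measurableType d1)
    (T2 : measurableType d2) (S : measurableType d) (R : realType)
    (mu1 : {measure set T1 -> \bar R}) (mu2 : {measure set T2 -> \bar R})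
    (X1 : T1 -> S) (X2 : T2 -> S) (H1 : T1 -> R) (H2 : T2 -> R) :
  measurable_fun setT X1 -> measurable_fun setT X2 ->
  measurable_fun setT H1 -> measurable_fun setT H2 ->
  (forall t, (0 <= H1 t)%R) -> (forall t, (0 <= H2 t)%R) ->
  (forall B, measurable B -> \int[mu1]_(t in X1 @^-1` B) (H1 t)%:E =
                             \int[mu2]_(t in X2 @^-1` B) (H2 t)%:E) ->
  forall f : S -> \bar R, measurable_fun setT f -> (forall s, 0 <= f s) ->
  \int[mu1]_t (f (X1 t) * (H1 t)%:E) = \int[mu2]_t (f (X2 t) * (H2 t)%:E).
Proof.
move=> mX1 mX2 mH1 mH2 H10 H20 H12 f mf f0.
pose g := nnsfun_approx measurableT mf.
have key d' (T : measurableType d') (mu : {measure set T -> \bar R}) X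
    (H : T -> R) :
    measurable_fun setT X -> measurable_fun setT H ->
    (forall t, (0 <= H t)%R) ->
    \int[mu]_t (f (X t) * (H t)%:E) =
    limn (fun n => \int[mu]_t ((g n (X t))%:E * (H t)%:E)).
  move=> mX mH H0; rewrite -monotone_convergence//.
  - apply: eq_integral => t _; apply/esym/cvg_lim => //.
    by apply: cvgeZr => //; exact: cvg_nnsfun_approx.
  - move=> n; apply: emeasurable_funM; apply/measurable_EFinP => //.
    exact: measurableT_comp.
  - by move=> n t _; rewrite mule_ge0// lee_fin.
  - move=> t _ a b ab; apply: lee_wpmul2r; rewrite lee_fin//.
    exact/lefP/nd_nnsfun_approx.
rewrite !key//; congr (limn _); apply/funext => n.
rewrite !integral_comp_nnsfun//; try exact/measurable_EFinP.
by apply: eq_fsbigr => r _; rewrite H12.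
Qed.

End weighted_change_of_variables.

Section real_dominated_convergence.
Context d (T : measurableType d) (R : realType) (mu : {measure set T -> \bar R}).

Lemma integrable_dominated (f g : T -> R) : measurable_fun setT f ->
  (forall t, `|f t| <= g t) -> mu.-integrable setT (EFin \o g) ->
  mu.-integrable setT (EFin \o f).
Proof.
move=> mf fg ig; apply: le_integrable ig => //; first exact/measurable_EFinP.
by move=> t _ /=; rewrite lee_fin (le_trans (fg t))// ler_norm.
Qed.

Lemma Rintegral_dominated_cvg (f_ : nat -> T -> R) (f g : T -> R) :
  (forall n, measurable_fun setT (f_ n)) ->
  (forall t, f_ n t @[n --> \oo] --> f t) ->
  (forall n t, `|f_ n t| <= g t) -> mu.-integrable setT (EFin \o g) ->
  mu.-integrable setT (EFin \o f) /\
  \int[mu]_t f_ n t @[n --> \oo] --> \int[mu]_t f t.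
Proof.
move=> mf_ ff fg ig.
have mf : measurable_fun setT f by apply: measurable_fun_cvg => // t _; exact: ff.
have := @dominated_convergence _ T R mu setT measurableT
  (fun n => EFin \o f_ n) (EFin \o f) (EFin \o g).
case.
- by move=> n; exact/measurable_EFinP.
- exact/measurable_EFinP.
- by apply: aeW => t _; apply/fine_cvgP; split; [exact: nearW|exact: ff].
- exact: ig.
- by apply: aeW => t n _; rewrite lee_fin.
move=> intf _ h; split => //.
have fin_f : (\int[mu]_t (f t)%:E)%E \is a fin_num by exact: integrable_fin_num.
rewrite /Rintegral; apply: fine_cvg; rewrite fineK//.
Qed.

Lemma intgZ (f : T -> R) k : mu.-integrable setT (EFin \o f) ->
  mu.-integrable setT (EFin \o (fun t => k * f t)).
Proof. exact: integrableZl. Qed.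

Lemma intgD (f g : T -> R) : mu.-integrable setT (EFin \o f) ->
  mu.-integrable setT (EFin \o g) ->
  mu.-integrable setT (EFin \o (fun t => f t + g t)).
Proof. exact: integrableD. Qed.

Lemma intg_sum (I : Type) (s : seq I) (Q : pred I) (f : I -> T -> R) :
  (forall i, Q i -> mu.-integrable setT (EFin \o f i)) ->
  mu.-integrable setT (EFin \o (fun t => \sum_(i <- s | Q i) f i t)).
Proof.
move=> h; elim: s => [|i s IH].
  apply: eq_integrable (integrable0 mu setT) => // t _.
  by rewrite /= big_nil.
have [Qi|Qi] := boolP (Q i).
  apply: eq_integrable (intgD (h _ Qi) IH) => // t _ /=.
  by rewrite big_cons Qi.
by apply: eq_integrable IH => // t _ /=; rewrite big_cons (negbTE Qi).
Qed.

Lemma Rintegral_sum (I : Type) (s : seq I) (Q : pred I) (f : I -> T -> R) :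
  (forall i, Q i -> mu.-integrable setT (EFin \o f i)) ->
  \int[mu]_t (\sum_(i <- s | Q i) f i t) = \sum_(i <- s | Q i) \int[mu]_t f i t.
Proof.
move=> h; elim: s => [|i s IH].
  under eq_Rintegral do rewrite big_nil.
  by rewrite big_nil Rintegral_cst// mul0r.
rewrite big_cons; case: ifPn => Qi; last first.
  by rewrite -IH; apply: eq_Rintegral => t _; rewrite big_cons (negbTE Qi).
rewrite -IH -RintegralD//; [|exact: h|exact: intg_sum].
by apply: eq_Rintegral => t _; rewrite big_cons Qi.
Qed.

End real_dominated_convergence.

Lemma measurable_expRN d (T : measurableType d) (R : realType) (k : R) (X : T -> R) :
  measurable_fun setT X -> measurable_fun setT (fun t => expR (- (k * X t))).
Proof.
move=> mX; rewrite (_ : (fun t => _) = expR \o (fun t => - k * X t)).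
  by apply: measurableT_comp => //; exact: measurable_funM.
by apply/funext => t /=; rewrite mulNr.
Qed.

Lemma cvgn_expR_comp (R : realType) (u : nat -> R) (l : R) :
  u n @[n --> \oo] --> l -> expR (u n) @[n --> \oo] --> expR l.
Proof. by move=> h; exact: (cvg_comp _ _ h (@continuous_expR R l)). Qed.

Lemma mem_preimage (T U : Type) (f : T -> U) (A : set U) t :
  (t \in f @^-1` A) = (f t \in A).
Proof. by apply/idP/idP; rewrite !in_setE. Qed.

Section weighted_law.
Local Open Scope ereal_scope.
Context d d' (T : measurableType d) (S : measurableType d') (R : realType)
  (mu : {measure set T -> \bar R}) (X : T -> S) (H : T -> R).
Hypotheses (mX : measurable_fun setT X) (mH : measurable_fun setT H)
  (H0 : forall t, (0 <= H t)%R).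

Definition weighted_law (B : set S) : \bar R :=
  \int[mu]_(t in X @^-1` B) (H t)%:E.

Lemma weighted_law0 : weighted_law set0 = 0.
Proof. by rewrite /weighted_law preimage_set0 integral_set0. Qed.

Lemma weighted_law_ge0 B : 0 <= weighted_law B.
Proof. by apply: integral_ge0 => t _; rewrite lee_fin. Qed.

Lemma weighted_law_sigma_additive : semi_sigma_additive weighted_law.
Proof.
move=> F mF tF mUF; rewrite /weighted_law preimage_bigcup.
have mXF i : measurable (X @^-1` F i).
  by rewrite -[Y in measurable Y]setTI; exact: mX.
rewrite ge0_integral_bigcup//=.
- apply: is_cvg_ereal_nneg_natsum_cond => n _ _.
  by apply: integral_ge0 => t _; rewrite lee_fin.
- by apply: measurable_funTS; exact/measurable_EFinP.
- by move=> t _; rewrite lee_fin.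
- apply/trivIsetP => i j _ _ ij; rewrite -preimage_setI.
  by move/trivIsetP : tF => ->//; rewrite preimage_set0.
Qed.

Definition weighted_law_measure : {measure set S -> \bar R} :=
  HB.pack weighted_law (isMeasure.Build _ _ _ weighted_law weighted_law0
    weighted_law_ge0 weighted_law_sigma_additive).

End weighted_law.

Section gumbel.
Context (R : realType).

(* [exp (- e^(m (x - X)))] is a power series in [e^(- m X)], and tends to the
   indicator of [X > x], up to the value at [X = x]. *)
Definition gumbel (x : R) m y : R := expR (- expR (m%:R * (x - y))).

Definition gumbel_lim (x y : R) : R := if y > x then 1 else if y == x then expR (-1) else 0.

Lemma cvg_expR_Nnat (a : R) : 0 < a -> expR (- (m%:R * a)) @[m --> \oo] --> 0.
Proof.
move=> a0.
have : expR (- a) ^+ m @[m --> \oo] --> 0.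
  apply: cvg_expr; rewrite ger0_norm ?expR_ge0// -expR0 ltr_expR oppr_lt0//.
by under eq_fun do rewrite -expRM_natl mulrN.
Qed.

Lemma gumbel_cvg x y : gumbel x m y @[m --> \oo] --> gumbel_lim x y.
Proof.
rewrite /gumbel_lim /gumbel; case: ifPn => [xy|yx]; last case: ifPn => [/eqP ->|nyx].
- have h : - expR (- (m%:R * (y - x))) @[m --> \oo] --> (0 : R).
    by rewrite -oppr0; apply: cvgN; apply: cvg_expR_Nnat; rewrite subr_gt0.
  rewrite (_ : (fun m => _) = (fun m => expR (- expR (- (m%:R * (y - x)))))).
    by have := cvgn_expR_comp h; rewrite expR0.
  by apply/funext => m; rewrite -mulrN opprB.
- rewrite (_ : (fun m => _) = cst (expR (-1))); first exact: cvg_cst.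
  by apply/funext => m; rewrite subrr mulr0 expR0.
- have xy : 0 < x - y by rewrite subr_gt0 lt_neqAle nyx leNgt yx.
  apply: (@squeeze_cvgr _ _ _ _ (cst 0) (fun m => expR (- (m%:R * (x - y))))).
  + apply: nearW => m; rewrite expR_ge0 ler_expR lerN2 /=.
    by rewrite (le_trans _ (expR_ge1Dx _))// ler_wpDl.
  + exact: cvg_cst.
  + exact: cvg_expR_Nnat.
Qed.

End gumbel.

Section laplace_determinacy.
Context d1 d2 (T1 : measurableType d1) (T2 : measurableType d2) (R : realType)
  (mu1 : {measure set T1 -> \bar R}) (mu2 : {measure set T2 -> \bar R})
  (X1 : T1 -> R) (X2 : T2 -> R) (H1 : T1 -> R) (H2 : T2 -> R).
Hypotheses (mX1 : measurable_fun setT X1) (mX2 : measurable_fun setT X2)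
  (iH1 : mu1.-integrable setT (EFin \o H1))
  (iH2 : mu2.-integrable setT (EFin \o H2))
  (H10 : forall t, 0 <= H1 t) (H20 : forall t, 0 <= H2 t)
  (X10 : forall t, 0 <= X1 t) (X20 : forall t, 0 <= X2 t).

Hypothesis laplace_eq : forall s : R, 0 <= s ->
  \int[mu1]_t (expR (- (s * X1 t)) * H1 t) = \int[mu2]_t (expR (- (s * X2 t)) * H2 t).

Let bounded_cvg_int (f1 : R -> R) (f : nat -> R -> R) (M : R) :
  (forall n, measurable_fun setT (f n)) ->
  (forall n (y : R), 0 <= y -> `|f n y| <= M) ->
  (forall y : R, 0 <= y -> f n y @[n --> \oo] --> f1 y) ->
  (forall n, \int[mu1]_t (f n (X1 t) * H1 t) = \int[mu2]_t (f n (X2 t) * H2 t)) ->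
  \int[mu1]_t (f1 (X1 t) * H1 t) = \int[mu2]_t (f1 (X2 t) * H2 t).
Proof.
move=> mf fM ff e12.
have key d (T : measurableType d) (mu : {measure set T -> \bar R}) (X H : T -> R) :
    measurable_fun setT X -> mu.-integrable setT (EFin \o H) ->
    (forall t, 0 <= X t) -> (forall t, 0 <= H t) ->
    \int[mu]_t (f n (X t) * H t) @[n --> \oo] --> \int[mu]_t (f1 (X t) * H t).
  move=> mX iH X0 H0.
  have mH : measurable_fun setT H by apply/measurable_EFinP/measurable_int/iH.
  apply: (@Rintegral_dominated_cvg _ _ _ mu (fun n t => f n (X t) * H t)
    (fun t => f1 (X t) * H t) (fun t => M * H t) _ _ _ _).2.
  - by move=> n; apply: measurable_funM => //; exact: measurableT_comp.
  - by move=> t; apply: cvgMr_tmp; exact: ff.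
  - by move=> n t; rewrite normrM (ger0_norm (H0 t)) ler_wpM2r// fM.
  - exact: intgZ.
have h1 := key _ _ mu1 X1 H1 mX1 iH1 X10 H10.
have h2 := key _ _ mu2 X2 H2 mX2 iH2 X20 H20.
apply: (cvg_unique _ h1) => //.
suff -> : (fun n => \int[mu1]_t (f n (X1 t) * H1 t)) =
    (fun n => \int[mu2]_t (f n (X2 t) * H2 t)) by [].
by apply/funext => n; exact: e12.
Qed.

(** The partial sums of the power series in [e^(- m X)] are finite combinations of Laplace
    transforms at the points [m k], on which both sides agree. *)
Let gumbel_eq (x : R) m : \int[mu1]_t (gumbel x m (X1 t) * H1 t) =
  \int[mu2]_t (gumbel x m (X2 t) * H2 t).
Proof.
pose f N (y : R) := series (exp_coeff (- expR (m%:R * (x - y)))) N.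
have fE N y : f N y = \sum_(k < N) (expR (m%:R * x) ^+ k * (-1) ^+ k / k`!%:R) * expR (- ((m * k)%:R * y)).
  rewrite /f /series /= big_mkord; apply: eq_bigr => k _.
  rewrite /exp_coeff/= (exprNn (expR _)).
  have e z : expR z ^+ k = expR (k%:R * z) by rewrite expRM_natl.
  rewrite !e (_ : - ((m * k)%:R * y) = k%:R * (m%:R * (x - y)) - k%:R * (m%:R * x)).
    rewrite expRB; field; rewrite fact_neq0 andbT.
    by rewrite gt_eqF ?expR_gt0.
  by rewrite natrM; ring.
(* On [y >= 0] one has [e^(m (x - y)) <= e^(m x)], so the partial sums are bounded uniformly in [N]
   and [y]. *)
apply: (@bounded_cvg_int _ f (expR (expR (m%:R * x)))).
- move=> N; rewrite (_ : f N = fun y => \sum_(k < N) (expR (m%:R * x) ^+ k * (-1) ^+ k / k`!%:R) * expR (- ((m * k)%:R * y))); last exact/funext.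
  apply: measurable_sum => k; apply: measurable_funM => //.
  exact: measurable_expRN.
- move=> N y y0.
  have le1 : `|f N y| <= series (exp_coeff (expR (m%:R * x))) N.
    rewrite /f /series /= (le_trans (ler_norm_sum _ _ _))// ler_sum// => k _.
    rewrite /exp_coeff /= normrM normrX normrN (gtr0_norm (expR_gt0 _)).
    rewrite (@ger0_norm _ (_^-1))// ler_wpM2r//.
    rewrite lerXn2r ?nnegrE ?expR_ge0// ler_expR ler_wpM2l//.
    by rewrite gerBl.
  rewrite (le_trans le1)//; apply: nondecreasing_cvgn_le.
    move=> a b ab; rewrite -subr_ge0 sub_series_geq// sumr_ge0// => i _.
    by rewrite exp_coeff_ge0// expR_ge0.
  exact: is_cvg_series_exp_coeff.
- by move=> y _; exact: is_cvg_series_exp_coeff.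
- move=> N.
  have key d (T : measurableType d) (mu : {measure set T -> \bar R}) (X H : T -> R) :
      measurable_fun setT X -> mu.-integrable setT (EFin \o H) ->
      (forall t, 0 <= X t) -> (forall t, 0 <= H t) ->
      \int[mu]_t (f N (X t) * H t) = \sum_(k < N) (expR (m%:R * x) ^+ k * (-1) ^+ k / k`!%:R) *
        \int[mu]_t (expR (- ((m * k)%:R * X t)) * H t).
    move=> mX iH X0 H0.
    have iE k : mu.-integrable setT (EFin \o (fun t => expR (- ((m * k)%:R * X t)) * H t)).
      have mH : measurable_fun setT H by apply/measurable_EFinP/measurable_int/iH.
      apply: integrable_dominated iH.
        by apply: measurable_funM => //; exact: measurable_expRN.
      move=> t; rewrite ger0_norm ?mulr_ge0 ?expR_ge0// ler_piMl//.
      by rewrite expR_le1 oppr_le0 mulr_ge0.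
    transitivity (\int[mu]_t (\sum_(k < N) (expR (m%:R * x) ^+ k * (-1) ^+ k / k`!%:R) *
        (expR (- ((m * k)%:R * X t)) * H t))).
      by apply: eq_Rintegral => t _; rewrite fE mulr_suml; apply: eq_bigr => k _; rewrite mulrA.
    rewrite Rintegral_sum; last by move=> k _; exact: intgZ.
    by apply: eq_bigr => k _; rewrite RintegralZl.
  rewrite !key//; apply: eq_bigr => k _; rewrite laplace_eq//.
Qed.

Let measurable_gumbel (x : R) m : measurable_fun setT (gumbel x m).
Proof.
rewrite /gumbel (_ : (fun y => _) = expR \o -%R \o (expR \o (fun y => m%:R * (x - y))))//.
apply: measurableT_comp; first exact: measurableT_comp.
apply: measurableT_comp => //; apply: measurable_funM => //.
by apply: measurable_funB.
Qed.

Let measurable_gumbel_lim (x : R) : measurable_fun setT (gumbel_lim x).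
Proof.
by apply: (@measurable_fun_cvg _ _ _ _ (gumbel x)) => [m|y _]; [exact: measurable_gumbel|exact: gumbel_cvg].
Qed.

Let gumbel_lim_eq (x : R) : \int[mu1]_t (gumbel_lim x (X1 t) * H1 t) =
  \int[mu2]_t (gumbel_lim x (X2 t) * H2 t).
Proof.
apply: (@bounded_cvg_int _ (gumbel x) 1) => //.
  by move=> m y _; rewrite ger0_norm ?expR_ge0// expR_le1 oppr_le0 expR_ge0.
by move=> y _; exact: gumbel_cvg.
Qed.

Let ray_eq x : \int[mu1]_t (\1_(`[x, +oo[) (X1 t) * H1 t) =
  \int[mu2]_t (\1_(`[x, +oo[) (X2 t) * H2 t).
Proof.
(* The thresholds approach [x] strictly from below: the exceptional value of [gumbel_lim] at its own
   threshold disappears, and the closed ray remains. *)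
apply: (@bounded_cvg_int _ (fun n => gumbel_lim (x - n.+1%:R^-1)) 1) => //.
- move=> n y _; rewrite /gumbel_lim; case: ifP => _; first by rewrite normr1.
  case: ifP => _; last by rewrite normr0.
  by rewrite ger0_norm ?expR_ge0// expR_le1 oppr_le0.
- move=> y _; rewrite indicE mem_setE/= in_itv/= andbT; case: (leP x y) => xy.
    apply: cvg_near_cst; apply: nearW => n; rewrite /gumbel_lim.
    by have -> : x - n.+1%:R^-1 < y by apply: lt_le_trans xy; rewrite gtrBl.
  have : n.+1%:R^-1 @[n --> \oo] --> (0 : R) by exact: cvg_harmonic.
  move=> /cvgrPdist_lt /(_ (x - y)); rewrite subr_gt0 => /(_ xy) h.
  apply: cvg_near_cst; near=> n.
  have : `|0 - n.+1%:R^-1| < x - y by near: n.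
  rewrite sub0r normrN ger0_norm// => hn; rewrite /gumbel_lim ifF; last first.
    by apply/negbTE; rewrite -leNgt lerBrDr -lerBrDl ltW.
  by rewrite ifF//; apply/negbTE; rewrite lt_eqF// ltrBrDr -ltrBrDl.
Unshelve. all: end_near. Qed.

(** Closed rays are stable under intersection and generate the Borel sets, so [ray_eq] suffices; the
    rays starting at [- n] exhaust the line with finite mass. *)
Theorem laplace_determinacy (B : set R) : measurable B ->
  (\int[mu1]_(t in X1 @^-1` B) (H1 t)%:E = \int[mu2]_(t in X2 @^-1` B) (H2 t)%:E)%E.
Proof.
have mH1 : measurable_fun setT H1 by apply/measurable_EFinP/measurable_int/iH1.
have mH2 : measurable_fun setT H2 by apply/measurable_EFinP/measurable_int/iH2.
have key d (T : measurableType d) (mu : {measure set T -> \bar R}) (X H : T -> R) A :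
   measurable_fun setT X -> mu.-integrable setT (EFin \o H) ->
   (forall t, 0 <= H t) -> measurable A ->
   (weighted_law mu X H A = (\int[mu]_t (\1_A (X t) * H t)%R)%:E)%E.
  move=> mX iH H0 mA.
  have mH : measurable_fun setT H by apply/measurable_EFinP/measurable_int/iH.
  have e : weighted_law mu X H A = (\int[mu]_t (\1_A (X t) * H t)%:E)%E.
    rewrite /weighted_law integral_mkcond; apply: eq_integral => t _.
    by rewrite patchE indicE mem_preimage; case: ifP => _; rewrite ?mul1r ?mul0r.
  rewrite e fineK//; apply: integrable_fin_num => //.
  apply: integrable_dominated iH.
    by apply: measurable_funM => //; apply: measurableT_comp => //; exact: measurable_indic.
  move=> t; rewrite normrM (ger0_norm (H0 t)) ler_piMl// indicE.
  by case: (_ \in _); rewrite ?normr1 ?normr0.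
move=> mB.
suff : weighted_law_measure mu1 mX1 mH1 H10 B = weighted_law_measure mu2 mX2 mH2 H20 B by [].
apply: (@measure_unique _ R _ (@RGenCInfty.G R) (fun n => `[(- n%:R : R), +oo[%classic) _ _ _ _
  (weighted_law_measure mu1 mX1 mH1 H10) (weighted_law_measure mu2 mX2 mH2 H20)) => //.
- exact: RGenCInfty.measurableE.
- move=> _ _ [x ->] [y ->]; exists (Num.max x y).
  by apply/seteqP; split => z /=; rewrite !in_itv/= !andbT ge_max => /andP.
- by move=> n; exists (- n%:R).
- rewrite -subTset => x _; exists (Num.truncn `|x|).+1 => //=.
  rewrite in_itv/= andbT lerNl; apply: le_trans (ler_norm _) _.
  by rewrite normrN ltW// truncnS_gt.
- by move=> _ [x ->] /=; rewrite !key// ray_eq.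
- by move=> n /=; rewrite key// ltry.
Qed.

End laplace_determinacy.

Section moment_determinacy.
Context (R : realType).

Let expr_le_expR (x d : R) n : 0 < d -> 0 <= x ->
  x ^+ n <= n`!%:R * d ^- n * expR (d * x).
Proof.
move=> d0 x0; rewrite mulrAC ler_pdivlMr ?exprn_gt0//.
rewrite -exprMn [n`!%:R * _]mulrC -ler_pdivrMr ?ltr0n ?fact_gt0//.
have dx0 : 0 <= x * d by rewrite mulr_ge0// ltW.
rewrite [d * x]mulrC.
suff h : series (exp_coeff (x * d)) n.+1 <= expR (x * d).
  apply: le_trans h; rewrite /series/= big_nat_recr//= lerDr sumr_ge0// => i _.
  exact: exp_coeff_ge0.
apply: nondecreasing_cvgn_le.
- move=> a b ab; rewrite -subr_ge0 sub_series_geq// sumr_ge0// => i _.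
  exact: exp_coeff_ge0.
- exact: is_cvg_series_exp_coeff.
Qed.

Section one_space.
Context d (T : measurableType d) (mu : {measure set T -> \bar R})
  (X H : T -> R) (delta : R).
Hypotheses (mX : measurable_fun setT X) (mH : measurable_fun setT H)
  (X0 : forall t, 0 <= X t) (H0 : forall t, 0 <= H t) (delta0 : 0 < delta)
  (iE : mu.-integrable setT (EFin \o (fun t => expR (delta * X t) * H t))).

(** One half of [delta] absorbs [X^n], the other half absorbs [e^(e X)]. *)
Lemma integrable_expR_moment n s e : 0 <= s -> e <= delta / 2 ->
  mu.-integrable setT
    (EFin \o (fun t => X t ^+ n * expR (- (s * X t)) * expR (e * X t) * H t)).
Proof.
move=> s0 e2; pose C := n`!%:R * (delta / 2) ^- n.
apply: integrable_dominated (intgZ C iE).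
  apply: measurable_funM => //; apply: measurable_funM; last first.
    by apply: measurableT_comp => //; exact: measurable_funM.
  by apply: measurable_funM; [exact: measurable_funX|exact: measurable_expRN].
move=> t; rewrite ger0_norm ?mulr_ge0 ?expR_ge0 ?exprn_ge0// mulrA ler_wpM2r//.
have h := @expr_le_expR (X t) (delta / 2) n.
have := h _ (X0 t); rewrite -/C => /(_ ltac:(by rewrite divr_gt0)) {}h.
have -> : expR (delta * X t) = expR (delta / 2 * X t) * expR (delta / 2 * X t).
  by rewrite -expRD; congr expR; field.
rewrite mulrA; apply: ler_pM; rewrite ?mulr_ge0 ?expR_ge0 ?exprn_ge0//.
  rewrite -[leRHS]mulr1; apply: ler_pM; rewrite ?expR_ge0 ?exprn_ge0//.
  by rewrite expR_le1 oppr_le0 mulr_ge0.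
by rewrite ler_expR ler_wpM2r.
Qed.

(** Taylor expansion at [s]: the tilted moments at [s + e] are determined by those at [s]. The
    domination is by [e^(e X)]. *)
Lemma laplace_shift_cvg n s e : 0 <= s -> 0 <= e -> e <= delta / 2 ->
  \sum_(k < N) ((- e) ^+ k / k`!%:R *
     \int[mu]_t (X t ^+ (n + k) * expR (- (s * X t)) * H t)) @[N --> \oo] -->
  \int[mu]_t (X t ^+ n * expR (- ((s + e) * X t)) * H t).
Proof.
move=> s0 e0 e2.
pose f N t := X t ^+ n * expR (- (s * X t)) * series (exp_coeff (- (e * X t))) N * H t.
have i0 m : mu.-integrable setT
    (EFin \o (fun t => X t ^+ m * expR (- (s * X t)) * H t)).
  have := @integrable_expR_moment m s 0 s0; rewrite divr_ge0 ?ltW// => /(_ erefl).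
  by apply: eq_integrable => // t _ /=; rewrite mul0r expR0 mulr1.
have fE N t : f N t = \sum_(k < N) ((- e) ^+ k / k`!%:R *
    (X t ^+ (n + k) * expR (- (s * X t)) * H t)).
  rewrite /f /series /= big_mkord mulr_sumr mulr_suml; apply: eq_bigr => k _.
  by rewrite /exp_coeff /= -[- (e * _)]mulNr exprMn exprD; ring.
have mf N : measurable_fun setT (f N).
  rewrite (_ : f N = fun t => \sum_(k < N) ((- e) ^+ k / k`!%:R *
    (X t ^+ (n + k) * expR (- (s * X t)) * H t))); last exact/funext.
  apply: measurable_sum => k; apply: measurable_funM => //.
  apply: measurable_funM => //; apply: measurable_funM; last exact: measurable_expRN.
  exact: measurable_funX.
have := @Rintegral_dominated_cvg _ _ _ mu f
  (fun t => X t ^+ n * expR (- ((s + e) * X t)) * H t)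
  (fun t => X t ^+ n * expR (- (s * X t)) * expR (e * X t) * H t) mf.
case.
- move=> t; rewrite /f mulrDl opprD expRD mulrA.
  apply: cvgMr_tmp; apply: cvgMl_tmp; exact: is_cvg_series_exp_coeff.
- move=> N t; rewrite /f normrM (ger0_norm (H0 t)) ler_wpM2r//.
  rewrite normrM ger0_norm ?mulr_ge0 ?expR_ge0 ?exprn_ge0// ler_wpM2l//.
    by rewrite mulr_ge0 ?expR_ge0 ?exprn_ge0.
  have ex0 : 0 <= e * X t by rewrite mulr_ge0.
  apply: (@le_trans _ _ (series (exp_coeff (e * X t)) N)).
    rewrite /series /= (le_trans (ler_norm_sum _ _ _))// ler_sum// => k _.
    rewrite /exp_coeff /= normrM normrX normrN (ger0_norm ex0).
    by rewrite (@ger0_norm _ (_^-1)).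
  apply: nondecreasing_cvgn_le; last exact: is_cvg_series_exp_coeff.
  move=> a b ab; rewrite -subr_ge0 sub_series_geq// sumr_ge0// => i _.
  exact: exp_coeff_ge0.
- exact: integrable_expR_moment.
move=> _ h; rewrite (_ : (fun N => _) = (fun N => \int[mu]_t f N t)); first exact: h.
apply/funext => N; apply/esym.
under eq_Rintegral do rewrite fE.
rewrite Rintegral_sum; last by move=> k _; exact: intgZ.
by apply: eq_bigr => k _; rewrite RintegralZl.
Qed.

End one_space.

Context d1 d2 (T1 : measurableType d1) (T2 : measurableType d2)
  (mu1 : {measure set T1 -> \bar R}) (mu2 : {measure set T2 -> \bar R})
  (X1 : T1 -> R) (X2 : T2 -> R) (H1 : T1 -> R) (H2 : T2 -> R) (delta : R).

(** Steps of length at most [delta / 2] carry the equality of tilted moments from [s = 0] to every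
    [s >= 0], where the order [n = 0] is the Laplace transform. All orders are carried along because
    one step at order [n] uses every higher order. *)
Theorem moment_determinacy (mX1 : measurable_fun setT X1)
  (mX2 : measurable_fun setT X2)
  (mH1 : measurable_fun setT H1) (mH2 : measurable_fun setT H2)
  (X10 : forall t, 0 <= X1 t) (X20 : forall t, 0 <= X2 t)
  (H10 : forall t, 0 <= H1 t) (H20 : forall t, 0 <= H2 t) (delta0 : 0 < delta)
  (iE1 : mu1.-integrable setT (EFin \o (fun t => expR (delta * X1 t) * H1 t)))
  (iE2 : mu2.-integrable setT (EFin \o (fun t => expR (delta * X2 t) * H2 t))) :
  (forall n, \int[mu1]_t (X1 t ^+ n * H1 t) = \int[mu2]_t (X2 t ^+ n * H2 t)) ->
  forall B, measurable B ->
  (\int[mu1]_(t in X1 @^-1` B) (H1 t)%:E = \int[mu2]_(t in X2 @^-1` B) (H2 t)%:E)%E.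
Proof.
move=> e12.
pose L s := forall n, \int[mu1]_t (X1 t ^+ n * expR (- (s * X1 t)) * H1 t) =
  \int[mu2]_t (X2 t ^+ n * expR (- (s * X2 t)) * H2 t).
have Lstep s e : 0 <= s -> 0 <= e -> e <= delta / 2 -> L s -> L (s + e).
  move=> s0 e0 e2 Ls n.
  have h1 := @laplace_shift_cvg _ _ mu1 X1 H1 delta mX1 mH1 X10 H10 delta0 iE1 n s e s0 e0 e2.
  have h2 := @laplace_shift_cvg _ _ mu2 X2 H2 delta mX2 mH2 X20 H20 delta0 iE2 n s e s0 e0 e2.
  apply: (cvg_unique _ h1) => //.
  rewrite (_ : (fun N => _) = (fun N => \sum_(k < N) ((- e) ^+ k / k`!%:R *
    \int[mu2]_t (X2 t ^+ (n + k) * expR (- (s * X2 t)) * H2 t)))); first exact: h2.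
  by apply/funext => N; apply: eq_bigr => k _; rewrite Ls.
have L0 : L 0.
  move=> n; transitivity (\int[mu1]_t (X1 t ^+ n * H1 t)).
    by apply: eq_Rintegral => t _; rewrite mul0r oppr0 expR0 mulr1.
  by rewrite e12; apply: eq_Rintegral => t _; rewrite mul0r oppr0 expR0 mulr1.
have Lnat (e : R) m : 0 <= e -> e <= delta / 2 -> L (m%:R * e).
  move=> e0 e2; elim: m => [|m IH]; first by rewrite mul0r.
  by rewrite -natr1 mulrDl mul1r; apply: Lstep => //; rewrite mulr_ge0.
have Ls s : 0 <= s -> L s.
  (* Enough equal steps for each to be at most [delta / 2]. *)
  move=> s0; pose m := (Num.truncn (s / (delta / 2))).+1.
  have m0 : 0 < m%:R :> R by rewrite ltr0n.
  have -> : s = m%:R * (s / m%:R) by field; rewrite gt_eqF.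
  apply: Lnat; first by rewrite divr_ge0.
  rewrite ler_pdivrMr// mulrC -ler_pdivrMr ?divr_gt0//.
  by rewrite ltW// truncnS_gt.
have iH d (T : measurableType d) (mu : {measure set T -> \bar R}) (X H : T -> R) :
    measurable_fun setT H -> (forall t, 0 <= X t) -> (forall t, 0 <= H t) ->
    mu.-integrable setT (EFin \o (fun t => expR (delta * X t) * H t)) ->
    mu.-integrable setT (EFin \o H).
  move=> mH X0 H0; apply: integrable_dominated => // t.
  rewrite ger0_norm// ler_peMl// -expR0 ler_expR mulr_ge0// ltW//.
apply: laplace_determinacy => //; [exact: iH iE1|exact: iH iE2|].
move=> s s0; have e := Ls _ s0 0%N.
transitivity (\int[mu1]_t (X1 t ^+ 0 * expR (- (s * X1 t)) * H1 t)).
  by apply: eq_Rintegral => t _; rewrite expr0 mul1r.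
by rewrite e; apply: eq_Rintegral => t _; rewrite expr0 mul1r.
Qed.

End moment_determinacy.

(** * Functions with finite moments, and expectations of independent products *)

Section finite_moments.
Context d (T : measurableType d) (R : realType) (P : probability T R).
Implicit Types (f g : T -> R).

(** Unlike integrability, this is stable under products, so it settles the integrability of all
    polynomials in such functions at once. *)
Definition finite_moments f := measurable_fun setT f /\
  forall n, P.-integrable setT (EFin \o (fun t => f t ^+ n)).

Notation "''Ex' f" := (\int[P]_t f t) (at level 10, f at level 8).

Lemma finite_moments_integrable f : finite_moments f -> P.-integrable setT (EFin \o f).
Proof. by case=> _ /(_ 1%N); apply: eq_integrable => // t _; rewrite /= expr1. Qed.

Lemma eq_finite_moments f g : f =1 g -> finite_moments f -> finite_moments g.
Proof. by move=> /funext ->. Qed.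

Lemma finite_moments_cst k : finite_moments (fun=> k).
Proof.
split; first exact: measurable_cst.
move=> n; exact: finite_measure_integrable_cst.
Qed.

Lemma finite_momentsM f g : finite_moments f -> finite_moments g ->
  finite_moments (fun t => f t * g t).
Proof.
move=> [mf hf] [mg hg]; split; first exact: measurable_funM.
move=> n; apply: integrable_dominated (intgD (hf n.*2) (hg n.*2)).
  by apply: measurable_funX; exact: measurable_funM.
move=> t; rewrite -addnn !exprD exprMn normrM.
have := sqr_ge0 (`|f t ^+ n| - `|g t ^+ n|).
rewrite -!expr2 -(real_normK (num_real (f t ^+ n))) -(real_normK (num_real (g t ^+ n))).
have := normr_ge0 (f t ^+ n); have := normr_ge0 (g t ^+ n); nra.
Qed.

Lemma finite_momentsX f n : finite_moments f -> finite_moments (fun t => f t ^+ n).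
Proof.
move=> hf; elim: n => [|n IH]; first exact: (@finite_moments_cst 1).
by apply: eq_finite_moments (finite_momentsM hf IH) => t; rewrite exprS.
Qed.

Lemma finite_momentsD f g : finite_moments f -> finite_moments g ->
  finite_moments (fun t => f t + g t).
Proof.
move=> hf hg; split; first by apply: measurable_funD; [exact: hf.1|exact: hg.1].
move=> n; apply: (@eq_integrable _ _ _ _ _ measurableT
  (EFin \o (fun t => \sum_(i < n.+1) ('C(n, i)%:R * (f t ^+ (n - i) * g t ^+ i))))).
  by move=> t _ /=; rewrite exprDn; congr (_%:E); apply: eq_bigr => i _; rewrite mulr_natl.
apply: intg_sum => i _; apply: intgZ; apply: finite_moments_integrable.
by apply: finite_momentsM; exact: finite_momentsX.
Qed.

Lemma finite_momentsZ k f : finite_moments f -> finite_moments (fun t => k * f t).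
Proof. by move=> hf; apply: finite_momentsM => //; exact: finite_moments_cst. Qed.

Lemma finite_momentsB f g : finite_moments f -> finite_moments g ->
  finite_moments (fun t => f t - g t).
Proof.
move=> hf hg; apply: eq_finite_moments (finite_momentsD hf (finite_momentsZ (-1) hg)).
by move=> t; rewrite mulN1r.
Qed.

Lemma finite_moments_sum (I : Type) (s : seq I) (Q : pred I) (F : I -> T -> R) :
  (forall i, Q i -> finite_moments (F i)) ->
  finite_moments (fun t => \sum_(i <- s | Q i) F i t).
Proof.
move=> h; elim: s => [|i s IH].
  by apply: eq_finite_moments (finite_moments_cst 0) => t; rewrite big_nil.
have [Qi|Qi] := boolP (Q i).
  by apply: eq_finite_moments (finite_momentsD (h _ Qi) IH) => t; rewrite big_cons Qi.
by apply: eq_finite_moments IH => t; rewrite big_cons (negbTE Qi).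
Qed.

Lemma finite_moments_prod (I : Type) (s : seq I) (Q : pred I) (F : I -> T -> R) :
  (forall i, Q i -> finite_moments (F i)) ->
  finite_moments (fun t => \prod_(i <- s | Q i) F i t).
Proof.
move=> h; elim: s => [|i s IH].
  by apply: eq_finite_moments (finite_moments_cst 1) => t; rewrite big_nil.
have [Qi|Qi] := boolP (Q i).
  by apply: eq_finite_moments (finite_momentsM (h _ Qi) IH) => t; rewrite big_cons Qi.
by apply: eq_finite_moments IH => t; rewrite big_cons (negbTE Qi).
Qed.

Lemma finite_moments_le f g : measurable_fun setT f ->
  (forall t, `|f t| <= g t) -> finite_moments g -> finite_moments f.
Proof.
move=> mf fg hg; split => // n.
apply: integrable_dominated (finite_moments_integrable (finite_momentsX n hg)).
  exact: measurable_funX.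
by move=> t; rewrite normrX lerXn2r ?nnegrE// (le_trans _ (fg t)).
Qed.

Lemma ExD f g : finite_moments f -> finite_moments g ->
  \int[P]_t (f t + g t) = 'Ex f + 'Ex g.
Proof. by move=> hf hg; rewrite RintegralD//; exact: finite_moments_integrable. Qed.

Lemma ExB f g : finite_moments f -> finite_moments g ->
  \int[P]_t (f t - g t) = 'Ex f - 'Ex g.
Proof. by move=> hf hg; rewrite RintegralB//; exact: finite_moments_integrable. Qed.

Lemma ExZ k f : finite_moments f -> \int[P]_t (k * f t) = k * 'Ex f.
Proof. by move=> hf; rewrite RintegralZl//; exact: finite_moments_integrable. Qed.

Lemma Ex_cst k : \int[P]_t k = k.
Proof.
by rewrite Rintegral_cst//= [X in fine X](@probability_setT _ _ _ P) /= mulr1.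
Qed.

Lemma Ex_sum (I : Type) (s : seq I) (Q : pred I) (F : I -> T -> R) :
  (forall i, Q i -> finite_moments (F i)) ->
  \int[P]_t (\sum_(i <- s | Q i) F i t) = \sum_(i <- s | Q i) 'Ex (F i).
Proof. by move=> h; rewrite Rintegral_sum// => i Qi; exact/finite_moments_integrable/h. Qed.

Lemma le_Ex f g : finite_moments f -> finite_moments g ->
  (forall t, f t <= g t) -> 'Ex f <= 'Ex g.
Proof. by move=> hf hg fg; apply: le_Rintegral => //; exact: finite_moments_integrable. Qed.

Lemma Ex_ge0 f : (forall t, 0 <= f t) -> 0 <= 'Ex f.
Proof. by move=> f0; apply: Rintegral_ge0. Qed.

Lemma eq_Ex f g : (forall t, f t = g t) -> 'Ex f = 'Ex g.
Proof. by move=> fg; apply: eq_Rintegral => t _; exact: fg. Qed.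

Lemma ae_eq_Ex f g : measurable_fun setT f -> measurable_fun setT g ->
  {ae P, forall t, f t = g t} -> 'Ex f = 'Ex g.
Proof.
move=> mf mg fg; rewrite /Rintegral; congr fine.
apply: ae_eq_integral => //; try exact/measurable_EFinP.
by apply: filterS fg => t -> _.
Qed.

Lemma EFin_Ex f : finite_moments f -> ('Ex f)%:E = (\int[P]_t (f t)%:E)%E.
Proof.
by move=> hf; rewrite fineK//; apply: integrable_fin_num => //; exact: finite_moments_integrable.
Qed.

End finite_moments.

Section independence.
Context d d' (T : measurableType d) (S : measurableType d') (R : realType)
  (P : probability T R) (I : finType) (X : I -> T -> S).
Hypotheses (mX : forall i, measurable_fun setT (X i)).
Hypothesis indep : forall B : I -> set S, (forall i, measurable (B i)) ->
  (P (\bigcap_(i in [set: I]) (X i @^-1` B i)) = \prod_(i : I) P (X i @^-1` B i))%E.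

(** Induction on the number of factors that are not indicators. For one such factor the others form
    a weight [H]; the case with an indicator in its place identifies the law under [H] with the law
    under the constant weight [C]. *)
Lemma expectation_prod_indep (f : I -> S -> R) :
  (forall i, measurable_fun setT (f i)) -> (forall i s, 0 <= f i s) ->
  (forall i, finite_moments P (f i \o X i)) ->
  \int[P]_t (\prod_i f i (X i t)) = \prod_i \int[P]_t f i (X i t).
Proof.
pose good (f : I -> S -> R) := forall i, [/\ measurable_fun setT (f i),
  forall s, 0 <= f i s & finite_moments P (f i \o X i)].
suff key (n : nat) (A : {set I}) (g : I -> S -> R) : (#|A| <= n)%N -> good g ->
    (forall i, i \notin A -> exists2 B, measurable B & g i = \1_B) ->
    \int[P]_t (\prod_i g i (X i t)) = \prod_i \int[P]_t g i (X i t).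
  move=> mf f0 hf; apply: (key #|[set: I]%SET| [set: I]%SET f) => //.
  by move=> i; rewrite inE.
elim: n A g => [|n IH] A g An gg gA.
  move: An; rewrite leqn0 cards_eq0 => /eqP A0.
  have gB i : exists B, measurable B /\ g i = \1_B.
    by have [|B mB gB] := gA i; [rewrite A0 inE|exists B].
  pose B i := sval (cid (gB i)).
  have mB i : measurable (B i) := (svalP (cid (gB i))).1.
  have gB' i : g i = \1_(B i) := (svalP (cid (gB i))).2.
  have mXB i : measurable (X i @^-1` B i).
    by rewrite -[Y in measurable Y]setTI; exact: mX.
  have iE (D : set T) : measurable D -> \int[P]_t (\1_D t : R) = fine (P D).
    by move=> mD; rewrite /Rintegral integral_indic// setIT.
  transitivity (\int[P]_t (\1_(\bigcap_(i in [set: I]) (X i @^-1` B i)) t : R)).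
    apply: eq_Rintegral => t _.
    under eq_bigr => i _ do rewrite gB' indicE.
    have [h|h] := pselect ((\bigcap_(i in [set: I]) (X i @^-1` B i)) t).
      by rewrite indicE mem_set// big1// => i _; rewrite mem_set//; exact: h.
    have [i hi] : exists i, ~ B i (X i t).
      by apply/existsNP => h'; apply: h => i _; exact: h'.
    by rewrite indicE [in RHS]memNset// (bigD1 i)//= memNset// mul0r.
  rewrite iE; last first.
    by apply: fin_bigcap_measurable => //; exact: finite_finset.
  rewrite indep//; under [RHS]eq_bigr => i _ do rewrite gB'.
  transitivity (fine (\prod_i (fine (P (X i @^-1` B i)))%:E)%E).
    congr fine; apply: eq_bigr => i _; rewrite fineK// fin_num_measure//.
  rewrite prodEFin /=; apply: eq_bigr => i _.
  rewrite -iE//; apply: eq_Rintegral => t _; rewrite !indicE; congr (_%:R).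
have [|] := leqP #|A| n; first by move=> An'; exact: IH gA.
move=> nA; have /card_gt0P[j jA] : (0 < #|A|)%N by exact: leq_ltn_trans nA.
pose upd (B : set S) i : S -> R := if i == j then \1_B else g i.
have updP B : measurable B -> good (upd B).
  move=> mB i; rewrite /upd; case: ifP => [_|_]; last exact: gg.
  split; first exact: measurable_indic.
    by move=> s; rewrite indicE.
  apply: finite_moments_le (finite_moments_cst P 1).
    by apply: measurableT_comp => //; exact: measurable_indic.
  by move=> t; rewrite /= indicE; case: (_ \in _); rewrite ?normr1 ?normr0.
have IHB B : measurable B -> \int[P]_t (\prod_i upd B i (X i t)) =
    \prod_i \int[P]_t upd B i (X i t).
  move=> mB; apply: (IH (A :\ j)%SET) => //.
  - by move: An; rewrite (cardsD1 j A) jA.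
  - exact: updP.
  - move=> i; rewrite in_setD1 negb_and negbK /upd; case: eqP => [_ _|_ /=]; last exact: gA.
    by exists B.
pose H t := \prod_(i | i != j) g i (X i t).
pose C := \prod_(i | i != j) \int[P]_t g i (X i t).
have H0 t : 0 <= H t by apply: prodr_ge0 => i _; have [] := gg i.
have C0 : 0 <= C by apply: prodr_ge0 => i _; apply: Rintegral_ge0 => t _; have [] := gg i.
have hH : finite_moments P H.
  by apply: finite_moments_prod => i _; have [] := gg i.
have := @ge0_integral_comp_weight _ _ _ T T S R P P (X j) (X j) H (fun=> C)
  (mX j) (mX j) hH.1 (measurable_cst _) H0 (fun=> C0).
move=> /(_ _ (EFin \o g j)) h.
have [mgj gj0 hgj] := gg j.
have {}h : (\int[P]_t ((g j (X j t))%:E * (H t)%:E) =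
            \int[P]_t ((g j (X j t))%:E * C%:E))%E.
  apply: h.
  - move=> B mB.
    have mXB : measurable (X j @^-1` B).
      by rewrite -[Y in measurable Y]setTI; exact: mX.
    have e1 : (\int[P]_(t in X j @^-1` B) (H t)%:E = \int[P]_t (\prod_i upd B i (X i t))%:E)%E.
      rewrite integral_mkcond; apply: eq_integral => t _.
      rewrite patchE (bigD1 j)//= /upd eqxx indicE mem_preimage.
      rewrite (eq_bigr (fun i => g i (X i t))); last by move=> i /negbTE ->.
      by case: ifP => _; rewrite ?mul1r ?mul0r.
    rewrite e1 -EFin_Ex; last by apply: finite_moments_prod => i _; have [] := updP B mB i.
    rewrite IHB// integral_cst// (bigD1 j)//= {1}/upd eqxx.
    rewrite (eq_bigr (fun i => \int[P]_t g i (X i t))); last by move=> i /negbTE ij; rewrite /upd ij.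
    rewrite -/C mulrC EFinM; congr (_ * _)%E.
    rewrite EFin_Ex; last by have [_ _] := updP B mB j; rewrite /upd eqxx.
    rewrite (eq_integral (fun t => (\1_(X j @^-1` B) t)%:E)).
      by rewrite integral_indic// setIT.
    by move=> t _; rewrite !indicE.
  - exact/measurable_EFinP.
  - by move=> s; rewrite lee_fin.
transitivity (fine (\int[P]_t ((g j (X j t))%:E * (H t)%:E))%E).
  by rewrite /Rintegral; congr fine; apply: eq_integral => t _; rewrite (bigD1 j)//= EFinM.
rewrite h (bigD1 j)//= -/C.
under eq_integral => t _ do rewrite muleC -EFinM.
by rewrite -/(Rintegral P setT (fun t => C * g j (X j t))) (ExZ C hgj) mulrC.
Qed.

End independence.

(** * Gamma random measures *)

Section laplace_gamma.
Context (R : realType).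

Let cvg_harmonic0 : (n.+1%:R^-1 : R) @[n --> \oo] --> 0.
Proof. exact: cvg_harmonic. Qed.

Let einf_cvg (u : nat -> R) l : u n @[n --> \oo] --> l ->
  limn_einf (fun n => (u n)%:E) = l%:E.
Proof.
move=> ul; apply: (cvg_limn_einf_sup _).1.
by apply/fine_cvgP; split; [exact: nearW|exact: ul].
Qed.

Lemma powRN_diff_cvg (b y : R) : 0 < y ->
  (y `^ (- b) - (y + n.+1%:R^-1) `^ (- b)) * n.+1%:R @[n --> \oo] -->
  b * y `^ (- b - 1).
Proof.
move=> y0; have hd := is_derive1_powR (- b) y0.
have /cvg_dnbhs_at_right := @ex_derive _ _ _ _ _ _ _ hd.
rewrite -/(derive (fun z : R => z `^ (- b)) y 1) (@derive_val _ _ _ _ _ _ _ hd).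
move=> /cvg_at_rightP /(_ (fun n => n.+1%:R^-1)) h.
have hp n : 0 < n.+1%:R^-1 :> R by rewrite invr_gt0.
have {}h := h (conj hp cvg_harmonic0).
have h' := cvgN h; rewrite mulNr opprK in h'.
rewrite (_ : (fun n => _) = (fun n => - (n.+1%:R^-1^-1 *:
  (((fun z : R => z `^ (- b)) \o shift y) (n.+1%:R^-1 *: (1 : R)) - y `^ (- b)))));
  first exact: h'.
apply/funext => n /=; rewrite invrK scaler1 -[_ *: _]/(_ * _) [_ + y]addrC.
by rewrite -mulrN opprB mulrC.
Qed.

Let exprN_diff_cvg (x : R) : 0 <= x ->
  (1 - expR (- (n.+1%:R^-1 * x))) * n.+1%:R @[n --> \oo] --> x.
Proof.
move=> x0.
apply: (@squeeze_cvgr _ _ _ _ (fun n => x * expR (- (n.+1%:R^-1 * x))) (cst x)).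
- apply: nearW => n; pose y := n.+1%:R^-1 * x.
  have y0 : 0 <= y by rewrite mulr_ge0.
  have nx : x = y * n.+1%:R by rewrite /y mulrAC mulVf ?mul1r ?pnatr_eq0.
  rewrite -/y nx mulrAC !ler_pM2r ?ltr0n//; apply/andP; split.
    have := expR_ge1Dx y; rewrite -(@ler_pM2r _ (expR (- y))) ?expR_gt0//.
    by rewrite -expRD subrr expR0 mulrDl mul1r -lerBrDl.
  by have := expR_ge1Dx (- y); rewrite lerBlDr lerBlDl addrC.
- have h : - (n.+1%:R^-1 * x) @[n --> \oo] --> (0 : R).
    rewrite -[X in _ --> X]oppr0; apply: cvgN.
    by have := @cvgMr_tmp _ _ _ _ _ 0 x cvg_harmonic0; rewrite mul0r; apply.
  have := cvgn_expR_comp h; rewrite expR0 => {}h.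
  by rewrite -[X in _ --> X]mulr1; apply: cvgMl_tmp.
- exact: cvg_cst.
Qed.

Context d (T : measurableType d) (P : probability T R) (X : T -> R) (a : R).
Hypotheses (mX : measurable_fun setT X) (X0 : forall t, 0 <= X t) (a0 : 0 <= a).
Hypothesis laplaceX : forall s, 0 <= s ->
  \int[P]_t expR (- (s * X t)) = (1 + s) `^ (- a).

(** Each step differentiates the Laplace transform in [s] through the difference quotients [g k].
    They lie between [0] and their limit [G], so Fatou first shows that [G] is integrable, and then
    [G] itself dominates the convergence. *)
Lemma laplace_gamma_moment n s : 0 <= s ->
  P.-integrable setT (EFin \o (fun t => X t ^+ n * expR (- (s * X t)))) /\
  \int[P]_t (X t ^+ n * expR (- (s * X t))) =
    rising a n * (1 + s) `^ (- (a + n%:R)).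
Proof.
elim: n s => [|n IH] s s0.
  split; last first.
    rewrite rising0 mul1r addr0 -laplaceX//.
    by apply: eq_Rintegral => t _; rewrite expr0 mul1r.
  apply: (@integrable_dominated _ _ _ _ _ (fun=> 1)).
  - by apply: measurable_funM; [exact: measurable_funX|exact: measurable_expRN].
  - move=> t; rewrite expr0 mul1r ger0_norm ?expR_ge0//.
    by rewrite expR_le1 oppr_le0 mulr_ge0.
  - exact: finite_measure_integrable_cst.
pose g k t := X t ^+ n * expR (- (s * X t)) *
  ((1 - expR (- (k.+1%:R^-1 * X t))) * k.+1%:R).
pose G t := X t ^+ n.+1 * expR (- (s * X t)).
have mg k : measurable_fun setT (g k).
  apply: measurable_funM.
    by apply: measurable_funM; [exact: measurable_funX|exact: measurable_expRN].
  apply: measurable_funM => //; apply: measurable_funB => //.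
  exact: measurable_expRN.
have mG : measurable_fun setT G.
  by apply: measurable_funM; [exact: measurable_funX|exact: measurable_expRN].
have GE t : G t = X t ^+ n * expR (- (s * X t)) * X t.
  by rewrite /G exprSr mulrAC.
have G0 t : 0 <= G t by rewrite mulr_ge0 ?exprn_ge0 ?expR_ge0.
have gG t : g k t @[k --> \oo] --> G t.
  by rewrite GE; apply: cvgMl_tmp; exact: exprN_diff_cvg.
have g0 k t : 0 <= g k t.
  rewrite !mulr_ge0 ?exprn_ge0 ?expR_ge0// subr_ge0 expR_le1 oppr_le0.
  by rewrite mulr_ge0.
have g_le k t : g k t <= G t.
  rewrite GE; apply: ler_wpM2l; first by rewrite mulr_ge0 ?exprn_ge0 ?expR_ge0.
  rewrite -ler_pdivlMr// [X t / _]mulrC.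
  by have := expR_ge1Dx (- (k.+1%:R^-1 * X t)); rewrite lerBlDr lerBlDl addrC.
have gint k : P.-integrable setT (EFin \o g k) /\ \int[P]_t g k t =
    rising a n * (((1 + s) `^ (- (a + n%:R)) -
     (1 + s + k.+1%:R^-1) `^ (- (a + n%:R))) * k.+1%:R).
  have [i1 e1] := IH s s0.
  have [|i2 e2] := IH (s + k.+1%:R^-1); first by rewrite addr_ge0.
  have gE t : g k t = k.+1%:R * (X t ^+ n * expR (- (s * X t)) -
       X t ^+ n * expR (- ((s + k.+1%:R^-1) * X t))).
    by rewrite /g [(s + _) * X t]mulrDl opprD expRD; ring.
  have -> : g k = (fun t => k.+1%:R * (X t ^+ n * expR (- (s * X t)) -
       X t ^+ n * expR (- ((s + k.+1%:R^-1) * X t)))) by exact/funext.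
  have i12 := integrableB measurableT i1 i2.
  split; first exact: intgZ.
  rewrite RintegralZl// RintegralB// e1 e2 addrA -mulrBr mulrCA.
  by congr (_ * _); exact: mulrC.
have lim_g : \int[P]_t g k t @[k --> \oo] -->
    rising a n.+1 * (1 + s) `^ (- (a + n.+1%:R)).
  rewrite (_ : (fun k => _) = (fun k => rising a n * (((1 + s) `^ (- (a + n%:R)) -
     (1 + s + k.+1%:R^-1) `^ (- (a + n%:R))) * k.+1%:R))); last first.
    by apply/funext => k; have [_ ->] := gint k.
  rewrite risingS -mulrA; apply: cvgMl_tmp.
  have s1 : 0 < 1 + s by rewrite ltr_wpDr.
  have -> : - (a + n.+1%:R) = - (a + n%:R) - 1 by rewrite -natr1; ring.
  exact: powRN_diff_cvg.
have iG : P.-integrable setT (EFin \o G).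
  apply/integrableP; split; first exact/measurable_EFinP.
  have -> : (\int[P]_t `|(EFin \o G) t|)%E = (\int[P]_t limn_einf (fun k => (g k t)%:E))%E.
    apply: eq_integral => t _; rewrite /= ger0_norm//.
    by apply/esym/einf_cvg.
  apply: le_lt_trans (fatou P measurableT _ _) _.
  - by move=> k; exact/measurable_EFinP.
  - by move=> k t _; rewrite lee_fin.
  - rewrite (_ : (fun k => _) = (fun k => (\int[P]_t g k t)%:E)); last first.
      apply/funext => k; rewrite fineK//; apply: integrable_fin_num => //.
      by have [] := gint k.
    by rewrite (einf_cvg lim_g) ltry.
split=> //.
have [|_ h] := @Rintegral_dominated_cvg _ _ _ P g G G mg gG _ iG.
  by move=> k t; rewrite ger0_norm.
exact: (cvg_unique _ h lim_g).
Qed.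

Lemma gamma_moment n : \int[P]_t (X t ^+ n) = rising a n.
Proof.
have [_] := laplace_gamma_moment n (lexx 0).
rewrite addr0 powR1 mulr1 => <-; apply: eq_Rintegral => t _.
by rewrite mul0r oppr0 expR0 mulr1.
Qed.

Lemma finite_moments_gamma : finite_moments P X.
Proof.
split => // n; have [+ _] := laplace_gamma_moment n (lexx 0).
apply: eq_integrable => // t _ /=.
by rewrite mul0r oppr0 expR0 mulr1.
Qed.

Lemma integrable_expR_gamma : exists2 delta, 0 < delta &
  P.-integrable setT (EFin \o (fun t => expR (delta * X t))).
Proof.
(* Since [risq a k <= (1 + a)^k], the terms of the exponential series at [1 / (2 (1 + a))] have
   expectations at most [2^(- k)]. *)
pose M := 1 + a.
have M0 : 0 < M by rewrite ltr_wpDr.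
exists ((2 * M)^-1); first by rewrite invr_gt0 mulr_gt0.
set dl := _^-1.
have dl0 : 0 < dl by rewrite invr_gt0 mulr_gt0.
have rM k : risq a k <= M ^+ k.
  elim: k => [|k IH]; first by rewrite risq0 expr0.
  have k1 : 0 < k.+1%:R :> R by [].
  rewrite -(ler_pM2l k1) risqS exprS [leRHS]mulrA.
  have h1 : a + k%:R <= k.+1%:R * M.
    by rewrite /M -natr1; have := mulr_ge0 (ler0n R k) a0; nra.
  by apply: ler_pM => //; [exact: addr_ge0|exact: risq_ge0].
pose f N t := series (exp_coeff (dl * X t)) N.
have dX0 t : 0 <= dl * X t by rewrite mulr_ge0// ltW.
have f0 N t : 0 <= f N t by rewrite sumr_ge0// => k _; exact: exp_coeff_ge0.
have fE N t : f N t = \sum_(k < N) (dl ^+ k / k`!%:R * X t ^+ k).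
  rewrite /f /series /= big_mkord; apply: eq_bigr => k _.
  by rewrite /exp_coeff /= exprMn mulrAC.
have hX := finite_moments_gamma.
have hf N : finite_moments P (f N).
  apply: eq_finite_moments (fun t => esym (fE N t)) _.
  by apply: finite_moments_sum => k _; apply: finite_momentsZ; exact: finite_momentsX.
have f2 N : \int[P]_t f N t <= 2.
  rewrite (eq_Ex _ (fE N)) Ex_sum; last first.
    by move=> k _; apply: finite_momentsZ; exact: finite_momentsX.
  apply: (@le_trans _ _ (\sum_(k < N) 2^-1 ^+ k)).
    apply: ler_sum => k _; rewrite ExZ; last exact: finite_momentsX.
    rewrite gamma_moment mulrAC -mulrA -/(risq a k).
    have -> : 2^-1 ^+ k = dl ^+ k * M ^+ k.
      by rewrite -exprMn /dl invfM -mulrA mulVf ?gt_eqF// mulr1.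
    by rewrite ler_wpM2l// exprn_ge0// ltW.
  have : \sum_(k < N) 2^-1 ^+ k = 2 - 2 * 2^-1 ^+ N :> R.
    elim: N => [|N IH]; first by rewrite big_ord0 expr0 mulr1 subrr.
    by rewrite big_ord_recr /= IH exprS; field.
  by move=> ->; rewrite gerBl mulr_ge0// exprn_ge0.
apply/integrableP; split.
  by apply/measurable_EFinP; apply: measurableT_comp => //; exact: measurable_funM.
have -> : (\int[P]_t `|(EFin \o (fun t => expR (dl * X t))) t|)%E =
    (\int[P]_t limn (fun k => (f k t)%:E))%E.
  apply: eq_integral => t _; rewrite /= ger0_norm ?expR_ge0//.
  apply/esym/cvg_lim => //.
  apply/fine_cvgP; split; [exact: nearW|].
  exact: is_cvg_series_exp_coeff.
have nd_f t : nondecreasing_seq (f ^~ t).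
  move=> m n mn; rewrite -subr_ge0 /f sub_series_geq// sumr_ge0// => i _.
  exact: exp_coeff_ge0.
rewrite monotone_convergence//.
- apply: (@le_lt_trans _ _ 2%:E); last exact: ltry.
  apply: lime_le.
    apply: ereal_nondecreasing_is_cvgn => m n mn; apply: ge0_le_integral => //.
    + by move=> t _; rewrite lee_fin.
    + by apply/measurable_EFinP; exact: (hf m).1.
    + by apply/measurable_EFinP; exact: (hf n).1.
    + by move=> t _; rewrite lee_fin; exact: nd_f.
  by apply: nearW => n; rewrite -EFin_Ex// lee_fin.
- by move=> k; apply/measurable_EFinP; exact: (hf k).1.
- by move=> k t _; rewrite lee_fin.
- by move=> t _ m n mn; rewrite lee_fin; exact: nd_f.
Qed.

End laplace_gamma.

Lemma measurable_expeRN d (T : measurableType d) (R : realType)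
    (f : T -> \bar R) : measurable_fun setT f -> (forall t, (0 <= f t)%E) ->
  measurable_fun setT (fun t => expeR (- f t)).
Proof.
move=> mf f0.
pose N := f @^-1` [set +oo%E].
have mN : measurable N by have := mf measurableT [set +oo%E] (emeasurable_set1 _); rewrite setTI.
rewrite (_ : (fun _ => _) = EFin \o (fun t => expR (- (1 * fine (f t))) * \1_(~` N) t)).
  apply/measurable_EFinP; apply: measurable_funM.
    by apply: measurable_expRN; exact: measurableT_comp.
  by apply: measurable_indic; exact: measurableC.
apply/funext => t /=; rewrite indicE; have [Nt|Nt] := pselect (N t).
  by rewrite Nt memNset ?mulr0//; exact.
rewrite mem_set// mulr1 mul1r -[in LHS](@fineK _ (f t))// ge0_fin_numE//.
by rewrite ltey; apply/eqP.
Qed.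

Lemma integral_scale_indic d (T : measurableType d) (R : realType)
    (mu : {measure set T -> \bar R}) (k : R) (A : set T) : 0 <= k -> measurable A ->
  (\int[mu]_t (k * \1_A t)%:E = k%:E * mu A)%E.
Proof.
move=> k0 mA; rewrite (@integralZl_indic _ _ _ _ _ measurableT (fun=> A))//.
  by rewrite integral_indic// setIT.
by rewrite ltNge k0.
Qed.

Section gamma_crm_facts.
Context (R : realType) (X : pmetricType R) (P0 : probability (borel X) R)
  d (Omega : measurableType d) (P : probability Omega R) (c : R)
  (mu : R.-ker Omega ~> borel X).
Hypotheses (c0 : 0 <= c) (gmu : gamma_crm P c P0 mu).

Definition shape (A : set (borel X)) : R := c * fine (P0 A).

Lemma shape_ge0 A : 0 <= shape A.
Proof. by rewrite mulr_ge0// fine_ge0. Qed.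

Let mass (A : set (borel X)) (w : Omega) : R := fine (mu w A).

Lemma measurable_mass A : measurable A -> measurable_fun setT (mass A).
Proof. by move=> mA; apply: measurableT_comp => //; exact: measurable_kernel. Qed.

Lemma mass_ge0 A w : 0 <= mass A w. Proof. exact: fine_ge0. Qed.

Let laplace_set A s : measurable A -> 0 <= s ->
  (\int[P]_w expeR (- (s%:E * mu w A)))%E = ((1 + s) `^ (- shape A))%:E.
Proof.
move=> mA s0; have s1 : 0 < 1 + s by rewrite ltr_wpDr.
pose f (x : borel X) : R := s * \1_A x.
have mf : measurable_fun setT f by apply: measurable_funM => //; exact: measurable_indic.
have f0 x : 0 <= f x by rewrite mulr_ge0.
have l0 : 0 <= ln (1 + s) by rewrite ln_ge0// lerDl.
have e1 : (\int[P0]_x (ln (1 + f x))%:E = (ln (1 + s) * fine (P0 A))%:E)%E.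
  rewrite EFinM fineK ?fin_num_measure// -integral_scale_indic//.
  apply: eq_integral => x _; rewrite /f indicE; case: (x \in A); rewrite ?mulr1//.
  by rewrite !mulr0 addr0 ln1.
have := gmu.2 f mf f0; rewrite e1 => /(_ (ltry _)).
under eq_integral do rewrite integral_scale_indic//.
move=> ->; rewrite -EFinM /= /powR gt_eqF// /shape.
by congr (expR _)%:E; ring.
Qed.

(** [E exp (- s mu(A))] is a lower bound for [P (mu(A) < +oo)] and tends to [1] as [s] tends to
    [0]. *)
Lemma crm_finite_ae A : measurable A -> {ae P, forall w, (mu w A < +oo)%E}.
Proof.
move=> mA; pose N := [set w | mu w A = +oo%E].
have mN : measurable N.
  have := measurable_kernel mu A mA measurableT [set +oo%E] (emeasurable_set1 _).
  by rewrite setTI.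
suff h : P N = 0%E.
  exists N; split => // w /= /negP.
  by rewrite -leNgt leye_eq => /eqP.
apply/eqP; rewrite eq_le measure_ge0 andbT.
apply/lee_addgt0Pr => e e0; rewrite add0e.
(* Chosen so that [shape A * ln (1 + s) <= shape A * s <= e]. *)
pose s := e / (1 + shape A).
have a1 : 0 < 1 + shape A by rewrite ltr_wpDr// shape_ge0.
have s0 : 0 < s by rewrite divr_gt0.
have hs : 1 - e <= (1 + s) `^ (- shape A).
  rewrite /powR gt_eqF; last by rewrite ltr_wpDr// ltW.
  apply: le_trans (expR_ge1Dx _); rewrite lerD2l mulNr lerN2.
  apply: (@le_trans _ _ (shape A * s)).
    by rewrite ler_wpM2l ?shape_ge0// le_ln1Dx// (lt_trans _ s0)// ltrN10.
  have h1 : shape A / (1 + shape A) <= 1 by rewrite ler_pdivrMr// mul1r lerDr.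
  by rewrite /s mulrCA; have := ltW e0; nra.
have := laplace_set mA (ltW s0) => e1.
have : ((1 - e)%:E <= P (~` N))%E.
  apply: (@le_trans _ _ ((1 + s) `^ (- shape A))%:E); first by rewrite lee_fin.
  rewrite -e1 -[X in (_ <= P X)%E]setIT -integral_indic//; last exact: measurableC.
  apply: ge0_le_integral => //.
  - by move=> w _; exact: expeR_ge0.
  - apply: measurable_expeRN; last by move=> w; rewrite mule_ge0// lee_fin ltW.
    by apply: measurable_funeM; exact: measurable_kernel.
  - by apply/measurable_EFinP; apply: measurable_indic; exact: measurableC.
  - move=> w _; rewrite indicE; have [wN|wN] := pselect (N w).
      have wA : mu w A = +oo%E := wN.
      by rewrite wA gt0_muley ?lte_fin// memNset//; exact.
    rewrite mem_set//; apply: (@le_trans _ _ (expeR 0)); last by rewrite expeR0.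
    by rewrite lee_expeR leeNl oppe0 mule_ge0// lee_fin ltW.
rewrite probability_setC// -(@fineK _ (P N)) ?fin_num_measure//.
by rewrite -EFinB !lee_fin; lra.
Qed.

Lemma crm_laplace A s : measurable A -> 0 <= s ->
  \int[P]_w expR (- (s * mass A w)) = (1 + s) `^ (- shape A).
Proof.
move=> mA s0; rewrite /Rintegral -[RHS]/(fine (_%:E)) -laplace_set//; congr fine.
apply: ae_eq_integral => //.
- by apply/measurable_EFinP; apply: measurable_expRN; exact: measurable_mass.
- apply: measurable_expeRN; last by move=> w; rewrite mule_ge0// lee_fin.
  by apply: measurable_funeM; exact: measurable_kernel.
apply: filterS (crm_finite_ae mA) => w wA _.
by rewrite -[in RHS](@fineK _ (mu w A)) ?ge0_fin_numE// -EFinM.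
Qed.

Lemma crm_moment A n : measurable A ->
  \int[P]_w (mass A w ^+ n) = rising (shape A) n.
Proof.
move=> mA; apply: gamma_moment; [exact: measurable_mass|exact: mass_ge0|].
by move=> s s0; exact: crm_laplace.
Qed.

Lemma crm_finite_moments A : measurable A -> finite_moments P (mass A).
Proof.
move=> mA; apply: (@finite_moments_gamma _ _ _ _ _ (shape A));
  [exact: measurable_mass|exact: mass_ge0|].
by move=> s s0; exact: crm_laplace.
Qed.

Lemma crm_exp_integrable A : measurable A -> exists2 delta, 0 < delta &
  P.-integrable setT (EFin \o (fun t => expR (delta * mass A t))).
Proof.
move=> mA; apply: (@integrable_expR_gamma _ _ _ _ _ (shape A));
  [exact: measurable_mass|exact: mass_ge0|exact: shape_ge0|].
by move=> s s0; exact: crm_laplace.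
Qed.

(** The mean of [mu(A)] is [c P0(A) = 0]. *)
Lemma crm_null A : measurable A -> P0 A = 0%E -> {ae P, forall w, mu w A = 0%E}.
Proof.
move=> mA PA0.
have : (\int[P]_w `|(mass A w)%:E| = 0)%E.
  under eq_integral do rewrite gee0_abs ?lee_fin ?mass_ge0//.
  rewrite -EFin_Ex; last exact: crm_finite_moments.
  have := crm_moment 1 mA; rewrite risingS rising0 mul1r addr0 /shape PA0 mulr0 => e.
  by congr (_%:E); rewrite -[RHS]e; apply: eq_Ex => w; rewrite expr1.
move=> h.
have mm : measurable_fun setT (fun w => (mass A w)%:E).
  by apply/measurable_EFinP; exact: measurable_mass.
have {}h := (ae_eq_integral_abs P measurableT mm).1 h.
apply: filterS2 (crm_finite_ae mA) h => w wA /(_ I) /= [].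
by move=> h; rewrite -[LHS]fineK ?ge0_fin_numE// -/(mass A w) h.
Qed.

End gamma_crm_facts.

Section laguerre_ell.
Context (R : realType).
Implicit Types (a x : R).

Lemma rising_negn n k : (k <= n)%N ->
  rising (- n%:R) k = (-1) ^+ k * (n`!%:R / (n - k)`!%:R) :> R.
Proof.
elim: k => [|k IH] kn; first by rewrite rising0 expr0 mul1r subn0 divff// fact_neq0.
have {}IH := IH (ltnW kn); rewrite risingS IH exprS.
have -> : (n - k = (n - k.+1).+1)%N by lia.
rewrite factS natrM.
have -> : (n - k.+1).+1%:R = n%:R - k%:R :> R by rewrite -subSn// subSS natrB// ltnW.
have nk0 : n%:R - k%:R != 0 :> R by rewrite subr_eq0 eqr_nat gtn_eqF.
by field; rewrite nk0 fact_neq0.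
Qed.

Lemma rising_negn0 n k : (n < k)%N -> rising (- n%:R) k = 0 :> R.
Proof.
move=> nk; rewrite /rising (bigD1 (Ordinal nk))//=.
by rewrite addNr mul0r.
Qed.

(** The series terminates: [rising (- n) k] contains the factor [0] once [k > n]. *)
Lemma hypergeo1F1_negn n a x : hypergeo1F1 (- n%:R) a x =
  \sum_(k < n.+1) rising (- n%:R) k / rising a k * (x ^+ k / k`!%:R).
Proof.
rewrite /hypergeo1F1; apply: cvg_lim => //.
apply: cvg_near_cst; near=> N.
have nN : (n.+1 <= N)%N by near: N; exact: nbhs_infty_ge.
rewrite /series /= (big_cat_nat (n := n.+1))//= big_mkord [X in _ + X]big1_seq ?addr0//.
by move=> k /andP[_]; rewrite mem_index_iota => /andP[nk _]; rewrite rising_negn0// !mul0r.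
Unshelve. all: end_near. Qed.

Lemma laguerreE n a x : 0 < a -> pochhammer a n = rising a n ->
  laguerre n a x = n`!%:R * ell a n x.
Proof.
move=> a0 pE; rewrite /laguerre pE hypergeo1F1_negn /ell !mulr_sumr.
apply: eq_bigr => k _; have kn : (k <= n)%N by rewrite -ltnS.
rewrite rising_negn// /risq.
have -> : rising a n = rising a k * rising (a + k%:R) (n - k).
  by rewrite -risingD subnKC.
have -> : (-1) ^+ n = (-1) ^+ k * (-1) ^+ (n - k) :> R by rewrite -exprD subnKC.
have r0 : rising a k != 0 by rewrite gt_eqF// rising_gt0.
have s1 : (-1) ^+ k * (-1) ^+ k = 1 :> R by rewrite -expr2 sqrr_sign.
set A := rising a k in r0 *; set B := rising (a + k%:R) (n - k).
set S := (-1) ^+ k in s1 *; set S' := (-1) ^+ (n - k).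
have := fact_neq0 (R := R) n; have := fact_neq0 (R := R) k; have := fact_neq0 (R := R) (n - k).
set f1 := n`!%:R; set f2 := k`!%:R; set f3 := (n - k)`!%:R => f30 f20 f10.
transitivity ((S * S) * (f1 * (S' * (B / f3) * (x ^+ k / f2)))).
  by field; rewrite r0 f30 f20.
by rewrite s1 mul1r.
Qed.

(** Under the gamma law the moments of [X] are quotients of values of [Gamma_fun], while the last
    hypothesis gives them as rising factorials. The functional equation of the Gamma function thus
    comes from a comparison of moments, without integration by parts. *)
Lemma pochhammer_rising d (T : measurableType d) (P : probability T R)
    (X : T -> R) a n : 0 < a -> finite_moments P X -> (forall t, 0 <= X t) ->
  (forall B, measurable B -> P (X @^-1` B) = gamma_law a B) ->
  (forall k, \int[P]_t (X t ^+ k) = rising a k) ->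
  pochhammer a n = rising a n.
Proof.
move=> a0 hX X0 lawX momX.
pose D := `]0%R, +oo[%classic : set R.
have mD : measurable D by exact: measurable_itv.
pose h (b x : R) := x `^ (b - 1) * expR (- x).
have h0 b x : 0 <= h b x by rewrite mulr_ge0 ?powR_ge0 ?expR_ge0.
have mh b : measurable_fun setT (h b).
  by apply: measurable_funM => //; have := measurable_expRN 1 (@measurable_id _ R setT);
     under eq_fun do rewrite mul1r.
pose G := Gamma_fun a.
have G0 : 0 <= G by apply: Rintegral_ge0 => x _; exact: h0.
pose H (x : R) := G^-1 * h a x * \1_D x.
have mH : measurable_fun setT H.
  apply: measurable_funM; last exact: measurable_indic.
  by apply: measurable_funM.
have H0 x : 0 <= H x.
  by rewrite /H indicE; apply: mulr_ge0 => //; apply: mulr_ge0; [rewrite invr_ge0|exact: h0].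
have key k : ((rising a k)%:E = (G^-1)%:E * \int[lebesgue_measure]_(x in D) (h (a + k%:R) x)%:E)%E.
  rewrite -momX EFin_Ex; last exact: finite_momentsX.
  have := @ge0_integral_comp_weight _ _ _ T (measurableTypeR R) (measurableTypeR R) R P (@lebesgue_measure R) X id
    (fun=> 1) H hX.1 (@measurable_id _ R setT) (measurable_cst _) mH (fun=> ler01) H0.
  move=> /(_ _ (fun x => (`|x| ^+ k)%:E)) e.
  rewrite (eq_integral (fun t => (`|X t| ^+ k)%:E * 1%:E)%E); last first.
    by move=> t _; rewrite mule1 ger0_norm.
  rewrite e.
  - rewrite -ge0_integralZl_EFin ?invr_ge0//; last 2 first.
      by move=> x _; rewrite lee_fin h0.
      apply: measurable_funTS; apply: measurableT_comp => //; exact: mh.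
    rewrite [RHS]integral_mkcond; apply: eq_integral => x _.
    rewrite patchE /H indicE; case: ifPn => [|_]; last by rewrite mulr0 mule0.
    rewrite inE /D /= in_itv/= andbT => x0.
    rewrite mulr1 -!EFinM gtr0_norm// /h; congr (_%:E).
    have -> : x `^ (a + k%:R - 1) = x `^ (a - 1) * x ^+ k.
      have -> : a + k%:R - 1 = a - 1 + k%:R by ring.
      by rewrite powRD ?powR_mulrn ?ltW// (gt_eqF x0) implybT.
    by ring.
  - move=> B mB; rewrite integral_cst//; last first.
      by rewrite -[X in measurable X]setTI; exact: hX.1.
    rewrite mul1e [LHS](lawX B mB) /gamma_law preimage_id.
    rewrite [LHS]integral_mkcond [RHS]integral_mkcond; apply: eq_integral => x _.
    rewrite !patchE in_setI /H indicE -/D /h -/G.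
    by case: (x \in B) => //=; case: (x \in D) => /=; rewrite ?mulr1 ?mulr0// mulrA.
  - by apply/measurable_EFinP; apply: measurable_funX; exact: normr_measurable.
  - by move=> x; rewrite lee_fin exprn_ge0.
(* The total mass [1] of the law excludes [G = 0], where the inverse takes its default value [0]. *)
have G1 : G^-1 != 0.
  by apply/eqP => G10; have := key 0%N; rewrite rising0 G10 mul0e => /eqP; rewrite eqe oner_eq0.
have Gk k : Gamma_fun (a + k%:R) = G * rising a k.
  have := key k; rewrite /Gamma_fun /Rintegral -/D.
  set I := integral _ _ _ => e.
  have Ifin : I \is a fin_num.
    have I0 : (0 <= I)%E by apply: integral_ge0 => x _; rewrite lee_fin h0.
    rewrite ge0_fin_numE// ltey; apply/eqP => Iy; move: e.
    by rewrite Iy gt0_muley// lte_fin lt_neqAle eq_sym G1 invr_ge0.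
  by move: e; rewrite -(fineK Ifin) -EFinM => -[->]; rewrite mulrA divff ?mul1r// -invr_eq0.
by rewrite /pochhammer Gk mulrAC divff ?mul1r// -invr_eq0.
Qed.

End laguerre_ell.

(** * Canonical pairs and the limit functional *)

Section canonical_pairs.
Context d (T : measurableType d) (R : realType) (P : probability T R).

Definition moment_rel (I : finType) (a : I -> R) (U : I -> T -> R) :=
  forall p : {ffun I -> nat},
  \int[P]_t (\prod_i U i t ^+ p i) = \prod_i rising (a i) (p i).

Definition ell_prod (I : finType) (a : I -> R) (U : I -> T -> R)
  (n : {ffun I -> nat}) t := \prod_i ell (a i) (n i) (U i t).

(** Only polynomial moments are kept, over an arbitrary finite index type: this makes subfamilies
    and sums of index types available. *)
Definition canonical_pair (I : finType) (a : I -> R) (U V : I -> T -> R) :=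
  [/\ forall i, finite_moments P (U i) /\ forall t, 0 <= U i t,
      forall i, finite_moments P (V i) /\ forall t, 0 <= V i t,
      moment_rel a U, moment_rel a V &
      forall n m : {ffun I -> nat}, n != m ->
        \int[P]_t (ell_prod a U n t * ell_prod a V m t) = 0].

(* [canonical_coef a U V n] is the canonical correlation coefficient
   [rho_n] times [prod_i (a_i)_(n_i) / n_i!]. *)
Definition canonical_coef (I : finType) (a : I -> R) (U V : I -> T -> R)
  (n : {ffun I -> nat}) := \int[P]_t (ell_prod a U n t * ell_prod a V n t).

Lemma finite_moments_ell a n (U : T -> R) : finite_moments P U ->
  finite_moments P (fun t => ell a n (U t)).
Proof.
move=> hU; apply: finite_moments_sum => k _; apply: finite_momentsZ.
apply: eq_finite_moments (finite_momentsZ (k`!%:R^-1) (finite_momentsX k hU)).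
by move=> t; rewrite mulrC.
Qed.

Lemma finite_moments_ell_prod (I : finType) (a : I -> R) (U : I -> T -> R) n :
  (forall i, finite_moments P (U i)) -> finite_moments P (ell_prod a U n).
Proof.
by move=> hU; apply: finite_moments_prod => i _; exact: finite_moments_ell.
Qed.

(** By [expr_ell], the coefficient of [ell a k] in [x^p / p!]; the boolean factor lets [k] range up
    to any larger bound. *)
Definition ell_coef a p k : R := (k <= p)%:R * risq (a + k%:R) (p - k).

Lemma expr_ell_coef a p N (x : R) : (p < N)%N ->
  x ^+ p / p`!%:R = \sum_(k < N) ell_coef a p k * ell a k x.
Proof.
move=> pN; rewrite (expr_ell a) (big_ord_widen N (fun k => risq (a + k%:R) (p - k) *
   ell a k x)) //= big_mkcond /=; apply: eq_bigr => k _.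
by rewrite /ell_coef ltnS; case: leqP => _; rewrite ?mul1r ?mul0r.
Qed.

Definition natf (I : finType) N (f : {ffun I -> 'I_N}) : {ffun I -> nat} :=
  [ffun i => nat_of_ord (f i)].

Lemma natf_inj (I : finType) N : injective (@natf I N).
Proof.
move=> f g /ffunP fg; apply/ffunP => i; apply/val_inj.
by have := fg i; rewrite !ffunE.
Qed.

Lemma prod_expr_ell (I : finType) (a : I -> R) N (p : I -> nat)
    (u : I -> R) : (forall i, p i < N)%N ->
  \prod_i (u i ^+ p i / (p i)`!%:R) =
  \sum_(f : {ffun I -> 'I_N}) (\prod_i ell_coef (a i) (p i) (f i)) *
     \prod_i ell (a i) (natf f i) (u i).
Proof.
move=> pN; under eq_bigr => i _ do rewrite (@expr_ell_coef (a i) (p i) N)//.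
rewrite bigA_distr_bigA /=; apply: eq_bigr => f _.
rewrite -big_split /=; apply: eq_bigr => i _.
by rewrite /natf ffunE.
Qed.

Section one_pair.
Context (I : finType) (a : I -> R) (U V : I -> T -> R).
Hypothesis cUV : canonical_pair a U V.

Let hU i : finite_moments P (U i). Proof. by have [h _ _ _ _] := cUV; exact: (h i).1. Qed.
Let hV i : finite_moments P (V i). Proof. by have [_ h _ _ _] := cUV; exact: (h i).1. Qed.
Let hell := finite_moments_ell_prod.

Lemma canonical_pair_orth n m :
  \int[P]_t (ell_prod a U n t * ell_prod a V m t) =
  (n == m)%:R * canonical_coef a U V n.
Proof.
have [_ _ _ _ h] := cUV; case: eqVneq => [->|nm]; first by rewrite mul1r.
by rewrite h// mul0r.
Qed.

Lemma canonical_pair_half p m :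
  \int[P]_t (\prod_i (U i t ^+ p i / (p i)`!%:R) * ell_prod a V m t) =
  canonical_coef a U V m * \prod_i ell_coef (a i) (p i) (m i).
Proof.
pose N := (\max_i maxn (p i) (m i)).+1.
have pN i : (p i < N)%N by rewrite ltnS (leq_trans (leq_maxl _ (m i)))// (leq_bigmax i).
have mN i : (m i < N)%N by rewrite ltnS (leq_trans (leq_maxr (p i) _))// (leq_bigmax i).
transitivity (\int[P]_t (\sum_(f : {ffun I -> 'I_N})
    (\prod_i ell_coef (a i) (p i) (f i)) * (ell_prod a U (natf f) t * ell_prod a V m t))).
  apply: eq_Ex => t; rewrite (@prod_expr_ell _ a N p (fun i => U i t) pN) mulr_suml.
  by apply: eq_bigr => f _; rewrite mulrA.
have hUV f : finite_moments P (fun t => ell_prod a U (natf f) t * ell_prod a V m t).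
  by apply: finite_momentsM; exact: hell.
rewrite Ex_sum; last by move=> f _; exact: finite_momentsZ.
pose fm : {ffun I -> 'I_N} := [ffun i => Ordinal (mN i)].
have fmE : natf fm = m by apply/ffunP => i; rewrite !ffunE.
rewrite (bigD1 fm)//= [X in _ + X]big1 ?addr0.
  rewrite ExZ// canonical_pair_orth fmE eqxx mul1r [RHS]mulrC.
  by congr (_ * _); apply: eq_bigr => i _; rewrite ffunE.
move=> f ffm; rewrite ExZ// canonical_pair_orth.
case: eqVneq => [e|_]; last by rewrite mul0r mulr0.
by move/eqP: ffm; case; apply: natf_inj; rewrite e.
Qed.

(** Both monomials are expanded in the polynomials [ell], and orthogonality reduces the double sum
    to its diagonal. *)
Lemma canonical_pair_moment N p q : (forall i, q i < N)%N ->
  \int[P]_t (\prod_i (U i t ^+ p i / (p i)`!%:R) *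
             \prod_i (V i t ^+ q i / (q i)`!%:R)) =
  \sum_(f : {ffun I -> 'I_N}) canonical_coef a U V (natf f) *
     \prod_i (ell_coef (a i) (p i) (f i) * ell_coef (a i) (q i) (f i)).
Proof.
move=> qN; transitivity (\int[P]_t (\sum_(f : {ffun I -> 'I_N})
    (\prod_i ell_coef (a i) (q i) (f i)) *
    (\prod_i (U i t ^+ p i / (p i)`!%:R) * ell_prod a V (natf f) t))).
  apply: eq_Ex => t; rewrite (@prod_expr_ell _ a N q (fun i => V i t) qN) mulr_sumr.
  by apply: eq_bigr => f _; rewrite mulrCA.
rewrite Ex_sum; last first.
  move=> f _; apply: finite_momentsZ; apply: finite_momentsM; last exact: hell.
  apply: finite_moments_prod => i _.
  apply: eq_finite_moments (finite_momentsZ ((p i)`!%:R^-1) (finite_momentsX (p i) (hU i))).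
  by move=> t; rewrite mulrC.
apply: eq_bigr => f _; rewrite ExZ; last first.
  apply: finite_momentsM; last exact: hell.
  apply: finite_moments_prod => i _.
  apply: eq_finite_moments (finite_momentsZ ((p i)`!%:R^-1) (finite_momentsX (p i) (hU i))).
  by move=> t; rewrite mulrC.
rewrite canonical_pair_half mulrCA; congr (_ * _).
rewrite mulrC -big_split /=; apply: eq_bigr => i _.
by rewrite /natf ffunE.
Qed.

End one_pair.
End canonical_pairs.

(** * Moments under large tilts *)

Section tilt_limit.
Context (R : realType).
Implicit Types (a : R).

Lemma near_eq_cvgn (f g : nat -> R) (l : R) :
  (\forall n \near \oo, g n = f n) -> g n @[n --> \oo] --> l ->
  f n @[n --> \oo] --> l.
Proof. by move=> fg; apply: cvg_trans; apply: near_eq_cvg; near=> n; near: n; apply: filterS fg => n ->. Unshelve. all: end_near. Qed.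

Let ratio_cvg (b c : R) : (L%:R - b) / (c + L%:R) @[L --> \oo] --> (1 : R).
Proof.
have inv0 : (c + L%:R)^-1 @[L --> \oo] --> (0 : R).
  apply/gtr0_cvgV0; first by near=> L; rewrite -ltrBlDl sub0r; near: L; exact: nbhs_infty_gtr.
  apply/cvgryPge => A; near=> L; rewrite -lerBlDl; near: L; exact: nbhs_infty_ger.
have h : 1 - (b + c) * (c + L%:R)^-1 @[L --> \oo] --> (1 : R).
  rewrite -[X in _ --> X]subr0 -[X in _ --> _ - X](mulr0 (b + c)).
  by apply: cvgB; [exact: cvg_cst|exact: cvgMl_tmp].
apply: cvg_trans h; apply: near_eq_cvg; near=> L.
have cL : c + L%:R != 0.
  rewrite gt_eqF// -ltrBlDl sub0r; near: L; exact: nbhs_infty_gtr.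
by field.
Unshelve. all: end_near. Qed.

Let inv_cvg (c : R) : (c + L%:R)^-1 @[L --> \oo] --> (0 : R).
Proof.
apply/gtr0_cvgV0; first by near=> L; rewrite -ltrBlDl sub0r; near: L; exact: nbhs_infty_gtr.
apply/cvgryPge => A; near=> L; rewrite -lerBlDl; near: L; exact: nbhs_infty_ger.
Unshelve. all: end_near. Qed.

Let ffact_rising_cvg a k n : (k <= n)%N ->
  (\prod_(i < k) (L%:R - i%:R)) / rising (a + L%:R) n @[L --> \oo] --> ((k == n)%:R : R).
Proof.
elim: n k => [|n IH] [|k] //=.
- move=> _; rewrite (_ : (fun _ => _) = cst 1); first exact: cvg_cst.
  by apply/funext => L; rewrite big_ord0 rising0 divr1.
- move=> _; rewrite (_ : (fun _ => _) = (fun L => (\prod_(i < 0) (L%:R - i%:R)) / rising (a + L%:R) n *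
     ((a + n%:R) + L%:R)^-1)); last first.
    by apply/funext => L; rewrite risingS invfM mulrA addrAC.
  rewrite -[X in _ --> X](mulr0 ((0 == n)%:R)); apply: cvgM; first exact: IH.
  exact: inv_cvg.
- rewrite ltnS => kn; rewrite (_ : (fun _ => _) = (fun L => (\prod_(i < k) (L%:R - i%:R)) / rising (a + L%:R) n *
     ((L%:R - k%:R) / ((a + n%:R) + L%:R)))); last first.
    by apply/funext => L; rewrite risingS big_ord_recr/= invfM addrAC; ring.
  rewrite eqSS -[X in _ --> X]mulr1; apply: cvgM; first exact: IH.
  exact: ratio_cvg.
Qed.

Let fact_falling k L : (k <= L)%N ->
  L`!%:R = (L - k)`!%:R * \prod_(i < k) (L%:R - i%:R) :> R.
Proof.
elim: k => [|k IH] kL; first by rewrite subn0 big_ord0 mulr1.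
rewrite (IH (ltnW kL)) big_ord_recr /=.
have -> : (L - k = (L - k.+1).+1)%N by lia.
rewrite factS natrM.
have -> : (L - k.+1).+1%:R = L%:R - k%:R :> R by rewrite -subSn// subSS natrB// ltnW.
by ring.
Qed.

(** For [k <= n] the quotient behaves like [L^(k - n)]: a falling factorial of [L] of order [k]
    stands against [rising (a + L) n]. Only [k = n] survives, and for [k > n] the coefficient is
    [0]. *)
Lemma tilt_cvg a n k B : 0 < a -> (n <= B)%N ->
  (L + (B - n))`!%:R * n`!%:R * (ell_coef a (L + (B - n)) k * ell_coef a n k) /
     rising a (L + B) @[L --> \oo] --> ((k == n)%:R / risq a n : R).
Proof.
move=> a0 nB.
pose g L : R := (L`!%:R * n`!%:R * (ell_coef a L k * ell_coef a n k)) / rising a (L + n).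
suff : g L @[L --> \oo] --> ((k == n)%:R / risq a n : R).
  rewrite -(cvg_shiftn (B - n)) /=; rewrite (_ : (fun _ => g _) = (fun L => (L + (B - n))`!%:R * n`!%:R * (ell_coef a (L + (B - n)) k * ell_coef a n k) /
     rising a (L + B))) //.
  by apply/funext => L; rewrite /g -addnA subnK.
case: (leqP k n) => kn; last first.
  rewrite gtn_eqF// mul0r (_ : g = cst 0); first exact: cvg_cst.
  by apply/funext => L; rewrite /g /ell_coef (leqNgt k n) kn /= !(mul0r, mulr0).
have := @ffact_rising_cvg a k n kn => h.
have {}h : (n`!%:R * risq (a + k%:R) (n - k) / rising a k) *
    ((\prod_(i < k) (L%:R - i%:R)) / rising (a + L%:R) n) @[L --> \oo] -->
    ((n`!%:R * risq (a + k%:R) (n - k) / rising a k) * (k == n)%:R : R).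
  by apply: cvgMl_tmp; exact: h.
have -> : (k == n)%:R / risq a n =
   (n`!%:R * risq (a + k%:R) (n - k) / rising a k) * (k == n)%:R.
  case: eqVneq => [->|_]; last by rewrite mul0r mulr0.
  by rewrite subnn risq0 !mulr1 mul1r /risq invfM invrK mulrC.
apply: near_eq_cvgn h; near=> L; apply/esym.
have kL : (k <= L)%N by near: L; exact: nbhs_infty_ge.
rewrite /g /ell_coef kn kL !mul1r /risq.
have -> : rising a (L + n) = rising a k * rising (a + k%:R) (L - k) * rising (a + L%:R) n.
  by rewrite risingD; congr (_ * _); rewrite -risingD subnKC.
rewrite (fact_falling kL).
have r1 : rising a k != 0 by rewrite gt_eqF// rising_gt0.
have r2 : rising (a + k%:R) (L - k) != 0 by rewrite gt_eqF// rising_gt0// ltr_wpDr.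
have r3 : rising (a + L%:R) n != 0 by rewrite gt_eqF// rising_gt0// ltr_wpDr.
by field; rewrite r1 r2 r3 !fact_neq0.
Unshelve. all: end_near. Qed.

End tilt_limit.

Section finite_cvg.
Context (R : realType).

Lemma cvgn_sum (J : Type) (s : seq J) (Q : pred J) (f : nat -> J -> R) (l : J -> R) :
  (forall j, Q j -> f n j @[n --> \oo] --> l j) ->
  \sum_(j <- s | Q j) f n j @[n --> \oo] --> \sum_(j <- s | Q j) l j.
Proof. by move=> h; apply: cvg_big => //; exact: add_continuous. Qed.

Lemma cvgn_prod (J : Type) (s : seq J) (Q : pred J) (f : nat -> J -> R) (l : J -> R) :
  (forall j, Q j -> f n j @[n --> \oo] --> l j) ->
  \prod_(j <- s | Q j) f n j @[n --> \oo] --> \prod_(j <- s | Q j) l j.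
Proof. by move=> h; apply: cvg_big => //; exact: mul_continuous. Qed.

End finite_cvg.

Section logconvex.
Context (R : realType).

Lemma quadratic_discr (x y z : R) : 0 <= x -> 0 <= z ->
  (forall s, 0 <= x - 2 * s * y + s ^+ 2 * z) -> y ^+ 2 <= x * z.
Proof.
move=> x0 z0 h; case: (ltrgtP z 0) z0 => // [zp _|ze _].
  have := h (y / z); have -> : x - 2 * (y / z) * y + (y / z) ^+ 2 * z = x - y ^+ 2 / z.
    by field; rewrite gt_eqF.
  by rewrite subr_ge0 ler_pdivrMr.
rewrite ze mulr0; have [->|y0] := eqVneq y 0; first by rewrite expr0n.
(* For [z = 0] the expression is affine in [s], and at this point it equals [- x - 2 < 0]. *)
have := h ((x + 1) / y); rewrite ze mulr0 addr0.
have -> : x - 2 * ((x + 1) / y) * y = - x - 2 by field.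
by move=> ?; lra.
Qed.

(** The ratios of a log-convex sequence are nondecreasing, so [u 1 > u 0] would force at least
    linear growth. *)
Lemma logconvex_bounded (u : nat -> R) C : (forall k, 0 <= u k) ->
  (forall k, u k.+1 ^+ 2 <= u k * u k.+2) -> (forall k, u k <= C) ->
  u 1%N <= u 0%N.
Proof.
move=> u0 ul uC; rewrite leNgt; apply/negP => u01.
have u0p : 0 < u 0%N.
  rewrite lt_neqAle u0 andbT eq_sym; apply/eqP => e; have := ul 0%N.
  by rewrite e mul0r; have := u0 0%N; rewrite e in u01; nra.
pose r := u 1%N / u 0%N.
have r1 : 1 < r by rewrite ltr_pdivlMr// mul1r.
have ugrow k : 0 < u k /\ r * u k <= u k.+1.
  elim: k => [|k [uk IH]]; first by rewrite /r mulfVK ?gt_eqF.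
  have uk1 : 0 < u k.+1 by apply: lt_le_trans IH; rewrite mulr_gt0// (lt_trans _ r1).
  split => //; rewrite -(ler_pM2l uk); apply: le_trans (ul k).
  by rewrite mulrA [u k * r]mulrC expr2 ler_pM2r.
have ulin k : u 0%N + k%:R * ((r - 1) * u 0%N) <= u k.
  elim: k => [|k IH]; first by rewrite mul0r addr0.
  have [uk h] := ugrow k; apply: le_trans h.
  have p1 : 0 <= k%:R * ((r - 1) * u 0%N) by rewrite !mulr_ge0// subr_ge0 ltW.
  have p2 : 0 <= (r - 1) * (u k - u 0%N) by rewrite mulr_ge0 ?subr_ge0 ?(ltW r1)//; lra.
  by rewrite -natr1; lra.
have e0 : 0 < (r - 1) * u 0%N by rewrite mulr_gt0// subr_gt0.
pose k := (Num.truncn (C / ((r - 1) * u 0%N))).+1.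
have : C < k%:R * ((r - 1) * u 0%N) by rewrite -ltr_pdivrMr// truncnS_gt.
by have := ulin k; have := uC k; lra.
Qed.

End logconvex.

Section tilted_functional.
Context d (T : measurableType d) (R : realType) (P : probability T R)
  (I : finType) (a : I -> R) (U V : I -> T -> R).
Hypothesis cUV : canonical_pair P a U V.
Hypothesis a_gt0 : forall i, 0 < a i.

Let hU i : finite_moments P (U i). Proof. by have [h _ _ _ _] := cUV; exact: (h i).1. Qed.
Let hV i : finite_moments P (V i). Proof. by have [_ h _ _ _] := cUV; exact: (h i).1. Qed.
Let U0 i t : 0 <= U i t. Proof. by have [h _ _ _ _] := cUV; exact: (h i).2. Qed.
Let V0 i t : 0 <= V i t. Proof. by have [_ h _ _ _] := cUV; exact: (h i).2. Qed.

Definition canonical_corr (n : {ffun I -> nat}) : R :=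
  canonical_coef P a U V n / \prod_i risq (a i) (n i).

(** Where [U] does not vanish this is [U^(L + B) (V / U)^n]; [B] bounds the degrees, and [L] is the
    strength of the tilt. *)
Let tilt B (n : {ffun I -> nat}) L t :=
  \prod_i (U i t ^+ (L + (B - n i)) * V i t ^+ n i).

Let hp L B (n : {ffun I -> nat}) : finite_moments P (tilt B n L).
Proof.
apply: finite_moments_prod => i _.
by apply: finite_momentsM; exact: finite_momentsX.
Qed.

(** Each term of [canonical_pair_moment] is a coefficient times a product over [i], to which
    [tilt_cvg] applies factor by factor; in the limit only the multi-index [n] remains. *)
Lemma tilt_moment_cvg B (n : {ffun I -> nat}) : (forall i, n i <= B)%N ->
  \int[P]_t tilt B n L t / \prod_i rising (a i) (L + B) @[L --> \oo] -->
  canonical_corr n.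
Proof.
move=> nB.
pose w L i k := (L + (B - n i))`!%:R * (n i)`!%:R *
  (ell_coef (a i) (L + (B - n i)) k * ell_coef (a i) (n i) k) /
     rising (a i) (L + B).
rewrite (_ : (fun L => _) = (fun L => \sum_(f : {ffun I -> 'I_B.+1})
   canonical_coef P a U V (natf f) * \prod_i w L i (f i))); last first.
  apply/funext => L.
  have -> : \int[P]_t tilt B n L t =
      (\prod_i ((L + (B - n i))`!%:R * (n i)`!%:R)) *
      \int[P]_t (\prod_i (U i t ^+ (L + (B - n i)) / (L + (B - n i))`!%:R) *
             \prod_i (V i t ^+ (n i) / (n i)`!%:R)).
    rewrite -ExZ; last first.
      apply: finite_momentsM; apply: finite_moments_prod => i _.
        apply: eq_finite_moments (finite_momentsZ _ (finite_momentsX (L + (B - n i)) (hU i))) => t.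
        exact: mulrC.
      apply: eq_finite_moments (finite_momentsZ _ (finite_momentsX (n i) (hV i))) => t.
      exact: mulrC.
    apply: eq_Ex => t; rewrite -!big_split /=; apply: eq_bigr => i _.
    by field; rewrite !fact_neq0.
  rewrite (@canonical_pair_moment _ _ _ _ _ _ _ _ cUV B.+1 (fun i => L + (B - n i))%N n)//.
  rewrite mulr_sumr mulr_suml; apply: eq_bigr => f _.
  rewrite mulrCA -mulrA; congr (_ * _).
  rewrite -prodfV -!big_split /=; apply: eq_bigr => i _.
  by rewrite /w mulrA.
have -> : canonical_corr n = \sum_(f : {ffun I -> 'I_B.+1})
   canonical_coef P a U V (natf f) * \prod_i ((nat_of_ord (f i) == n i)%:R / risq (a i) (n i)).
  have nB' i : (n i < B.+1)%N by rewrite ltnS.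
  pose fn : {ffun I -> 'I_B.+1} := [ffun i => Ordinal (nB' i)].
  have fnE : natf fn = n by apply/ffunP => i; rewrite !ffunE.
  rewrite (bigD1 fn)//= fnE [X in _ + X]big1 ?addr0.
    rewrite /canonical_corr -prodfV; congr (_ * _); apply: eq_bigr => i _.
    by rewrite ffunE /= eqxx mul1r.
  move=> f ffn; have [i hi] : exists i, nat_of_ord (f i) != n i.
    apply/existsP; apply: contraR ffn => /existsPn h.
    apply/eqP/ffunP => i; apply/val_inj; rewrite ffunE; apply/eqP.
    by have := h i; rewrite negbK.
  by rewrite (bigD1 i)//= (negbTE hi) !mul0r mulr0.
apply: cvgn_sum => f _; apply: cvgMl_tmp; apply: cvgn_prod => i _.
exact: tilt_cvg.
Qed.

Definition poly_eval (p : seq (R * {ffun I -> nat})) (v : I -> R) :=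
  \sum_(c <- p) c.1 * \prod_i v i ^+ c.2 i.

Definition poly_corr (p : seq (R * {ffun I -> nat})) :=
  \sum_(c <- p) c.1 * canonical_corr c.2.

(* [canonical_corr] is the limit of the moments of [V / U] under the
   probability with density proportional to [prod_i U_i ^ M]. *)
Lemma poly_corr_ge0 p : (forall v, (forall i, 0 <= v i) -> 0 <= poly_eval p v) ->
  0 <= poly_corr p.
Proof.
move=> p0; pose B := \max_(c <- p) \max_i c.2 i.
have nB (c : R * {ffun I -> nat}) i : c \in p -> (c.2 i <= B)%N.
  move=> cp; apply: (@leq_trans (\max_i c.2 i)); first exact: leq_bigmax.
  by rewrite /B (big_rem c)//= leq_maxl.
pose E L := \sum_(c <- p) c.1 *
  (\int[P]_t tilt B c.2 L t / \prod_i rising (a i) (L + B)).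
have EP : E L @[L --> \oo] --> poly_corr p.
  rewrite /E /poly_corr; under eq_fun do rewrite big_seq.
  rewrite big_seq; apply: cvgn_sum => c cp; apply: cvgMl_tmp.
  by apply: tilt_moment_cvg => i; exact: nB.
rewrite -(cvg_lim _ EP)//; apply: limr_ge; first by apply/cvg_ex; exists (poly_corr p).
(* With [L > 0] both sides of the factorization below vanish where [U i t = 0], whatever the default
   value of [V i t / U i t]. *)
near=> L; have L0 : (0 < L)%N by near: L; exact: nbhs_infty_gt.
have r0 : 0 <= (\prod_i rising (a i) (L + B))^-1.
  by rewrite invr_ge0 prodr_ge0// => i _; rewrite rising_ge0// ltW.
have -> : E L = \int[P]_t (\sum_(c <- p) c.1 * tilt B c.2 L t) *
    (\prod_i rising (a i) (L + B))^-1.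
  rewrite Ex_sum; last by move=> c _; exact: finite_momentsZ.
  by rewrite mulr_suml; apply: eq_bigr => c _; rewrite ExZ// mulrA.
apply: mulr_ge0 => //; apply: Ex_ge0 => t.
rewrite (_ : \sum_(c <- p) _ = \prod_i U i t ^+ (L + B) * poly_eval p (fun i => V i t / U i t)).
  rewrite mulr_ge0 ?prodr_ge0//; first by move=> i _; rewrite exprn_ge0.
  by apply: p0 => i; rewrite divr_ge0.
rewrite /poly_eval mulr_sumr big_seq [RHS]big_seq; apply: eq_bigr => c cp.
rewrite mulrCA; congr (_ * _); rewrite -big_split /=; apply: eq_bigr => i _.
have cB := nB c i cp; rewrite expr_div_n.
have [->|u0] := eqVneq (U i t) 0.
  by rewrite !expr0n !addn_eq0 (gtn_eqF L0) /= !mul0r.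
have -> : (L + B = L + (B - c.2 i) + c.2 i)%N by rewrite -addnA subnK.
rewrite [U i t ^+ (_ + c.2 i)]exprD.
by field; rewrite expf_neq0.
Unshelve. all: end_near. Qed.

Definition is_poly (F : (I -> R) -> R) := exists p, forall v, F v = poly_eval p v.

(* [poly_corr_ge0] makes the value independent of the representation of [F]; it is [0] when [F]
   is not polynomial. *)
Definition Lam (F : (I -> R) -> R) : R :=
  poly_corr (xget [::] [set p | forall v, F v = poly_eval p v]).

Let poly_corr_cat p q : poly_corr (p ++ q) = poly_corr p + poly_corr q.
Proof. by rewrite /poly_corr big_cat. Qed.

Let poly_eval_cat p q v : poly_eval (p ++ q) v = poly_eval p v + poly_eval q v.
Proof. by rewrite /poly_eval big_cat. Qed.

Definition poly_scale k (p : seq (R * {ffun I -> nat})) := [seq (k * c.1, c.2) | c <- p].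

Let poly_corr_scale k p : poly_corr (poly_scale k p) = k * poly_corr p.
Proof.
by rewrite /poly_corr big_map mulr_sumr; apply: eq_bigr => c _; rewrite mulrA.
Qed.

Let poly_eval_scale k p v : poly_eval (poly_scale k p) v = k * poly_eval p v.
Proof.
by rewrite /poly_eval big_map mulr_sumr; apply: eq_bigr => c _; rewrite mulrA.
Qed.

Let poly_corr_le p q : (forall v, (forall i, 0 <= v i) -> poly_eval p v <= poly_eval q v) ->
  poly_corr p <= poly_corr q.
Proof.
move=> pq; rewrite -subr_ge0 -mulN1r -poly_corr_scale -poly_corr_cat.
apply: poly_corr_ge0 => v v0.
by rewrite poly_eval_cat poly_eval_scale mulN1r subr_ge0 pq.
Qed.

Lemma LamE F p : (forall v, F v = poly_eval p v) -> Lam F = poly_corr p.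
Proof.
move=> Fp; rewrite /Lam; case: xgetP => [q _ Fq|/(_ p) //].
by apply/eqP; rewrite eq_le; apply/andP; split; apply: poly_corr_le => v _;
  rewrite -Fp -Fq.
Qed.

Lemma Lam_le F G : is_poly F -> is_poly G ->
  (forall v, (forall i, 0 <= v i) -> F v <= G v) -> Lam F <= Lam G.
Proof.
move=> [p Fp] [q Gq] FG; rewrite (LamE Fp) (LamE Gq).
by apply: poly_corr_le => v v0; rewrite -Fp -Gq FG.
Qed.

Lemma is_poly_monomial (n : {ffun I -> nat}) : is_poly (fun v => \prod_i v i ^+ n i).
Proof. by exists [:: (1, n)] => v; rewrite /poly_eval big_seq1 mul1r. Qed.

Lemma Lam_monomial (n : {ffun I -> nat}) :
  Lam (fun v => \prod_i v i ^+ n i) = canonical_corr n.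
Proof.
rewrite (@LamE _ [:: (1, n)]); first by rewrite /poly_corr big_seq1 mul1r.
by move=> v; rewrite /poly_eval big_seq1 mul1r.
Qed.

Lemma is_polyD F G : is_poly F -> is_poly G -> is_poly (fun v => F v + G v).
Proof. by move=> [p Fp] [q Gq]; exists (p ++ q) => v; rewrite poly_eval_cat Fp Gq. Qed.

Lemma LamD F G : is_poly F -> is_poly G -> Lam (fun v => F v + G v) = Lam F + Lam G.
Proof.
move=> [p Fp] [q Gq]; rewrite (LamE Fp) (LamE Gq) -poly_corr_cat.
by apply: LamE => v; rewrite poly_eval_cat Fp Gq.
Qed.

Lemma is_polyZ k F : is_poly F -> is_poly (fun v => k * F v).
Proof. by move=> [p Fp]; exists (poly_scale k p) => v; rewrite poly_eval_scale Fp. Qed.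

Lemma LamZ k F : is_poly F -> Lam (fun v => k * F v) = k * Lam F.
Proof.
move=> [p Fp]; rewrite (LamE Fp) -poly_corr_scale.
by apply: LamE => v; rewrite poly_eval_scale Fp.
Qed.

Lemma is_polyM F G : is_poly F -> is_poly G -> is_poly (fun v => F v * G v).
Proof.
move=> [p Fp] [q Gq].
exists [seq (c.1 * e.1, [ffun i : I => (c.2 i + e.2 i)%N]) | c : R * {ffun I -> nat} <- p, e : R * {ffun I -> nat} <- q] => v.
rewrite Fp Gq /poly_eval big_allpairs_dep mulr_suml; apply: eq_bigr => c _.
rewrite mulr_sumr; apply: eq_bigr => e _ /=.
rewrite mulrACA; congr (_ * _); rewrite -big_split /=; apply: eq_bigr => i _.
by rewrite ffunE exprD.
Qed.

Lemma is_poly_cst k : is_poly (fun=> k).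
Proof.
exists [:: (k, [ffun=> 0%N])] => v; rewrite /poly_eval big_seq1 big1 ?mulr1// => i _.
by rewrite ffunE expr0.
Qed.

Lemma eq_is_poly F G : F =1 G -> is_poly F -> is_poly G.
Proof. by move=> /funext ->. Qed.

Lemma is_polyB F G : is_poly F -> is_poly G -> is_poly (fun v => F v - G v).
Proof.
move=> hF hG; apply: eq_is_poly (is_polyD hF (is_polyZ (-1) hG)) => v.
by rewrite mulN1r.
Qed.

Lemma LamB F G : is_poly F -> is_poly G -> Lam (fun v => F v - G v) = Lam F - Lam G.
Proof.
move=> hF hG; have := LamD hF (is_polyZ (-1) hG); rewrite LamZ// mulN1r => <-.
by congr Lam; apply/funext => v; rewrite mulN1r.
Qed.

Lemma is_polyX F n : is_poly F -> is_poly (fun v => F v ^+ n).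
Proof.
move=> hF; elim: n => [|n IH]; first exact: (is_poly_cst 1).
by apply: eq_is_poly (is_polyM hF IH) => v; rewrite exprS.
Qed.

Lemma is_poly_coord i k : is_poly (fun v => v i ^+ k).
Proof.
apply: eq_is_poly (is_poly_monomial [ffun j => if j == i then k else 0%N]) => v.
rewrite (bigD1 i)//= ffunE eqxx big1 ?mulr1// => j /negbTE ji.
by rewrite ffunE ji expr0.
Qed.

Lemma is_poly_sum (J : Type) (s : seq J) (Q : pred J) (F : J -> (I -> R) -> R) :
  (forall j, Q j -> is_poly (F j)) -> is_poly (fun v => \sum_(j <- s | Q j) F j v).
Proof.
move=> h; elim: s => [|j s IH].
  by apply: eq_is_poly (is_poly_cst 0) => v; rewrite big_nil.
have [Qj|Qj] := boolP (Q j).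
  by apply: eq_is_poly (is_polyD (h _ Qj) IH) => v; rewrite big_cons Qj.
by apply: eq_is_poly IH => v; rewrite big_cons (negbTE Qj).
Qed.

Lemma is_poly_prod (J : Type) (s : seq J) (Q : pred J) (F : J -> (I -> R) -> R) :
  (forall j, Q j -> is_poly (F j)) -> is_poly (fun v => \prod_(j <- s | Q j) F j v).
Proof.
move=> h; elim: s => [|j s IH].
  by apply: eq_is_poly (is_poly_cst 1) => v; rewrite big_nil.
have [Qj|Qj] := boolP (Q j).
  by apply: eq_is_poly (is_polyM (h _ Qj) IH) => v; rewrite big_cons Qj.
by apply: eq_is_poly IH => v; rewrite big_cons (negbTE Qj).
Qed.

Lemma eq_Lam F G : F =1 G -> Lam F = Lam G.
Proof. by move=> /funext ->. Qed.

Lemma canonical_corr0 : canonical_corr [ffun=> 0%N] = 1.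
Proof.
rewrite /canonical_corr big1 => [|i _]; last by rewrite ffunE risq0.
rewrite divr1 /canonical_coef (eq_Ex _ (g := fun=> 1)) ?Ex_cst// => t.
by rewrite /ell_prod !big1 ?mulr1// => i _; rewrite ffunE ell0.
Qed.

Lemma Lam_cst k : Lam (fun=> k) = k.
Proof.
rewrite (@LamE _ [:: (k, [ffun=> 0%N])]) => [|v].
  by rewrite /poly_corr big_seq1 canonical_corr0 mulr1.
by rewrite /poly_eval big_seq1 big1 ?mulr1// => i _; rewrite ffunE expr0.
Qed.

Lemma Lam_sum (J : Type) (s : seq J) (Q : pred J) (F : J -> (I -> R) -> R) :
  (forall j, Q j -> is_poly (F j)) ->
  Lam (fun v => \sum_(j <- s | Q j) F j v) = \sum_(j <- s | Q j) Lam (F j).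
Proof.
move=> h; elim: s => [|j s IH].
  by rewrite big_nil -[RHS](Lam_cst 0); apply: eq_Lam => v; rewrite big_nil.
rewrite big_cons; case: ifPn => Qj.
  rewrite -IH -LamD//; [|exact: h|exact: is_poly_sum].
  by apply: eq_Lam => v; rewrite big_cons Qj.
by rewrite -IH; apply: eq_Lam => v; rewrite big_cons (negbTE Qj).
Qed.

Lemma Lam_ge0 F : is_poly F -> (forall v, (forall i, 0 <= v i) -> 0 <= F v) -> 0 <= Lam F.
Proof. by move=> hF F0; rewrite -(Lam_cst 0); apply: Lam_le => //; exact: is_poly_cst. Qed.

(** Discriminant of a nonnegative quadratic in [s]. A weight [W] that is a power of one coordinate
    gives the log-convexity used in [Lam_contract]. *)
Lemma Lam_cauchy_schwarz W F G : is_poly W -> is_poly F -> is_poly G ->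
  (forall v, (forall i, 0 <= v i) -> 0 <= W v) ->
  Lam (fun v => W v * F v * G v) ^+ 2 <=
  Lam (fun v => W v * F v ^+ 2) * Lam (fun v => W v * G v ^+ 2).
Proof.
move=> hW hF hG W0.
have hsq H : is_poly H -> is_poly (fun v => W v * H v ^+ 2).
  by move=> hH; apply: is_polyM => //; exact: is_polyX.
have sq0 H : is_poly H -> 0 <= Lam (fun v => W v * H v ^+ 2).
  by move=> hH; apply: Lam_ge0 => [|v v0]; [exact: hsq|rewrite mulr_ge0 ?W0 ?sqr_ge0].
have hWFG : is_poly (fun v => W v * F v * G v).
  by apply: is_polyM => //; exact: is_polyM.
apply: quadratic_discr; [exact: sq0|exact: sq0|] => s.
have -> : Lam (fun v => W v * F v ^+ 2) - 2 * s * Lam (fun v => W v * F v * G v) +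
     s ^+ 2 * Lam (fun v => W v * G v ^+ 2) = Lam (fun v => W v * (F v - s * G v) ^+ 2).
  have h1 : is_poly (fun v => W v * F v ^+ 2) by exact: hsq.
  have h2 : is_poly (fun v => 2 * s * (W v * F v * G v)) by exact: is_polyZ.
  have h3 : is_poly (fun v => s ^+ 2 * (W v * G v ^+ 2)) by apply: is_polyZ; exact: hsq.
  rewrite -(LamZ _ hWFG) -(LamZ _ (hsq G hG)) -(LamB h1 h2) -LamD//; last exact: is_polyB.
  by apply: eq_Lam => v; ring.
by apply: sq0; apply: is_polyB => //; exact: is_polyZ.
Qed.

Section bounded.
Hypothesis bounded_corr : forall i, exists C, forall k, Lam (fun v => v i ^+ k) <= C.

(* In [k], these moments are log-convex and bounded, hence nonincreasing. *)
Lemma Lam_contract i k F : is_poly F ->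
  Lam (fun v => v i ^+ k.+1 * F v ^+ 2) <= Lam (fun v => v i ^+ k * F v ^+ 2).
Proof.
move=> hF; pose u m := Lam (fun v => v i ^+ (k + m) * F v ^+ 2).
have [C hC] := bounded_corr i.
have hu m : is_poly (fun v => v i ^+ (k + m) * F v ^+ 2).
  by apply: is_polyM; [exact: is_poly_coord|exact: is_polyX].
have pos m (v : I -> R) : (forall i, 0 <= v i) -> 0 <= v i ^+ m.
  by move=> v0; rewrite exprn_ge0.
have -> : Lam (fun v => v i ^+ k.+1 * F v ^+ 2) = u 1%N by rewrite /u addn1.
have -> : Lam (fun v => v i ^+ k * F v ^+ 2) = u 0%N by rewrite /u addn0.
apply: (@logconvex_bounded _ _ (C + Lam (fun v => F v ^+ 4))).
- move=> m; apply: Lam_ge0; first exact: hu.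
  by move=> v v0; apply: mulr_ge0; [exact: pos|exact: sqr_ge0].
- move=> m; have := @Lam_cauchy_schwarz (fun v => v i ^+ (k + m)) F (fun v => v i * F v).
  have hvF : is_poly (fun v => v i * F v).
    by apply: is_polyM => //; exact: (is_poly_coord i 1).
  move=> /(_ (is_poly_coord i _) hF hvF (@pos _)).
  rewrite /u; congr (_ ^+ 2 <= _ * _); apply: eq_Lam => v.
    by rewrite addnS exprSr; ring.
  by rewrite !addnS !exprSr; ring.
(* Boundedness in [m]: [x y <= x^2 + y^2] separates the powers of the coordinate, bounded by [C],
   from [F]. *)
- move=> m; rewrite -[leLHS]mul1r; apply: (@le_trans _ _ (Lam (fun v => v i ^+ (k + m).*2) + Lam (fun v => F v ^+ 4))).
    rewrite -LamD; [|exact: is_poly_coord|exact: is_polyX].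
    rewrite mul1r; apply: Lam_le => //.
      by apply: is_polyD; [exact: is_poly_coord|exact: is_polyX].
    move=> v _; have := sqr_ge0 (v i ^+ (k + m) - F v ^+ 2).
    have -> : v i ^+ (k + m).*2 = (v i ^+ (k + m)) ^+ 2 by rewrite -exprM muln2.
    have -> : F v ^+ 4 = (F v ^+ 2) ^+ 2 by rewrite -exprM.
    by have := sqr_ge0 (v i ^+ (k + m)); have := sqr_ge0 (F v ^+ 2); nra.
  by rewrite lerD2r.
Qed.

Lemma Lam_contract0 i k F : is_poly F ->
  Lam (fun v => v i ^+ k * F v ^+ 2) <= Lam (fun v => F v ^+ 2).
Proof.
move=> hF; elim: k => [|k IH]; last exact: le_trans (Lam_contract _ _ _) IH.
by rewrite le_eqVlt; apply/orP; left; apply/eqP/eq_Lam => v; rewrite expr0 mul1r.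
Qed.

(** [Lam_contract] concerns squares, so [(1 - v i)^j] is split by parity: for even [j] it is a
    square, and for odd [j] a square times [1 - v i], where the contraction applies. *)
Lemma Lam_completely_monotone i k j :
  0 <= Lam (fun v => v i ^+ k * (1 - v i) ^+ j).
Proof.
have hF m : is_poly (fun v => (1 - v i) ^+ m).
  by apply: is_polyX; apply: is_polyB; [exact: (is_poly_cst 1)|exact: (is_poly_coord i 1)].
have hG k' m : is_poly (fun v => v i ^+ k' * ((1 - v i) ^+ m) ^+ 2).
  by apply: is_polyM; [exact: is_poly_coord|exact: is_polyX].
rewrite -(odd_double_half j); set m := j./2; case: (odd j).
  rewrite add1n (eq_Lam (G := fun v => v i ^+ k * ((1 - v i) ^+ m) ^+ 2 -
       v i ^+ k.+1 * ((1 - v i) ^+ m) ^+ 2)).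
    by rewrite LamB// subr_ge0; exact: Lam_contract.
  by move=> v; rewrite -exprM muln2 !exprS; ring.
rewrite add0n; apply: Lam_ge0.
  by apply: is_polyM; [exact: is_poly_coord|exact: hF].
move=> v v0; rewrite -muln2 exprM mulr_ge0 ?sqr_ge0// exprn_ge0//.
Qed.

End bounded.
End tilted_functional.

(** * Concentration under refinement *)

Section vanishing.
Context (R : realType).
Implicit Types (x y z : nat -> R).

Lemma vanish_le x y : (forall m, `|x m| <= y m) -> y m @[m --> \oo] --> (0 : R) ->
  x m @[m --> \oo] --> (0 : R).
Proof.
move=> xy y0; apply/cvgrPdist_lt => e e0; move/cvgrPdist_lt : y0 => /(_ _ e0); apply: filterS => m.
rewrite !sub0r !normrN; apply: le_lt_trans; apply: le_trans (xy m) _; exact: ler_norm.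
Qed.

Lemma vanish_sqr x y C : (forall m, x m ^+ 2 <= C * y m) ->
  y m @[m --> \oo] --> (0 : R) -> x m @[m --> \oo] --> (0 : R).
Proof.
move=> xy y0.
have x20 : x m ^+ 2 @[m --> \oo] --> (0 : R).
  apply: (@vanish_le _ (fun m => C * y m)).
    by move=> m; rewrite ger0_norm ?sqr_ge0.
  by rewrite -(mulr0 C); exact: cvgMl_tmp.
apply/cvgrPdist_lt => e e0; have e20 : 0 < e ^+ 2 by rewrite exprn_gt0.
move/cvgrPdist_lt : x20 => /(_ _ e20); apply: filterS => m.
rewrite !sub0r !normrN ger0_norm ?sqr_ge0// -(real_normK (num_real (x m))).
by rewrite ltr_pXn2r// nnegrE// ltW.
Qed.

End vanishing.

(** * Concentration of power sums for a sequence of positive functionals *)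

Section concentration.
Context (R : realType) (X : nat -> Type).
Context (isP : forall m, (X m -> R) -> Prop) (L : forall m, (X m -> R) -> R).
Arguments isP {m}.
Arguments L {m}.
Hypotheses
  (PD : forall m (F G : X m -> R), isP F -> isP G -> isP (fun v => F v + G v))
  (PZ : forall m k (F : X m -> R), isP F -> isP (fun v => k * F v))
  (PM : forall m (F G : X m -> R), isP F -> isP G -> isP (fun v => F v * G v))
  (P1 : forall m k, isP (fun _ : X m => k))
  (LD : forall m (F G : X m -> R), isP F -> isP G -> L (fun v => F v + G v) = L F + L G)
  (LZ : forall m k (F : X m -> R), isP F -> L (fun v => k * F v) = k * L F)
  (L1 : forall m k, L (fun _ : X m => k) = k)
  (Lsq : forall m (F : X m -> R), isP F -> 0 <= L (fun v => F v ^+ 2))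
  (LCS : forall m (F G : X m -> R), isP F -> isP G ->
     L (fun v => F v * G v) ^+ 2 <= L (fun v => F v ^+ 2) * L (fun v => G v ^+ 2)).
Context (S h : forall m, nat -> X m -> R) (alpha : R) (kap c : nat -> R).
Hypotheses
  (PS : forall m l, isP (@S m l)) (Ph : forall m l, isP (@h m l))
  (h0 : forall m (v : X m), h 0 v = 1 :> R)
  (hrec : forall m N (v : X m), N%:R * h N v = \sum_(l < N) S l.+1 v * h (N - l.+1) v)
  (alpha0 : 0 <= alpha)
  (S_contract : forall m l (F : X m -> R), isP F ->
     L (fun v => (S l.+1 v * F v) ^+ 2) <= alpha ^+ 2 * L (fun v => F v ^+ 2))
  (LS : forall l, L (@S m l.+1) @[m --> \oo] --> kap l.+1)
  (Lh : forall m N, L (@h m N) = c N)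
  (c0 : c 0%N = 1) (crec : logderiv kap c).

Let PB m (F G : X m -> R) : isP F -> isP G -> isP (fun v => F v - G v).
Proof.
move=> hF hG; have := PD hF (PZ (-1) hG); congr isP.
by apply/funext => v; rewrite mulN1r.
Qed.

Let LB m (F G : X m -> R) : isP F -> isP G -> L (fun v => F v - G v) = L F - L G.
Proof.
move=> hF hG; have := LD hF (PZ (-1) hG); rewrite LZ// mulN1r => <-.
by congr L; apply/funext => v; rewrite mulN1r.
Qed.

Let Psum m n (F : nat -> X m -> R) : (forall i, isP (F i)) ->
  isP (fun v => \sum_(i < n) F i v).
Proof.
move=> hF; elim: n => [|n IH].
  by have := P1 m 0; congr isP; apply/funext => v; rewrite big_ord0.
by have := PD IH (hF n); congr isP; apply/funext => v; rewrite big_ord_recr.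
Qed.

Let Lsum m n (F : nat -> X m -> R) : (forall i, isP (F i)) ->
  L (fun v => \sum_(i < n) F i v) = \sum_(i < n) L (F i).
Proof.
move=> hF; elim: n => [|n IH].
  rewrite big_ord0 -[RHS](L1 m 0); congr L; apply/funext => v; exact: big_ord0.
rewrite big_ord_recr /= -IH -LD//; last exact: Psum.
by congr L; apply/funext => v; rewrite big_ord_recr.
Qed.

Let Pext m (F G : X m -> R) : F =1 G -> isP F -> isP G.
Proof. by move=> /funext ->. Qed.
Let Lext m (F G : X m -> R) : F =1 G -> L F = L G.
Proof. by move=> /funext ->. Qed.

Let nrm m (F : X m -> R) := L (fun v => F v ^+ 2).

Let Psq m (F : X m -> R) : isP F -> isP (fun v => F v ^+ 2).
Proof. by move=> hF; apply: Pext (PM hF hF) => v; rewrite expr2. Qed.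

Let nrmZ m k (F : X m -> R) : isP F -> nrm (fun v => k * F v) = k ^+ 2 * nrm F.
Proof.
by move=> hF; rewrite /nrm -LZ; [apply: Lext => v; rewrite exprMn|exact: Psq].
Qed.

Let nrm0 m (F : X m -> R) : isP F -> 0 <= nrm F. Proof. exact: Lsq. Qed.

Let nrmD m (F G : X m -> R) : isP F -> isP G ->
  nrm (fun v => F v + G v) <= 2 * (nrm F + nrm G).
Proof.
move=> hF hG; have h1 := nrm0 (PB hF hG).
have : nrm (fun v => F v + G v) + nrm (fun v => F v - G v) = 2 * (nrm F + nrm G).
  have h2 := Psq hF; have h3 := Psq hG.
  rewrite /nrm -[in RHS]LD// -[in RHS]LZ; last exact: PD.
  rewrite -LD; [|exact/Psq/PD|exact/Psq/PB].
  by apply: Lext => v; ring.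
lra.
Qed.

Let nrm_sum m n (F : nat -> X m -> R) : (forall i, isP (F i)) ->
  nrm (fun v => \sum_(i < n) F i v) <= 2 ^+ n * \sum_(i < n) nrm (F i).
Proof.
move=> hF; elim: n => [|n IH].
  rewrite big_ord0 mulr0 /nrm (Lext (G := fun=> 0)) ?L1// => v.
  by rewrite big_ord0 expr0n.
rewrite /nrm (Lext (G := fun v => (\sum_(i < n) F i v + F n v) ^+ 2)); last first.
  by move=> v; rewrite big_ord_recr.
apply: le_trans (nrmD (Psum _ hF) (hF n)) _.
rewrite big_ord_recr /= exprS -mulrA ler_wpM2l// mulrDr lerD//.
by rewrite ler_peMl ?nrm0// exprn_ege1// ler1n.
Qed.

(** Newton's identity expresses [h N] through the bounded multipliers [S] and earlier [h], so
    multiplication by [h N] is bounded in [L^2] uniformly in [m]. *)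
Let nrm_h N : exists2 C, 0 <= C & forall m (G : X m -> R), isP G ->
  nrm (fun v => h N v * G v) <= C * nrm G.
Proof.
elim/ltn_ind: N => -[|N] IH.
  exists 1 => // m G hG; rewrite mul1r le_eqVlt; apply/orP; left; apply/eqP.
  by apply: Lext => v; rewrite h0 mul1r.
have {}IH : forall l : 'I_N.+1, exists2 C, 0 <= C & forall m (G : X m -> R), isP G ->
    nrm (fun v => h (N.+1 - l.+1) v * G v) <= C * nrm G.
  by move=> l; apply: IH; rewrite subSS ltnS leq_subr.
pose C l := s2val (cid2 (IH l)).
have C0 l : 0 <= C l := s2valP (cid2 (IH l)).
have hC l := s2valP' (cid2 (IH l)).
pose C' := N.+1%:R ^- 2 * (2 ^+ N.+1 * \sum_(l < N.+1) (alpha ^+ 2 * C l)).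
exists C'.
  rewrite /C' mulr_ge0 ?invr_ge0 ?exprn_ge0// mulr_ge0 ?exprn_ge0// sumr_ge0// => l _.
  by rewrite mulr_ge0 ?sqr_ge0.
move=> m G hG.
pose F (l : nat) v := S l.+1 v * (h (N.+1 - l.+1) v * G v).
have hF l : isP (@F l) by apply: PM => //; exact: PM.
have -> : nrm (fun v => h N.+1 v * G v) =
    N.+1%:R ^- 2 * nrm (fun v => \sum_(l < N.+1) F l v).
  rewrite -exprVn -nrmZ; last exact: Psum.
  apply: Lext => v; congr (_ ^+ 2); rewrite /F.
  under eq_bigr do rewrite mulrA.
  by rewrite -mulr_suml -hrec mulrA mulrA mulVf ?mul1r// factS_neq0.
rewrite /C' -!mulrA ler_wpM2l ?invr_ge0 ?exprn_ge0//.
apply: le_trans (nrm_sum _ hF) _; rewrite ler_wpM2l ?exprn_ge0// mulr_suml.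
apply: ler_sum => l _; apply: le_trans (S_contract _ (PM (Ph _ _) hG)) _.
by rewrite -[leRHS]mulrA ler_wpM2l ?sqr_ge0//; exact: hC.
Qed.

Let D l m := nrm (fun v : X m => S l v - kap l).
Let PSk m l : isP (fun v : X m => S l v - kap l). Proof. exact: PB. Qed.
Let Phc m l : isP (fun v : X m => h l v - c l). Proof. exact: PB. Qed.

(** Cauchy-Schwarz, for a factor that vanishes in [L^2] against a bounded one. *)
Let pair_vanish (F G : forall m, X m -> R) C :
  (forall m, isP (F m)) -> (forall m, isP (G m)) -> (forall m, nrm (G m) <= C) ->
  nrm (F m) @[m --> \oo] --> (0 : R) ->
  L (fun v => F m v * G m v) @[m --> \oo] --> (0 : R).
Proof.
move=> hF hG GC F0; apply: (@vanish_sqr _ _ (fun m => nrm (F m)) C) => // m.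
apply: le_trans (LCS (hF m) (hG m)) _; rewrite mulrC; apply: ler_wpM2r; [exact: nrm0|exact: GC].
Qed.

(** The recursions of [h] and of its limit [c] are subtracted term by term, with
    [S h - kap c = S (h - c) + c (S - kap)]. *)
Let h_vanish n : (forall l, (0 < l < n)%N -> D l m @[m --> \oo] --> (0 : R)) ->
  forall j, (j < n)%N -> nrm (fun v : X m => h j v - c j) @[m --> \oo] --> (0 : R).
Proof.
move=> Dn; elim/ltn_ind => -[|j] IH jn.
  rewrite (_ : (fun m => _) = cst 0); first exact: cvg_cst.
  by apply/funext => m; rewrite /nrm (Lext (G := fun=> 0)) ?L1// => v; rewrite h0 c0 subrr expr0n.
pose F m (l : nat) (v : X m) := S l.+1 v * (h (j.+1 - l.+1) v - c (j.+1 - l.+1)%N) +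
   c (j.+1 - l.+1)%N * (S l.+1 v - kap l.+1).
have hF m l : isP (@F m l).
  by apply: PD; [exact: PM|exact: PZ].
have nF m l : nrm (@F m l) <= 2 * (alpha ^+ 2 * nrm (fun v : X m => h (j.+1 - l.+1) v - c (j.+1 - l.+1)%N) +
    c (j.+1 - l.+1)%N ^+ 2 * D l.+1 m).
  apply: le_trans (nrmD (PM (PS _ _) (Phc _ _)) (PZ _ (PSk _ _))) _.
  by rewrite ler_wpM2l// nrmZ// lerD2r; exact: S_contract.
apply: (@vanish_le _ _ (fun m => j.+1%:R ^- 2 * (2 ^+ j.+1 * \sum_(l < j.+1)
   (2 * (alpha ^+ 2 * nrm (fun v : X m => h (j.+1 - l.+1) v - c (j.+1 - l.+1)%N) +
    c (j.+1 - l.+1)%N ^+ 2 * D l.+1 m))))).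
  move=> m; rewrite ger0_norm ?nrm0//.
  have -> : nrm (fun v : X m => h j.+1 v - c j.+1) =
      j.+1%:R ^- 2 * nrm (fun v : X m => \sum_(l < j.+1) F m l v).
    rewrite -exprVn -nrmZ; last exact: Psum.
    apply: Lext => v; congr (_ ^+ 2).
    apply: (@mulfI _ j.+1%:R); first exact: factS_neq0.
    rewrite mulrA divff ?factS_neq0// mul1r mulrBr hrec crec -sumrB.
    by apply: eq_bigr => l _; rewrite /F; ring.
  rewrite ler_wpM2l ?invr_ge0 ?exprn_ge0//.
  apply: le_trans (nrm_sum _ (hF m)) _; rewrite ler_wpM2l ?exprn_ge0//.
  by apply: ler_sum => l _; exact: nF.
rewrite -[X in _ --> X](mulr0 (j.+1%:R ^- 2)); apply: cvgMl_tmp.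
rewrite -[X in _ --> X](mulr0 (2 ^+ j.+1)); apply: cvgMl_tmp.
rewrite [X in _ --> X](_ : 0 = \sum_(l < j.+1) (2 * (alpha ^+ 2 * 0 + c (j.+1 - l.+1)%N ^+ 2 * 0))); last first.
  by rewrite big1// => l _; rewrite !mulr0 addr0 mulr0.
apply: cvgn_sum => l _; apply: cvgMl_tmp; apply: cvgD; apply: cvgMl_tmp.
  by apply: IH; [rewrite subSS ltnS leq_subr|rewrite (leq_ltn_trans _ jn)// leq_subr].
by apply: Dn; rewrite /= (leq_ltn_trans _ jn)//.
Qed.

Let nrm_h1 N : exists2 C, 0 <= C & forall m, nrm (@h m N) <= C.
Proof.
have [C C0 hC] := nrm_h N; exists C => // m.
have := hC m (fun=> 1) (P1 m 1).
have -> : nrm (fun _ : X m => 1) = 1 by rewrite /nrm (Lext (G := fun=> 1)) ?L1// => v; rewrite expr1n.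
by rewrite mulr1; congr (_ <= _); apply: Lext => v; rewrite mulr1.
Qed.

Let nrm_S l m : nrm (@S m l.+1) <= alpha ^+ 2.
Proof.
have := S_contract l (P1 m 1).
have -> : L (fun _ : X m => 1 ^+ 2) = 1 by rewrite (Lext (G := fun=> 1)) ?L1// => v; rewrite expr1n.
by rewrite mulr1; congr (_ <= _); apply: Lext => v; rewrite mulr1.
Qed.

(* Strong induction on [n].  Expanding [2n h_(2n)] by [hrec] yields the limit of [L (S_n h_n)],
   because the terms other than [S_n h_n] have a factor that is already known to concentrate;
   expanding [n h_n] in [L (S_n h_n)] then yields the limit of [L (S_n ^ 2)]. *)
Lemma concentration n : (0 < n)%N -> D n m @[m --> \oo] --> (0 : R).
Proof.
elim/ltn_ind: n => -[//|n'] IH _; set n := n'.+1 in IH *.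
have Dn l : (0 < l < n)%N -> D l m @[m --> \oo] --> (0 : R).
  by move=> /andP[l0 ln]; exact: IH.
have hn := h_vanish Dn.
have LhB m l : L (fun v : X m => h l v - c l) = 0.
  by rewrite LB// Lh L1 subrr.
have low l N : (0 < l < n)%N ->
    L (fun v : X m => S l v * h N v) @[m --> \oo] --> kap l * c N.
  move=> ln; have [C _ hC] := nrm_h1 N.
  have h1 := @pair_vanish (fun m v => S l v - kap l) (fun m => @h m N) C
    (fun m => PSk m l) (fun m => Ph m N) hC (Dn l ln).
  have hh' : L (fun v : X m => (S l v - kap l) * h N v) + kap l * c N @[m --> \oo] -->
      0 + kap l * c N by apply: cvgD h1 _; exact: cvg_cst.
  rewrite add0r in hh'; apply: near_eq_cvgn hh'; apply: nearW => m /=.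
  rewrite -(Lh m N) -LZ// -LD; [|exact: PM|exact: PZ].
  by apply: Lext => v; ring.
have high l N : (N < n)%N ->
    L (fun v : X m => S l.+1 v * h N v) @[m --> \oo] --> kap l.+1 * c N.
  move=> Nn.
  have h1 := @pair_vanish (fun m v => h N v - c N) (fun m => @S m l.+1) (alpha ^+ 2)
    (fun m => Phc m N) (fun m => PS m _) (nrm_S l) (hn N Nn).
  have h2 : L (fun v : X m => (h N v - c N) * S l.+1 v) + L (@S m l.+1) * c N @[m --> \oo] -->
      0 + kap l.+1 * c N by apply: cvgD h1 _; apply: cvgMr_tmp; exact: LS.
  rewrite add0r in h2; apply: near_eq_cvgn h2; apply: nearW => m /=.
  rewrite mulrC -LZ// -LD; [|exact: PM|exact: PZ].
  by apply: Lext => v; ring.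
have mid : L (fun v : X m => S n v * h n v) @[m --> \oo] --> kap n * c n.
  have [n2 nn] : (n < n.*2)%N /\ (n.*2 - n = n)%N by rewrite -addnn addnK /n; lia.
  (* Because of the shift [l.+1], the summand of index [l0 = n - 1] is [S_n h_n]. *)
  pose l0 : 'I_n.*2 := Ordinal (leq_trans (ltnSn n') (ltnW n2)).
  have hl0 : (l0.+1 = n)%N by [].
  have h2 : n.*2%:R * c n.*2 - \sum_(l < n.*2 | l != l0) L (fun v : X m => S l.+1 v * h (n.*2 - l.+1) v)
      @[m --> \oo] --> n.*2%:R * c n.*2 - \sum_(l < n.*2 | l != l0) kap l.+1 * c (n.*2 - l.+1)%N.
    apply: cvgB; first exact: cvg_cst.
    apply: cvgn_sum => l ll0; have [ln|nl] := leqP l.+1 n; last first.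
      by apply: high; rewrite -[n in X in (_ < X)%N]nn ltn_sub2l.
    apply: low; rewrite /= ltn_neqAle ln andbT; apply: contra ll0 => /eqP e.
    by apply/eqP/val_inj; apply: succn_inj; rewrite /= e hl0.
  have e1 : n.*2%:R * c n.*2 - \sum_(l < n.*2 | l != l0) kap l.+1 * c (n.*2 - l.+1)%N = kap n * c n.
    by rewrite crec (bigD1 l0)//= hl0 nn addrK.
  rewrite e1 in h2; apply: near_eq_cvgn h2; apply: nearW => m.
  rewrite -(Lh m) -LZ// (Lext (@hrec m _))
    (@Lsum m n.*2 (fun l v => S l.+1 v * h (n.*2 - l.+1) v)); last by move=> l; exact: PM.
  by rewrite (bigD1 l0)//= hl0 nn addrK.
have mid2 l : (0 < l < n)%N ->
    L (fun v : X m => S n v * (S l v * h (n - l) v)) @[m --> \oo] --> kap n * (kap l * c (n - l)%N).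
  move=> /[dup] ln /andP[l0 ln'].
  have hh : (n - l < n)%N by rewrite /n; lia.
  have [C C0 hC] := nrm_h (n - l).
  have h1 := @pair_vanish (fun m v => S l v - kap l) (fun m v => h (n - l) v * S n v) (C * alpha ^+ 2)
    (fun m => PSk m l) (fun m => PM (Ph m _) (PS m _))
    (fun m => le_trans (hC m _ (PS m _)) (ler_wpM2l C0 (nrm_S n' m))) (Dn l ln).
  have h2 : L (fun v : X m => (S l v - kap l) * (h (n - l) v * S n v)) +
      kap l * L (fun v : X m => S n v * h (n - l) v) @[m --> \oo] -->
      0 + kap l * (kap n * c (n - l)%N).
    by apply: cvgD h1 _; apply: cvgMl_tmp; exact: (high n' (n - l)%N hh).
  rewrite add0r mulrCA in h2; apply: near_eq_cvgn h2; apply: nearW => m /=.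
  rewrite -LZ; last exact: PM.
  rewrite -LD; [|by apply: PM => //; exact: PM|by apply: PZ; exact: PM].
  by apply: Lext => v; rewrite -/n; ring.
have sq : L (fun v : X m => S n v ^+ 2) @[m --> \oo] --> kap n ^+ 2.
  have h1 : n%:R * L (fun v : X m => S n v * h n v) -
     \sum_(l < n') L (fun v : X m => S n v * (S l.+1 v * h (n - l.+1) v)) @[m --> \oo] -->
     n%:R * (kap n * c n) - \sum_(l < n') kap n * (kap l.+1 * c (n - l.+1)%N).
    apply: cvgB; first exact: cvgMl_tmp.
    by apply: cvgn_sum => l _; apply: mid2; rewrite /= ltnS.
  have e1 : n%:R * (kap n * c n) - \sum_(l < n') kap n * (kap l.+1 * c (n - l.+1)%N) = kap n ^+ 2.
    by rewrite mulrCA crec /n big_ord_recr /= subnn c0 -mulr_sumr; ring.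
  rewrite e1 in h1; apply: near_eq_cvgn h1; apply: nearW => m.
  rewrite -LZ; last exact: PM.
  rewrite (Lext (G := fun v => S n v * (\sum_(l < n) S l.+1 v * h (n - l.+1) v))); last first.
    by move=> v; rewrite -hrec; ring.
  rewrite (Lext (G := fun v => \sum_(l < n) S n v * (S l.+1 v * h (n - l.+1) v))); last first.
    by move=> v; rewrite mulr_sumr.
  rewrite (@Lsum m n (fun l v => S n v * (S l.+1 v * h (n - l.+1) v))); last first.
    by move=> l; apply: PM => //; exact: PM.
  rewrite {1}/n big_ord_recr /= addrAC subrr add0r.
  by apply: Lext => v; rewrite subnn h0 mulr1 expr2.
have hh' : L (fun v : X m => S n v ^+ 2) + (- 2 * kap n * L (fun v : X m => S n v) + kap n ^+ 2)
    @[m --> \oo] --> kap n ^+ 2 + (- 2 * kap n * kap n + kap n ^+ 2).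
  apply: cvgD => //; apply: cvgD; last exact: cvg_cst.
  by apply: cvgMl_tmp; exact: LS.
have e0 : kap n ^+ 2 + (- 2 * kap n * kap n + kap n ^+ 2) = 0 by ring.
rewrite e0 in hh'; apply: near_eq_cvgn hh'; apply: nearW => m /=; rewrite /D /nrm.
rewrite -LZ// -(L1 m (kap n ^+ 2)) -LD//; last exact: PZ.
rewrite -LD; [|exact: Psq|by apply: PD => //; exact: PZ].
by apply: Lext => v; rewrite -/n; ring.
Qed.

(** Allows the power sum to be replaced by its limit in front of any [G] bounded in [L^2]; this is
    how it decorrelates from the sets that are not refined. *)
Lemma concentration_product l N (G : forall m, X m -> R) C :
  (forall m, isP (G m)) -> (forall m, L (fun v => G m v ^+ 2) <= C) ->
  L (fun v => S l.+1 v * (h N v * G m v)) - kap l.+1 * L (fun v => h N v * G m v)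
    @[m --> \oo] --> (0 : R).
Proof.
move=> hG GC; have [C' C'0 hC'] := nrm_h N.
have h1 := @pair_vanish (fun m v => S l.+1 v - kap l.+1) (fun m v => h N v * G m v) (C' * C)
    (fun m => PSk m l.+1) (fun m => PM (Ph m N) (hG m)).
have {}h1 := h1 _ (concentration (ltn0Sn l)).
have := h1 (fun m => le_trans (hC' m (G m) (hG m)) (ler_wpM2l C'0 (GC m))).
apply: cvg_trans; apply: near_eq_cvg; apply: nearW => m /=.
rewrite -LZ; last exact: PM.
rewrite -LB; [|by apply: PM => //; exact: PM|by apply: PZ; exact: PM].
by apply: Lext => v; ring.
Qed.

End concentration.

Section iterated_convolution.
Context (R : realType) (K : finType).
Implicit Types (u kap : K -> nat -> R).

(** The coefficient of [t^N] in a product of generating functions over [K]; the bound [N.+1] on the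
    values loses nothing, as they add up to [N]. *)
Definition bconv u N : R :=
  \sum_(f : {ffun K -> 'I_N.+1} | (\sum_i f i == N)%N) \prod_i u i (f i).

(** The same coefficient by successive convolutions, suited to induction on the list. *)
Let wconv u (s : seq K) : nat -> R :=
  foldr (fun i w => conv (u i) w) (fun n => (n == 0)%:R) s.

Let wconv_coef u s M n : (n < M)%N ->
  wconv u s n = (\prod_(i <- s) \poly_(k < M) u i k)`_n.
Proof.
elim: s n => [|i s IH] n nM; first by rewrite big_nil coef1.
rewrite big_cons coefM /= /conv; apply: eq_bigr => k _.
rewrite coef_poly (leq_trans (ltn_ord k) nM) IH//.
by rewrite (leq_ltn_trans (leq_subr _ _)).
Qed.

Let bconvE u N : bconv u N = wconv u (index_enum K) N.
Proof.
rewrite (@wconv_coef _ _ N.+1)//.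
under [in RHS]eq_bigr => i _ do rewrite poly_def.
rewrite bigA_distr_bigA /= coef_sum /bconv big_mkcond; apply: eq_bigr => f _.
rewrite (_ : \prod_i _ = (\prod_i u i (f i)) *: 'X^(\sum_i f i)).
  by rewrite coefZ coefXn eq_sym; case: eqP => _; rewrite ?mulr1 ?mulr0.
rewrite scaler_prod; congr (_ *: _).
by elim/big_ind2: _ => [|x1 y1 x2 y2 -> ->|i _]; rewrite ?expr0 ?exprD.
Qed.

Lemma logderiv_bconv kap u : (forall i, logderiv (kap i) (u i)) ->
  logderiv (fun l => \sum_i kap i l) (bconv u).
Proof.
move=> h n; rewrite bconvE.
under eq_bigr do rewrite bconvE.
move: n; elim: (index_enum K) => [|i s IH].
  move=> [|n]; first by rewrite big_ord0 mul0r.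
  by rewrite /= mulr0 big1// => l _; rewrite big_nil mul0r.
have {}IH : logderiv (fun l => \sum_(i <- s) kap i l) (wconv u s) := IH.
suff : logderiv (fun l => \sum_(j <- i :: s) kap j l) (wconv u (i :: s)) by [].
by apply: eq_logderiv (logderiv_conv (h i) IH) => l _; rewrite big_cons.
Qed.

Lemma bconv0 u : bconv u 0 = \prod_i u i 0%N.
Proof.
rewrite bconvE; elim: (index_enum K) => [|i s IH]; first by rewrite big_nil.
by rewrite big_cons /= conv0 IH.
Qed.

Lemma ell_bconv (a x : K -> R) N :
  ell (\sum_i a i) N (\sum_i x i) = bconv (fun i k => ell (a i) k (x i)) N.
Proof.
apply: (@logderiv_uniq _ (fun l => \sum_i (-1) ^+ l * (a i - l%:R * x i))
  (fun n => ell (\sum_i a i) n (\sum_i x i))).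
- by rewrite ell0 bconv0 big1// => i _; exact: ell0.
- apply: eq_logderiv (logderiv_ell (\sum_i a i) (\sum_i x i)) => l _.
  by rewrite -mulr_sumr sumrB -mulr_sumr.
- by apply: logderiv_bconv => i; exact: logderiv_ell.
Qed.

End iterated_convolution.

Section cumulant_approximation.
Context (R : realType) (A : R).
Hypothesis A0 : 0 <= A.

Let risq_le n : exists2 C : R, 0 <= C & forall a, 0 <= a -> a <= A ->
  risq a n.+1 <= C * a.
Proof.
elim: n => [|n [C C0 IH]].
  by exists 1 => // a a0 aA; have := risqS a 0; rewrite risq0; lra.
exists ((A + n.+1%:R) * C); first by rewrite mulr_ge0 ?addr_ge0.
move=> a a0 aA; have := IH a a0 aA => IHa.
have r1 : 0 <= risq a n.+1 by exact: risq_ge0.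
have e := risqS a n.+1.
have r2 : 0 <= risq a n.+2 by exact: risq_ge0.
have n1 : 1 <= n.+2%:R :> R by rewrite ler1n.
apply: (@le_trans _ _ (n.+2%:R * risq a n.+2)); first by rewrite ler_peMl.
rewrite e -mulrA; apply: ler_pM => //; first by rewrite addr_ge0.
by rewrite lerD2r.
Qed.

Let risq_approx n : exists2 C : R, 0 <= C & forall a, 0 <= a -> a <= A ->
  `|n.+1%:R * risq a n.+1 - a| <= C * a ^+ 2.
Proof.
suff [C C0 hC] : exists2 C : R, 0 <= C & forall a, 0 <= a -> a <= A ->
    `|\sum_(k < n) risq a k.+1| <= C * a.
  exists C => // a a0 aA; rewrite sum_risq big_ord_recl risq0 mulrDr mulr1 addrAC subrr add0r.
  rewrite normrM ger0_norm// expr2 mulrCA ler_wpM2l//; exact: hC.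
elim: n => [|n [C C0 IH]].
  by exists 0 => // a _ _; rewrite big_ord0 normr0 mul0r.
have [C' C'0 h] := risq_le n; exists (C + C'); first exact: addr_ge0.
move=> a a0 aA; rewrite big_ord_recr /= (le_trans (ler_normD _ _))// mulrDl lerD ?IH//.
by rewrite ger0_norm ?risq_ge0 ?h.
Qed.

(* [risq a k] is [a / k] up to [O(a^2)], so that products of two coefficients are negligible. *)
Lemma cumulant_approx n : exists2 C : R, 0 <= C &
  forall a (rho kap : nat -> R), 0 <= a -> a <= A -> rho 0%N = 1 ->
  (forall k, `|rho k| <= 1) -> logderiv kap (fun k => risq a k * rho k) ->
  `|kap n.+1 - a * rho n.+1| <= C * a ^+ 2.
Proof.
elim/ltn_ind: n => n IH.
(* A bound of order [a] is enough for the earlier cumulants: each is multiplied by some [risq a j]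
   with [j > 0], which is itself of order [a]. *)
have bnd k : (k < n)%N -> exists2 C : R, 0 <= C &
    forall a (rho kap : nat -> R), 0 <= a -> a <= A -> rho 0%N = 1 ->
    (forall k, `|rho k| <= 1) -> logderiv kap (fun k => risq a k * rho k) ->
    `|kap k.+1| <= C * a.
  move=> kn; have [C C0 hC] := IH k kn.
  exists (C * A + 1); first by rewrite addr_ge0// mulr_ge0.
  move=> a rho kap a0 aA r0 r1 hk.
  have h1 := hC a rho kap a0 aA r0 r1 hk.
  have -> : kap k.+1 = (kap k.+1 - a * rho k.+1) + a * rho k.+1 by ring.
  rewrite (le_trans (ler_normD _ _))// mulrDl lerD//.
    by rewrite (le_trans h1)// -mulrA ler_wpM2l// expr2 ler_wpM2r.
  by rewrite normrM ger0_norm// mul1r ler_piMr.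
have [C1 C10 hC1] := risq_approx n.
suff [C C0 hC] : exists2 C : R, 0 <= C & forall a (rho kap : nat -> R),
    0 <= a -> a <= A -> rho 0%N = 1 ->
    (forall k, `|rho k| <= 1) -> logderiv kap (fun k => risq a k * rho k) ->
    `|\sum_(l < n) kap l.+1 * (risq a (n.+1 - l.+1) * rho (n.+1 - l.+1)%N)| <= C * a ^+ 2.
  exists (C1 + C); first exact: addr_ge0.
  move=> a rho kap a0 aA r0 r1 hk.
  have := hk n.+1; rewrite big_ord_recr /= subnn risq0 r0 !mulr1 => e.
  have -> : kap n.+1 - a * rho n.+1 = (n.+1%:R * risq a n.+1 - a) * rho n.+1 -
     \sum_(l < n) kap l.+1 * (risq a (n.+1 - l.+1) * rho (n.+1 - l.+1)%N).
    by rewrite mulrBl -mulrA e; ring.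
  rewrite (le_trans (ler_normB _ _))// [leRHS]mulrDl lerD ?hC//.
  rewrite normrM -[leRHS]mulr1 ler_pM//; exact: hC1.
have tm (l : 'I_n) : exists2 C : R, 0 <= C & forall a (rho kap : nat -> R),
    0 <= a -> a <= A -> rho 0%N = 1 ->
    (forall k, `|rho k| <= 1) -> logderiv kap (fun k => risq a k * rho k) ->
    `|kap l.+1 * (risq a (n.+1 - l.+1) * rho (n.+1 - l.+1)%N)| <= C * a ^+ 2.
  have [C C0 hC] := bnd l (ltn_ord l).
  have [k nk] : exists k, (n.+1 - l.+1 = k.+1)%N.
    by exists (n - l).-1; have := ltn_ord l; lia.
  have [C' C'0 hC'] := risq_le k.
  exists (C * C'); first exact: mulr_ge0.
  move=> a rho kap a0 aA r0 r1 hk; rewrite nk normrM.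
  have -> : C * C' * a ^+ 2 = (C * a) * (C' * a) by ring.
  apply: ler_pM => //; first exact: (hC a rho kap).
  rewrite normrM -[leRHS]mulr1; apply: ler_pM => //.
  by rewrite ger0_norm ?risq_ge0// hC'.
exists (\sum_(l < n) s2val (cid2 (tm l))).
  by apply: sumr_ge0 => l _; exact: (s2valP (cid2 (tm l))).
move=> a rho kap a0 aA r0 r1 hk.
rewrite (le_trans (ler_norm_sum _ _ _))// mulr_suml; apply: ler_sum => l _.
exact: (s2valP' (cid2 (tm l))).
Qed.

End cumulant_approximation.

Section canonical_subfamily.
Context d (T : measurableType d) (R : realType) (P : probability T R).

(** The multi-index is extended by [0], where every factor equals [1]. *)
Lemma prod_extend (I J : finType) (h : J -> I) (F : I -> nat -> R) (n : {ffun J -> nat}) :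
  injective h -> (forall i, F i 0%N = 1) ->
  \prod_i F i ([ffun i => if [pick j | h j == i] is Some j then n j else 0%N] i) =
  \prod_j F (h j) (n j).
Proof.
move=> hinj F0; rewrite (bigID (mem (codom h))) /= mulrC big1 ?mul1r; last first.
  move=> i hi; rewrite ffunE; case: pickP => [j /eqP e|_]; last exact: F0.
  by case/negP: hi; rewrite -e codom_f.
have pe : perm_eq [seq i <- index_enum I | i \in codom h] (map h (index_enum J)).
  apply: uniq_perm; [by rewrite filter_uniq// index_enum_uniq|by rewrite map_inj_uniq// index_enum_uniq|].
  move=> i; rewrite mem_filter mem_index_enum andbT; apply/codomP/mapP => [[j ->]|[j _ ->]]; by exists j.
rewrite -(@big_filter _ _ _ _ _ (fun i => i \in codom h)) (perm_big _ pe).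
rewrite big_map; apply: eq_bigr => j _; rewrite ffunE.
case: pickP => [j' /eqP/hinj -> //|/(_ j)]; by rewrite eqxx.
Qed.

Lemma canonical_pair_sub (I J : finType) (h : J -> I) (a : I -> R) (U V : I -> T -> R) :
  injective h -> canonical_pair P a U V ->
  canonical_pair P (a \o h) (U \o h) (V \o h).
Proof.
move=> hinj [hU hV mU mV orth].
pose ext (n : {ffun J -> nat}) : {ffun I -> nat} :=
  [ffun i => if [pick j | h j == i] is Some j then n j else 0%N].
have mom W : moment_rel P a W -> moment_rel P (a \o h) (W \o h).
  move=> mW p; have := mW (ext p).
  rewrite (@prod_extend _ _ h (fun i => rising (a i)))//; last by move=> i; rewrite rising0.
  by move=> <-; apply: eq_Ex => t; rewrite (@prod_extend _ _ h (fun i k => W i t ^+ k)).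
have ellE W (n : {ffun J -> nat}) t : ell_prod (a \o h) (W \o h) n t = ell_prod a W (ext n) t.
  by rewrite /ell_prod (@prod_extend _ _ h (fun i k => ell (a i) k (W i t)))// => i; exact: ell0.
split => //; [by move=> j; exact: hU|by move=> j; exact: hV|exact: mom|exact: mom|].
move=> n m nm; under eq_Rintegral do rewrite !ellE.
apply: orth; apply: contra nm => /eqP/ffunP e; apply/eqP/ffunP => j.
have := e (h j); rewrite !ffunE; case: pickP => [j' /eqP/hinj -> //|/(_ j)].
by rewrite eqxx.
Qed.

(** In the tilted moment [U^L V^n <= U^(L + n) + V^(L + n)], and both terms have the expectation
    that serves as normalization. Any bound uniform in [n] will do, since log-convexity turns it
    into monotonicity. *)
Lemma canonical_corr_unit_le (a : unit -> R) (U V : unit -> T -> R) n :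
  (forall i, 0 < a i) -> canonical_pair P a U V -> canonical_corr P a U V n <= 2.
Proof.
move=> a0 cUV; have [hU hV mU mV _] := cUV; pose B := n tt.
have nB i : (n i <= B)%N by case: i.
have hc := tilt_moment_cvg cUV a0 nB.
rewrite -(cvg_lim _ hc)//; apply: limr_le; first by apply/cvg_ex; eexists; exact: hc.
apply: nearW => L.
have r0 : 0 < \prod_i rising (a i) (L + B) by apply: prodr_gt0 => i _; exact: rising_gt0.
rewrite ler_pdivrMr//.
have one (F : unit -> R) : \prod_i F i = F tt.
  by rewrite (bigD1 tt)//= big1 ?mulr1// => -[].
have hX i k : finite_moments P (fun t => U i t ^+ k) by apply: finite_momentsX; exact: (hU i).1.
have hY i k : finite_moments P (fun t => V i t ^+ k) by apply: finite_momentsX; exact: (hV i).1.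
have mom W : moment_rel P a W -> \int[P]_t (W tt t ^+ (L + B)) = rising (a tt) (L + B).
  move=> mW; have := mW [ffun=> (L + B)%N]; rewrite one ffunE => <-.
  by apply: eq_Ex => t; rewrite one ffunE.
have -> : 2 * \prod_i rising (a i) (L + B) =
    \int[P]_t (U tt t ^+ (L + B) + V tt t ^+ (L + B)).
  by rewrite ExD// mom// mom// one; ring.
apply: le_Ex.
- by apply: finite_moments_prod => i _; apply: finite_momentsM.
- exact: finite_momentsD.
move=> t; rewrite one -/B subnn addn0.
have u0 := (hU tt).2 t; have v0 := (hV tt).2 t.
rewrite !exprD; have [uv|vu] := leP (U tt t) (V tt t).
  apply: (@le_trans _ _ (V tt t ^+ L * V tt t ^+ B)); last by rewrite lerDr mulr_ge0 ?exprn_ge0.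
  by rewrite ler_wpM2r ?exprn_ge0// lerXn2r.
apply: (@le_trans _ _ (U tt t ^+ L * U tt t ^+ B)); last by rewrite lerDl mulr_ge0 ?exprn_ge0.
by rewrite ler_wpM2l ?exprn_ge0// lerXn2r// ltW.
Qed.

Lemma canonical_corr_unit_ge0 (a : unit -> R) (U V : unit -> T -> R) n :
  (forall i, 0 < a i) -> canonical_pair P a U V -> 0 <= canonical_corr P a U V n.
Proof.
move=> a0 cUV; rewrite -(Lam_monomial cUV a0); apply: Lam_ge0 => //.
  exact: is_poly_monomial.
by move=> v v0; rewrite prodr_ge0// => i _; rewrite exprn_ge0.
Qed.

Lemma Lam_coord (I : finType) (a : I -> R) (U V : I -> T -> R) i k :
  (forall i, 0 < a i) -> canonical_pair P a U V ->
  Lam P a U V (fun v => v i ^+ k) =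
  (\int[P]_t (ell (a i) k (U i t) * ell (a i) k (V i t))) / risq (a i) k.
Proof.
move=> a0 cUV; pose n := [ffun j => if j == i then k else 0%N] : {ffun I -> nat}.
have one (F : I -> nat -> R) : (forall j, F j 0%N = 1) -> \prod_j F j (n j) = F i k.
  move=> F0; rewrite (bigD1 i)//= ffunE eqxx big1 ?mulr1// => j /negbTE ji.
  by rewrite ffunE ji.
rewrite (eq_Lam _ _ _ _ (G := fun v => \prod_j v j ^+ n j)); last first.
  by move=> v; rewrite (one (fun j m => v j ^+ m)).
rewrite Lam_monomial// /canonical_corr (one (fun j m => risq (a j) m)); last by move=> j; rewrite risq0.
congr (_ / _); apply: eq_Ex => t; rewrite /ell_prod.
by rewrite !(one (fun j m => ell (a j) m (_ j t)))// => j; rewrite ell0.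
Qed.

(** By [Lam_coord] a coordinate moment depends only on the subfamily reduced to [i]. *)
Lemma bounded_corr (I : finType) (a : I -> R) (U V : I -> T -> R) i k :
  (forall i, 0 < a i) -> canonical_pair P a U V ->
  0 <= Lam P a U V (fun v => v i ^+ k) <= 2.
Proof.
move=> a0 cUV.
have hinj : injective (fun _ : unit => i) by case=> -[].
have cu := canonical_pair_sub hinj cUV.
have au0 (j : unit) : 0 < (a \o (fun _ : unit => i)) j by exact: a0.
rewrite (_ : Lam _ _ _ _ _ = Lam P (a \o (fun _ : unit => i)) (U \o (fun=> i)) (V \o (fun=> i))
    (fun v => v tt ^+ k)); last by rewrite !Lam_coord.
rewrite (@eq_Lam _ _ _ _ _ _ _ _ _ (fun v => \prod_j v j ^+ ([ffun=> k] : {ffun unit -> nat}) j)); last first.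
  by move=> v; rewrite (bigD1 tt)//= ffunE big1 ?mulr1// => -[].
rewrite Lam_monomial//.
by rewrite canonical_corr_unit_ge0// canonical_corr_unit_le.
Qed.

End canonical_subfamily.

(** * Splitting one set into small pieces of equal measure *)

Section split.
Context d (T : measurableType d) (R : realType) (P : probability T R).
Context (J : finType) (aJ : J -> R) (UJ VJ : J -> T -> R) (alpha : R).
Context (UB VB : T -> R) (Up Vp : forall m, 'I_m.+1 -> T -> R).
Let a m := alpha / m.+1%:R.
Let I m := ('I_m.+1 + J)%type.
Definition sum_fun (K : finType) (S : Type) (F : K -> S) (H : J -> S) (s : K + J) : S :=
  match s with inl i => F i | inr j => H j end.
Let aI m : I m -> R := sum_fun (fun=> a m) aJ.
Let UI m : I m -> T -> R := sum_fun (@Up m) UJ.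
Let VI m : I m -> T -> R := sum_fun (@Vp m) VJ.
Context (kp : forall m, 'I_m.+1 -> nat -> R) (kap : nat -> R).
Hypotheses (alpha0 : 0 < alpha) (aJ0 : forall j, 0 < aJ j)
  (cp : forall m, canonical_pair P (@aI m) (@UI m) (@VI m))
  (sumU : forall m t, \sum_(i < m.+1) Up i t = UB t)
  (sumV : forall m t, \sum_(i < m.+1) Vp i t = VB t)
  (kpE : forall m (i : 'I_m.+1), logderiv (kp i)
     (fun k => \int[P]_t (ell (a m) k (Up i t) * ell (a m) k (Vp i t))))
  (sum_kp : forall m l, \sum_(i < m.+1) kp i l = kap l)
  (kapE : logderiv kap (fun N => \int[P]_t (ell alpha N (UB t) * ell alpha N (VB t)))).

Let a0 m : 0 < a m. Proof. by rewrite /a divr_gt0. Qed.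
Let aI0 m s : 0 < @aI m s. Proof. by case: s => //= _; exact: a0. Qed.

Let join m N (f : {ffun 'I_m.+1 -> 'I_N.+1}) (n : {ffun J -> nat}) : {ffun I m -> nat} :=
  [ffun s => sum_fun (fun i => nat_of_ord (f i)) n s].

Let join_inj m N n : injective (fun f => @join m N f n).
Proof.
move=> f g /ffunP e; apply/ffunP => i; apply/val_inj.
by have := e (inl i); rewrite !ffunE.
Qed.

Let prod_join m (F : 'I_m.+1 -> R) (H : J -> R) :
  \prod_(s : I m) sum_fun F H s = \prod_i F i * \prod_j H j.
Proof. by rewrite big_sumType. Qed.

Let L m := Lam P (@aI m) (@UI m) (@VI m).
Let S m l (v : I m -> R) := \sum_(i < m.+1) a m * v (inl i) ^+ l.
Let h m N (v : I m -> R) :=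
  bconv (fun (i : 'I_m.+1) k => risq (a m) k * v (inl i) ^+ k) N.
Let G m (n : {ffun J -> nat}) (v : I m -> R) := \prod_j v (inr j) ^+ n j.
Let D N n := \int[P]_t ((ell alpha N (UB t) * ell alpha N (VB t)) *
  (ell_prod aJ UJ n t * ell_prod aJ VJ n t)).
Let r (n : {ffun J -> nat}) := \prod_j risq (aJ j) (n j).

Let r0 n : 0 < r n. Proof. by apply: prodr_gt0 => j _; exact: risq_gt0. Qed.

(** Additivity of [ell]: the polynomial of the whole is the iterated convolution of those of the
    [m + 1] pieces, each of parameter [alpha / (m + 1)]. *)
Let ellS m W (w : 'I_m.+1 -> T -> R) H N (n : {ffun J -> nat}) t :
  (forall t, \sum_i w i t = W t) ->
  ell alpha N (W t) * ell_prod aJ H n t =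
  \sum_(f : {ffun 'I_m.+1 -> 'I_N.+1} | (\sum_i f i == N)%N)
     ell_prod (@aI m) (sum_fun w H) (join f n) t.
Proof.
move=> hW; have e : alpha = \sum_(i < m.+1) a m.
  by rewrite sumr_const card_ord -[RHS]mulr_natr /a mulfVK// pnatr_eq0.
rewrite -hW [X in ell X]e ell_bconv /bconv mulr_suml; apply: eq_bigr => f _.
rewrite /ell_prod -prod_join; apply: eq_bigr => -[i|j] _ /=; by rewrite ffunE.
Qed.

(** Orthogonality removes the pairs [f != g], so the coefficient of the coarse family is a plain sum
    of coefficients of the refined one, for every [m]. *)
Let DE m N n : D N n =
  \sum_(f : {ffun 'I_m.+1 -> 'I_N.+1} | (\sum_i f i == N)%N)
    canonical_coef P (@aI m) (@UI m) (@VI m) (join f n).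
Proof.
have [hU hV _ _ _] := cp m.
have fU k : finite_moments P (ell_prod (@aI m) (@UI m) k).
  by apply: finite_moments_ell_prod => s; exact: (hU s).1.
have fV k : finite_moments P (ell_prod (@aI m) (@VI m) k).
  by apply: finite_moments_ell_prod => s; exact: (hV s).1.
transitivity (\int[P]_t (\sum_(f : {ffun 'I_m.+1 -> 'I_N.+1} | (\sum_i f i == N)%N)
   \sum_(g : {ffun 'I_m.+1 -> 'I_N.+1} | (\sum_i g i == N)%N)
   (ell_prod (@aI m) (@UI m) (join f n) t * ell_prod (@aI m) (@VI m) (join g n) t))).
  apply: eq_Ex => t; rewrite mulrACA (ellS UJ N n t (@sumU m)) (ellS VJ N n t (@sumV m)).
  by rewrite mulr_suml; apply: eq_bigr => f _; rewrite mulr_sumr.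
rewrite Ex_sum; last first.
  by move=> f _; apply: finite_moments_sum => g _; exact: finite_momentsM.
apply: eq_bigr => f Nf; rewrite Ex_sum; last by move=> g _; exact: finite_momentsM.
rewrite (bigD1 f)//= (canonical_pair_orth (cp m)) eqxx mul1r big1 ?addr0// => g /andP[_ gf].
rewrite (canonical_pair_orth (cp m)) (inj_eq (@join_inj m N n)) eq_sym (negbTE gf).
by rewrite mul0r.
Qed.

Let is_poly_G m n : is_poly (@G m n).
Proof. by apply: is_poly_prod => j _; exact: is_poly_coord. Qed.

Let is_poly_S m l : is_poly (@S m l).
Proof. by apply: is_poly_sum => i _; apply: is_polyZ; exact: is_poly_coord. Qed.

Let is_poly_h m N : is_poly (@h m N).
Proof.
apply: is_poly_sum => f _; apply: is_poly_prod => i _; apply: is_polyZ.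
exact: is_poly_coord.
Qed.

(** The factors [risq (a m)] in [h] cancel those in the denominator of [canonical_corr]; hence a
    value that is the same for all [m]. *)
Let L_hG m N n : L (fun v => h N v * @G m n v) = D N n / r n.
Proof.
rewrite (DE m) mulr_suml.
rewrite /L (@eq_Lam _ _ _ _ _ _ _ _ _ (fun v =>
   \sum_(f : {ffun 'I_m.+1 -> 'I_N.+1} | (\sum_i f i == N)%N)
     (\prod_i risq (a m) (f i)) * \prod_s v s ^+ (join f n) s)); last first.
  move=> v; rewrite /h /bconv mulr_suml; apply: eq_bigr => f _.
  rewrite big_split /= -mulrA; congr (_ * _).
  rewrite /G -prod_join; apply: eq_bigr => -[i|j] _ /=; by rewrite ffunE.
rewrite (Lam_sum (cp m))//; last by move=> f _; apply: is_polyZ; exact: is_poly_monomial.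
apply: eq_bigr => f _; rewrite (LamZ (cp m))//; last exact: is_poly_monomial.
rewrite (Lam_monomial (cp m))// /canonical_corr.
have -> : \prod_i risq (@aI m i) (join f n i) = (\prod_i risq (a m) (f i)) * r n.
  by rewrite -prod_join; apply: eq_bigr => -[i|j] _ /=; rewrite ffunE.
have : \prod_i risq (a m) (f i) != 0 by rewrite gt_eqF// prodr_gt0// => i _; exact: risq_gt0.
have := lt0r_neq0 (r0 n); move=> h1 h2; field; exact/andP.
Qed.

Let hrec m N (v : I m -> R) : N%:R * h N v = \sum_(l < N) S l.+1 v * h (N - l.+1) v.
Proof.
exact: (@logderiv_bconv _ _ (fun (i : 'I_m.+1) l => a m * v (inl i) ^+ l)
  (fun i k => risq (a m) k * v (inl i) ^+ k) (fun i => logderiv_risq (a m) (v (inl i)))).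
Qed.

Let h0 m (v : I m -> R) : h 0 v = 1.
Proof. by rewrite /h bconv0 big1// => i _; rewrite risq0 mul1r. Qed.

Let bc m i : exists C, forall k, L (fun v : I m -> R => v i ^+ k) <= C.
Proof. by exists 2 => k; have /andP[] := bounded_corr i k (@aI0 m) (cp m). Qed.

Let LZ m k (F : (I m -> R) -> R) : is_poly F -> L (fun v => k * F v) = k * L F.
Proof. exact: (LamZ (cp m) (@aI0 m)). Qed.

(** Cauchy-Schwarz over the pieces, whose weights [a m] add up to [alpha], followed by contraction
    by each coordinate. *)
Let S_contract m l (F : (I m -> R) -> R) : is_poly F ->
  L (fun v => (S l.+1 v * F v) ^+ 2) <= alpha ^+ 2 * L (fun v => F v ^+ 2).
Proof.
move=> hF.
have hv i : is_poly (fun v : I m -> R => v (inl i) ^+ (l.+1 * 2) * F v ^+ 2).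
  by apply: is_polyM; [exact: is_poly_coord|exact: is_polyX].
apply: (@le_trans _ _ (L (fun v => alpha * \sum_(i < m.+1) a m * (v (inl i) ^+ (l.+1 * 2) * F v ^+ 2)))).
  apply: (Lam_le (cp m)) => //.
  - by apply: is_polyX; apply: is_polyM.
  - by apply: is_polyZ; apply: is_poly_sum => i _; apply: is_polyZ.
  move=> v _; rewrite exprMn.
  have -> : alpha * (\sum_(i < m.+1) a m * (v (inl i) ^+ (l.+1 * 2) * F v ^+ 2)) =
      (alpha * \sum_(i < m.+1) a m * v (inl i) ^+ (l.+1 * 2)) * F v ^+ 2.
    by rewrite -mulrA; congr (_ * _); rewrite mulr_suml; apply: eq_bigr => i _; rewrite mulrA.
  rewrite ler_wpM2r ?sqr_ge0// /S -!mulr_sumr exprMn.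
  set x := fun i : 'I_m.+1 => v (inl i) ^+ l.+1.
  have -> : \sum_(i < m.+1) v (inl i) ^+ (l.+1 * 2) = \sum_i x i ^+ 2.
    by apply: eq_bigr => i _; rewrite exprM.
  rewrite -/(\sum_i x i).
  have Mp : 0 < m.+1%:R :> R by [].
  (* Nonnegativity of this sum of squares amounts to [s^2 <= (m + 1) q]. *)
  have := @sumr_ge0 R _ (index_enum 'I_m.+1) xpredT (fun i => (m.+1%:R * x i - \sum_i x i) ^+ 2)
    (fun i _ => sqr_ge0 _).
  set s := \sum_i x i; set q := \sum_i x i ^+ 2.
  have -> : \sum_i (m.+1%:R * x i - s) ^+ 2 = m.+1%:R * (m.+1%:R * q - s ^+ 2).
    transitivity (\sum_(i < m.+1) (m.+1%:R ^+ 2 * x i ^+ 2 + (- 2 * m.+1%:R * s) * x i + s ^+ 2)).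
      by apply: eq_bigr => i _; ring.
    by rewrite !big_split /= -!mulr_sumr sumr_const card_ord -mulr_natl -/s -/q; ring.
  rewrite pmulr_rge0// subr_ge0 => hs.
  rewrite /a; apply: (@le_trans _ _ ((alpha / m.+1%:R) ^+ 2 * (m.+1%:R * q))).
    by rewrite ler_wpM2l// sqr_ge0.
  by rewrite le_eqVlt; apply/orP; left; apply/eqP; field; rewrite addrC natr1 pnatr_eq0.
have -> : L (fun v => alpha * \sum_(i < m.+1) a m * (v (inl i) ^+ (l.+1 * 2) * F v ^+ 2)) =
    alpha * L (fun v => \sum_(i < m.+1) a m * (v (inl i) ^+ (l.+1 * 2) * F v ^+ 2)).
  by apply: (LamZ (cp m) (@aI0 m)); apply: is_poly_sum => i _; apply: is_polyZ.
rewrite expr2 -mulrA (ler_wpM2l (ltW alpha0))//.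
have -> : L (fun v => \sum_(i < m.+1) a m * (v (inl i) ^+ (l.+1 * 2) * F v ^+ 2)) =
    \sum_(i < m.+1) L (fun v => a m * (v (inl i) ^+ (l.+1 * 2) * F v ^+ 2)).
  by apply: (Lam_sum (cp m) (@aI0 m)) => i _; apply: is_polyZ.
apply: (@le_trans _ _ (\sum_(i < m.+1) a m * L (fun v => F v ^+ 2))).
  apply: ler_sum => i _; rewrite LZ// (ler_wpM2l (ltW (a0 m)))//.
  exact: (Lam_contract0 (cp m) (@aI0 m) (@bc m)).
rewrite sumr_const card_ord -mulr_natr /a.
by rewrite le_eqVlt; apply/orP; left; apply/eqP; field; rewrite addrC natr1 pnatr_eq0.
Qed.

Let rhop m (i : 'I_m.+1) k := L (fun v : I m -> R => v (inl i) ^+ k).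

Let rhop_le m (i : 'I_m.+1) k : `|rhop i k| <= 1.
Proof.
have /andP[p0 _] := bounded_corr (inl i) k (@aI0 m) (cp m).
rewrite ger0_norm//.
have := Lam_contract0 (cp m) (@aI0 m) (@bc m) (inl i) k (@is_poly_cst R (I m) 1).
rewrite (@eq_Lam _ _ _ _ _ _ _ _ (fun v => 1 ^+ 2) (fun=> 1)); last by move=> v; rewrite expr1n.
rewrite (Lam_cst (cp m))//; congr (_ <= _); apply: eq_Lam => v.
by rewrite expr1n mulr1.
Qed.

(** Each of the [m + 1] pieces contributes an error of order [a^2] with [a = alpha / (m + 1)], so
    the total error is of order [1 / (m + 1)]. *)
Let LS l : L (@S m l.+1) @[m --> \oo] --> kap l.+1.
Proof.
have [C C0 hC] := cumulant_approx (ltW alpha0) l.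
have bnd m : `|kap l.+1 - L (@S m l.+1)| <= C * alpha ^+ 2 * m.+1%:R^-1.
  rewrite /L /S (Lam_sum (cp m))//; last by move=> i _; apply: is_polyZ; exact: is_poly_coord.
  rewrite -(sum_kp m) -sumrB; apply: le_trans (ler_norm_sum _ _ _) _.
  apply: (@le_trans _ _ (\sum_(i < m.+1) C * a m ^+ 2)).
    apply: ler_sum => i _; rewrite (LamZ (cp m))//; last exact: is_poly_coord.
    apply: (hC (a m) (rhop i) (kp i)) => //.
    - exact: ltW.
    - by rewrite /a ler_pdivrMr// ler_peMr ?ler1n// ltW.
    - by rewrite -[RHS](Lam_cst (cp m)).
    rewrite (_ : (fun k => _) = (fun k => \int[P]_t (ell (a m) k (Up i t) * ell (a m) k (Vp i t)))).
      exact: kpE.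
    apply/funext => k; rewrite /rhop /L (Lam_coord _ _ (@aI0 m) (cp m)) /= mulrC divfK//.
    by rewrite gt_eqF// risq_gt0.
  rewrite sumr_const card_ord -mulr_natr /a.
  by rewrite le_eqVlt; apply/orP; left; apply/eqP; field; rewrite addrC natr1 pnatr_eq0.
apply/cvgrPdist_le => e e0.
have lim0 : C * alpha ^+ 2 * m.+1%:R^-1 @[m --> \oo] --> (0 : R).
  rewrite -[X in _ --> X](mulr0 (C * alpha ^+ 2)); apply: cvgMl_tmp.
  exact: cvg_harmonic.
have /cvgrPdist_le/(_ e e0) := lim0.
apply: filterS => m; rewrite sub0r normrN => hm.
apply: le_trans (bnd m) _; apply: le_trans hm; exact: ler_norm.
Qed.

(* [D N n] and [c_N] times the coefficient of the family [J] both solve [logderiv kap], by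
   [concentration_product] for the former. *)
Theorem split_factor N n : D N n =
  (\int[P]_t (ell alpha N (UB t) * ell alpha N (VB t))) * canonical_coef P aJ UJ VJ n.
Proof.
set c := fun N => \int[P]_t (ell alpha N (UB t) * ell alpha N (VB t)).
have Dz k : D k [ffun=> 0%N] = c k.
  apply: eq_Ex => t; rewrite [X in _ * X](_ : _ = 1) ?mulr1//.
  by rewrite /ell_prod !big1 ?mulr1// => j _; rewrite ffunE ell0.
have rz : r [ffun=> 0%N] = 1 by rewrite /r big1// => j _; rewrite ffunE risq0.
have Lh m k : L (@h m k) = c k.
  rewrite -Dz; transitivity (L (fun v => h k v * @G m [ffun=> 0%N] v)).
    apply: eq_Lam => v; rewrite /G big1 ?mulr1// => j _; by rewrite ffunE expr0.
  by rewrite L_hG rz divr1.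
have c0 : c 0%N = 1.
  by rewrite -(Lh 0%N 0%N) -[RHS](Lam_cst (cp 0) (@aI0 0)); apply: eq_Lam => v; exact: h0.
have D0 : D 0%N n = canonical_coef P aJ UJ VJ n.
  by apply: eq_Ex => t; rewrite !ell0 !mul1r.
suff hD : logderiv kap (fun N => D N n).
  apply: (@logderiv_uniq _ kap (fun N => D N n)
     (fun N => c N * canonical_coef P aJ UJ VJ n)) => //.
    by rewrite c0 mul1r.
  move=> k; rewrite mulrA kapE mulr_suml; apply: eq_bigr => l _; by rewrite mulrA.
(* The squared norm of [G] is a normalized coefficient of the family [J] at the doubled multi-index,
   hence the same for all [m]. *)
pose dn := D 0 [ffun j => (n j * 2)%N] / r [ffun j => (n j * 2)%N].
have G2 m : L (fun v => @G m n v ^+ 2) <= dn.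
  rewrite /dn -(L_hG m) le_eqVlt; apply/orP; left; apply/eqP/eq_Lam => v.
  rewrite h0 mul1r /G -prodrXl; apply: eq_bigr => j _; by rewrite ffunE exprM.
have main l k : L (fun v => S l.+1 v * (h k v * @G m n v)) -
    kap l.+1 * L (fun v => h k v * @G m n v) @[m --> \oo] --> (0 : R).
  apply: (@concentration_product R (fun m => I m -> R) (fun m => @is_poly R (I m))
    L _ _ _ _ _ _ _ _ _ S h alpha kap c _ _ _ _ _ _ _ _ _ _ l k (fun m => @G m n) dn).
  - by move=> m F H; exact: is_polyD.
  - by move=> m x F; exact: is_polyZ.
  - by move=> m F H; exact: is_polyM.
  - by move=> m x; exact: is_poly_cst.
  - by move=> m F H; exact: (LamD (cp m) (@aI0 m)).
  - by move=> m x F; exact: (LamZ (cp m) (@aI0 m)).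
  - by move=> m x; exact: (Lam_cst (cp m) (@aI0 m)).
  - move=> m F hF; apply: (Lam_ge0 (cp m) (@aI0 m)) => [|v _]; [exact: is_polyX|exact: sqr_ge0].
  - move=> m F H hF hH.
    have := Lam_cauchy_schwarz (cp m) (@aI0 m) (@is_poly_cst R (I m) 1) hF hH (fun _ _ => ler01).
    congr (_ ^+ 2 <= _ * _); apply: eq_Lam => v; by rewrite !mul1r.
  - exact: is_poly_S.
  - exact: is_poly_h.
  - exact: h0.
  - exact: hrec.
  - exact: ltW.
  - exact: S_contract.
  - exact: LS.
  - exact: Lh.
  - exact: c0.
  - exact: kapE.
  - by move=> m; exact: is_poly_G.
  - exact: G2.
move=> N'; apply: subr0_eq.
have rn0 := lt0r_neq0 (r0 n).
suff : (N'%:R * D N' n - \sum_(l < N') kap l.+1 * D (N' - l.+1)%N n) / r n = 0.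
  by move/eqP; rewrite mulf_eq0 invr_eq0 (negbTE rn0) orbF => /eqP.
(* The defect [w m] tends to [0] and, by [wE] below, does not depend on [m]. *)
pose w m := \sum_(l < N') (L (fun v => S l.+1 v * (h (N' - l.+1) v * @G m n v)) -
    kap l.+1 * L (fun v => h (N' - l.+1) v * @G m n v)).
have w0 : w m @[m --> \oo] --> (0 : R).
  rewrite (_ : (0 : R) = \sum_(l < N') (0 : R)); last by rewrite big1.
  by apply: cvgn_sum => l _; exact: main.
have pSG m l k : is_poly (fun v => S l.+1 v * (h k v * @G m n v)).
  by apply: is_polyM => //; exact: is_polyM.
have wE m : w m = (N'%:R * D N' n - \sum_(l < N') kap l.+1 * D (N' - l.+1)%N n) / r n.
  rewrite /w sumrB mulrBl mulr_suml; congr (_ - _); last first.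
    by apply: eq_bigr => l _; rewrite L_hG mulrA.
  rewrite -mulrA -(L_hG m) -(LamZ (cp m) (@aI0 m)); last exact: is_polyM.
  rewrite -(Lam_sum (cp m) (@aI0 m))//; apply: eq_Lam => v.
  rewrite mulrA hrec mulr_suml; apply: eq_bigr => l _; by rewrite mulrA.
have := cvg_lim (@Rhausdorff R) w0; rewrite (_ : w = fun=> (N'%:R * D N' n - \sum_(l < N') kap l.+1 * D (N' - l.+1)%N n) / r n); last first.
  by apply/funext.
by rewrite lim_cst => [e|]; [exact: e|exact: Rhausdorff].
Qed.

End split.

(** * From factorized coefficients to independent increments *)

Section moment_factorization.
Context d (T : measurableType d) (R : realType) (P : probability T R).

Lemma set_integral_Ex d' (S : measurableType d') (X : T -> S) (g : T -> R) B :
  measurable_fun setT X -> measurable B -> finite_moments P g ->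
  (\int[P]_(t in X @^-1` B) (g t)%:E)%E = (\int[P]_t (\1_B (X t) * g t))%:E.
Proof.
move=> mX mB fg.
have mXB : measurable (X @^-1` B) by rewrite -[_ @^-1` _]setTI; exact: mX.
rewrite EFin_Ex; last first.
  apply: finite_momentsM => //; split; first exact: measurableT_comp.
  move=> n; apply: (@integrable_dominated _ _ _ _ _ (fun=> 1)).
  - by apply: measurable_funX; exact: measurableT_comp.
  - by move=> t; rewrite indicE; case: (_ \in _); rewrite ?expr1n ?expr0n ?normr1//; case: (n == 0)%N; rewrite ?normr0 ?normr1.
  - exact: finite_measure_integrable_cst.
rewrite integral_mkcond; apply: eq_integral => t _.
rewrite patchE mem_preimage indicE; case: (_ \in _); by rewrite ?mul1r ?mul0r.
Qed.

Lemma finite_moments_indic d' (S : measurableType d') (X : T -> S) B :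
  measurable_fun setT X -> measurable B -> finite_moments P (fun t => \1_B (X t) : R).
Proof.
move=> mX mB; split; first exact: measurableT_comp.
move=> n; apply: (@integrable_dominated _ _ _ _ _ (fun=> 1)).
- by apply: measurable_funX; exact: measurableT_comp.
- by move=> t; rewrite indicE; case: (_ \in _); rewrite ?expr1n ?expr0n ?normr1//; case: (n == 0)%N; rewrite ?normr0 ?normr1.
- exact: finite_measure_integrable_cst.
Qed.

Definition exp_moment (U : T -> R) := exists2 delta, 0 < delta &
  P.-integrable setT (EFin \o (fun t => expR (delta * U t))).

(** By [x y <= x^2 + y^2], halving the exponent leaves room for the weight [H]. *)
Lemma exp_moment_weight (U H : T -> R) : measurable_fun setT U -> exp_moment U -> finite_moments P H ->
  exists2 delta, 0 < delta & P.-integrable setT (EFin \o (fun t => expR (delta * U t) * H t)).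
Proof.
move=> mU [de de0 iU] fH; exists (de / 2); first by rewrite divr_gt0.
have mE : measurable_fun setT (fun t => expR (de / 2 * U t)).
  by apply: measurableT_comp => //; exact: measurable_funM.
apply: (@integrable_dominated _ _ _ _ _ (fun t => expR (de * U t) + H t ^+ 2)).
- by apply: measurable_funM => //; exact: fH.1.
- move=> t; rewrite normrM (ger0_norm (expR_ge0 _)).
  have -> : expR (de * U t) = expR (de / 2 * U t) ^+ 2.
    by rewrite expr2 -expRD; congr expR; field.
  rewrite -(real_normK (num_real (H t))).
  by have := sqr_ge0 (expR (de / 2 * U t) - `|H t|); have := expR_gt0 (de / 2 * U t); have := normr_ge0 (H t); nra.
- by apply: intgD => //; exact: fH.2.
Qed.

(** One real variable at a time: [moment_determinacy] for [U] with weight [V^q H], then for [V] with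
    weight [1_B1(U) H], and finally the passage from rectangles to Borel sets of the plane. *)
Lemma weighted_pair_determinacy (U V H : T -> R) :
  finite_moments P U -> finite_moments P V -> finite_moments P H ->
  (forall t, 0 <= U t) -> (forall t, 0 <= V t) -> (forall t, 0 <= H t) ->
  exp_moment U -> exp_moment V ->
  (forall p q, \int[P]_t (U t ^+ p * V t ^+ q * H t) =
     \int[P]_t (U t ^+ p * V t ^+ q) * \int[P]_t H t) ->
  forall B : set (R * R), measurable B ->
  \int[P]_t (\1_B (U t, V t) * H t) = \int[P]_t (\1_B (U t, V t)) * \int[P]_t H t.
Proof.
move=> fU fV fH U0 V0 H0 eU eV mom B mB; set h := \int[P]_t H t.
have h0 : 0 <= h by exact: Ex_ge0.
have mU := fU.1; have mV := fV.1.
have s1 (B1 : set R) q : measurable B1 ->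
  \int[P]_t (\1_B1 (U t) * (V t ^+ q * H t)) = \int[P]_t (\1_B1 (U t) * (h * V t ^+ q)).
  move=> mB1; have fVH : finite_moments P (fun t => V t ^+ q * H t).
    by apply: finite_momentsM => //; exact: finite_momentsX.
  have fhV : finite_moments P (fun t => h * V t ^+ q).
    by apply: finite_momentsZ; exact: finite_momentsX.
  have [d1 d10 i1] := exp_moment_weight mU eU fVH.
  have [d2 d20 i2] := exp_moment_weight mU eU fhV.
  have [de [de0 i1' i2']] : exists de, [/\ 0 < de,
      P.-integrable setT (EFin \o (fun t => expR (de * U t) * (V t ^+ q * H t))) &
      P.-integrable setT (EFin \o (fun t => expR (de * U t) * (h * V t ^+ q)))].
    exists (Num.min d1 d2); split; first by rewrite lt_min d10.
      apply: integrable_dominated i1.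
        by apply: measurable_funM fVH.1; apply: measurableT_comp => //; exact: measurable_funM.
      move=> t; rewrite ger0_norm ?mulr_ge0 ?expR_ge0 ?exprn_ge0//.
      by rewrite ler_wpM2r ?mulr_ge0 ?exprn_ge0// ler_expR ler_wpM2r// ge_min lexx.
    apply: integrable_dominated i2.
      by apply: measurable_funM fhV.1; apply: measurableT_comp => //; exact: measurable_funM.
    move=> t; rewrite ger0_norm ?mulr_ge0 ?expR_ge0 ?exprn_ge0//.
    by rewrite ler_wpM2r ?mulr_ge0 ?exprn_ge0// ler_expR ler_wpM2r// ge_min lexx orbT.
  apply: EFin_inj; rewrite -!set_integral_Ex//.
  apply: (moment_determinacy mU mU fVH.1 fhV.1 U0 U0 _ _ de0 i1' i2') => //.
  - by move=> t; rewrite mulr_ge0 ?exprn_ge0.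
  - by move=> t; rewrite mulr_ge0 ?exprn_ge0.
  move=> n; transitivity (\int[P]_t (U t ^+ n * V t ^+ q * H t)).
    by apply: eq_Ex => t; rewrite mulrA.
  rewrite mom mulrC -ExZ; last by apply: finite_momentsM; exact: finite_momentsX.
  by apply: eq_Ex => t; rewrite mulrCA.
have s2 (B1 B2 : set R) : measurable B1 -> measurable B2 ->
  \int[P]_t (\1_B2 (V t) * (\1_B1 (U t) * H t)) = \int[P]_t (\1_B2 (V t) * (h * \1_B1 (U t))).
  move=> mB1 mB2; have fI := finite_moments_indic mU mB1.
  have i01 t : 0 <= \1_B1 (U t) :> R by rewrite indicE; case: (_ \in _).
  have f1 : finite_moments P (fun t => \1_B1 (U t) * H t) by exact: finite_momentsM.
  have f2 : finite_moments P (fun t => h * \1_B1 (U t)) by exact: finite_momentsZ.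
  have [d1 d10 i1] := exp_moment_weight mV eV f1.
  have [d2 d20 i2] := exp_moment_weight mV eV f2.
  have [de [de0 i1' i2']] : exists de, [/\ 0 < de,
      P.-integrable setT (EFin \o (fun t => expR (de * V t) * (\1_B1 (U t) * H t))) &
      P.-integrable setT (EFin \o (fun t => expR (de * V t) * (h * \1_B1 (U t))))].
    exists (Num.min d1 d2); split; first by rewrite lt_min d10.
      apply: integrable_dominated i1.
        by apply: measurable_funM f1.1; apply: measurableT_comp => //; exact: measurable_funM.
      move=> t; rewrite ger0_norm ?mulr_ge0 ?expR_ge0 ?exprn_ge0//.
      by rewrite ler_wpM2r ?mulr_ge0 ?exprn_ge0// ler_expR ler_wpM2r// ge_min lexx.
    apply: integrable_dominated i2.
      by apply: measurable_funM f2.1; apply: measurableT_comp => //; exact: measurable_funM.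
    move=> t; rewrite ger0_norm ?mulr_ge0 ?expR_ge0 ?exprn_ge0//.
    by rewrite ler_wpM2r ?mulr_ge0 ?exprn_ge0// ler_expR ler_wpM2r// ge_min lexx orbT.
  apply: EFin_inj; rewrite -!set_integral_Ex//.
  apply: (moment_determinacy mV mV f1.1 f2.1 V0 V0 _ _ de0 i1' i2') => //.
  - by move=> t; rewrite mulr_ge0.
  - by move=> t; rewrite mulr_ge0.
  move=> n; transitivity (\int[P]_t (\1_B1 (U t) * (V t ^+ n * H t))).
    by apply: eq_Ex => t; rewrite mulrCA.
  by rewrite s1//; apply: eq_Ex => t; ring.
have mUV : measurable_fun setT (fun t => (U t, V t)) by exact: measurable_fun_pair.
have mH := fH.1.
have mch : measurable_fun setT (fun _ : T => h) by exact: measurable_cst.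
have fch := finite_moments_cst P h.
rewrite [RHS]mulrC -ExZ; last exact: finite_moments_indic.
apply: EFin_inj.
have -> : \int[P]_t (h * \1_B (U t, V t)) = \int[P]_t (\1_B (U t, V t) * h).
  by apply: eq_Ex => t; rewrite mulrC.
rewrite -!(set_integral_Ex (X := fun t => (U t, V t)))//.
have h0' (_ : T) : 0 <= h by [].
apply: (@measure_unique _ _ _ [set A `*` B | A in measurable & B in measurable] (fun=> setT)
  _ _ _ _ (weighted_law_measure P mUV mH H0) (weighted_law_measure P mUV mch h0')) => //.
- exact: measurable_prod_measurableType.
- move=> _ _ [A1 mA1 [A2 mA2 <-]] [A3 mA3 [A4 mA4 <-]]; rewrite -setXI.
  by exists (A1 `&` A3); [exact: measurableI|exists (A2 `&` A4); [exact: measurableI|]].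
- by move=> _; exists setT => //; exists setT => //; rewrite setXTT.
- by rewrite bigcup_const//; exists 0%N.
- move=> _ [A1 mA1 [A2 mA2 <-]]; rewrite /= /weighted_law.
  have mA : measurable (A1 `*` A2) by exact: measurableX.
  rewrite !(set_integral_Ex (X := fun t => (U t, V t)))//; congr EFin.
  have ind t : \1_(A1 `*` A2) (U t, V t) = \1_A2 (V t) * \1_A1 (U t) :> R.
    by rewrite !indicE in_setX /=; do 2 case: (_ \in _); rewrite ?mulr1 ?mulr0.
  transitivity (\int[P]_t (\1_A2 (V t) * (\1_A1 (U t) * H t))).
    by apply: eq_Ex => t; rewrite ind mulrA.
  by rewrite s2//; apply: eq_Ex => t; rewrite ind -mulrA [h * _]mulrC.
- by move=> _; rewrite /= /weighted_law (set_integral_Ex (X := fun t => (U t, V t)))// ltry.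
Qed.

(** Monomials are replaced by indicators one index at a time. The exponents stay arbitrary
    throughout the induction, since the step at [i] uses the factorization for every pair of
    exponents there. *)
Lemma moment_factor_indep (I : finType) (U V : I -> T -> R) :
  (forall i, finite_moments P (U i)) -> (forall i, finite_moments P (V i)) ->
  (forall i t, 0 <= U i t) -> (forall i t, 0 <= V i t) ->
  (forall i, exp_moment (U i)) -> (forall i, exp_moment (V i)) ->
  (forall p q : I -> nat, \int[P]_t (\prod_i (U i t ^+ p i * V i t ^+ q i)) =
     \prod_i \int[P]_t (U i t ^+ p i * V i t ^+ q i)) ->
  forall B : I -> set (R * R), (forall i, measurable (B i)) ->
  \int[P]_t (\prod_i \1_(B i) (U i t, V i t)) = \prod_i \int[P]_t \1_(B i) (U i t, V i t).
Proof.
move=> fU fV U0 V0 eU eV mom B mB.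
pose F (s : seq I) (p q : I -> nat) i t : R :=
  if i \in s then \1_(B i) (U i t, V i t) else U i t ^+ p i * V i t ^+ q i.
have fI i : finite_moments P (fun t => \1_(B i) (U i t, V i t) : R).
  apply: (finite_moments_indic (X := fun t => (U i t, V i t))) (mB i).
  by apply: measurable_fun_pair; [exact: (fU i).1|exact: (fV i).1].
have fF s p q i : finite_moments P (F s p q i).
  rewrite /F; case: (i \in s); first exact: fI.
  by apply: finite_momentsM; exact: finite_momentsX.
have F0 s p q i t : 0 <= F s p q i t.
  by rewrite /F; case: ifP => _; rewrite ?indicE ?mulr_ge0 ?exprn_ge0// ler0n.
suff main s p q : \int[P]_t (\prod_i F s p q i t) = \prod_i \int[P]_t F s p q i t.
  have := main (index_enum I) (fun=> 0%N) (fun=> 0%N).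
  rewrite /F; under eq_Rintegral do under eq_bigr do rewrite mem_index_enum.
  move=> ->; apply: eq_bigr => i _.
  by under eq_Rintegral do rewrite mem_index_enum.
elim: s p q => [|i s IH] p q; first exact: mom.
have [si|nsi] := boolP (i \in s).
  have FE j t : F (i :: s) p q j t = F s p q j t.
    by rewrite /F inE; case: eqVneq => [->|//]; rewrite si.
  under eq_Rintegral do under eq_bigr do rewrite FE.
  rewrite IH; apply: eq_bigr => j _; exact: eq_Ex.
have FE j t : j != i -> F (i :: s) p q j t = F s p q j t.
  by rewrite /F inE => /negbTE ->.
have Fi t : F (i :: s) p q i t = \1_(B i) (U i t, V i t) by rewrite /F inE eqxx.
pose H t := \prod_(j | j != i) F s p q j t.
have fH : finite_moments P H by apply: finite_moments_prod => j _; exact: fF.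
pose up (x : nat) (f : I -> nat) j := if j == i then x else f j.
have IH' p' q' : \int[P]_t (U i t ^+ p' * V i t ^+ q' * H t) =
    \int[P]_t (U i t ^+ p' * V i t ^+ q') * \prod_(j | j != i) \int[P]_t F s p q j t.
  have := IH (up p' p) (up q' q); rewrite (bigD1 i)//=.
  have Fup t : F s (up p' p) (up q' q) i t = U i t ^+ p' * V i t ^+ q'.
    by rewrite /F (negbTE nsi) /up eqxx.
  have Fup' j t : j != i -> F s (up p' p) (up q' q) j t = F s p q j t.
    by rewrite /F /up => /negbTE ->.
  rewrite (eq_Ex _ Fup) => e.
  transitivity (\int[P]_t (\prod_i F s (up p' p) (up q' q) i t)).
    apply: eq_Ex => t; rewrite [RHS](bigD1 i)//= Fup; congr (_ * _).
    by apply: eq_bigr => j /Fup' ->.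
  rewrite e; congr (_ * _); apply: eq_bigr => j ji; apply: eq_Ex => t; exact: Fup'.
have EH : \int[P]_t H t = \prod_(j | j != i) \int[P]_t F s p q j t.
  have e1 : \int[P]_t (U i t ^+ 0 * V i t ^+ 0) = 1.
    by rewrite -[RHS](Ex_cst P 1); apply: eq_Ex => t; rewrite !expr0 mulr1.
  have := IH' 0%N 0%N; rewrite e1 mul1r => <-.
  by apply: eq_Ex => t; rewrite !expr0 !mul1r.
have H0 t : 0 <= H t by apply: prodr_ge0 => j _; exact: F0.
have momH p' q' : \int[P]_t (U i t ^+ p' * V i t ^+ q' * H t) =
    \int[P]_t (U i t ^+ p' * V i t ^+ q') * \int[P]_t H t by rewrite IH' EH.
have key := weighted_pair_determinacy (fU i) (fV i) fH (U0 i) (V0 i) H0 (eU i) (eV i) momH.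
transitivity (\int[P]_t (\1_(B i) (U i t, V i t) * H t)).
  apply: eq_Ex => t; rewrite (bigD1 i)//= Fi; congr (_ * _).
  by apply: eq_bigr => j /FE ->.
rewrite key//.
rewrite EH [RHS](bigD1 i)//=; congr (_ * _); first by apply: eq_Ex => t; rewrite Fi.
by apply: eq_bigr => j ji; apply: eq_Ex => t; rewrite FE.
Qed.

End moment_factorization.

Section finite_mass.
Context (R : realType) (X : pmetricType R) d (Omega : measurableType d)
  (mu : R.-ker Omega ~> borel X).

(* Setting [fmass mu A w = 0] for all [A] when the total mass is infinite makes it additive. *)
Definition fmass (A : set (borel X)) (w : Omega) : R :=
  if (mu w [set: borel X] < +oo)%E then fine (mu w A) else 0.

Lemma fmass_ge0 A w : 0 <= fmass A w.
Proof. by rewrite /fmass; case: ifP => // _; exact: fine_ge0. Qed.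

Lemma measurable_fmass A : measurable A -> measurable_fun setT (fmass A).
Proof.
move=> mA; apply: measurable_fun_ifT.
- apply: (measurable_fun_lte (f := fun w => mu w setT) (g := fun=> +oo%E)) => //.
  exact: measurable_kernel.
- by apply: measurableT_comp => //; exact: measurable_kernel.
- exact: measurable_cst.
Qed.

Lemma fmassE A w : (mu w [set: borel X] < +oo)%E -> measurable A ->
  (fmass A w)%:E = mu w A.
Proof.
move=> h mA; rewrite /fmass h fineK// ge0_fin_numE//.
by apply: le_lt_trans h; apply: le_measure; rewrite ?inE.
Qed.

Lemma fmass_bigsetU (I : finType) (A : I -> set (borel X)) w :
  (forall i, measurable (A i)) -> trivIset [set: I] A ->
  fmass (\bigcup_i A i) w = \sum_i fmass (A i) w.
Proof.
move=> mA tA; have [h|h] := boolP (mu w [set: borel X] < +oo)%E; last first.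
  by rewrite /fmass (negbTE h) big1.
have mU : measurable (\bigcup_i A i).
  by apply: fin_bigcup_measurable => //; exact: finite_finset.
have -> : \bigcup_i A i = \bigcup_(i in [set` index_enum I]) A i.
  by congr (bigcup _ _); apply/seteqP; split => // i _ /=; rewrite mem_index_enum.
have {}mU : measurable (\bigcup_(i in [set` index_enum I]) A i).
  by apply: fin_bigcup_measurable => //; exact: finite_seq.
apply: EFin_inj; rewrite fmassE// measure_fin_bigcup//; last exact: sub_trivIset tA.
rewrite -fsbig_seq ?index_enum_uniq// -sumEFin.
by apply: eq_bigr => i _; rewrite fmassE.
Qed.

End finite_mass.

Section gamma_crm_fmass.
Context (R : realType) (X : pmetricType R) (P0 : probability (borel X) R)
  d (Omega : measurableType d) (P : probability Omega R) (c : R)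
  (mu : R.-ker Omega ~> borel X).
Hypotheses (c0 : 0 <= c) (gmu : gamma_crm P c P0 mu).

Lemma crm_fmass_ae A : measurable A -> {ae P, forall w, mu w A = (fmass mu A w)%:E}.
Proof.
move=> mA; have := crm_finite_ae c0 gmu (measurableT : measurable [set: borel X]).
by apply: filterS => w h; rewrite fmassE.
Qed.

Lemma crm_fmass_moment A n : measurable A ->
  \int[P]_w (fmass mu A w ^+ n) = rising (shape P0 c A) n.
Proof.
move=> mA; rewrite -(crm_moment c0 gmu n mA); apply: ae_eq_Ex.
- by apply: measurable_funX; exact: measurable_fmass.
- by apply: measurable_funX; exact: measurable_mass.
- by apply: filterS (crm_fmass_ae mA) => w ->.
Qed.

Lemma ae_eq_integrable (f g : Omega -> R) : measurable_fun setT g ->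
  {ae P, forall w, f w = g w} -> P.-integrable setT (EFin \o f) ->
  P.-integrable setT (EFin \o g).
Proof.
move=> mg fg /integrableP[mf hf].
apply/integrableP; split; first exact/measurable_EFinP.
move: hf; apply: le_lt_trans.
rewrite le_eqVlt; apply/orP; left; apply/eqP; apply: ae_eq_integral => //.
- by apply: measurableT_comp => //; exact/measurable_EFinP.
- by apply: measurableT_comp.
- by apply: filterS fg => w /= -> _.
Qed.

Lemma ae_finite_moments (f g : Omega -> R) : measurable_fun setT g ->
  {ae P, forall w, f w = g w} -> finite_moments P f -> finite_moments P g.
Proof.
move=> mg fg [mf hf]; split => // n.
apply: ae_eq_integrable (hf n); first exact: measurable_funX.
by apply: filterS fg => w ->.
Qed.

Lemma crm_fmass_finite_moments A : measurable A -> finite_moments P (fmass mu A).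
Proof.
move=> mA; apply: (@ae_finite_moments (fun w => fine (mu w A))).
- exact: measurable_fmass.
- by apply: filterS (crm_fmass_ae mA) => w ->.
- exact: (crm_finite_moments c0 gmu).
Qed.

Lemma crm_fmass_exp_moment A : measurable A -> exp_moment P (fmass mu A).
Proof.
move=> mA; have [de de0 ide] := crm_exp_integrable c0 gmu mA.
exists de => //; apply: ae_eq_integrable ide.
  apply: measurableT_comp => //; apply: measurable_funM => //.
  exact: measurable_fmass.
by apply: filterS (crm_fmass_ae mA) => w /= ->.
Qed.

Lemma crm_expectation_prod (I : finType) (A : I -> set (borel X)) (f : I -> R -> R) :
  (forall i, measurable (A i)) -> trivIset [set: I] A ->
  (forall i, measurable_fun setT (f i)) -> (forall i x, 0 <= f i x) ->
  (forall i, finite_moments P (fun w => f i (fmass mu (A i) w))) ->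
  \int[P]_w (\prod_i f i (fmass mu (A i) w)) =
  \prod_i \int[P]_w f i (fmass mu (A i) w).
Proof.
move=> mA tA mf f0 hf.
have mk i : measurable_fun setT (fun w => mu w (A i)) by exact: measurable_kernel.
have e1 i : {ae P, forall w, f i (fine (mu w (A i))) = f i (fmass mu (A i) w)}.
  by apply: filterS (crm_fmass_ae (mA i)) => w ->.
have mfine i : measurable_fun setT (fun y : \bar R => f i (fine y)).
  by apply: measurableT_comp => //; exact: measurable_fine.
have hf' i : finite_moments P (fun w => f i (fine (mu w (A i)))).
  apply: ae_finite_moments (hf i); first exact: measurableT_comp (mfine i) (mk i).
  by apply: filterS (e1 i) => w ->.
transitivity (\int[P]_w (\prod_i f i (fine (mu w (A i))))).
  apply: ae_eq_Ex.
  - have [] // : finite_moments P (fun w => \prod_i f i (fmass mu (A i) w)).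
    exact: finite_moments_prod.
  - have [] // : finite_moments P (fun w => \prod_i f i (fine (mu w (A i)))).
    exact: finite_moments_prod.
  have h1 : {ae P, forall w, forall i, f i (fine (mu w (A i))) = f i (fmass mu (A i) w)}.
    exact: filter_forall.
  by apply: filterS h1 => w h /=; apply: eq_bigr => i _; rewrite h.
rewrite (@expectation_prod_indep _ _ _ _ _ P I (fun i w => mu w (A i)) mk _ (fun i y => f i (fine y)))//.
  apply: eq_bigr => i _; apply: ae_eq_Ex => //; [exact: (hf' i).1|exact: (hf i).1].
move=> B mB; have [[_ ind] _] := gmu.
have tE : trivIset [set: 'I_#|I|] (A \o enum_val).
  by move=> i j _ _ h; apply: enum_val_inj; exact: tA.
have := ind #|I| (A \o enum_val) (fun i => mA _) tE (B \o enum_val) (fun i => mB _).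
rewrite (_ : \bigcap_i _ = \bigcap_(i in [set: I]) ((fun w => mu w (A i)) @^-1` B i)).
  by move=> ->; rewrite (@big_enum_val _ _ _ I predT) /=.
apply/seteqP; split => w h i _; last exact: h.
by have := h (enum_rank i) Logic.I; rewrite /= enum_rankK.
Qed.

Lemma crm_moment_rel (I : finType) (A : I -> set (borel X)) :
  (forall i, measurable (A i)) -> trivIset [set: I] A ->
  moment_rel P (fun i => shape P0 c (A i)) (fun i => fmass mu (A i)).
Proof.
move=> mA tA p.
(* The test functions must be nonnegative on the whole line, hence the absolute values. *)
have e w : \prod_i fmass mu (A i) w ^+ p i = \prod_i (`|fmass mu (A i) w| ^+ p i).
  by apply: eq_bigr => i _; rewrite ger0_norm// fmass_ge0.
rewrite (eq_Ex _ e) (@crm_expectation_prod _ _ (fun i x => `|x| ^+ p i))//.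
- apply: eq_bigr => i _; rewrite -crm_fmass_moment//; apply: eq_Ex => w.
  by rewrite ger0_norm// fmass_ge0.
- by move=> i; apply: measurable_funX; exact: normr_measurable.
- by move=> i; apply: eq_finite_moments (finite_momentsX (p i) (crm_fmass_finite_moments (mA i))) => w; rewrite ger0_norm// fmass_ge0.
Qed.

End gamma_crm_fmass.

(** * Canonical pairs attached to two gamma random measures *)

Section crm_canonical.
Context (R : realType) (X : pmetricType R) (P0 : probability (borel X) R)
  d (Omega : measurableType d) (P : probability Omega R) (c : R)
  (mu1 mu2 : R.-ker Omega ~> borel X).
Hypotheses (c_gt0 : 0 < c) (gamma1 : gamma_crm P c P0 mu1)
  (gamma2 : gamma_crm P c P0 mu2)
  (canon12 : in_canonical_correlation P c P0 mu1 mu2).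

Let c0 : 0 <= c. Proof. exact: ltW. Qed.

Lemma shape_gt0 A : (0 < P0 A)%E -> measurable A -> 0 < shape P0 c A.
Proof.
move=> A0 mA; rewrite mulr_gt0// fine_gt0// A0/=.
by rewrite ltey_eq fin_num_measure.
Qed.

(** Canonical correlation of the family reduced to [A] contains the gamma law of [mu1(A)], to which
    [pochhammer_rising] applies. *)
Lemma shape_pochhammer A n : measurable A -> (0 < P0 A)%E ->
  pochhammer (shape P0 c A) n = rising (shape P0 c A) n.
Proof.
move=> mA A0; have tA : trivIset [set: 'I_1] (fun=> A) by move=> i j _ _ _; rewrite !ord1.
have [rho [_ _ hg _ _]] := canon12 (fun i : 'I_1 => mA) tA (fun=> A0).
apply: (pochhammer_rising (P := P) (X := fun w => fine (mu1 w A))).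
- exact: shape_gt0.
- exact: (crm_finite_moments c0 gamma1).
- by move=> t; exact: fine_ge0.
- move=> B mB; have := hg (fun=> B) (fun=> mB); rewrite big_ord1 => <-.
  by congr (P _); apply/seteqP; split => [w h i _//|w /(_ ord0)]; exact.
- by move=> k; exact: (crm_moment c0 gamma1).
Qed.

Section family.
Context (k : nat) (A : 'I_k -> set (borel X)).
Hypotheses (mA : forall i, measurable (A i)) (A0 : forall i, (0 < P0 (A i))%E).
Let al i := shape P0 c (A i).
Let U i := fmass mu1 (A i).
Let V i := fmass mu2 (A i).

Lemma laguerre_expectation (n m : {ffun 'I_k -> nat}) :
  ('E_P[fun w => (\prod_(i < k) laguerre (n i) (increment_shapes c P0 A i) (increments mu1 A i w) *
                  \prod_(i < k) laguerre (m i) (increment_shapes c P0 A i) (increments mu2 A i w))%R])%E =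
  ((\prod_i (n i)`!%:R * \prod_i (m i)`!%:R) *
    \int[P]_w (ell_prod al U n w * ell_prod al V m w))%:E.
Proof.
have fU i : finite_moments P (U i) by exact: (crm_fmass_finite_moments c0 gamma1).
have fV i : finite_moments P (V i) by exact: (crm_fmass_finite_moments c0 gamma2).
have fUV : finite_moments P (fun w => ell_prod al U n w * ell_prod al V m w).
  by apply: finite_momentsM; exact: finite_moments_ell_prod.
have lagE (mu : R.-ker Omega ~> borel X) (p : {ffun 'I_k -> nat}) w :
    \prod_(i < k) laguerre (p i) (increment_shapes c P0 A i) (increments mu A i w) =
    \prod_i (p i)`!%:R * ell_prod al (increments mu A) p w.
  rewrite /ell_prod -big_split /=; apply: eq_bigr => i _.
  by rewrite laguerreE//; [exact: shape_gt0|exact: shape_pochhammer].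
have fI (mu : R.-ker Omega ~> borel X) (p : {ffun 'I_k -> nat}) : gamma_crm P c P0 mu ->
    finite_moments P (ell_prod al (increments mu A) p).
  by move=> g; apply: finite_moments_ell_prod => i; exact: (crm_finite_moments c0 g).
have fI2 : finite_moments P (fun w => ell_prod al (increments mu1 A) n w * ell_prod al (increments mu2 A) m w).
  by apply: finite_momentsM; exact: fI.
rewrite unlock.
transitivity (\int[P]_w ((\prod_i (n i)`!%:R * \prod_i (m i)`!%:R) *
    (ell_prod al (increments mu1 A) n w * ell_prod al (increments mu2 A) m w))%:E)%E.
  by apply: eq_integral => w _; rewrite !lagE mulrACA.
rewrite -EFin_Ex; last exact: finite_momentsZ.
rewrite ExZ//; congr (_ * _)%:E.
apply: ae_eq_Ex; [exact: fI2.1|exact: fUV.1|].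
have h1 : {ae P, forall w, forall i, mu1 w (A i) = (U i w)%:E}.
  by apply: filter_forall => i; exact: (crm_fmass_ae c0 gamma1).
have h2 : {ae P, forall w, forall i, mu2 w (A i) = (V i w)%:E}.
  by apply: filter_forall => i; exact: (crm_fmass_ae c0 gamma2).
apply: filterS2 h1 h2 => w h1 h2; congr (_ * _); apply: eq_bigr => i _.
  by rewrite /increments h1.
by rewrite /increments h2.
Qed.

Lemma canonical_pair_ord : trivIset [set: 'I_k] A -> canonical_pair P al U V.
Proof.
move=> tA; split.
- by move=> i; split; [exact: (crm_fmass_finite_moments c0 gamma1)|move=> t; exact: fmass_ge0].
- by move=> i; split; [exact: (crm_fmass_finite_moments c0 gamma2)|move=> t; exact: fmass_ge0].
- exact: (crm_moment_rel c0 gamma1).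
- exact: (crm_moment_rel c0 gamma2).
move=> n m nm; have [rho [_ _ _ _ h]] := canon12 mA tA A0.
have := h n m; rewrite laguerre_expectation (negbTE nm) mulr0 mul0r => e0; have /eqP := EFin_inj e0.
rewrite mulf_eq0 => /orP[/eqP e|/eqP//]; exfalso; move/eqP: e; apply/negP.
by rewrite mulf_neq0//; apply/prodf_neq0 => i _; exact: fact_neq0.
Qed.

End family.

Definition crm_coef A n := \int[P]_w (ell (shape P0 c A) n (fmass mu1 A w) *
  ell (shape P0 c A) n (fmass mu2 A w)).

Lemma canonical_pair_crm (I : finType) (A : I -> set (borel X)) :
  (forall i, measurable (A i)) -> (forall i, (0 < P0 (A i))%E) ->
  trivIset [set: I] A ->
  canonical_pair P (fun i => shape P0 c (A i)) (fun i => fmass mu1 (A i))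
    (fun i => fmass mu2 (A i)).
Proof.
move=> mA A0 tA.
have tE : trivIset [set: 'I_#|I|] (A \o enum_val).
  by move=> i j _ _ h; apply: enum_val_inj; exact: tA.
have := canonical_pair_sub (@enum_rank_inj I)
  (canonical_pair_ord (fun i => mA (enum_val i)) (fun i => A0 (enum_val i)) tE).
congr canonical_pair; apply/funext => i /=; by rewrite enum_rankK.
Qed.

(** From right to left, laws and orthogonality come from [canon12], and [rho] is the only candidate
    because [risq] is positive. *)
Lemma coefficients_crm_coef A rho : measurable A -> (0 < P0 A)%E ->
  canonical_coefficients P c P0 mu1 mu2 (fun _ : 'I_1 => A) rho <->
  forall n, crm_coef A n = rho [ffun=> n] * risq (shape P0 c A) n.
Proof.
move=> mA A0; have tA : trivIset [set: 'I_1] (fun=> A) by move=> i j _ _ _; rewrite !ord1.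
have ffE (n : {ffun 'I_1 -> nat}) : n = [ffun=> n ord0].
  by apply/ffunP => i; rewrite ffunE ord1.
have key rho' : canonical_coefficients P c P0 mu1 mu2 (fun _ : 'I_1 => A) rho' ->
    forall n, crm_coef A n = rho' [ffun=> n] * risq (shape P0 c A) n.
  move=> [_ _ _ _ h] n; have e1 := laguerre_expectation (fun _ : 'I_1 => mA) (fun=> A0) [ffun=> n] [ffun=> n].
  have := EFin_inj (etrans (esym e1) (h [ffun=> n] [ffun=> n])); rewrite eqxx mulr1.
  rewrite !big_ord1 ffunE /laguerre_sqnorm shape_pochhammer// => e.
  have nz : n`!%:R != 0 :> R by exact: fact_neq0.
  rewrite /risq; apply: (mulfI (mulf_neq0 nz nz)).
  rewrite [RHS](_ : _ = rho' [ffun=> n] * (n`!%:R * rising (shape P0 c A) n)); last by field.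
  rewrite -e; congr (_ * _); apply: eq_Ex => w; by rewrite /ell_prod !big_ord1 ffunE.
split; first exact: key.
move=> h; have [rho' cc] := canon12 (fun i : 'I_1 => mA) tA (fun=> A0).
suff -> : rho = rho' by [].
apply/funext => n; rewrite (ffE n).
have := h (n ord0); rewrite (key _ cc) => /mulIf -> //.
by rewrite gt_eqF// risq_gt0// shape_gt0.
Qed.

(** By [canonical_pair_moment] a mixed moment is a sum over multi-indices of a coefficient times a
    product over [i], so factorized coefficients give factorized moments. *)
Lemma canonical_coef_factor_indep (I : finType) (A : I -> set (borel X)) :
  (forall i, measurable (A i)) -> (forall i, (0 < P0 (A i))%E) ->
  trivIset [set: I] A ->
  (forall n : {ffun I -> nat}, canonical_coef P (fun i => shape P0 c (A i))
    (fun i => fmass mu1 (A i)) (fun i => fmass mu2 (A i)) n =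
    \prod_i crm_coef (A i) (n i)) ->
  forall B : I -> set (R * R), (forall i, measurable (B i)) ->
  \int[P]_w (\prod_i \1_(B i) (fmass mu1 (A i) w, fmass mu2 (A i) w)) =
  \prod_i \int[P]_w \1_(B i) (fmass mu1 (A i) w, fmass mu2 (A i) w).
Proof.
move=> mA A0 tA fac; apply: moment_factor_indep.
- by move=> i; exact: (crm_fmass_finite_moments c0 gamma1).
- by move=> i; exact: (crm_fmass_finite_moments c0 gamma2).
- by move=> i t; exact: fmass_ge0.
- by move=> i t; exact: fmass_ge0.
- by move=> i; exact: (crm_fmass_exp_moment c0 gamma1).
- by move=> i; exact: (crm_fmass_exp_moment c0 gamma2).
move=> p q; pose N := (\max_i q i).+1.
have qN i : (q i < N)%N by rewrite ltnS (leq_bigmax i).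
have fU i : finite_moments P (fmass mu1 (A i)) by exact: (crm_fmass_finite_moments c0 gamma1).
have fV i : finite_moments P (fmass mu2 (A i)) by exact: (crm_fmass_finite_moments c0 gamma2).
pose a i := shape P0 c (A i).
have one i : \int[P]_w (fmass mu1 (A i) w ^+ p i / (p i)`!%:R * (fmass mu2 (A i) w ^+ q i / (q i)`!%:R)) =
    \sum_(f < N) crm_coef (A i) f * (ell_coef (a i) (p i) f * ell_coef (a i) (q i) f).
  have tA1 : trivIset [set: 'I_1] (fun=> A i) by move=> x y _ _ _; rewrite !ord1.
  have cp := canonical_pair_ord (fun _ : 'I_1 => mA i) (fun=> A0 i) tA1.
  have := @canonical_pair_moment _ _ _ _ _ _ _ _ cp N (fun=> p i) (fun=> q i) (fun=> qN i).
  under eq_Rintegral do rewrite !big_ord1.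
  move=> ->; rewrite (reindex (fun f : 'I_N => [ffun _ : 'I_1 => f])) /=; last first.
    exists (fun g => g ord0) => [f _|g _]; first by rewrite ffunE.
    by apply/ffunP => x; rewrite ffunE (ord1 x).
  apply: eq_bigr => f _; rewrite big_ord1 ffunE; congr (_ * _).
  by apply: eq_Ex => w; rewrite /ell_prod !big_ord1 !ffunE.
have scale (F : R) x y : x != 0 -> y != 0 -> F = (x * y) * (F / x / y) by move=> *; field; exact/andP.
pose K i : R := (p i)`!%:R * (q i)`!%:R.
transitivity ((\prod_i K i) * \int[P]_w (\prod_i (fmass mu1 (A i) w ^+ p i / (p i)`!%:R) *
    \prod_i (fmass mu2 (A i) w ^+ q i / (q i)`!%:R))).
  rewrite -ExZ; last first.
    by apply: finite_momentsM; apply: finite_moments_prod => i _; apply: finite_momentsM;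
      [exact: finite_momentsX|exact: finite_moments_cst|exact: finite_momentsX|exact: finite_moments_cst].
  apply: eq_Ex => w; rewrite -!big_split /=; apply: eq_bigr => i _.
  by rewrite /K; field; rewrite !fact_neq0.
rewrite (@canonical_pair_moment _ _ _ _ _ _ _ _ (canonical_pair_crm mA A0 tA) N p q qN).
transitivity ((\prod_i K i) * \prod_i \sum_(f < N) crm_coef (A i) f * (ell_coef (a i) (p i) f * ell_coef (a i) (q i) f)).
  congr (_ * _); rewrite bigA_distr_bigA; apply: eq_bigr => f _.
  rewrite fac -big_split /=; apply: eq_bigr => i _; by rewrite ffunE.
rewrite -big_split /=; apply: eq_bigr => i _; rewrite -one -ExZ; last first.
  by apply: finite_momentsM; apply: finite_momentsM;
    [exact: finite_momentsX|exact: finite_moments_cst|exact: finite_momentsX|exact: finite_moments_cst].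
by apply: eq_Ex => w; rewrite /K; field; rewrite !fact_neq0.
Qed.

End crm_canonical.

(** * Atomless measures on separable metric spaces *)

Section separating_function.
Context (R : realType) (X : pmetricType R).

Lemma metric_ball_open (x : X) (e : R) : open (ball x e).
Proof.
rewrite openE => y; rewrite -metricType_numDomainType.ball_mdistE /= => xy.
apply/nbhs_ballP; exists (e - mdist x y); first by rewrite /= subr_gt0.
move=> z; rewrite -metricType_numDomainType.ball_mdistE /= => yz.
by apply: le_lt_trans (metric_triangle x y z) _; rewrite -ltrBrDl.
Qed.

(** Balls around the points of a dense set separate points: if the radius is below half the distance
    from [x] to [y], a ball that contains [x] cannot contain [y]. *)
Lemma separating_sequence : separable_space X -> exists C : nat -> set X,
  (forall n, open (C n)) /\ forall x y, x <> y -> exists n, C n x /\ ~ C n y.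
Proof.
move=> [D /countable_injP[f finj] Dd].
(* The injection [f] numbers the points of [D], so at most one ball enters this union. *)
pose B n k : set X := \bigcup_(z in D `&` [set z | f z = n]) ball z k.+1%:R^-1.
pose C m := if unpickle m is Some p then B p.1 p.2 else set0.
have oB n k : open (B n k) by apply: bigcup_open => z _; exact: metric_ball_open.
exists C; split; first by move=> m; rewrite /C; case: unpickle => [p|]; [exact: oB|exact: open0].
move=> x y xy; have d0 : 0 < mdist x y by rewrite mdist_gt0; apply/eqP.
have [k hk] : exists k, k.+1%:R^-1 < mdist x y / 2.
  have : \forall k \near \oo, k.+1%:R^-1 < mdist x y / 2 :> R.
    apply: (cvgr_lt (0 : R)); last by rewrite divr_gt0.
    exact: cvg_harmonic.
  by move=> [N _ /(_ N (leqnn N))]; exists N.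
have k0 : 0 < k.+1%:R^-1 :> R by rewrite invr_gt0.
have [z [xz Dz]] : ball x k.+1%:R^-1 `&` D !=set0.
  by apply: Dd; [exists x; exact: ballxx|exact: metric_ball_open].
exists (pickle (f z, k)); rewrite /C pickleK /=; split.
  by exists z => //; exact: ball_sym.
move=> [z' [Dz' fz] zy]; have zz' : z' = z by apply: finj; rewrite ?inE.
move: zy xz; rewrite zz' -metricType_numDomainType.ball_mdistE /= => zy xz.
have := metric_triangle x z y; rewrite leNgt => /negP; apply.
by rewrite (splitr (mdist x y)) ltrD// (lt_trans _ hk).
Qed.

(** A ternary expansion of the indicators of a separating sequence. The tail after position [n] is
    at most [3^(- n) / 2], so the first differing digit decides the order of the values, whence
    injectivity. *)
Lemma separating_function : separable_space X ->
  exists h : borel X -> R, [/\ measurable_fun setT h, injective h & forall x, 0 <= h x <= 2].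
Proof.
move=> /separating_sequence[C [oC sepC]].
pose q : R := 3^-1.
have q0 : 0 < q by rewrite invr_gt0.
pose s n (x : borel X) : R := \sum_(k < n) \1_(C k) x * q ^+ k.
have sS n x : s n.+1 x = s n x + \1_(C n) x * q ^+ n by rewrite /s big_ord_recr.
have sle n j x : s (n + j)%N x <= s n x + q ^+ n * (3 / 2) * (1 - q ^+ j).
  elim: j => [|j IH]; first by rewrite addn0 expr0 subrr mulr0 addr0.
  rewrite addnS sS.
  have h1 : \1_(C (n + j)) x * q ^+ (n + j) <= q ^+ n * q ^+ j.
    rewrite -exprD; apply: ler_piMl; first by rewrite exprn_ge0// ltW.
    by rewrite indicE lern1 leq_b1.
  apply: le_trans (lerD IH h1) _; rewrite exprS /q.
  by rewrite le_eqVlt; apply/orP; left; apply/eqP; field.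
have sm x : nondecreasing_seq (s ^~ x).
  apply/nondecreasing_seqP => n; rewrite sS lerDl; apply: mulr_ge0.
    by rewrite indicE ler0n.
  by rewrite exprn_ge0// ltW.
have sle' n m x : s m x <= s n x + q ^+ n * (3 / 2).
  apply: (@le_trans _ _ (s (n + m)%N x)); first by apply: sm; rewrite leq_addl.
  apply: le_trans (sle _ _ _) _; rewrite lerD2l; apply: ler_piMr.
    by rewrite mulr_ge0 ?exprn_ge0 ?divr_ge0// ltW.
  by rewrite lerBlDr lerDl exprn_ge0// ltW.
have sc x : cvgn (s ^~ x).
  apply: nondecreasing_is_cvgn => //; exists (s 0%N x + q ^+ 0 * (3 / 2)) => _ [n _ <-].
  exact: sle'.
exists (fun x => limn (s ^~ x)); split; last 1 first.
- move=> x; have s0 : s 0%N x = 0 by rewrite /s big_ord0.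
  apply/andP; split.
    by rewrite -s0; apply: nondecreasing_cvgn_le.
  apply: (@le_trans _ _ (s 0%N x + q ^+ 0 * (3 / 2))).
    by apply: limr_le => //; apply: nearW => m; exact: sle'.
  by rewrite s0 expr0; lra.
- apply: (@measurable_fun_cvg _ _ _ _ s) => [m|x _]; last exact: sc.
  apply: measurable_sum => k; apply: measurable_funM => //.
  by apply: measurable_indic; apply: sub_sigma_algebra; exact: oC.
have lt_h n x y : (forall k, (k < n)%N -> \1_(C k) x = \1_(C k) y :> R) ->
    C n x -> ~ C n y -> limn (s ^~ y) < limn (s ^~ x).
  move=> e xC yC; apply: (@lt_le_trans _ _ (s n.+1 x)); last first.
    by apply: nondecreasing_cvgn_le.
  apply: (@le_lt_trans _ _ (s n.+1 y + q ^+ n.+1 * (3 / 2))).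
    by apply: limr_le => //; apply: nearW => m; exact: sle'.
  have es : s n x = s n y by apply: eq_bigr => k _; rewrite e.
  rewrite !sS es !indicE (mem_set xC) (memNset yC) mul0r mul1r addr0 ltrD2l.
  by rewrite exprS /q mulrAC gtr_pMl ?exprn_gt0// /q; lra.
move=> x y hxy; apply: contrapT => xy.
pose dif n := \1_(C n) x != \1_(C n) y :> R.
have [n hn] : exists n, dif n.
  have [n [xC yC]] := sepC x y xy; exists n; rewrite /dif !indicE (mem_set xC) (memNset yC).
  exact: oner_neq0.
case: (ex_minnP (ex_intro _ n hn)) => m hm minm.
have e k : (k < m)%N -> \1_(C k) x = \1_(C k) y :> R.
  move=> km; apply/eqP/negPn/negP => hk; have := minm k hk.
  by rewrite leqNgt km.
have [xC|xC] := pselect (C m x); have [yC|yC] := pselect (C m y).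
- by move: hm; rewrite /dif !indicE (mem_set xC) (mem_set yC) eqxx.
- by have := lt_h m x y e xC yC; rewrite hxy ltxx.
- by have := lt_h m y x (fun k km => esym (e k km)) yC xC; rewrite hxy ltxx.
- by move: hm; rewrite /dif !indicE (memNset xC) (memNset yC) eqxx.
Qed.

Lemma measurable_set1_borel (x : X) : measurable ([set x] : set (borel X)).
Proof.
rewrite -[[set x]]setCK; apply: measurableC; apply: sub_sigma_algebra.
rewrite openE => y /= yx; apply/nbhs_ballP; exists (mdist y x).
  by rewrite /= mdist_gt0; apply/eqP.
by move=> z; rewrite -metricType_numDomainType.ball_mdistE /= => yz zx; move: yz; rewrite zx ltxx.
Qed.

(** A singleton has only trivial subsets, so one of positive measure would be an atom. *)
Lemma nonatomic_set1 (P0 : probability (borel X) R) (x : X) :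
  nonatomic P0 -> P0 [set x] = 0%E.
Proof.
move=> na; apply: contrapT => h; apply: (na [set x]); split.
- exact: measurable_set1_borel.
- by rewrite lt_neqAle measure_ge0 andbT eq_sym; apply/eqP.
move=> B mB Bx; have [xB|xB] := pselect (B x).
  by right; congr (P0 _); apply/seteqP; split => // z ->.
left; rewrite (_ : B = set0) ?measure0//; apply/seteqP; split => // z Bz.
by apply: xB; rewrite -(Bx _ Bz).
Qed.

End separating_function.

Section uniform_variable.
Context d (T : measurableType d) (R : realType) (P : probability T R)
  (h : T -> R) (A : set T).
Hypotheses (mh : measurable_fun setT h) (h0 : forall y, P (h @^-1` [set y]) = 0%E)
  (mA : measurable A).

Let m (B : set R) := P (A `&` h @^-1` B).
Let mhB (B : set R) : measurable B -> measurable (A `&` h @^-1` B).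
Proof. by move=> mB; apply: measurableI => //; rewrite -[_ @^-1` _]setTI; exact: mh. Qed.
Let F (y : R) : R := fine (m [set` `]-oo, y]]).
Let FE y : (F y)%:E = m [set` `]-oo, y]].
Proof. by rewrite fineK// fin_num_measure//; exact: mhB. Qed.
Let m_le (B C : set R) : measurable B -> measurable C -> B `<=` C -> (m B <= m C)%E.
Proof.
move=> mB mC BC; apply: le_measure; rewrite ?inE; [exact: mhB|exact: mhB|].
by apply: setIS => x /=; exact: BC.
Qed.
Let F_homo : {homo F : x y / x <= y}.
Proof.
move=> x y xy; rewrite -lee_fin !FE; apply: m_le => //.
by move=> z /=; rewrite !in_itv/= => /le_trans; exact.
Qed.

(* The distribution function of an atomless variable, composed with that variable. *)
Definition uniform_on (x : T) : R := F (h x).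

Lemma measurable_uniform_on : measurable_fun setT uniform_on.
Proof. by apply: (measurableT_comp (f := F)) => //; exact: nondecreasing_measurable. Qed.

Let F_lt y : m [set` `]-oo, y[] = (F y)%:E.
Proof.
rewrite FE; apply/eqP; rewrite eq_le m_le//=; last first.
  by move=> z /=; rewrite !in_itv/= => /ltW.
have -> : [set` `]-oo, y]] = [set` `]-oo, y[] `|` [set y].
  apply/seteqP; split => z /=; rewrite !in_itv/= ?le_eqVlt.
    by case/orP => [/eqP|]; [right|left].
  by case => [->|->]; rewrite ?orbT ?eqxx.
rewrite /m preimage_setU setIUr; apply: le_trans (measureU2 _ _ _) _; [exact: mhB|exact: mhB|].
rewrite -[leRHS]adde0 leeD2l//.
apply: (@le_trans _ _ (P (h @^-1` [set y]))); last by rewrite h0.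
apply: le_measure; rewrite ?inE; [exact: mhB| |by move=> ? []].
by rewrite -[_ @^-1` _]setTI; exact: mh.
Qed.

Hypothesis hb : forall x, 0 <= h x <= 2.

(** Intermediate value theorem for [F] at a supremum: [F_lt], which expresses that no point is
    charged, gives the upper bound from the left, and continuity of [P] from above gives the lower
    bound from the right. *)
Let F_eq t : 0 < t -> (t%:E < P A)%E -> exists y, F y = t.
Proof.
move=> t0 tA; pose S := [set y | F y <= t].
have SN1 : S (- 1).
  rewrite /S /= (_ : F (-1) = 0) ?ltW//.
  apply: EFin_inj; rewrite FE /m (_ : _ `&` _ = set0) ?measure0//.
  apply/seteqP; split => // x [_ /=]; rewrite in_itv/=.
  by have /andP[h0' _] := hb x; lra.
have F2 : (F 2)%:E = P A.
  rewrite FE /m; congr (P _); apply/seteqP; split => [x []//|x Ax]; split => //=.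
  by rewrite in_itv/=; have /andP[] := hb x.
have Sub : ubound S 2.
  move=> y yS; rewrite leNgt; apply/negP => /ltW/F_homo.
  by rewrite -lee_fin F2 leNgt => /negP; apply; apply: le_lt_trans tA; rewrite lee_fin.
have hs : has_sup S by split; [exists (-1)|exists 2].
set y := sup S; exists y; apply/eqP; rewrite eq_le; apply/andP; split.
  rewrite -lee_fin -F_lt.
  pose G n := A `&` h @^-1` [set` `]-oo, y - n.+1%:R^-1]].
  have GU : \bigcup_n G n = A `&` h @^-1` [set` `]-oo, y[].
    apply/seteqP; split => x /=.
      move=> [n _ [Ax /=]]; rewrite !in_itv/= => hx; split => //.
      by apply: le_lt_trans hx _; rewrite ltrBlDr ltrDl invr_gt0.
    move=> [Ax]; rewrite !in_itv/= => hx.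
    have [n hn] : exists n, n.+1%:R^-1 < y - h x.
      have : \forall k \near \oo, k.+1%:R^-1 < y - h x :> R.
        apply: (cvgr_lt (0 : R)); last by rewrite subr_gt0.
        exact: cvg_harmonic.
      by move=> [N _ /(_ N (leqnn N))]; exists N.
    by exists n => //; split => //=; rewrite in_itv/= lerBrDr ltW// -ltrBrDl.
  have := @nondecreasing_cvg_mu _ _ _ P G (fun n => mhB (measurable_itv _)).
  rewrite GU => /(_ (mhB (measurable_itv _))) hh.
  rewrite -/(m _) /m -(cvg_lim _ (hh _))//; last first.
    move=> a b ab; apply/subsetPset; apply: setIS => x /=; rewrite !in_itv/= => /le_trans; apply.
    by rewrite lerD2l lerN2 lef_pV2 ?posrE// ler_nat.
  apply: lime_le; first by apply/cvg_ex; eexists; apply: hh; move=> a b ab; apply/subsetPset; apply: setIS => x /=; rewrite !in_itv/= => /le_trans; apply; rewrite lerD2l lerN2 lef_pV2 ?posrE// ler_nat.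
  apply: nearW => n; rewrite /= -/(m _) -FE lee_fin.
  have [z Sz yz] : exists2 z, S z & y - n.+1%:R^-1 < z.
    by apply: sup_adherent.
  by apply: le_trans Sz; apply: F_homo; exact: ltW.
rewrite -lee_fin FE.
pose G n := A `&` h @^-1` [set` `]-oo, y + n.+1%:R^-1]].
have GI : \bigcap_n G n = A `&` h @^-1` [set` `]-oo, y]].
  apply/seteqP; split => x /=.
    move=> hx; split; first by have [] := hx 0%N I.
    rewrite in_itv/= leNgt; apply/negP => yx.
    have [n hn] : exists n, n.+1%:R^-1 < h x - y.
      have : \forall k \near \oo, k.+1%:R^-1 < h x - y :> R.
        apply: (cvgr_lt (0 : R)); last by rewrite subr_gt0.
        exact: cvg_harmonic.
      by move=> [N _ /(_ N (leqnn N))]; exists N.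
    by have [_ /=] := hx n I; rewrite in_itv/= leNgt => /negP; apply; rewrite -ltrBrDl.
  move=> [Ax]; rewrite in_itv/= => hx n _; split => //=; rewrite in_itv/=.
  by apply: le_trans hx _; rewrite lerDl.
have hom : {homo G : a b / (a <= b)%N >-> (b <= a)%O}.
  move=> a b ab; apply/subsetPset; apply: setIS => x /=; rewrite !in_itv/= => /le_trans; apply.
  by rewrite lerD2l lef_pV2 ?posrE// ler_nat.
have hfin : (P (G 0%N) < +oo)%E by rewrite ltey_eq fin_num_measure//; exact: mhB.
have := @nonincreasing_cvg_mu _ _ _ P G hfin (fun n => mhB (measurable_itv _)).
rewrite GI => /(_ (mhB (measurable_itv _)) hom) hh.
rewrite -/(m _) /m -(cvg_lim _ hh)//.
apply: lime_ge; first by apply/cvg_ex; eexists; exact: hh.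
apply: nearW => n; rewrite /= -/(m _) -FE lee_fin leNgt; apply/negP => Ft.
have : y + n.+1%:R^-1 <= y by apply: sup_upper_bound => //; exact: ltW.
by rewrite leNgt ltrDl invr_gt0 ltr0Sn.
Qed.

(** [F] may be constant on intervals, so the event is compared with events [h x <= y]: from below
    with [F y = t], from above with [F y = t + e]. *)
Lemma uniform_on_law t : 0 <= t -> (t%:E <= P A)%E ->
  P (A `&` [set x | uniform_on x <= t]) = t%:E.
Proof.
move=> t0 tA; have mUt s : measurable (A `&` [set x | uniform_on x <= s]).
  apply: measurableI => //; rewrite -[X in measurable X]setTI.
  rewrite (_ : [set x | _] = uniform_on @^-1` [set` `]-oo, s]]).
    exact: measurable_uniform_on.
  by apply/seteqP; split => x /=; rewrite in_itv.
apply/eqP; rewrite eq_le; apply/andP; split.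
  apply/lee_addgt0Pr => e e0.
  have [ht|ht] := leP (P A) (t + e)%:E.
    rewrite -EFinD; apply: le_trans ht; apply: le_measure; rewrite ?inE//; by move=> x [].
  have te0 : 0 < t + e by rewrite ltr_wpDl.
  have [y Fy] := F_eq te0 ht; rewrite -EFinD -Fy FE /m.
  apply: le_measure; rewrite ?inE//; first exact: mhB.
  move=> x [Ax /= Ux]; split => //=; rewrite in_itv/= leNgt; apply/negP => /ltW/F_homo.
  by rewrite Fy leNgt => /negP; apply; apply: le_lt_trans Ux _; rewrite ltrDl.
have /orP[/eqP <-//|{}t0] : (0 == t) || (0 < t) by rewrite -le_eqVlt.
have /orP[/eqP {}tA|{}tA] : (t%:E == P A)%E || (t%:E < P A)%E by rewrite -le_eqVlt.
  have sub : A `<=` A `&` [set x | uniform_on x <= t].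
    move=> x Ax; split => //=; rewrite -lee_fin tA /uniform_on FE.
    by apply: le_measure; rewrite ?inE//; exact: mhB.
  by rewrite [X in (X <= _)%E]tA; apply: le_measure; rewrite ?inE.
have [y Fy] := F_eq t0 tA; rewrite -Fy FE; apply: le_measure; rewrite ?inE//; first exact: mhB.
by move=> x [Ax /=]; rewrite in_itv/= => hx; split => //=; exact: F_homo.
Qed.

End uniform_variable.

Lemma uniform_partition d (T : measurableType d) (R : realType) (P0 : probability T R)
    (A : set T) (U : T -> R) m : measurable A -> measurable_fun setT U ->
  (forall t, 0 <= t -> (t%:E <= P0 A)%E -> P0 (A `&` [set x | U x <= t]) = t%:E) ->
  exists B : 'I_m.+1 -> set T, [/\ forall i, measurable (B i),
    trivIset [set: 'I_m.+1] B, \bigcup_i B i = A,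
    forall i, fine (P0 (B i)) = fine (P0 A) / m.+1%:R &
    forall i x, B i x -> (i != 0%N :> nat -> fine (P0 A) * i%:R / m.+1%:R < U x) /\
                         (i != m :> nat -> U x <= fine (P0 A) * i.+1%:R / m.+1%:R)].
Proof.
move=> mA mU UP.
have PAf : P0 A \is a fin_num by rewrite fin_num_measure.
pose a := fine (P0 A); have a0 : 0 <= a by exact: fine_ge0.
have aE : P0 A = a%:E by rewrite /a fineK.
pose tt (i : nat) := a * i%:R / m.+1%:R.
have tt0 i : 0 <= tt i by rewrite /tt !mulr_ge0.
have ttm : {homo tt : i j / (i <= j)%N >-> i <= j}.
  by move=> i j ij; rewrite /tt ler_wpM2r ?invr_ge0// ler_wpM2l// ler_nat.
have tt1 : tt m.+1 = a by rewrite /tt mulfK// pnatr_eq0.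
pose G i := A `&` [set x | U x <= tt i].
have mG i : measurable (G i).
  apply: measurableI => //; rewrite -[X in measurable X]setTI.
  rewrite (_ : [set x | _] = U @^-1` [set` `]-oo, tt i]]); first exact: mU.
  by apply/seteqP; split => x /=; rewrite in_itv.
have PG i : (i <= m.+1)%N -> P0 (G i) = (tt i)%:E.
  by move=> im; apply: UP => //; rewrite aE lee_fin -tt1 ttm.
(* The ends are set to the empty set and to [A], because the law fixes the events [U <= 0] and
   [U <= P0(A)] only up to null sets. For the same reason the first piece has no lower bound on [U]
   and the last no upper bound. *)
pose H i : set T := if i == 0%N then set0 else if i == m.+1 then A else G i.
have mH i : measurable (H i).
  by rewrite /H; case: ifP => // _; case: ifP.
have Hm i j : (i <= j)%N -> (j <= m.+1)%N -> H i `<=` H j.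
  move=> ij jm; rewrite /H; case: (eqVneq i 0%N) => [_|i0]; first exact: sub0set.
  have j0 : j != 0%N by rewrite -lt0n (leq_trans _ ij)// lt0n.
  rewrite (negbTE j0); case: (eqVneq j m.+1) => [_|jm'] /=.
    by case: (i == m.+1) => //= x [].
  have im' : i != m.+1 by rewrite ltn_eqF// (leq_ltn_trans ij)// ltn_neqAle jm'.
  by rewrite (negbTE im') => x [Ax /= h]; split => //=; apply: le_trans h (ttm _ _ ij).
have PH i : (i <= m.+1)%N -> P0 (H i) = (tt i)%:E.
  move=> im; rewrite /H; case: eqVneq => [->|_]; first by rewrite measure0 /tt mulr0 mul0r.
  by case: eqVneq => [->|_]; rewrite ?tt1// PG.
exists (fun i : 'I_m.+1 => H i.+1 `\` H i); split.
- by move=> i; exact: measurableD.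
- move=> i j _ _ [x [[Hi1 Hi] [Hj1 Hj]]]; apply/val_inj.
  case: (ltngtP (val i) (val j)) => // h; exfalso.
    by apply: Hj; apply: (Hm i.+1) => //; exact: ltnW.
  by apply: Hi; apply: (Hm j.+1) => //; exact: ltnW.
- apply/seteqP; split => [x [i _ [Hx _]]|x Ax].
    have := Hm i.+1 m.+1 (ltn_ord i) (leqnn _) x Hx; by rewrite /H eqxx.
  have ex : exists i, `[< H i x >].
    by exists m.+1; apply/asboolP; rewrite /H eqxx.
  case: (ex_minnP ex) => i /asboolP Hi mini.
  have i0 : (0 < i)%N by rewrite lt0n; apply/eqP => i0; move: Hi; rewrite /H i0.
  have im : (i <= m.+1)%N.
    by apply: mini; apply/asboolP; rewrite /H eqxx.
  have im1 : (i.-1 < m.+1)%N by rewrite prednK.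
  exists (Ordinal im1) => //=; rewrite prednK//; split => // Hi1.
  have /mini : `[< H i.-1 x >] by apply/asboolP.
  by rewrite leqNgt ltn_predL i0.
- move=> i /=; rewrite measureD//; last by rewrite ltey_eq fin_num_measure.
rewrite setIidr; last by apply: Hm => //; exact: ltn_ord.
have e1 : P0 (H i.+1) = (tt i.+1)%:E := PH i.+1 (ltn_ord i).
have e2 : P0 (H i) = (tt i)%:E := PH i (ltnW (ltn_ord i)).
transitivity (fine ((tt i.+1)%:E - (tt i)%:E)%E).
  by congr (fine (_ - _)%E); [exact: e1|exact: e2].
by rewrite /= /tt -/a -mulrBl -mulrBr -natrB// subSnn mulr1.
move=> i x [Hi1 Hi]; split => [i0|im].
  rewrite ltNge; apply/negP => h; apply: Hi; rewrite /H (negbTE i0).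
  rewrite ltn_eqF//; split => //.
  by move: Hi1; rewrite /H /=; case: ifP => // _ [].
move: Hi1; rewrite /H /= eqSS (negbTE im) => -[_ h]; exact: h.
Qed.

Section equal_partition.
Context (R : realType) (X : pmetricType R) (P0 : probability (borel X) R).
Hypotheses (sepX : separable_space X) (P0na : nonatomic P0).

Lemma uniform_exists (A : set (borel X)) : measurable A ->
  exists2 U : borel X -> R, measurable_fun setT U &
  forall t, 0 <= t -> (t%:E <= P0 A)%E -> P0 (A `&` [set x | U x <= t]) = t%:E.
Proof.
move=> mA; have [h [mh hinj hb]] := separating_function sepX.
have h0 y : P0 (h @^-1` [set y]) = 0%E.
  have [[x hx]|nx] := pselect (exists x, h x = y).
    rewrite (_ : _ @^-1` _ = [set x]) ?nonatomic_set1//.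
    by apply/seteqP; split => [z /= hz|z /= ->//]; apply: hinj; rewrite hz hx.
  rewrite (_ : _ @^-1` _ = set0) ?measure0//; apply/seteqP; split => // z /= hz.
  by apply: nx; exists z.
exists (uniform_on P0 h A); first exact: measurable_uniform_on.
by move=> t t0 tA; apply: uniform_on_law.
Qed.

Lemma equal_partition (A : set (borel X)) m : measurable A ->
  exists B : 'I_m.+1 -> set (borel X), [/\ forall i, measurable (B i),
    trivIset [set: 'I_m.+1] B, \bigcup_i B i = A &
    forall i, fine (P0 (B i)) = fine (P0 A) / m.+1%:R].
Proof.
move=> mA; have [U mU UP] := uniform_exists mA.
by have [B [h1 h2 h3 h4 _]] := uniform_partition m mA mU UP; exists B.
Qed.

End equal_partition.

Section factorization.
Context (R : realType) (X : pmetricType R) (P0 : probability (borel X) R)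
  d (Omega : measurableType d) (P : probability Omega R) (c : R)
  (mu1 mu2 : R.-ker Omega ~> borel X).
Hypotheses (c_gt0 : 0 < c) (gamma1 : gamma_crm P c P0 mu1)
  (gamma2 : gamma_crm P c P0 mu2)
  (canon12 : in_canonical_correlation P c P0 mu1 mu2).
Hypotheses (sepX : separable_space X) (P0na : nonatomic P0).
Context (kap : set (borel X) -> nat -> R).
Hypotheses (kapE : forall A, measurable A -> (0 < P0 A)%E ->
    logderiv (kap A) (crm_coef P0 P c mu1 mu2 A))
  (kap_add : forall m (A : 'I_m -> set (borel X)) l,
    (forall i, measurable (A i)) -> trivIset [set: 'I_m] A ->
    \sum_i kap (A i) l = kap (\bigcup_i A i) l).

Lemma canonical_coef_split (J : finType) (B : set (borel X)) (A : J -> set (borel X)) N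
    (n : {ffun J -> nat}) :
  measurable B -> (0 < P0 B)%E -> (forall j, measurable (A j)) ->
  (forall j, (0 < P0 (A j))%E) -> trivIset [set: J] A -> (forall j, B `&` A j = set0) ->
  \int[P]_t ((ell (shape P0 c B) N (fmass mu1 B t) * ell (shape P0 c B) N (fmass mu2 B t)) *
    (ell_prod (fun j => shape P0 c (A j)) (fun j => fmass mu1 (A j)) n t *
     ell_prod (fun j => shape P0 c (A j)) (fun j => fmass mu2 (A j)) n t)) =
  crm_coef P0 P c mu1 mu2 B N *
  canonical_coef P (fun j => shape P0 c (A j)) (fun j => fmass mu1 (A j)) (fun j => fmass mu2 (A j)) n.
Proof.
move=> mB B0 mA A0 tA BA.
pose Bp m := sval (cid (equal_partition sepX P0na m mB)).
have hBp m : [/\ forall i, measurable (Bp m i), trivIset [set: 'I_m.+1] (Bp m),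
    \bigcup_i Bp m i = B & forall i, fine (P0 (Bp m i)) = fine (P0 B) / m.+1%:R].
  exact: svalP (cid (equal_partition sepX P0na m mB)).
have Bp0 m i : (0 < P0 (Bp m i))%E.
  have [mBp _ _ PBp] := hBp m.
  rewrite -(fineK (fin_num_measure P0 _ (mBp i))) lte_fin PBp divr_gt0// fine_gt0// B0/=.
  by rewrite ltey_eq fin_num_measure.
have shp m i : shape P0 c (Bp m i) = shape P0 c B / m.+1%:R.
  by have [_ _ _ PBp] := hBp m; rewrite /shape PBp mulrA.
apply: (@split_factor _ _ _ P J (fun j => shape P0 c (A j)) (fun j => fmass mu1 (A j))
   (fun j => fmass mu2 (A j)) (shape P0 c B) (fmass mu1 B) (fmass mu2 B)
   (fun m i => fmass mu1 (Bp m i)) (fun m i => fmass mu2 (Bp m i))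
   (fun m i => kap (Bp m i)) (kap B)).
- exact: shape_gt0.
- by move=> j; exact: shape_gt0.
- move=> m; have [mBp tBp UBp PBp] := hBp m.
  pose F (s : 'I_m.+1 + J) := match s with inl i => Bp m i | inr j => A j end.
  have mF s : measurable (F s) by case: s.
  have F0 s : (0 < P0 (F s))%E by case: s => //; exact: Bp0.
  have tF : trivIset [set: 'I_m.+1 + J] F.
    have sub i : Bp m i `<=` B by rewrite -UBp; exact: bigcup_sup.
    move=> [i|j] [i'|j'] _ _ /= [x [h1 h2]].
    - by congr inl; apply: tBp => //; exists x.
    - by exfalso; have h3 : (B `&` A j') x := conj (sub i _ h1) h2; rewrite BA in h3.
    - by exfalso; have h3 : (B `&` A j) x := conj (sub i' _ h2) h1; rewrite BA in h3.
    - by congr inr; apply: tA => //; exists x.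
  have := canonical_pair_crm c_gt0 gamma1 gamma2 canon12 mF F0 tF.
  by congr canonical_pair; apply/funext => -[i|j] //=; rewrite shp.
- by move=> m t; have [mBp tBp UBp _] := hBp m; rewrite -fmass_bigsetU// UBp.
- by move=> m t; have [mBp tBp UBp _] := hBp m; rewrite -fmass_bigsetU// UBp.
- move=> m i; have [mBp _ _ _] := hBp m; rewrite -(shp m i).
  exact: kapE.
- by move=> m l; have [mBp tBp UBp _] := hBp m; rewrite kap_add// UBp.
- exact: kapE.
Qed.

(** Induction on the number of sets: one set is split off by [canonical_coef_split], where it is the
    set that gets refined. *)
Lemma canonical_coef_factor (I : finType) (A : I -> set (borel X)) (n : {ffun I -> nat}) :
  (forall i, measurable (A i)) -> (forall i, (0 < P0 (A i))%E) -> trivIset [set: I] A ->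
  canonical_coef P (fun i => shape P0 c (A i))
    (fun i => fmass mu1 (A i)) (fun i => fmass mu2 (A i)) n =
    \prod_i crm_coef P0 P c mu1 mu2 (A i) (n i).
Proof.
move: {2}#|I| (erefl #|I|) => k; elim: k I A n => [|k IH] I A n Ik mA A0 tA.
  have no (i : I) : False by have := card0_eq Ik i; rewrite inE.
  rewrite big1 => [|i]; last by have := no i.
  rewrite /canonical_coef (eq_Ex _ (g := fun=> 1)) ?Ex_cst// => t.
  by rewrite /ell_prod !big1 ?mulr1// => i; have := no i.
have [i0 _] : exists i0 : I, true.
  have : (0 < #|I|)%N by rewrite Ik.
  by case/card_gt0P => i _; exists i.
pose J := {j : I | j != i0}.
have cJ : #|{: J}| = k.
  have := cardC1 i0; rewrite Ik /= => e; rewrite -e card_sig.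
  by apply: eq_card => j; rewrite !inE.
have prodJ (F : I -> R) : \prod_i F i = F i0 * \prod_(j : J) F (val j).
  rewrite (bigD1 i0)//=; congr (_ * _).
  rewrite -big_filter (perm_big (map val (index_enum J))) ?big_map//.
  apply: uniq_perm; [by rewrite filter_uniq// index_enum_uniq|by rewrite map_inj_uniq ?index_enum_uniq//; exact: val_inj|].
  move=> i; rewrite mem_filter mem_index_enum andbT; apply/idP/mapP => [ii0|[j _ ->]].
    by exists (exist _ i ii0).
  exact: (valP j).
pose nJ : {ffun J -> nat} := [ffun j => n (val j)].
transitivity (\int[P]_t ((ell (shape P0 c (A i0)) (n i0) (fmass mu1 (A i0) t) *
     ell (shape P0 c (A i0)) (n i0) (fmass mu2 (A i0) t)) *
    (ell_prod (fun j : J => shape P0 c (A (val j))) (fun j => fmass mu1 (A (val j))) nJ t *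
     ell_prod (fun j : J => shape P0 c (A (val j))) (fun j => fmass mu2 (A (val j))) nJ t))).
  apply: eq_Ex => t; rewrite /ell_prod !prodJ mulrACA; congr (_ * (_ * _));
  by apply: eq_bigr => j _; rewrite ffunE.
have tJ : trivIset [set: J] (fun j => A (val j)).
  by move=> i j _ _ h; apply/val_inj; exact: tA.
rewrite canonical_coef_split//; last first.
  move=> j; apply: contrapT => /eqP/set0P h; have := tA i0 (val j) Logic.I Logic.I h.
  by move=> e; have := valP j; rewrite -e eqxx.
rewrite prodJ IH//; congr (_ * _); by apply: eq_bigr => j _; rewrite ffunE.
Qed.

End factorization.

Section independent_increments_of_coef.
Context (R : realType) (X : pmetricType R) (P0 : probability (borel X) R)
  d (Omega : measurableType d) (P : probability Omega R) (c : R)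
  (mu1 mu2 : R.-ker Omega ~> borel X).
Hypotheses (c_gt0 : 0 < c) (gamma1 : gamma_crm P c P0 mu1)
  (gamma2 : gamma_crm P c P0 mu2).

Let c0 : 0 <= c. Proof. exact: ltW. Qed.

Lemma Ex_indic (S : set Omega) : measurable S -> (\int[P]_t (\1_S t : R))%:E = P S.
Proof.
move=> mS; rewrite EFin_Ex; first by rewrite integral_indic// setIT.
by have := @finite_moments_indic _ _ _ P _ _ id S (@measurable_id _ _ _) mS.
Qed.

Lemma ae_eq_measure (S S' : set Omega) : measurable S -> measurable S' ->
  {ae P, forall w, S w <-> S' w} -> P S = P S'.
Proof.
move=> mS mS' h; rewrite -!Ex_indic//; congr EFin; apply: ae_eq_Ex => //.
  by apply: filterS h => w [h1 h2]; rewrite !indicE; congr ((nat_of_bool _)%:R);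
    apply/idP/idP; rewrite !inE.
Qed.

(** Two reductions: the extended real values agree almost surely with the finite values [fmass], and
    over sets of [P0]-measure zero both increments vanish almost surely, which leaves the sets of
    positive measure. *)
Lemma independent_increments_of_coef :
  (forall (I : finType) (A : I -> set (borel X)), (forall i, measurable (A i)) ->
     (forall i, (0 < P0 (A i))%E) -> trivIset [set: I] A ->
     forall B : I -> set (R * R), (forall i, measurable (B i)) ->
     \int[P]_w (\prod_i \1_(B i) (fmass mu1 (A i) w, fmass mu2 (A i) w)) =
     \prod_i \int[P]_w \1_(B i) (fmass mu1 (A i) w, fmass mu2 (A i) w)) ->
  independent_increments P mu1 mu2.
Proof.
move=> hind k A mA tA B mB.
pose C i : set (R * R) := (fun z : R * R => (z.1%:E, z.2%:E)) @^-1` B i.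
have mC i : measurable (C i).
  rewrite -[C i]setTI; have : measurable_fun setT (fun z : R * R => (z.1%:E, z.2%:E)).
    by apply: measurable_fun_pair; apply/measurable_EFinP.
  by apply.
pose Y i w := (fmass mu1 (A i) w, fmass mu2 (A i) w).
have mY i : measurable_fun setT (Y i) by apply: measurable_fun_pair; exact: measurable_fmass.
have mX i : measurable_fun setT (fun w => (mu1 w (A i), mu2 w (A i))).
  by apply: measurable_fun_pair; exact: measurable_kernel.
have XY : {ae P, forall w, forall i, (mu1 w (A i), mu2 w (A i)) = ((Y i w).1%:E, (Y i w).2%:E)}.
  apply: filter_forall => i; apply: filterS2 (crm_fmass_ae c0 gamma1 (mA i)) (crm_fmass_ae c0 gamma2 (mA i)).
  by move=> w -> ->.
have mXB i : measurable ((fun w => (mu1 w (A i), mu2 w (A i))) @^-1` B i).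
  by rewrite -[_ @^-1` _]setTI; exact: mX.
have mYC i : measurable (Y i @^-1` C i) by rewrite -[_ @^-1` _]setTI; exact: mY.
have PX i : P ((fun w => (mu1 w (A i), mu2 w (A i))) @^-1` B i) = (\int[P]_w (\1_(C i) (Y i w) : R))%:E.
  rewrite (@ae_eq_measure _ (Y i @^-1` C i))//; last first.
    by apply: filterS XY => w h /=; rewrite h.
  by rewrite -Ex_indic.
have fI i : finite_moments P (fun w => \1_(C i) (Y i w) : R) by exact: finite_moments_indic.
have mbig (D : 'I_k -> set Omega) : (forall i, measurable (D i)) -> measurable (\bigcap_(i in [set: 'I_k]) D i).
  by move=> mD; apply: fin_bigcap_measurable => //; exact: finite_finset.
have -> : P (\bigcap_(i in [set: 'I_k]) ((fun w => (mu1 w (A i), mu2 w (A i))) @^-1` B i)) =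
    P (\bigcap_(i in [set: 'I_k]) (Y i @^-1` C i)).
  apply: ae_eq_measure; [exact: mbig|exact: mbig|].
  by apply: filterS XY => w h; split => hw i _; have := hw i Logic.I => /=; rewrite h.
transitivity (\prod_(i < k) (\int[P]_w (\1_(C i) (Y i w) : R))%:E)%E; last first.
  by apply: eq_bigr => i _; rewrite PX.
rewrite prodEFin -Ex_indic; last exact: mbig.
congr EFin.
transitivity (\int[P]_w (\prod_i (\1_(C i) (Y i w) : R))).
  apply: eq_Ex => w; rewrite indicE; have [h|h] := boolP (w \in _).
    rewrite big1// => i _; rewrite indicE mem_set//.
    by move: h; rewrite inE => /(_ i Logic.I).
  have [i hi] : exists i, ~ C i (Y i w).
    apply: contrapT => h'; move/negP: h; apply; rewrite inE => i _.
    by apply: contrapT => h2; apply: h'; exists i.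
  by rewrite (bigD1 i)//= indicE memNset// mul0r.
pose J := {i : 'I_k | (0 < P0 (A i))%E}.
have tJ : trivIset [set: J] (fun j => A (val j)).
  by move=> i j _ _ h; apply/val_inj; exact: tA.
have hJ := hind _ (fun j : J => A (val j)) (fun j => mA _) (fun j => valP j) tJ _ (fun j => mC (val j)).
have null i : ~~ (0 < P0 (A i))%E -> {ae P, forall w, Y i w = (0, 0)}.
  rewrite -leNgt => h; have e : P0 (A i) = 0%E by apply/eqP; rewrite eq_le h measure_ge0.
  apply: filterS2 (crm_null c0 gamma1 (mA i) e) (crm_null c0 gamma2 (mA i) e) => w h1 h2.
  by rewrite /Y /fmass h1 h2 /=; do 2 case: ifP.
pose e i : R := \1_(C i) (0, 0).
have split_prod (F : 'I_k -> R) : \prod_i F i =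
    \prod_(j : J) F (val j) * \prod_(i | ~~ (0 < P0 (A i))%E) F i.
  rewrite (bigID (fun i => (0 < P0 (A i))%E))/=; congr (_ * _).
  rewrite -big_filter (perm_big (map val (index_enum J))) ?big_map//.
  apply: uniq_perm; [by rewrite filter_uniq// index_enum_uniq|by rewrite map_inj_uniq ?index_enum_uniq//; exact: val_inj|].
  move=> i; rewrite mem_filter mem_index_enum andbT; apply/idP/mapP => [ii0|[j _ ->]].
    by exists (exist _ i ii0).
  exact: (valP j).
have en i : ~~ (0 < P0 (A i))%E -> \int[P]_w (\1_(C i) (Y i w) : R) = e i.
  move=> h; rewrite -[RHS](Ex_cst P); apply: ae_eq_Ex => //; first exact: (fI i).1.
  by apply: filterS (null i h) => w ->.
rewrite [RHS]split_prod -hJ.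
transitivity (\int[P]_w ((\prod_(i | ~~ (0 < P0 (A i))%E) e i) * \prod_(j : J) (\1_(C (val j)) (Y (val j) w) : R))).
  apply: ae_eq_Ex.
  - have [] // : finite_moments P (fun w => \prod_i (\1_(C i) (Y i w) : R)).
    exact: finite_moments_prod.
  - have [] // : finite_moments P (fun w => (\prod_(i | ~~ (0 < P0 (A i))%E) e i) * \prod_(j : J) (\1_(C (val j)) (Y (val j) w) : R)).
    by apply: finite_momentsZ; apply: finite_moments_prod.
  have h : {ae P, forall w, forall i, ~~ (0 < P0 (A i))%E -> Y i w = (0, 0)}.
    apply: filter_forall => i; have [h|h] := boolP (0 < P0 (A i))%E.
      by apply: nearW => w.
    by apply: filterS (null i h) => w ->.
  apply: filterS h => w h; rewrite split_prod mulrC; congr (_ * _).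
  by apply: eq_bigr => i hi; rewrite h.
rewrite ExZ; last exact: finite_moments_prod.
rewrite mulrC; congr (_ * _); apply: eq_bigr => i hi; by rewrite en.
Qed.

End independent_increments_of_coef.

(** * Moments of Dirichlet means *)

Section power_bconv.
Context (R : realType) (K : finType).

Lemma logderiv_expr (x : R) :
  logderiv (fun l => (l == 1)%N%:R * x) (fun n => x ^+ n / n`!%:R).
Proof.
move=> [|n]; first by rewrite big_ord0 mul0r.
rewrite big_ord_recl big1 => [|l _]; last by rewrite mul0r mul0r.
rewrite /= mul1r addr0 subSS subn0 exprS factS natrM.
by field; apply/andP; split; rewrite ?fact_neq0// addrC natr1 pnatr_eq0.
Qed.

Lemma expr_bconv (x : K -> R) N :
  (\sum_i x i) ^+ N / N`!%:R = bconv (fun i k => x i ^+ k / k`!%:R) N.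
Proof.
apply: (@logderiv_uniq _ (fun l => (l == 1)%N%:R * \sum_i x i)
  (fun n => (\sum_i x i) ^+ n / n`!%:R)).
- rewrite bconv0 [RHS]big1; last by move=> i _; rewrite expr0 fact0 divr1.
  by rewrite expr0 fact0 divr1.
- exact: logderiv_expr.
- apply: eq_logderiv (logderiv_bconv (fun i => logderiv_expr (x i))) => l _.
  by rewrite mulr_sumr.
Qed.

End power_bconv.

Lemma expRN_le1 (R : realType) (x : R) : 0 <= x -> expR (- x) <= 1.
Proof. by move=> x0; rewrite -[leRHS]expR0 ler_expR lerNl oppr0. Qed.

Lemma measurable_invr_norm (R : realType) : measurable_fun setT (fun x : R => `|x|^-1).
Proof.
rewrite (_ : (fun _ => _) = (@powR R ^~ (-1)) \o Num.norm).
  by apply: measurableT_comp; [exact: measurable_powR|exact: normr_measurable].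
by apply/funext => x /=; rewrite powR_inv1.
Qed.

(** * Linear functionals of a gamma random measure *)

Section crm_functional.
Context (R : realType) (Y : pmetricType R) (G : probability (borel Y) R)
  d (T : measurableType d) (P : probability T R) (a : R)
  (mu : R.-ker T ~> borel Y).
Hypotheses (a0 : 0 < a) (gmu : gamma_crm P a G mu).

Let a0' : 0 <= a. Proof. exact: ltW. Qed.

(** As for [fmass], the value [0] at infinite total mass makes this additive on bounded measurable
    functions for every [w]. *)
Definition fint (f : borel Y -> R) (w : T) : R :=
  if (mu w [set: borel Y] < +oo)%E then \int[mu w]_x f x else 0.

Definition bounded_mfun (f : borel Y -> R) :=
  measurable_fun setT f /\ exists C, forall x, 0 <= f x <= C.

Lemma bounded_mfun_integrable (f : borel Y -> R) w : bounded_mfun f ->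
  (mu w [set: borel Y] < +oo)%E -> (mu w).-integrable setT (EFin \o f).
Proof.
move=> [mf [C fC]] fin; apply: (@integrable_dominated _ _ _ _ _ (fun=> C)) => //.
  by move=> x; have /andP[f0 fc] := fC x; rewrite ger0_norm.
apply/integrableP; split; first exact: measurable_cst.
by rewrite integral_cst// lte_mul_pinfty// ?lee_fin.
Qed.

Lemma fintE (f : borel Y -> R) w : bounded_mfun f -> (mu w [set: borel Y] < +oo)%E ->
  (\int[mu w]_x (f x)%:E)%E = (fint f w)%:E.
Proof.
move=> bf fin; rewrite /fint fin /Rintegral fineK//.
exact: integrable_fin_num (bounded_mfun_integrable bf fin).
Qed.

Lemma fint_ge0 f w : (forall x, 0 <= f x) -> 0 <= fint f w.
Proof. by move=> f0; rewrite /fint; case: ifP => // _; apply: Rintegral_ge0. Qed.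

Lemma le_fint f g w : bounded_mfun f -> bounded_mfun g -> (forall x, f x <= g x) ->
  fint f w <= fint g w.
Proof.
move=> bf bg fg; rewrite /fint; case: ifPn => // fin.
by apply: le_Rintegral => //; exact: bounded_mfun_integrable.
Qed.

Lemma bounded_mfun_cst C : 0 <= C -> bounded_mfun (fun=> C).
Proof. by move=> C0; split; [exact: measurable_cst|exists C => x; rewrite C0/=]. Qed.

Lemma bounded_mfunD f g : bounded_mfun f -> bounded_mfun g -> bounded_mfun (fun x => f x + g x).
Proof.
move=> [mf [C fC]] [mg [D gD]]; split; first exact: measurable_funD.
exists (C + D) => x; have /andP[f0 f1] := fC x; have /andP[g0 g1] := gD x.
by rewrite addr_ge0//= lerD.
Qed.

Lemma bounded_mfunZ t f : 0 <= t -> bounded_mfun f -> bounded_mfun (fun x => t * f x).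
Proof.
move=> t0 [mf [C fC]]; split; first exact: measurable_funM.
exists (t * C) => x; have /andP[f0 f1] := fC x.
by rewrite mulr_ge0//= ler_wpM2l.
Qed.

Lemma bounded_mfun_indic A : measurable A -> bounded_mfun \1_A.
Proof.
move=> mA; split; first exact: measurable_indic.
by exists 1 => x; rewrite indicE ler0n lern1 leq_b1.
Qed.

Lemma fintD f g w : bounded_mfun f -> bounded_mfun g ->
  fint (fun x => f x + g x) w = fint f w + fint g w.
Proof.
move=> bf bg; rewrite /fint; case: ifPn => [fin|_]; last by rewrite addr0.
by rewrite RintegralD//; exact: bounded_mfun_integrable.
Qed.

Lemma fintZ t f w : bounded_mfun f -> fint (fun x => t * f x) w = t * fint f w.
Proof.
move=> bf; rewrite /fint; case: ifPn => [fin|_]; last by rewrite mulr0.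
by rewrite RintegralZl//; exact: bounded_mfun_integrable.
Qed.

Lemma fint_indic A w : measurable A -> fint \1_A w = fmass mu A w.
Proof.
move=> mA; rewrite /fint /fmass; case: ifPn => // fin.
by rewrite /Rintegral integral_indic// setIT.
Qed.

Lemma bounded_mfun_sum (I : Type) (s : seq I) (F : I -> borel Y -> R) :
  (forall i, bounded_mfun (F i)) -> bounded_mfun (fun x => \sum_(i <- s) F i x).
Proof.
move=> bF; elim: s => [|i s IH].
  by under eq_fun do rewrite big_nil; exact: bounded_mfun_cst.
by under eq_fun do rewrite big_cons; exact: bounded_mfunD.
Qed.

Lemma fint_sum (I : Type) (s : seq I) (F : I -> borel Y -> R) w :
  (forall i, bounded_mfun (F i)) ->
  fint (fun x => \sum_(i <- s) F i x) w = \sum_(i <- s) fint (F i) w.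
Proof.
move=> bF; elim: s => [|i s IH].
  rewrite big_nil; under eq_fun do rewrite big_nil.
  by rewrite -[fun=> 0]/(fun x : borel Y => 0 : R) /fint; case: ifP => // _; rewrite Rintegral_cst// mul0r.
rewrite big_cons -IH -fintD//; last exact: bounded_mfun_sum.
by congr fint; apply/funext => x; rewrite big_cons.
Qed.

Lemma measurable_fint f : bounded_mfun f -> measurable_fun setT (fint f).
Proof.
move=> [mf [C fC]]; apply: measurable_fun_ifT.
- apply: (measurable_fun_lte (f := fun w => mu w setT) (g := fun=> +oo%E)) => //.
  exact: measurable_kernel.
- apply: measurableT_comp => //.
  apply: (@measurable_fun_integral_kernel _ _ _ _ _ (fun w => mu w) _ (fun x => (f x)%:E)).
  + by move=> U mU; exact: measurable_kernel.
  + by move=> x; rewrite lee_fin; have /andP[] := fC x.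
  + exact/measurable_EFinP.
- exact: measurable_cst.
Qed.

Lemma fint_le_mass f C w : bounded_mfun f -> 0 <= C -> (forall x, f x <= C) ->
  fint f w <= C * fmass mu setT w.
Proof.
move=> bf C0 fC; rewrite -fint_indic// -fintZ; last exact: bounded_mfun_indic.
apply: le_fint => //; first by apply: bounded_mfunZ => //; exact: bounded_mfun_indic.
by move=> x; rewrite indicE mem_setT mulr1.
Qed.

Lemma fint_finite_moments f : bounded_mfun f -> finite_moments P (fint f).
Proof.
move=> bf; have [mf [C fC]] := bf.
have C0 : 0 <= C by have /andP[] := fC point; exact: le_trans.
apply: (@finite_moments_le _ _ _ P _ (fun w => C * fmass mu setT w)).
- exact: measurable_fint.
- move=> w; rewrite ger0_norm; last by apply: fint_ge0 => x; have /andP[] := fC x.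
  by apply: fint_le_mass => // x; have /andP[] := fC x.
- by apply: finite_momentsZ; exact: (crm_fmass_finite_moments a0' gmu).
Qed.

Lemma fint_laplace f : bounded_mfun f ->
  \int[P]_w expR (- fint f w) = expR (- (a * \int[G]_x ln (1 + f x))).
Proof.
move=> bf; have [mf [C fC]] := bf.
have f0 x : 0 <= f x by have /andP[] := fC x.
have ml : measurable_fun setT (fun x => ln (1 + f x)).
  by apply: measurableT_comp => //; exact: measurable_funD.
have il : G.-integrable setT (EFin \o (fun x => ln (1 + f x))).
  apply: (@integrable_dominated _ _ _ _ _ (fun=> ln (1 + C))) => //.
    move=> x; rewrite ger0_norm ?ln_ge0 ?lerDl//.
    by rewrite ler_ln ?posrE ?lerD2l ?ltr_pwDl//; have /andP[h1 h2] := fC x; rewrite ?(le_trans h1).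
  exact: finite_measure_integrable_cst.
have lE : (\int[G]_x (ln (1 + f x))%:E)%E = (\int[G]_x ln (1 + f x))%:E.
  by rewrite /Rintegral fineK//; exact: integrable_fin_num il.
have [_ /(_ f mf f0)] := gmu; rewrite lE => /(_ (ltry _)).
rewrite -EFinM -EFinN /= => h.
have me : measurable_fun setT (fun w => expR (- fint f w)).
  by apply: measurableT_comp => //; apply: measurableT_comp => //; exact: measurable_fint.
apply: EFin_inj; rewrite -h.
have fm : finite_moments P (fun w => expR (- fint f w)).
  apply: (@finite_moments_le _ _ _ P _ (fun=> 1)) => //; last exact: finite_moments_cst.
  by move=> w; rewrite ger0_norm ?expR_ge0// -expR0 ler_expR lerNl oppr0 fint_ge0.
rewrite EFin_Ex//.
have mi : measurable_fun setT (fun w => (\int[mu w]_x (f x)%:E)%E).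
  apply: (@measurable_fun_integral_kernel _ _ _ _ _ (fun w => mu w) _ (fun x => (f x)%:E)).
  - by move=> U mU; exact: measurable_kernel.
  - by move=> x; rewrite lee_fin.
  - exact/measurable_EFinP.
apply: ae_eq_integral => //.
- exact/measurable_EFinP.
- by apply: measurable_expeRN => // w; apply: integral_ge0 => x _; rewrite lee_fin.
apply: filterS (crm_finite_ae a0' gmu (measurableT : measurable [set: borel Y])) => w fin _.
by rewrite fintE.
Qed.

Section ratio.
Context (f : borel Y -> R).
Hypotheses (mf : measurable_fun setT f) (f01 : forall x, 0 <= f x <= 1).
Let K := fint f.
Let M := fmass mu setT.
Let bf : bounded_mfun f. Proof. by split => //; exists 1. Qed.
Let f0 x : 0 <= f x. Proof. by have /andP[] := f01 x. Qed.
Let K0 w : 0 <= K w. Proof. exact: fint_ge0. Qed.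
Let M0 w : 0 <= M w. Proof. exact: fmass_ge0. Qed.
Let mK : measurable_fun setT K. Proof. exact: measurable_fint. Qed.
Let mM : measurable_fun setT M. Proof. exact: measurable_fmass. Qed.
Let KM w : K w <= M w.
Proof. by rewrite -[M w]mul1r; apply: fint_le_mass => // x; have /andP[] := f01 x. Qed.
Let fmK : finite_moments P K. Proof. exact: fint_finite_moments. Qed.
Let fmM : finite_moments P M. Proof. exact: (crm_fmass_finite_moments a0' gmu). Qed.

Let f0' t x : 0 <= t -> 0 < 1 + t * f x.
Proof. by move=> t0; rewrite ltr_pwDl// mulr_ge0. Qed.

Let iln t : 0 <= t -> G.-integrable setT (EFin \o (fun x => ln (1 + t * f x))).
Proof.
move=> t0; apply: (@integrable_dominated _ _ _ _ _ (fun=> ln (1 + t))).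
- by apply: measurableT_comp => //; apply: measurable_funD => //; exact: measurable_funM.
- move=> x; have h : 0 <= t * f x by rewrite mulr_ge0.
  rewrite ger0_norm; last by rewrite ln_ge0// lerDl.
  rewrite ler_ln ?posrE ?f0' ?ltr_pwDl// lerD2l ler_piMr//.
  by have /andP[] := f01 x.
- exact: finite_measure_integrable_cst.
Qed.

(* [1 + u + t f = (1 + u) (1 + t f / (1 + u))]: tilting by [exp (- u M)] only rescales [K], which
   is the independence of [K / M] and [M]. *)
Lemma fint_joint_laplace u t : 0 <= u -> 0 <= t ->
  \int[P]_w (expR (- (t * K w)) * expR (- (u * M w))) =
  \int[P]_w (expR (- (t * (K w / (1 + u)))) * (1 + u) `^ (- a)).
Proof.
move=> u0 t0; have u1 : 0 < 1 + u by rewrite ltr_pwDl.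
have bI : bounded_mfun \1_[set: borel Y] by exact: bounded_mfun_indic.
have b1 : bounded_mfun (fun x => t * f x + u * \1_[set: borel Y] x).
  by apply: bounded_mfunD; apply: bounded_mfunZ.
have t10 : 0 <= t / (1 + u) by rewrite divr_ge0// ltW.
have b2 : bounded_mfun (fun x => t / (1 + u) * f x) by exact: bounded_mfunZ.
transitivity (\int[P]_w expR (- fint (fun x => t * f x + u * \1_[set: borel Y] x) w)).
  apply: eq_Ex => w; rewrite fintD ?fintZ ?fint_indic//; [|exact: bounded_mfunZ|exact: bounded_mfunZ].
  by rewrite opprD expRD.
rewrite fint_laplace//.
have -> : \int[G]_x ln (1 + (t * f x + u * \1_[set: borel Y] x)) =
    ln (1 + u) + \int[G]_x ln (1 + t / (1 + u) * f x).
  transitivity (\int[G]_x (ln (1 + u) + ln (1 + t / (1 + u) * f x))).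
    apply: eq_Ex => x; rewrite indicE mem_setT mulr1 -lnM ?posrE ?f0'//.
    by congr ln; field; rewrite gt_eqF.
  rewrite RintegralD//; last exact: iln; last exact: finite_measure_integrable_cst.
  by rewrite Ex_cst.
rewrite mulrDr opprD expRD -fint_laplace//.
rewrite -[X in X * _](_ : (1 + u) `^ (- a) = _); last first.
  by rewrite /powR gt_eqF// mulNr.
rewrite mulrC.
have fe : finite_moments P (fun w => expR (- fint (fun x => t / (1 + u) * f x) w)).
  apply: (@finite_moments_le _ _ _ P _ (fun=> 1)); last exact: finite_moments_cst.
    by apply: measurableT_comp => //; apply: measurableT_comp => //; exact: measurable_fint.
  by move=> w; rewrite ger0_norm ?expR_ge0// expRN_le1// fint_ge0// => x; rewrite mulr_ge0.
rewrite mulrC -ExZ//; apply: eq_Ex => w; rewrite fintZ// mulrC; congr (expR (- _) * _).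
by rewrite /K; field; rewrite gt_eqF.
Qed.

Let fe t (V : T -> R) : measurable_fun setT V -> (forall w, 0 <= V w) -> 0 <= t ->
  finite_moments P (fun w => expR (- (t * V w))).
Proof.
move=> mV V0 t0; apply: (@finite_moments_le _ _ _ P _ (fun=> 1)); last exact: finite_moments_cst.
  exact: measurable_expRN.
by move=> w; rewrite ger0_norm ?expR_ge0// expRN_le1// mulr_ge0.
Qed.

(** The joint Laplace transform identifies the law of [K] under the density [exp (- u M)] with
    [(1 + u)^(- a)] times the law of [K / (1 + u)]. *)
Lemma fint_tilted_moment N u : 0 <= u ->
  \int[P]_w (expR (- (u * M w)) * K w ^+ N) =
  \int[P]_w (K w ^+ N) * (1 + u) `^ (- (a + N%:R)).
Proof.
move=> u0; have u1 : 0 < 1 + u by rewrite ltr_pwDl.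
have mK2 : measurable_fun setT (fun w => K w / (1 + u)) by exact: measurable_funM.
have p0 : 0 <= (1 + u) `^ (- a) by exact: powR_ge0.
have K20 w : 0 <= K w / (1 + u) by rewrite divr_ge0// ltW.
have det := @laplace_determinacy _ _ _ _ _ P P K (fun w => K w / (1 + u))
  (fun w => expR (- (u * M w))) (fun=> (1 + u) `^ (- a)) mK mK2
  (finite_moments_integrable (fe mM M0 u0))
  (finite_measure_integrable_cst _ _ measurableT) (fun w => expR_ge0 _) (fun=> p0) K0 K20
  (fun t t0 => fint_joint_laplace u0 t0).
have := @ge0_integral_comp_weight _ _ _ _ _ _ _ P P K (fun w => K w / (1 + u))
  (fun w => expR (- (u * M w))) (fun=> (1 + u) `^ (- a)) mK mK2 (fe mM M0 u0).1
  (measurable_cst _) (fun w => expR_ge0 _) (fun=> p0) det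
  (fun x => (`|x| ^+ N)%:E).
have mN : measurable_fun setT (fun x : R => (`|x| ^+ N)%:E).
  by apply/measurable_EFinP; apply: measurable_funX; exact: normr_measurable.
move=> /(_ mN (fun x => exprn_ge0 _ (normr_ge0 _))) h.
apply: EFin_inj.
have fKN : finite_moments P (fun w => K w ^+ N) by exact: finite_momentsX.
rewrite EFin_Ex; last by apply: finite_momentsM => //; exact: fe.
transitivity (\int[P]_w ((`|K w| ^+ N)%:E * (expR (- (u * M w)))%:E))%E.
  by apply: eq_integral => w _; rewrite -EFinM mulrC ger0_norm.
rewrite h mulrC -ExZ// EFin_Ex; last exact: finite_momentsZ.
apply: eq_integral => w _; rewrite -EFinM ger0_norm// expr_div_n; congr EFin.
rewrite opprD powRD; last by apply/implyP => _; rewrite gt_eqF.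
by rewrite [_ `^ (- N%:R)]powRN (powR_mulrn _ (ltW u1)) mulrC mulrAC -mulrA.
Qed.

Lemma crm_mass_laplace u : 0 <= u -> \int[P]_w expR (- (u * M w)) = (1 + u) `^ (- a).
Proof.
move=> u0; have := fint_tilted_moment 0 u0; rewrite addr0.
have -> : \int[P]_w (K w ^+ 0) = 1 by rewrite -[RHS](Ex_cst P).
by rewrite mul1r => <-; apply: eq_Ex => w; rewrite expr0 mulr1.
Qed.

Lemma crm_mass_gt0 : {ae P, forall w, 0 < M w}.
Proof.
have mS : measurable (M @^-1` [set 0]) by rewrite -[_ @^-1` _]setTI; exact: mM.
exists (M @^-1` [set 0]); split => //; last first.
  by move=> w /= h; apply/eqP; rewrite eq_le M0 andbT leNgt; apply/negP.
rewrite -Ex_indic//; congr EFin; apply/eqP; rewrite eq_le; apply/andP; split; last first.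
  by apply: Ex_ge0 => w; rewrite indicE ler0n.
apply/ler_addgt0Pr => e e0; rewrite add0r.
have ei : 0 < e^-1 by rewrite invr_gt0.
(* Chosen so that [u^a = 1 / e], whence [(1 + u)^(- a) <= e]. *)
pose u := e^-1 `^ a^-1; have u0 : 0 <= u by exact: powR_ge0.
apply: (@le_trans _ _ (\int[P]_w expR (- (u * M w)))).
  apply: le_Ex; [|exact: fe|].
    by have := @finite_moments_indic _ _ _ P _ _ id (M @^-1` [set 0]) (@measurable_id _ _ _) mS.
  move=> w; rewrite indicE; have [h|h] := boolP (w \in _); last by rewrite expR_ge0.
  by move: h; rewrite inE => /= ->; rewrite mulr0 oppr0 expR0.
rewrite crm_mass_laplace// powRN invf_ple ?posrE// ?powR_gt0 ?ltr_pwDl//.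
apply: (@le_trans _ _ (u `^ a)).
  by rewrite /u -powRrM mulVf ?gt_eqF// powRr1// ltW.
by apply: ge0_ler_powR; rewrite ?nnegrE; [exact: ltW|exact: u0|rewrite addr_ge0|rewrite lerDr].
Qed.

(** With [k = E K^N / (a)_N], the weights [K^N] and [k M^N] give the same law of [M], as their
    Laplace transforms agree by [fint_tilted_moment]. Integrating [M^(- N)] against both yields the
    moment of [K / M]. *)
Lemma fint_ratio_moment N :
  \int[P]_w ((K w / M w) ^+ N) * rising a N = \int[P]_w (K w ^+ N).
Proof.
have [->|N0] := eqVneq N 0%N.
  by rewrite rising0 mulr1; apply: eq_Ex => w; rewrite !expr0.
have raN : 0 < rising a N by exact: rising_gt0.
pose k := \int[P]_w (K w ^+ N) / rising a N.
have k0 : 0 <= k by rewrite divr_ge0 ?(ltW raN)//; apply: Ex_ge0 => w; rewrite exprn_ge0.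
have fKN : finite_moments P (fun w => K w ^+ N) by exact: finite_momentsX.
have fMN : finite_moments P (fun w => k * M w ^+ N) by apply: finite_momentsZ; exact: finite_momentsX.
have lapMN s : 0 <= s -> \int[P]_w (M w ^+ N * expR (- (s * M w))) =
    rising a N * (1 + s) `^ (- (a + N%:R)).
  by move=> s0; have [] := @laplace_gamma_moment _ _ _ P M a mM M0 crm_mass_laplace N s s0.
have det := @laplace_determinacy _ _ _ _ _ P P M M
  (fun w => K w ^+ N) (fun w => k * M w ^+ N) mM mM
  (finite_moments_integrable fKN) (finite_moments_integrable fMN)
  (fun w => exprn_ge0 _ (K0 w)) (fun w => mulr_ge0 k0 (exprn_ge0 _ (M0 w))) M0 M0.
have hs s : 0 <= s -> \int[P]_t (expR (- (s * M t)) * K t ^+ N) =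
    \int[P]_t (expR (- (s * M t)) * (k * M t ^+ N)).
  move=> s0; rewrite fint_tilted_moment//.
  transitivity (\int[P]_t (k * (M t ^+ N * expR (- (s * M t))))); last by apply: eq_Ex => t; ring.
  rewrite ExZ; last by apply: finite_momentsM; [exact: finite_momentsX|exact: fe].
  by rewrite lapMN// /k; field; rewrite gt_eqF.
have {}det := det hs.
have := @ge0_integral_comp_weight _ _ _ _ _ _ _ P P M M
  (fun w => K w ^+ N) (fun w => k * M w ^+ N) mM mM fKN.1 fMN.1
  (fun w => exprn_ge0 _ (K0 w)) (fun w => mulr_ge0 k0 (exprn_ge0 _ (M0 w))) det
  (fun x => (`|x|^-1 ^+ N)%:E).
have mV : measurable_fun setT (fun x : R => (`|x|^-1 ^+ N)%:E).
  apply/measurable_EFinP; apply: measurable_funX.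
  exact: measurable_invr_norm.
move=> /(_ mV (fun x => exprn_ge0 _ _)) h.
have fr : finite_moments P (fun w => (K w / M w) ^+ N).
  apply: finite_momentsX; apply: (@finite_moments_le _ _ _ P _ (fun=> 1)); last exact: finite_moments_cst.
    apply: measurable_funM => //; rewrite (_ : (fun _ => _) = (fun x : R => `|x|^-1) \o M).
      by apply: measurableT_comp => //; exact: measurable_invr_norm.
    by apply/funext => w /=; rewrite ger0_norm.
  move=> w; rewrite ger0_norm ?divr_ge0//.
  have [->|m0] := eqVneq (M w) 0; first by rewrite invr0 mulr0.
  by rewrite ler_pdivrMr ?mul1r// lt_neqAle eq_sym m0 M0.
suff -> : \int[P]_w ((K w / M w) ^+ N) = k by rewrite /k divfK// gt_eqF.
apply: EFin_inj; rewrite EFin_Ex//.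
transitivity (\int[P]_w ((`|M w|^-1 ^+ N)%:E * (K w ^+ N)%:E))%E.
  by apply: eq_integral => w _; rewrite -EFinM ger0_norm// -exprMn mulrC.
rewrite h; last by move=> s; rewrite invr_ge0.
rewrite -[RHS](_ : \int[P]_w k%:E = k%:E)%E; last first.
  by rewrite -(EFin_Ex (finite_moments_cst P k)) Ex_cst.
apply: ae_eq_integral => //.
- apply: emeasurable_funM; first exact: measurableT_comp mV mM.
  by apply/measurable_EFinP; exact: fMN.1.
- apply: filterS crm_mass_gt0 => w m0 _; rewrite -EFinM ger0_norm//; congr EFin.
  by rewrite mulrCA -exprMn mulVf ?expr1n ?mulr1// gt_eqF.
Qed.

End ratio.

End crm_functional.

Section fint_moments.
Context (R : realType) (Y : pmetricType R) (G : probability (borel Y) R)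
  d (T : measurableType d) (P : probability T R) (a : R)
  (mu : R.-ker T ~> borel Y).
Hypotheses (a0 : 0 < a) (gmu : gamma_crm P a G mu).
Context (f : borel Y -> R).
Hypotheses (mf : measurable_fun setT f) (f01 : forall x, 0 <= f x <= 1).

Let a0' : 0 <= a. Proof. exact: ltW. Qed.
Let f0 x : 0 <= f x. Proof. by have /andP[] := f01 x. Qed.
Let bf : bounded_mfun f. Proof. by split => //; exists 1. Qed.
Let M := fmass mu setT.

(** Half-open levels of width [1 / (m + 1)]; the index [m + 1] is there for the value [f x = 1]. *)
Let level m (i : 'I_m.+2) : set (borel Y) :=
  f @^-1` [set` `[i%:R / m.+1%:R, i.+1%:R / m.+1%:R[].
Let step m (x : borel Y) : R := \sum_(i < m.+2) (i%:R / m.+1%:R) * \1_(@level m i) x.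

Let mlevel m i : measurable (@level m i).
Proof. by rewrite -[@level m i]setTI; exact: mf. Qed.

Let tlevel m : trivIset [set: 'I_m.+2] (@level m).
Proof.
have h (i j : 'I_m.+2) x : @level m i x -> @level m j x -> (i <= j)%N.
  rewrite /level /= !in_itv/= => /andP[h1 _] /andP[_ h2].
  have := le_lt_trans h1 h2; rewrite ltr_pM2r ?invr_gt0// ltr_nat ltnS; exact.
move=> i j _ _ [x [hi hj]]; apply/val_inj/eqP; rewrite eqn_leq.
by rewrite (h i j x)// (h j i x).
Qed.

Let level_ex m x : exists i, @level m i x.
Proof.
have mp : 0 < m.+1%:R :> R by rewrite ltr0Sn.
have h0 : 0 <= m.+1%:R * f x by rewrite mulr_ge0// ltW.
have /truncn_itv/andP[t1 t2] := h0.
have tm : (Num.trunc (m.+1%:R * f x) < m.+2)%N.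
  rewrite -(ltr_nat R); apply: le_lt_trans t1 _.
  apply: (@le_lt_trans _ _ m.+1%:R); last by rewrite ltr_nat.
  by rewrite ler_piMr//; have /andP[] := f01 x.
exists (Ordinal tm); rewrite /level /= in_itv/= ler_pdivrMr// ltr_pdivlMr//.
by rewrite ![f x * _]mulrC t1 t2.
Qed.

Let step_level m i x : @level m i x -> step m x = i%:R / m.+1%:R.
Proof.
move=> hi; rewrite /step (bigD1 i)//= indicE mem_set// mulr1 big1 ?addr0// => j ji.
rewrite indicE memNset ?mulr0// => hj; move/eqP: ji; apply.
by apply: (@tlevel m) => //; exists x.
Qed.

Let step_le m x : step m x <= f x.
Proof.
have [i hi] := level_ex m x; rewrite (step_level hi).
by move: hi; rewrite /level /= in_itv/= => /andP[].
Qed.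

Let step_ge m x : f x <= step m x + m.+1%:R^-1.
Proof.
have [i hi] := level_ex m x; rewrite (step_level hi).
move: hi; rewrite /level /= in_itv/= => /andP[_ /ltW].
by rewrite -[i.+1]addn1 natrD mulrDl mul1r.
Qed.

Let step0 m x : 0 <= step m x.
Proof. by apply: sumr_ge0 => i _; rewrite mulr_ge0 ?divr_ge0// indicE ler0n. Qed.

Let bind m (i : 'I_m.+2) : bounded_mfun (fun x => (i%:R / m.+1%:R) * \1_(@level m i) x : R).
Proof. by apply: bounded_mfunZ; [rewrite divr_ge0|exact: bounded_mfun_indic]. Qed.

Let bstep m : bounded_mfun (step m).
Proof. by apply: bounded_mfun_sum => i; exact: bind. Qed.

Let fint_step m w : fint mu (step m) w = \sum_(i < m.+2) (i%:R / m.+1%:R) * fmass mu (@level m i) w.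
Proof.
rewrite /step fint_sum; last by move=> i; exact: bind.
apply: eq_bigr => i _; rewrite fintZ ?fint_indic//; exact: bounded_mfun_indic.
Qed.

(** On a step function [fint] is a linear combination of independent gamma variables, so its moments
    are convolutions of gamma moments. *)
Let step_moment m N : \int[P]_w (fint mu (step m) w ^+ N / N`!%:R) =
  bconv (fun (i : 'I_m.+2) k => risq (shape G a (@level m i)) k * (i%:R / m.+1%:R) ^+ k) N.
Proof.
pose x (i : 'I_m.+2) w : R := (i%:R / m.+1%:R) * fmass mu (@level m i) w.
have fx i k : finite_moments P (fun w => x i w ^+ k / k`!%:R).
  apply: finite_momentsM; last exact: finite_moments_cst.
  by apply: finite_momentsX; apply: finite_momentsZ; exact: (crm_fmass_finite_moments a0' gmu).
transitivity (\int[P]_w (bconv (fun i k => x i w ^+ k / k`!%:R) N)).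
  by apply: eq_Ex => w; rewrite fint_step expr_bconv.
rewrite /bconv Ex_sum; last by move=> g _; exact: finite_moments_prod.
apply: eq_bigr => g _.
have e w : \prod_(i < m.+2) (x i w ^+ g i / (g i)`!%:R) =
   \prod_(i < m.+2) (((i%:R / m.+1%:R) * `|fmass mu (@level m i) w|) ^+ g i / (g i)`!%:R).
  by apply: eq_bigr => i _; rewrite ger0_norm// fmass_ge0.
rewrite (eq_Ex _ e) (@crm_expectation_prod _ _ _ _ _ _ _ _ a0' gmu _ (@level m)
   (fun i y => ((i%:R / m.+1%:R) * `|y|) ^+ g i / (g i)`!%:R))//.
- apply: eq_bigr => i _.
  transitivity (\int[P]_w ((((i%:R / m.+1%:R) ^+ g i) / (g i)`!%:R) * fmass mu (@level m i) w ^+ g i)).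
    by apply: eq_Ex => w; rewrite ger0_norm ?fmass_ge0// exprMn mulrAC.
  rewrite ExZ; last by apply: finite_momentsX; exact: (crm_fmass_finite_moments a0' gmu).
  by rewrite (crm_fmass_moment a0' gmu)// /risq mulrC mulrA mulrAC.
- exact: tlevel.
- move=> i; apply: measurable_funM => //; apply: measurable_funX.
  by apply: measurable_funM; [exact: measurable_cst|exact: normr_measurable].
- move=> i; apply: eq_finite_moments (fx i (g i)) => w.
  by rewrite ger0_norm ?fmass_ge0.
Qed.

Let fint_step_cvg w : fint mu (step m) w @[m --> \oo] --> fint mu f w.
Proof.
have M0 : 0 <= M w by exact: fmass_ge0.
have bnd m : `|fint mu f w - fint mu (step m) w| <= M w * m.+1%:R^-1.
  have h1 : fint mu (step m) w <= fint mu f w by apply: le_fint.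
  rewrite ger0_norm ?subr_ge0// lerBlDl mulrC /M -fint_indic// -fintZ; last exact: bounded_mfun_indic.
  have bb : bounded_mfun (fun x : borel Y => m.+1%:R^-1 * \1_[set: borel Y] x : R).
    by apply: bounded_mfunZ; [rewrite invr_ge0|exact: bounded_mfun_indic].
  rewrite -fintD//; apply: le_fint => //; first exact: bounded_mfunD.
  by move=> x; rewrite indicE mem_setT mulr1.
apply/cvgrPdist_le => e e0.
have lim0 : M w * m.+1%:R^-1 @[m --> \oo] --> (0 : R).
  rewrite -[X in _ --> X](mulr0 (M w)); apply: cvgMl_tmp; exact: cvg_harmonic.
have /cvgrPdist_le/(_ e e0) := lim0.
apply: filterS => m; rewrite sub0r normrN => hm.
by apply: le_trans (bnd m) _; apply: le_trans hm; exact: ler_norm.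
Qed.

Let step_cvg x : step m x @[m --> \oo] --> f x.
Proof.
apply/cvgrPdist_le => e e0.
have lim0 : m.+1%:R^-1 @[m --> \oo] --> (0 : R) by exact: cvg_harmonic.
have /cvgrPdist_le/(_ e e0) := lim0.
apply: filterS => m; rewrite sub0r normrN => hm.
rewrite ger0_norm ?subr_ge0// lerBlDl; apply: le_trans (step_ge m x) _.
by rewrite lerD2l; apply: le_trans hm; exact: ler_norm.
Qed.

(** Formally, the Laplace functional at [- t f] is the exponential of [a sum_l t^l / l int f^l dG].
    Step functions give the recursion through a finite product over levels, and dominated
    convergence transfers it to [f]. *)
Lemma fint_logderiv : logderiv (fun l => a * \int[G]_x (f x ^+ l))
  (fun N => \int[P]_w (fint mu f w ^+ N / N`!%:R)).
Proof.
have fM : finite_moments P M by exact: (crm_fmass_finite_moments a0' gmu).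
pose e m N := \int[P]_w (fint mu (step m) w ^+ N / N`!%:R).
pose kp m l := a * \int[G]_x (step m x ^+ l).
have logm m : logderiv (kp m) (e m).
  have -> : e m = bconv (fun (i : 'I_m.+2) k => risq (shape G a (@level m i)) k * (i%:R / m.+1%:R) ^+ k).
    by apply/funext => N; exact: step_moment.
  apply: eq_logderiv (logderiv_bconv (fun i => logderiv_risq _ _)) => l l0.
  rewrite /kp.
  transitivity (a * \int[G]_x (\sum_(i < m.+2) (i%:R / m.+1%:R) ^+ l * \1_(@level m i) x)).
    rewrite Ex_sum; last first.
      move=> i _; apply: finite_momentsZ.
      by have := @finite_moments_indic _ _ _ G _ _ id (@level m i) (@measurable_id _ _ _) (mlevel i).
    rewrite mulr_sumr; apply: eq_bigr => i _.
    rewrite ExZ; last by have := @finite_moments_indic _ _ _ G _ _ id (@level m i) (@measurable_id _ _ _) (mlevel i).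
    have -> : \int[G]_x (\1_(@level m i) x) = fine (G (@level m i)).
      by rewrite /Rintegral integral_indic// setIT.
    by rewrite /shape; ring.
  congr (_ * _); apply: eq_Ex => x; have [i hi] := level_ex m x.
  rewrite (step_level hi) (bigD1 i)//= indicE mem_set// mulr1 big1 ?addr0// => j ji.
  rewrite indicE memNset ?mulr0// => hj; move/eqP: ji; apply.
  by apply: (@tlevel m) => //; exists x.
have step1 m x : step m x <= 1 by apply: le_trans (step_le m x) _; have /andP[] := f01 x.
have powc (g : nat -> R) (y : R) l : g m @[m --> \oo] --> y -> g m ^+ l @[m --> \oo] --> y ^+ l.
  move=> h; elim: l => [|l IH]; first by under eq_cvg do rewrite expr0; exact: cvg_cst.
  by under eq_cvg do rewrite exprS; rewrite exprS; exact: cvgM.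
have kcvg l : kp m l @[m --> \oo] --> a * \int[G]_x (f x ^+ l).
  apply: cvgMl_tmp.
  have h : G.-integrable setT (EFin \o (fun x => f x ^+ l)) /\
      \int[G]_x (step m x ^+ l) @[m --> \oo] --> \int[G]_x (f x ^+ l).
    apply: (@Rintegral_dominated_cvg _ _ _ G (fun m x => step m x ^+ l) (fun x => f x ^+ l) (fun=> 1)).
    - by move=> m; apply: measurable_funX; exact: (bstep m).1.
    - by move=> x; apply: powc; exact: step_cvg.
    - by move=> m x; rewrite ger0_norm ?exprn_ge0// exprn_ile1.
    - exact: finite_measure_integrable_cst.
  exact: h.2.
have ecvg N : e m N @[m --> \oo] --> \int[P]_w (fint mu f w ^+ N / N`!%:R).
  have h : P.-integrable setT (EFin \o (fun w => fint mu f w ^+ N / N`!%:R)) /\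
      e m N @[m --> \oo] --> \int[P]_w (fint mu f w ^+ N / N`!%:R).
    apply: (@Rintegral_dominated_cvg _ _ _ P (fun m w => fint mu (step m) w ^+ N / N`!%:R)
      (fun w => fint mu f w ^+ N / N`!%:R) (fun w => M w ^+ N)).
    - move=> m; apply: measurable_funM; last exact: measurable_cst.
      by apply: measurable_funX; exact: measurable_fint.
    - by move=> w; apply: cvgMr_tmp; apply: powc; exact: fint_step_cvg.
    - move=> m w; have h0 : 0 <= fint mu (step m) w by exact: fint_ge0.
      rewrite ger0_norm ?divr_ge0 ?exprn_ge0// ler_pdivrMr ?ltr0n ?fact_gt0//.
      apply: (@le_trans _ _ (M w ^+ N)).
        rewrite lerXn2r ?nnegrE ?fmass_ge0//.
        by rewrite -[M w]mul1r; apply: fint_le_mass.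
      by rewrite ler_peMr ?exprn_ge0 ?fmass_ge0// ler1n fact_gt0.
    - by apply: finite_moments_integrable; exact: finite_momentsX.
  exact: h.2.
move=> N.
have h1 : N%:R * e m N @[m --> \oo] --> N%:R * \int[P]_w (fint mu f w ^+ N / N`!%:R).
  by apply: cvgMl_tmp; exact: ecvg.
have h2 : \sum_(l < N) kp m l.+1 * e m (N - l.+1)%N @[m --> \oo] -->
    \sum_(l < N) (a * \int[G]_x (f x ^+ l.+1)) *
      \int[P]_w (fint mu f w ^+ (N - l.+1) / (N - l.+1)`!%:R).
  by apply: cvgn_sum => l _; apply: cvgM; [exact: kcvg|exact: ecvg].
have e12 : (fun m => N%:R * e m N) = (fun m => \sum_(l < N) kp m l.+1 * e m (N - l.+1)%N).
  by apply/funext => m; exact: logm.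
by rewrite -(cvg_lim (@Rhausdorff R) h1) -(cvg_lim (@Rhausdorff R) h2) e12.
Qed.

End fint_moments.

Section unit_interval_borel.
Context (R : realType).
Local Notation I01 := (borel (unit_itv R)).

Lemma measurable_sval_itv : measurable_fun setT (fun x : I01 => sval x : R).
Proof.
apply: (measurability (@RGenOInfty.G R)); first exact: RGenOInfty.measurableE.
move=> _ [_ [r ->] <-]; rewrite setTI; apply: sub_sigma_algebra.
rewrite openE => x /=; rewrite in_itv/= andbT => rx.
apply/nbhs_ballP; exists (sval x - r); first by rewrite /= subr_gt0.
move=> y; rewrite -metricType_numDomainType.ball_mdistE /= => xy.
rewrite in_itv/= andbT; have : sval x - sval y < sval x - r.
  exact: le_lt_trans (ler_norm _) xy.
by rewrite ltrD2l ltrN2.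
Qed.

Lemma sval_itv01 (x : I01) : 0 <= (sval x : R) <= 1. Proof. exact: (svalP x). Qed.

End unit_interval_borel.

Section dirichlet.
Context (R : realType) (G : probability (borel (unit_itv R)) R) (a : R).
Hypothesis a0 : 0 < a.

Let sv (x : borel (unit_itv R)) : R := sval x.
Let msv : measurable_fun setT sv. Proof. exact: measurable_sval_itv. Qed.
Let sv01 x : 0 <= sv x <= 1. Proof. exact: sval_itv01. Qed.
Let bsv : bounded_mfun sv. Proof. by split => //; exists 1. Qed.

Definition kernel_mean d (T : measurableType d) (p : R.-pker T ~> borel (unit_itv R)) (w : T) : R :=
  \int[p w]_(s in [set: borel (unit_itv R)]) sval s.

Lemma measurable_kernel_mean d (T : measurableType d) (p : R.-pker T ~> borel (unit_itv R)) :
  measurable_fun setT (kernel_mean p).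
Proof.
apply: measurableT_comp => //.
apply: (@measurable_fun_integral_kernel _ _ _ _ _ (fun w => p w) _ (fun x => (sv x)%:E)).
- by move=> U mU; exact: measurable_kernel.
- by move=> x; rewrite lee_fin; have /andP[] := sv01 x.
- exact/measurable_EFinP.
Qed.

Lemma kernel_mean_ge0 d (T : measurableType d) (p : R.-pker T ~> borel (unit_itv R)) w :
  0 <= kernel_mean p w.
Proof. by apply: Rintegral_ge0 => x _; have /andP[] := sv01 x. Qed.

(** By [fint_ratio_moment] the factor [(a)_n] turns moments of the normalized mean into moments of
    the gamma functional, whose recursion is known: a moment form of the Markov-Krein identity. *)
Lemma dirichlet_kernel_mean d (T : measurableType d) (P : probability T R)
    (p : R.-pker T ~> borel (unit_itv R)) : dirichlet_process P a G p ->
  logderiv (fun l => a * \int[G]_x (sv x ^+ l))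
    (fun n => \int[P]_w (kernel_mean p w ^+ n) * risq a n) /\
  forall n, finite_moments P (fun w => kernel_mean p w ^+ n).
Proof.
move=> [mu gmu pmu]; pose K := fint mu sv; pose M := fmass mu setT.
have mM : measurable_fun setT M by exact: measurable_fmass.
have mK : measurable_fun setT K by exact: measurable_fint.
have mW := measurable_kernel_mean p.
have e : {ae P, forall w, kernel_mean p w = K w / M w}.
  apply: filterS2 pmu (crm_mass_gt0 a0 gmu msv sv01) => w pw m0.
  have fin : (mu w [set: borel (unit_itv R)] < +oo)%E.
    by move: m0; rewrite /fmass; case: ifPn => // _; rewrite ltxx.
  have ME : M w = fine (mu w setT) by rewrite /M /fmass fin.
  have Mi0 : 0 <= (M w)^-1 by rewrite invr_ge0 fmass_ge0.
  rewrite /kernel_mean /Rintegral.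
  rewrite (eq_measure_integral (mscale (NngNum Mi0) (mu w))); last first.
    move=> A mA _; rewrite pw// -ME /mscale /= mulrC EFinM; congr (_ * _)%E.
    rewrite fineK// ge0_fin_numE//; apply: le_lt_trans fin.
    by apply: le_measure; rewrite ?inE.
  rewrite ge0_integral_mscale//; last 2 first.
  - exact/measurable_EFinP.
  - by move=> x _; rewrite lee_fin; have /andP[] := sv01 x.
  by rewrite -/sv fintE// /= mulrC.
have fKM n : finite_moments P (fun w => (K w / M w) ^+ n).
  apply: finite_momentsX; apply: (@finite_moments_le _ _ _ P _ (fun=> 1)); last exact: finite_moments_cst.
    apply: measurable_funM => //; rewrite (_ : (fun _ => _) = (fun x : R => `|x|^-1) \o M).
      by apply: measurableT_comp => //; exact: measurable_invr_norm.
    by apply/funext => w /=; rewrite ger0_norm// fmass_ge0.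
  move=> w; have K0 : 0 <= K w by apply: fint_ge0 => x; have /andP[] := sv01 x.
  have M0 : 0 <= M w := fmass_ge0 _ _ _.
  rewrite ger0_norm ?divr_ge0//.
  have [->|m0] := eqVneq (M w) 0; first by rewrite invr0 mulr0.
  rewrite ler_pdivrMr ?mul1r; last by rewrite lt_neqAle eq_sym m0 M0.
  by rewrite -[M w]mul1r; apply: fint_le_mass => // x; have /andP[] := sv01 x.
have eW n : {ae P, forall w, (K w / M w) ^+ n = kernel_mean p w ^+ n}.
  by apply: filterS e => w ->.
split; last first.
  by move=> n; apply: ae_finite_moments (eW n) (fKM n); exact: measurable_funX.
have -> : (fun n => \int[P]_w (kernel_mean p w ^+ n) * risq a n) =
    (fun N => \int[P]_w (K w ^+ N / N`!%:R)).
  apply/funext => n; rewrite (@ae_eq_Ex _ _ _ P _ (fun w => (K w / M w) ^+ n)); last first.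
  - by apply: filterS e => w ->.
  - exact: (fKM n).1.
  - exact: measurable_funX.
  rewrite /risq mulrA (fint_ratio_moment a0 gmu)// mulrC -ExZ; last first.
    by apply: finite_momentsX; exact: (fint_finite_moments a0 gmu).
  by apply: eq_Ex => w; rewrite mulrC.
exact: fint_logderiv.
Qed.

Lemma dirichlet_mean_logderiv d (T : measurableType d) (PT : probability T R)
    (Z : {RV PT >-> R}) : dirichlet_mean a G Z ->
  logderiv (fun l => a * \int[G]_x (sv x ^+ l))
    (fun n => fine ('E_PT[fun w => (Z w ^+ n)%R])%E * risq a n).
Proof.
move=> [d' [T' [PT' [p [dp law]]]]]; have [ld fm] := dirichlet_kernel_mean dp.
suff e n : fine ('E_PT[fun w => (Z w ^+ n)%R])%E = \int[PT']_w (kernel_mean p w ^+ n).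
  by rewrite (_ : (fun n => _ * risq a n) = (fun n => \int[PT']_w (kernel_mean p w ^+ n) * risq a n))//;
    apply/funext => n; rewrite e.
have mZ : measurable_fun setT (Z : T -> R) by exact: measurable_funPT.
(* Nonnegativity of [Z] is read off its law, so it holds almost surely only. *)
have Z0 : {ae PT, forall w, 0 <= Z w}.
  exists (Z @^-1` [set` `]-oo, 0[]); split.
  - by rewrite -[_ @^-1` _]setTI; exact: mZ.
  - rewrite law// (_ : _ @^-1` _ = set0) ?measure0//.
    apply/seteqP; split => // w /=; rewrite in_itv/= ltNge.
    by have := kernel_mean_ge0 p w; rewrite /kernel_mean => ->.
  - by move=> w /= h; rewrite in_itv/= ltNge; apply/negP.
have := @ge0_integral_comp_weight _ _ _ _ _ _ _ PT PT' (Z : T -> R) (kernel_mean p)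
  (fun=> 1) (fun=> 1) mZ (measurable_kernel_mean p) (measurable_cst _) (measurable_cst _)
  (fun=> ler01) (fun=> ler01) _ (fun x => (`|x| ^+ n)%:E).
have mN : measurable_fun setT (fun x : R => (`|x| ^+ n)%:E).
  by apply/measurable_EFinP; apply: measurable_funX; exact: normr_measurable.
have lawE (B : set R) : measurable B ->
   (\int[PT]_(t in (Z : T -> R) @^-1` B) 1%:E = \int[PT']_(t in kernel_mean p @^-1` B) 1%:E)%E.
  move=> mB; rewrite !integral_cst ?mul1e//; first exact: law.
  - by rewrite -[_ @^-1` _]setTI; exact: (measurable_kernel_mean p).
  - by rewrite -[_ @^-1` _]setTI; exact: mZ.
move=> /(_ lawE mN (fun x => exprn_ge0 _ (normr_ge0 _))) h.
rewrite unlock; apply: EFin_inj; rewrite EFin_Ex; last exact: fm.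
transitivity (\int[PT]_w ((`|Z w| ^+ n)%:E * 1%:E))%E; last first.
  rewrite h; apply: eq_integral => w _; rewrite mule1 ger0_norm//; exact: kernel_mean_ge0.
have e1 : (\int[PT]_w (Z w ^+ n)%:E = \int[PT]_w ((`|Z w| ^+ n)%:E * 1%:E))%E.
  apply: ae_eq_integral => //.
  - by apply/measurable_EFinP; exact: measurable_funX.
  - by under eq_fun do rewrite mule1; exact: measurableT_comp mN mZ.
  - by apply: filterS Z0 => w w0 _; rewrite mule1 ger0_norm.
rewrite -e1 fineK// e1 h.
under eq_integral do rewrite mule1.
rewrite (eq_integral (fun w => (kernel_mean p w ^+ n)%:E)); last first.
  by move=> w _; rewrite ger0_norm// kernel_mean_ge0.
by rewrite -EFin_Ex.
Qed.

End dirichlet.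

(** * Integrals against mixtures, and the sufficient condition *)

Section mixture_integral.
Context d d' (X : measurableType d) (Y : measurableType d') (R : realType)
  (P0 : probability X R) (Q : R.-pker X ~> Y) (A : set X) (mA : measurable A).

(** As a kernel on [unit], the restriction can be composed with [Q]; up to a constant the mixture is
    this composition, so its integrals follow from [integral_kcomp]. *)
Definition restr_kernel (_ : unit) : {measure set X -> \bar R} := mrestr P0 mA.

Let restr_kernel_measurable U : measurable U ->
  measurable_fun [set: unit] (restr_kernel ^~ U).
Proof. by move=> mU; exact: measurable_cst. Qed.

HB.instance Definition _ :=
  isKernel.Build _ _ unit X R restr_kernel restr_kernel_measurable.

Let restr_kernel_uub : measure_fam_uub restr_kernel.
Proof.
exists 2 => u; apply: (@le_lt_trans _ _ 1%E); last by rewrite lte_fin; lra.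
by apply: probability_le1; rewrite setTI.
Qed.

HB.instance Definition _ :=
  Kernel_isFinite.Build _ _ unit X R restr_kernel restr_kernel_uub.

Definition snd_kernel (p : unit * X) : {measure set Y -> \bar R} := Q p.2.

Let snd_kernel_measurable U : measurable U ->
  measurable_fun [set: unit * X] (snd_kernel ^~ U).
Proof. by move=> mU; exact: (measurableT_comp (measurable_kernel Q U mU) measurable_snd). Qed.

HB.instance Definition _ :=
  isKernel.Build _ _ (unit * X)%type Y R snd_kernel snd_kernel_measurable.

Let snd_kernel_prob p : snd_kernel p [set: Y] = 1%E.
Proof. exact: prob_kernel. Qed.

HB.instance Definition _ :=
  Kernel_isProbability.Build _ _ (unit * X)%type Y R snd_kernel snd_kernel_prob.

Lemma integral_restr_kernel (f : X -> \bar R) : measurable_fun setT f -> (forall x, 0 <= f x)%E ->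
  (\int[mrestr P0 mA]_x f x = \int[P0]_(x in A) f x)%E.
Proof.
move=> mf f0.
have ind0 (x : X) : (0 <= (\1_A x : R))%R by rewrite indicE ler0n.
have := @ge0_integral_comp_weight _ _ _ _ _ _ _ P0 (mrestr P0 mA) id id
  (\1_A) (fun=> 1) (@measurable_id _ _ _) (@measurable_id _ _ _) (measurable_indic mA)
  (measurable_cst _) ind0 (fun=> ler01) _ f mf f0.
have e B : measurable B ->
  (\int[P0]_(t in id @^-1` B) (\1_A t)%:E = \int[mrestr P0 mA]_(t in id @^-1` B) 1%:E)%E.
  by move=> mB; rewrite preimage_id integral_indic// integral_cst// mul1e /mrestr setIC.
move=> /(_ e) h.
transitivity (\int[mrestr P0 mA]_x (f x * 1%:E))%E; first by apply: eq_integral => x _; rewrite mule1.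
rewrite -h [RHS]integral_mkcond; apply: eq_integral => x _.
by rewrite patchE indicE; case: (x \in A); rewrite ?mule1 ?mule0.
Qed.

Lemma integral_mixture (PA0 : (0 < P0 A)%E) (f : Y -> \bar R) :
  measurable_fun setT f -> (forall s, 0 <= f s)%E ->
  (\int[mixture Q mA PA0]_s f s = (\int[P0]_(x in A) \int[Q x]_s f s) * (fine (P0 A))^-1%:E)%E.
Proof.
move=> mf f0.
have k0 : 0 <= (fine (P0 A))^-1 by rewrite invr_ge0 fine_ge0.
rewrite (eq_measure_integral (mscale (NngNum k0) (kcomp restr_kernel snd_kernel tt))); last first.
  move=> U mU _; transitivity ((fine (P0 A))^-1%:E * \int[mrestr P0 mA]_x Q x U)%E; last by [].
  by rewrite integral_restr_kernel// 1?muleC//; exact: measurable_kernel.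
rewrite ge0_integral_mscale// integral_kcomp// muleC; congr (_ * _)%E.
rewrite /= integral_restr_kernel//.
  apply: measurable_fun_integral_kernel => // U mU; exact: measurable_kernel.
by move=> x; apply: integral_ge0.
Qed.

End mixture_integral.

Section sufficiency.
Context (R : realType) (X : pmetricType R) (P0 : probability (borel X) R)
  d (Omega : measurableType d) (P : probability Omega R) (c : R)
  (mu1 mu2 : R.-ker Omega ~> borel X).
Hypotheses (c_gt0 : 0 < c) (gamma1 : gamma_crm P c P0 mu1)
  (gamma2 : gamma_crm P c P0 mu2)
  (canon12 : in_canonical_correlation P c P0 mu1 mu2).
Hypotheses (sepX : separable_space X) (P0na : nonatomic P0).
Context (Q : R.-pker borel X ~> borel (unit_itv R)).

Definition kernel_moment l (x : borel X) : R := \int[Q x]_(s in [set: borel (unit_itv R)]) (sval s ^+ l).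

Lemma kernel_moment01 l x : 0 <= kernel_moment l x <= 1.
Proof.
apply/andP; split; first by apply: Rintegral_ge0 => s _; rewrite exprn_ge0//; have /andP[] := svalP s.
have h : (Q x).-integrable setT (EFin \o (fun s : borel (unit_itv R) => (sval s : R) ^+ l)).
  apply: (@integrable_dominated _ _ _ _ _ (fun=> 1)).
  - by apply: measurable_funX; exact: measurable_sval_itv.
  - by move=> s; have /andP[h0 h1] := svalP s; rewrite ger0_norm ?exprn_ge0// exprn_ile1.
  - apply/integrableP; split; first exact: measurable_cst.
    by rewrite integral_cst//= normr1 mul1e prob_kernel ltry.
rewrite -lee_fin /kernel_moment /Rintegral fineK; last exact: integrable_fin_num h.
apply: (@le_trans _ _ (\int[Q x]_s 1%:E)%E); last by rewrite integral_cst//= mul1e prob_kernel.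
apply: ge0_le_integral => //.
- by move=> s _; rewrite lee_fin exprn_ge0//; have /andP[] := svalP s.
- by apply/measurable_EFinP; apply: measurable_funX; exact: measurable_sval_itv.
- by move=> s _; rewrite lee_fin; have /andP[h0 h1] := svalP s; rewrite exprn_ile1.
Qed.

Lemma kernel_momentE l x : (\int[Q x]_s ((sval s : R) ^+ l)%:E)%E = (kernel_moment l x)%:E.
Proof.
have h : (Q x).-integrable setT (EFin \o (fun s : borel (unit_itv R) => (sval s : R) ^+ l)).
  apply: (@integrable_dominated _ _ _ _ _ (fun=> 1)).
  - by apply: measurable_funX; exact: measurable_sval_itv.
  - by move=> s; have /andP[h0 h1] := svalP s; rewrite ger0_norm ?exprn_ge0// exprn_ile1.
  - apply/integrableP; split; first exact: measurable_cst.
    by rewrite integral_cst//= normr1 mul1e prob_kernel ltry.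
by rewrite /kernel_moment /Rintegral fineK//; exact: integrable_fin_num h.
Qed.

Lemma measurable_kernel_moment l : measurable_fun setT (kernel_moment l).
Proof.
apply: measurableT_comp => //.
apply: (@measurable_fun_integral_kernel _ _ _ _ _ (fun w => Q w) _ (fun x => ((sval x : R) ^+ l)%:E)).
- by move=> U mU; exact: measurable_kernel.
- by move=> s; rewrite lee_fin exprn_ge0//; have /andP[] := svalP s.
- by apply/measurable_EFinP; apply: measurable_funX; exact: measurable_sval_itv.
Qed.

Lemma mixture_moment (A : set (borel X)) (mA : measurable A) (PA0 : (0 < P0 A)%E) l :
  shape P0 c A * \int[mixture Q mA PA0]_s ((sval s : R) ^+ l) =
  c * fine (\int[P0]_(x in A) (kernel_moment l x)%:E)%E.
Proof.
rewrite /Rintegral integral_mixture; last 2 first.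
- by apply/measurable_EFinP; apply: measurable_funX; exact: measurable_sval_itv.
- by move=> s; rewrite lee_fin exprn_ge0//; have /andP[] := svalP s.
under eq_integral do rewrite kernel_momentE.
have PAf : P0 A \is a fin_num by rewrite fin_num_measure.
have PA0' : 0 < fine (P0 A) by rewrite fine_gt0// PA0 ltey_eq PAf.
have fin : (\int[P0]_(x in A) (kernel_moment l x)%:E)%E \is a fin_num.
  rewrite ge0_fin_numE; last by apply: integral_ge0 => x _; rewrite lee_fin; have /andP[] := kernel_moment01 l x.
  apply: (@le_lt_trans _ _ (\int[P0]_(x in A) 1%:E)%E).
    apply: ge0_le_integral => //.
    - by move=> x _; rewrite lee_fin; have /andP[] := kernel_moment01 l x.
    - by apply/measurable_EFinP; apply: measurable_funTS; exact: measurable_kernel_moment.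
    - by move=> x _; rewrite lee_fin; have /andP[] := kernel_moment01 l x.
  by rewrite integral_cst// mul1e ltey_eq PAf.
by rewrite fineM//= /shape; field; rewrite gt_eqF.
Qed.

Theorem independent_increments_of_kernel :
  (forall (A : set (borel X)) (mA : measurable A) (PA0 : (0 < P0 A)%E),
    exists (d' : measure_display) (T : measurableType d')
      (PT : probability T R) (Z : {RV PT >-> R}),
      dirichlet_mean (c * fine (P0 A)) (mixture Q mA PA0) Z /\
      canonical_coefficients P c P0 mu1 mu2 (fun _ : 'I_1 => A)
        (fun n => fine ('E_PT[fun w => (Z w ^+ n ord0)%R])%E)) ->
  independent_increments P mu1 mu2.
Proof.
move=> hQ; apply: (independent_increments_of_coef c_gt0 gamma1 gamma2) => I A mA A0 tA.
apply: (canonical_coef_factor_indep c_gt0 gamma1 gamma2 canon12) => // n.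
(* Additive in [B] as an integral, and equal to the cumulants of the Dirichlet mean by
   [mixture_moment]. *)
pose kap (B : set (borel X)) l := c * fine (\int[P0]_(x in B) (kernel_moment l x)%:E)%E.
apply: (@canonical_coef_factor _ _ P0 _ _ P c mu1 mu2 c_gt0 gamma1 gamma2 canon12 sepX P0na kap) => //.
  move=> B mB B0; have [d' [T [PT [Z [dm cc]]]]] := hQ B mB B0.
  have := dirichlet_mean_logderiv (shape_gt0 c_gt0 B0 mB) dm.
  have /(coefficients_crm_coef c_gt0 gamma1 gamma2 canon12 _ mB B0) h := cc.
  rewrite (_ : (fun n => fine ('E_PT[fun w => (Z w ^+ n)%R])%E * _) = crm_coef P0 P c mu1 mu2 B); last first.
    by apply/funext => k; rewrite h ffunE.
  by apply: eq_logderiv => l _; exact: mixture_moment.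
move=> m B l mB tB; rewrite /kap -mulr_sumr; congr (_ * _).
have fin D : measurable D -> (\int[P0]_(x in D) (kernel_moment l x)%:E)%E \is a fin_num.
  move=> mD; rewrite ge0_fin_numE; last by apply: integral_ge0 => x _; rewrite lee_fin; have /andP[] := kernel_moment01 l x.
  apply: (@le_lt_trans _ _ (\int[P0]_(x in D) 1%:E)%E).
    apply: ge0_le_integral => //.
    - by move=> x _; rewrite lee_fin; have /andP[] := kernel_moment01 l x.
    - by apply/measurable_EFinP; apply: measurable_funTS; exact: measurable_kernel_moment.
    - by move=> x _; rewrite lee_fin; have /andP[] := kernel_moment01 l x.
  by rewrite integral_cst// mul1e ltey_eq fin_num_measure.
apply: EFin_inj; rewrite -sumEFin fineK; last first.
  by apply: fin; apply: fin_bigcup_measurable => //; exact: finite_finset.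
have -> : \bigcup_i B i = \big[setU/set0]_(i <- index_enum 'I_m) B i.
  rewrite -bigcup_seq; congr (bigcup _ _); apply/seteqP; split => // i _ /=.
  by rewrite mem_index_enum.
rewrite ge0_integral_bigsetU//.
- by apply: eq_bigr => i _; rewrite fineK// fin.
- exact: index_enum_uniq.
- exact: sub_trivIset tB.
- by apply/measurable_EFinP; apply: measurable_funTS; exact: measurable_kernel_moment.
- by move=> x _; rewrite lee_fin; have /andP[] := kernel_moment01 l x.
Qed.

End sufficiency.

(** * Additive cumulants *)

Section independent_product.
Context d d' (T : measurableType d) (S : measurableType d') (R : realType)
  (P : probability T R) (X1 X2 : T -> S).
Hypotheses (mX1 : measurable_fun setT X1) (mX2 : measurable_fun setT X2).
Hypothesis ind : forall B1 B2, measurable B1 -> measurable B2 ->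
  (P (X1 @^-1` B1 `&` X2 @^-1` B2) = P (X1 @^-1` B1) * P (X2 @^-1` B2))%E.

Let ge0_mul (f g : S -> R) : measurable_fun setT f -> measurable_fun setT g ->
  (forall s, 0 <= f s) -> (forall s, 0 <= g s) ->
  finite_moments P (f \o X1) -> finite_moments P (g \o X2) ->
  \int[P]_t (f (X1 t) * g (X2 t)) = \int[P]_t f (X1 t) * \int[P]_t g (X2 t).
Proof.
move=> mf mg f0 g0 hf hg.
pose XX (b : bool) := if b then X1 else X2; pose ff (b : bool) := if b then f else g.
have mXX b : measurable_fun setT (XX b) by case: b.
have bool2 (V : Type) (idx : V) (op : Monoid.com_law idx) (F : bool -> V) :
    \big[op/idx]_b F b = op (F true) (F false).
  by rewrite (bigD1 true)//= (bigD1 false)//= big1 ?Monoid.mulm1// => -[].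
have indXX (B : bool -> set S) : (forall b, measurable (B b)) ->
   (P (\bigcap_(b in [set: bool]) (XX b @^-1` B b)) = \prod_(b : bool) P (XX b @^-1` B b))%E.
  move=> mB; rewrite [RHS](bigD1 true)//= (bigD1 false)//= big1 => [|[]//].
  rewrite mule1 -ind//; congr (P _).
  by apply/seteqP; split => [t h|t [h1 h2] [] _//]; split; [exact: (h true)|exact: (h false)].
have := @expectation_prod_indep _ _ _ _ _ P _ XX mXX indXX ff.
have -> : (fun t => \prod_(b : bool) ff b (XX b t)) = (fun t => f (X1 t) * g (X2 t)).
  by apply/funext => t; rewrite bool2.
by rewrite bool2; apply; case.
Qed.

(** Signed functions reduce to the nonnegative case through [f = (|f| + f) - |f|], which leaves four
    products of nonnegative functions. *)
Lemma expectation_mul_indep (f g : S -> R) : measurable_fun setT f -> measurable_fun setT g ->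
  finite_moments P (f \o X1) -> finite_moments P (g \o X2) ->
  \int[P]_t (f (X1 t) * g (X2 t)) = \int[P]_t f (X1 t) * \int[P]_t g (X2 t).
Proof.
move=> mf mg hf hg.
have mabs (h : S -> R) : measurable_fun setT h -> measurable_fun setT (fun s => `|h s|).
  by move=> mh; apply: measurableT_comp => //; exact: normr_measurable.
have fabs (h : S -> R) (X : T -> S) : measurable_fun setT h -> measurable_fun setT X ->
    finite_moments P (h \o X) -> finite_moments P ((fun s => `|h s|) \o X).
  move=> mh mX fh; split; first exact: measurableT_comp (mabs _ mh) mX.
  move=> n; have /integrable_abse := fh.2 n; congr (_.-integrable _ _).
  by apply/funext => t /=; rewrite normrX.
have mp (h : S -> R) : measurable_fun setT h -> measurable_fun setT (fun s => `|h s| + h s).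
  by move=> mh; apply: measurable_funD => //; exact: mabs.
have p0 (h : S -> R) s : 0 <= `|h s| + h s.
  by rewrite -lerBlDr sub0r; apply: le_trans (ler_norm _) _; rewrite normrN.
have af := fabs f X1 mf mX1 hf; have ag := fabs g X2 mg mX2 hg.
have pf : finite_moments P ((fun s => `|f s| + f s) \o X1) by exact: finite_momentsD.
have pg : finite_moments P ((fun s => `|g s| + g s) \o X2) by exact: finite_momentsD.
have e11 := ge0_mul (mp f mf) (mp g mg) (p0 f) (p0 g) pf pg.
have e12 := ge0_mul (mp f mf) (mabs g mg) (p0 f) (fun s => normr_ge0 _) pf ag.
have e21 := ge0_mul (mabs f mf) (mp g mg) (fun s => normr_ge0 _) (p0 g) af pg.
have e22 := ge0_mul (mabs f mf) (mabs g mg) (fun s => normr_ge0 _) (fun s => normr_ge0 _) af ag.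
have F1 : \int[P]_t f (X1 t) = \int[P]_t (`|f (X1 t)| + f (X1 t)) - \int[P]_t `|f (X1 t)|.
  by rewrite ExD// addrAC subrr add0r.
have G1 : \int[P]_t g (X2 t) = \int[P]_t (`|g (X2 t)| + g (X2 t)) - \int[P]_t `|g (X2 t)|.
  by rewrite ExD// addrAC subrr add0r.
have m11 := finite_momentsM pf pg; have m12 := finite_momentsM pf ag.
have m21 := finite_momentsM af pg; have m22 := finite_momentsM af ag.
transitivity (\int[P]_t (((`|f (X1 t)| + f (X1 t)) * (`|g (X2 t)| + g (X2 t)) -
   (`|f (X1 t)| + f (X1 t)) * `|g (X2 t)|) - (`|f (X1 t)| * (`|g (X2 t)| + g (X2 t)) -
   `|f (X1 t)| * `|g (X2 t)|))).
  by apply: eq_Ex => t; ring.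
rewrite ExB; [|exact: finite_momentsB|exact: finite_momentsB].
rewrite ExB// ExB// e11 e12 e21 e22 F1 G1; ring.
Qed.

End independent_product.

Section necessity_cumulants.
Context (R : realType) (X : pmetricType R) (P0 : probability (borel X) R)
  d (Omega : measurableType d) (P : probability Omega R) (c : R)
  (mu1 mu2 : R.-ker Omega ~> borel X).
Hypotheses (c_gt0 : 0 < c) (gamma1 : gamma_crm P c P0 mu1)
  (gamma2 : gamma_crm P c P0 mu2)
  (canon12 : in_canonical_correlation P c P0 mu1 mu2)
  (indep12 : independent_increments P mu1 mu2).
Let c0 : 0 <= c. Proof. exact: ltW. Qed.
Local Notation sh := (shape P0 c).
Local Notation cc := (crm_coef P0 P c mu1 mu2).

Let fm1 A : measurable A -> finite_moments P (fmass mu1 A).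
Proof. exact: (crm_fmass_finite_moments c0 gamma1). Qed.
Let fm2 A : measurable A -> finite_moments P (fmass mu2 A).
Proof. exact: (crm_fmass_finite_moments c0 gamma2). Qed.

Let mell a n : measurable_fun setT (ell a n : R -> R).
Proof.
apply: measurable_sum => k; apply: measurable_funM; first exact: measurable_cst.
by apply: measurable_funM; [exact: exprn_measurable|exact: measurable_cst].
Qed.

Let fell A k l : measurable A ->
  finite_moments P (fun w => ell (sh A) k (fmass mu1 A w) * ell (sh A) l (fmass mu2 A w)).
Proof.
by move=> mA; apply: finite_momentsM; apply: finite_moments_ell; [exact: fm1|exact: fm2].
Qed.

(** Independence is stated for extended real values, with which [fmass] agrees almost surely; hence
    the detour through [F]. *)
Lemma increments_mul (A B : set (borel X)) k k' l l' : measurable A -> measurable B ->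
  A `&` B = set0 ->
  \int[P]_w ((ell (sh A) k (fmass mu1 A w) * ell (sh A) l (fmass mu2 A w)) *
             (ell (sh B) k' (fmass mu1 B w) * ell (sh B) l' (fmass mu2 B w))) =
  \int[P]_w (ell (sh A) k (fmass mu1 A w) * ell (sh A) l (fmass mu2 A w)) *
  \int[P]_w (ell (sh B) k' (fmass mu1 B w) * ell (sh B) l' (fmass mu2 B w)).
Proof.
move=> mA mB AB.
pose X1 w := (mu1 w A, mu2 w A); pose X2 w := (mu1 w B, mu2 w B).
have mX D : measurable D -> measurable_fun setT (fun w => (mu1 w D, mu2 w D)).
  by move=> mD; apply: measurable_fun_pair; exact: measurable_kernel.
pose F D k l (z : \bar R * \bar R) := ell (sh D) k (fine z.1) * ell (sh D) l (fine z.2).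
have mF D m n : measurable_fun setT (F D m n).
  apply: measurable_funM; apply: (measurableT_comp (mell _ _)); apply: measurableT_comp => //.
have ind B1 B2 : measurable B1 -> measurable B2 ->
    (P (X1 @^-1` B1 `&` X2 @^-1` B2) = P (X1 @^-1` B1) * P (X2 @^-1` B2))%E.
  move=> mB1 mB2; pose AA (i : 'I_2) := if i == ord0 then A else B.
  pose BB (i : 'I_2) := if i == ord0 then B1 else B2.
  have mAA i : measurable (AA i) by rewrite /AA; case: ifP.
  have mBB i : measurable (BB i) by rewrite /BB; case: ifP.
  have o1 (i : 'I_2) : i != ord0 -> i = lift ord0 ord0.
    by move=> i0; apply/val_inj; case: i i0 => -[|[|[]]].
  have tAA : trivIset [set: 'I_2] AA.
    move=> i j _ _ [x [hi hj]]; apply: contrapT => ij.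
    have : (A `&` B) x.
      move: hi hj ij; rewrite /AA; have [->|/o1 ->] := eqVneq i ord0;
        by have [->|/o1 ->] := eqVneq j ord0.
    by rewrite AB.
  have := indep12 mAA tAA mBB; rewrite !big_ord_recl big_ord0 mule1 /=.
  rewrite (_ : \bigcap_i _ = X1 @^-1` B1 `&` X2 @^-1` B2)//.
  apply/seteqP; split => [w h|w [h1 h2] i _].
    by split; [have := h ord0 Logic.I|have := h (lift ord0 ord0) Logic.I].
  by rewrite /AA /BB /=; case: ifP.
have e D m n : measurable D ->
    {ae P, forall w, ell (sh D) m (fmass mu1 D w) * ell (sh D) n (fmass mu2 D w) =
                     F D m n (mu1 w D, mu2 w D)}.
  move=> mD; apply: filterS2 (crm_fmass_ae c0 gamma1 mD) (crm_fmass_ae c0 gamma2 mD) => w h1 h2.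
  by rewrite /F h1 h2.
have fF D m n : measurable D -> finite_moments P (F D m n \o (fun w => (mu1 w D, mu2 w D))).
  move=> mD; apply: ae_finite_moments (e D m n mD) (fell m n mD).
  exact: measurableT_comp (mF D m n) (mX D mD).
have := expectation_mul_indep (mX A mA) (mX B mB) ind (mF A k l) (mF B k' l') (fF A k l mA) (fF B k' l' mB).
have eE D m n : measurable D ->
    \int[P]_w F D m n (mu1 w D, mu2 w D) =
    \int[P]_w (ell (sh D) m (fmass mu1 D w) * ell (sh D) n (fmass mu2 D w)).
  move=> mD; apply: ae_eq_Ex; [exact: (fF D m n mD).1|exact: (fell m n mD).1|].
  by apply: filterS (e D m n mD) => w ->.
rewrite !eE// => <-; apply: ae_eq_Ex.
- exact: (finite_momentsM (fell k l mA) (fell k' l' mB)).1.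
- exact: (finite_momentsM (fF A k l mA) (fF B k' l' mB)).1.
- by apply: filterS2 (e A k l mA) (e B k' l' mB) => w -> ->.
Qed.

Lemma crm_coef_orth A k l : measurable A -> (0 < P0 A)%E ->
  \int[P]_w (ell (sh A) k (fmass mu1 A w) * ell (sh A) l (fmass mu2 A w)) =
  (k == l)%:R * cc A k.
Proof.
move=> mA A0; have tA : trivIset [set: unit] (fun=> A) by move=> [] [].
have cp := canonical_pair_crm c_gt0 gamma1 gamma2 canon12 (fun _ : unit => mA) (fun=> A0) tA.
have one (F : unit -> R) : \prod_i F i = F tt by rewrite (bigD1 tt)//= big1 ?mulr1// => -[].
have := canonical_pair_orth cp [ffun=> k] [ffun=> l].
rewrite /canonical_coef /ell_prod.
have -> : ([ffun=> k] == [ffun=> l] :> {ffun unit -> nat}) = (k == l).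
  by apply/eqP/eqP => [/ffunP/(_ tt)|->//]; rewrite !ffunE.
under eq_Rintegral do rewrite !one !ffunE.
by move=> ->; congr (_ * _); apply: eq_Ex => w; rewrite !one !ffunE.
Qed.

Lemma shapeU (A B : set (borel X)) : measurable A -> measurable B -> A `&` B = set0 ->
  sh (A `|` B) = sh A + sh B.
Proof.
move=> mA mB AB; rewrite /shape measureU// fineD ?mulrDr//; exact: fin_num_measure.
Qed.

Lemma fmassU (mu : R.-ker Omega ~> borel X) (A B : set (borel X)) w :
  measurable A -> measurable B -> A `&` B = set0 ->
  fmass mu (A `|` B) w = fmass mu A w + fmass mu B w.
Proof.
move=> mA mB AB; have [h|h] := boolP (mu w [set: borel X] < +oo)%E; last first.
  by rewrite /fmass (negbTE h) addr0.
by apply: EFin_inj; rewrite EFinD !fmassE//; [rewrite measureU|exact: measurableU].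
Qed.

(** Null sets are outside the scope of [canon12]; there both masses vanish almost surely, and the
    polynomials reduce to [ell 0 n 0]. *)
Lemma crm_coef_null_set (A : set (borel X)) : measurable A -> P0 A = 0%E ->
  cc A = (fun n => (n == 0%N)%:R).
Proof.
move=> mA A0; apply/funext => n; rewrite /crm_coef.
have s0 : sh A = 0 by rewrite /shape A0 mulr0.
rewrite s0 -[RHS](Ex_cst P); apply: ae_eq_Ex => //.
  by have := (fell n n mA).1; rewrite s0.
apply: filterS2 (crm_null c0 gamma1 mA A0) (crm_null c0 gamma2 mA A0) => w h1 h2.
have z (mu : R.-ker Omega ~> borel X) : mu w A = 0%E -> fmass mu A w = 0.
  by move=> h; rewrite /fmass h; case: ifP.
by rewrite !z// ell_at0; case: n => [|n]; rewrite ?mulr1// mulr0.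
Qed.

(** [ell_add] expands both polynomials of the union, independence separates the two sets, and
    orthogonality on each set keeps equal degrees only: a convolution remains. *)
Lemma crm_coefU (A B : set (borel X)) : measurable A -> measurable B -> A `&` B = set0 ->
  cc (A `|` B) = conv (cc A) (cc B).
Proof.
move=> mA mB AB.
have orth D k l : measurable D ->
    \int[P]_w (ell (sh D) k (fmass mu1 D w) * ell (sh D) l (fmass mu2 D w)) =
    (k == l)%:R * cc D k.
  move=> mD; have [D0|D0] := boolP (0 < P0 D)%E; first exact: crm_coef_orth.
  have {}D0 : P0 D = 0%E by apply/eqP; rewrite eq_le measure_ge0 andbT leNgt.
  have [->|kl] := eqVneq k l; first by rewrite mul1r.
  have s0 : sh D = 0 by rewrite /shape D0 mulr0.
  rewrite mul0r -[RHS](Ex_cst P); apply: ae_eq_Ex => //; first exact: (fell k l mD).1.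
  apply: filterS2 (crm_null c0 gamma1 mD D0) (crm_null c0 gamma2 mD D0) => w h1 h2.
  have z (mu : R.-ker Omega ~> borel X) : mu w D = 0%E -> fmass mu D w = 0.
    by move=> h; rewrite /fmass h; case: ifP.
  rewrite !z// s0 !ell_at0 -natrM mulnb; case: k kl => [|k]; case: l => [|l]//=.
apply/funext => n; rewrite /crm_coef /conv.
transitivity (\int[P]_w (\sum_(k < n.+1) \sum_(l < n.+1)
    ((ell (sh A) k (fmass mu1 A w) * ell (sh A) l (fmass mu2 A w)) *
     (ell (sh B) (n - k) (fmass mu1 B w) * ell (sh B) (n - l) (fmass mu2 B w))))).
  apply: eq_Ex => w; rewrite !fmassU// shapeU// !ell_add /conv mulr_suml.
  apply: eq_bigr => k _; rewrite mulr_sumr; apply: eq_bigr => l _; ring.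
have fm k l : finite_moments P (fun w => (ell (sh A) k (fmass mu1 A w) * ell (sh A) l (fmass mu2 A w)) *
     (ell (sh B) (n - k) (fmass mu1 B w) * ell (sh B) (n - l) (fmass mu2 B w))).
  by apply: finite_momentsM; exact: fell.
rewrite Ex_sum; last by move=> k _; apply: finite_moments_sum => l _; exact: fm.
apply: eq_bigr => k _; rewrite Ex_sum; last by move=> l _; exact: fm.
rewrite (bigD1 k)//= increments_mul// !orth// !eqxx !mul1r big1 ?addr0// => l lk.
by rewrite increments_mul// orth// eq_sym (negbTE (_ : (l : nat) != k))// !mul0r.
Qed.

Lemma crm_coef_at0 A : cc A 0%N = 1.
Proof. by rewrite /crm_coef -[RHS](Ex_cst P); apply: eq_Ex => w; rewrite !ell0 mulr1. Qed.

(* The value at [0] makes [crm_moment_seq A] the moment sequence of [c G_A P0(A)]. *)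
Definition crm_moment_seq (A : set (borel X)) l : R :=
  if l is 0%N then sh A else cumulant (cc A) l.

Lemma crm_moment_seq_logderiv A : logderiv (crm_moment_seq A) (cc A).
Proof. by apply: eq_logderiv (logderiv_cumulant (crm_coef_at0 A)) => -[]. Qed.

Lemma crm_moment_seqU (A B : set (borel X)) l : measurable A -> measurable B -> A `&` B = set0 ->
  crm_moment_seq (A `|` B) l = crm_moment_seq A l + crm_moment_seq B l.
Proof.
move=> mA mB AB; case: l => [|l]; first exact: shapeU.
apply: (cumulant_uniq (kap := fun l => crm_moment_seq A l + crm_moment_seq B l)) => //.
  exact: crm_coef_at0.
rewrite crm_coefU//; apply: logderiv_conv; exact: crm_moment_seq_logderiv.
Qed.

Lemma crm_moment_seq0 l : crm_moment_seq set0 l = 0.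
Proof.
have := @crm_moment_seqU set0 set0 l measurable0 measurable0 (setI0 _).
by rewrite setU0 => /eqP; rewrite -subr_eq0 opprD addrA subrr sub0r oppr_eq0 => /eqP.
Qed.

Lemma crm_moment_seq_sum m (A : 'I_m -> set (borel X)) l :
  (forall i, measurable (A i)) -> trivIset [set: 'I_m] A ->
  crm_moment_seq (\big[setU/set0]_i A i) l = \sum_i crm_moment_seq (A i) l.
Proof.
elim: m A => [|m IH] A mA tA; first by rewrite !big_ord0 crm_moment_seq0.
rewrite !big_ord_recr /= crm_moment_seqU//; last 2 first.
- by apply: bigsetU_measurable.
- elim/big_rec: _ => [|i y _ IHy]; first by rewrite set0I.
  rewrite setIUl IHy setU0; apply/seteqP; split => // x hx.
  have := tA _ _ Logic.I Logic.I (ex_intro _ x hx) => /(congr1 val) /= e.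
  by have := ltn_ord i; rewrite e ltnn.
rewrite IH//; move=> i j _ _ h; have := tA _ _ Logic.I Logic.I h.
by move=> /(congr1 val) /= e; apply/val_inj.
Qed.

End necessity_cumulants.

(** * Complete monotonicity *)

Section finite_differences.
Context (R : realType).
Implicit Types u v : nat -> R.

(** With this sign, the difference multiplies the integrand of a moment by [1 - s], so that complete
    monotonicity involves no alternating signs. *)
Definition fdiff u k : R := u k - u k.+1.

Definition completely_monotone u := forall j k, 0 <= iter j fdiff u k.

Lemma iter_fdiffD j u v : iter j fdiff (fun l => u l + v l) =
  (fun l => iter j fdiff u l + iter j fdiff v l).
Proof.
elim: j u v => [//|j IH] u v; rewrite !iterS IH; apply/funext => k.
by rewrite /fdiff; ring.
Qed.

Lemma iter_fdiffZ j a u : iter j fdiff (fun l => a * u l) = (fun l => a * iter j fdiff u l).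
Proof.
elim: j u => [//|j IH] u; rewrite !iterS IH; apply/funext => k.
by rewrite /fdiff; ring.
Qed.

Lemma iter_fdiff0 j : iter j fdiff (fun=> 0) = (fun=> 0).
Proof. by elim: j => [//|j IH]; rewrite iterS IH; apply/funext => k; rewrite /fdiff subrr. Qed.

Lemma iter_fdiff_sum (I : Type) (s : seq I) (F : I -> nat -> R) j k :
  iter j fdiff (fun l => \sum_(i <- s) F i l) k = \sum_(i <- s) iter j fdiff (F i) k.
Proof.
elim: s k => [|i s IH] k.
  by under eq_fun do rewrite big_nil; rewrite iter_fdiff0 big_nil.
by under eq_fun do rewrite big_cons; rewrite iter_fdiffD IH big_cons.
Qed.

Lemma iter_fdiff_bound j u k e : (forall l, (l <= k + j)%N -> `|u l| <= e) ->
  `|iter j fdiff u k| <= 2 ^+ j * e.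
Proof.
elim: j k => [|j IH] k ue; first by rewrite expr0 mul1r ue// leq_addr.
rewrite iterS {1}/fdiff; apply: le_trans (ler_normB _ _) _.
rewrite exprS -mulrA mulr2n mulrDl mul1r; apply: lerD; apply: IH => l lk; apply: ue.
  by rewrite (leq_trans lk)// leq_add2l.
by rewrite (leq_trans lk)// addSnnS.
Qed.

Lemma completely_monotone_const a : 0 <= a -> completely_monotone (fun=> a).
Proof.
move=> a0 [|j] k //; rewrite iterSr (_ : fdiff _ = fun=> 0) ?iter_fdiff0//.
by apply/funext => l; rewrite /fdiff subrr.
Qed.

End finite_differences.

Section necessity_monotone.
Context (R : realType) (X : pmetricType R) (P0 : probability (borel X) R)
  d (Omega : measurableType d) (P : probability Omega R) (c : R)
  (mu1 mu2 : R.-ker Omega ~> borel X).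
Hypotheses (c_gt0 : 0 < c) (gamma1 : gamma_crm P c P0 mu1)
  (gamma2 : gamma_crm P c P0 mu2)
  (canon12 : in_canonical_correlation P c P0 mu1 mu2)
  (indep12 : independent_increments P mu1 mu2).
Hypotheses (sepX : separable_space X) (P0na : nonatomic P0).
Local Notation sh := (shape P0 c).
Local Notation cc := (crm_coef P0 P c mu1 mu2).
Local Notation u := (crm_moment_seq P0 P c mu1 mu2).

Let rho A l := cc A l / risq (sh A) l.

(** Iterated differences of the coefficients are the values of [Lam] at [v^k (1 - v)^j]. *)
Lemma crm_corr_bounds A : measurable A -> (0 < P0 A)%E ->
  (forall l, `|rho A l| <= 1) /\ completely_monotone (rho A).
Proof.
move=> mA A0; have tA : trivIset [set: unit] (fun=> A) by move=> [] [].
have cp := canonical_pair_crm c_gt0 gamma1 gamma2 canon12 (fun _ : unit => mA) (fun=> A0) tA.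
have s0 (i : unit) : 0 < sh A by exact: shape_gt0.
have bc (i : unit) : exists C, forall k, Lam P (fun=> sh A) (fun=> fmass mu1 A) (fun=> fmass mu2 A)
    (fun v : unit -> R => v i ^+ k) <= C.
  by exists 2 => k; have /andP[] := bounded_corr i k s0 cp.
have E l : rho A l = Lam P (fun=> sh A) (fun=> fmass mu1 A) (fun=> fmass mu2 A)
    (fun v : unit -> R => v tt ^+ l).
  by rewrite (Lam_coord tt l s0 cp).
have E2 j k : iter j (@fdiff R) (rho A) k = Lam P (fun=> sh A) (fun=> fmass mu1 A) (fun=> fmass mu2 A)
    (fun v : unit -> R => v tt ^+ k * (1 - v tt) ^+ j).
  elim: j k => [|j IH] k.
    by rewrite /= E; apply: eq_Lam => v; rewrite expr0 mulr1.
  rewrite iterS /fdiff !IH -(LamB cp s0).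
  - by apply: eq_Lam => v; rewrite !exprS; ring.
  - apply: is_polyM; first exact: is_poly_coord.
    by apply: is_polyX; apply: is_polyB; [exact: is_poly_cst|exact: (@is_poly_coord R unit tt 1)].
  - apply: is_polyM; first exact: is_poly_coord.
    by apply: is_polyX; apply: is_polyB; [exact: is_poly_cst|exact: (@is_poly_coord R unit tt 1)].
split; last by move=> j k; rewrite E2; exact: (Lam_completely_monotone cp s0 bc).
move=> l; have /andP[p0 _] := bounded_corr tt l s0 cp.
rewrite E ger0_norm//.
have := Lam_contract0 cp s0 bc tt l (@is_poly_cst R unit 1).
rewrite (@eq_Lam _ _ _ _ _ _ _ _ (fun v => 1 ^+ 2) (fun=> 1)); last by move=> v; rewrite expr1n.
rewrite (Lam_cst cp s0); congr (_ <= _); apply: eq_Lam => v.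
by rewrite expr1n mulr1.
Qed.

Lemma crm_moment_seq_null A l : measurable A -> P0 A = 0%E -> u A l = 0.
Proof.
move=> mA A0; case: l => [|l]; first by rewrite /= /shape A0 mulr0.
rewrite /= (crm_coef_null_set c_gt0 gamma1 gamma2 mA A0).
apply: (cumulant_uniq (kap := fun=> 0)) => // n.
rewrite big1 => [|i _]; last by rewrite mul0r.
by case: n => [|n]; rewrite ?mul0r ?mulr0.
Qed.

Lemma crm_moment_seq_cm A : measurable A -> completely_monotone (u A).
Proof.
move=> mA j k; have [A0|A0] := boolP (0 < P0 A)%E; last first.
  have {}A0 : P0 A = 0%E by apply/eqP; rewrite eq_le measure_ge0 andbT leNgt.
  rewrite (_ : u A = fun=> 0) ?iter_fdiff0//.
  by apply/funext => l; exact: crm_moment_seq_null.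
have al0 : 0 < sh A by exact: shape_gt0.
set al := sh A in al0 *.
have hC l := cid2 (cumulant_approx (ltW al0) l).
(* Orders [1] to [k + j] enter the difference; order [0] has no error. *)
pose C := \sum_(l < k + j) s2val (hC l).
have Ci0 l : 0 <= s2val (hC l) by exact: (s2valP (hC l)).
have C0 : 0 <= C by apply: sumr_ge0 => l _.
(* Over [m + 1] equal pieces the main terms are completely monotone, and the errors [C a^2],
   amplified by [2^j], add up to [2^j C al^2 / (m + 1)]. *)
suff bnd m : - (2 ^+ j * C * al ^+ 2 * m.+1%:R^-1) <= iter j (@fdiff R) (u A) k.
  have lim0 : - (2 ^+ j * C * al ^+ 2 * m.+1%:R^-1) @[m --> \oo] --> (0 : R).
    rewrite -[X in _ --> X]oppr0; apply: cvgN.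
    rewrite -[X in _ --> X](mulr0 (2 ^+ j * C * al ^+ 2)); apply: cvgMl_tmp.
    exact: cvg_harmonic.
  rewrite -(cvg_lim (@Rhausdorff R) lim0); apply: limr_le; first by apply/cvg_ex; eexists; exact: lim0.
  exact: nearW.
have [B [mB tB UB PB]] := equal_partition sepX P0na m mA.
pose a := al / m.+1%:R.
have a0 : 0 < a by rewrite divr_gt0.
have B0 i : (0 < P0 (B i))%E.
  rewrite -(fineK (fin_num_measure P0 _ (mB i))) lte_fin PB divr_gt0// fine_gt0// A0/=.
  by rewrite ltey_eq fin_num_measure.
have shB i : sh (B i) = a by rewrite /shape PB mulrA.
have -> : u A = (fun l => \sum_(i < m.+1) u (B i) l).
  apply/funext => l; rewrite -(crm_moment_seq_sum c_gt0 gamma1 gamma2 canon12 indep12)//.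
  congr (u _ l); rewrite -UB -bigcup_mkord_ord; apply/seteqP; split => [x [i _ Bi]|x [i /= im Bi]].
    by exists i => //=; rewrite inord_val.
  by exists (inord i).
rewrite iter_fdiff_sum.
apply: (@le_trans _ _ (\sum_(i < m.+1) - (2 ^+ j * (C * a ^+ 2)))).
  rewrite sumr_const card_ord -mulr_natr /a.
  by rewrite le_eqVlt; apply/orP; left; apply/eqP; field; rewrite addrC natr1 pnatr_eq0.
apply: ler_sum => i _.
have [r1 rcm] := crm_corr_bounds (mB i) (B0 i).
pose e l := u (B i) l - a * rho (B i) l.
have -> : u (B i) = (fun l => a * rho (B i) l + e l).
  by apply/funext => l; rewrite /e addrC subrK.
rewrite iter_fdiffD iter_fdiffZ.
have el l : (l <= k + j)%N -> `|e l| <= C * a ^+ 2.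
  case: l => [_|l lkj].
    rewrite /e /= shB /rho risq0 crm_coef_at0 divr1 mulr1 subrr normr0.
    by rewrite mulr_ge0// sqr_ge0.
  apply: (@le_trans _ _ (s2val (hC l) * a ^+ 2)).
    rewrite /e; apply: (s2valP' (hC l)) => //.
    - exact: ltW.
    - by rewrite /a ler_pdivrMr// ler_peMr ?ler1n// ltW.
    - by rewrite /rho risq0 crm_coef_at0 divr1.
    rewrite (_ : (fun k => _) = cc (B i)); first exact: crm_moment_seq_logderiv.
    apply/funext => n; rewrite /rho shB mulrC divfK// gt_eqF// risq_gt0//.
  rewrite ler_wpM2r ?sqr_ge0//.
  rewrite /C (bigD1 (Ordinal lkj))//= lerDl sumr_ge0//.
have := iter_fdiff_bound el; rewrite ler_norml => /andP[h _].
apply: le_trans h _; rewrite lerDr mulr_ge0//; exact: ltW.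
Qed.

Lemma crm_moment_seq_ge0 A l : measurable A -> 0 <= u A l.
Proof. by move=> mA; exact: (crm_moment_seq_cm mA 0 l). Qed.

Lemma crm_moment_seq_le A l : measurable A -> u A l <= sh A.
Proof.
move=> mA; rewrite -/(u A 0%N); elim: l => [//|l]; apply: le_trans.
by rewrite -subr_ge0; exact: (crm_moment_seq_cm mA 1 l).
Qed.

(** A charge is a function on all sets, whereas the cumulants are controlled on measurable ones;
    hence the value [0] elsewhere. *)
Definition crm_moment_measure l (A : set (borel X)) : \bar R :=
  if `[<measurable A>] then (u A l)%:E else 0%E.

Let nuE l A : measurable A -> crm_moment_measure l A = (u A l)%:E.
Proof. by move=> mA; rewrite /crm_moment_measure asboolT. Qed.

Let nu0 l : crm_moment_measure l set0 = 0%E.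
Proof. by rewrite nuE// (crm_moment_seq0 c_gt0 gamma1 gamma2 canon12 indep12). Qed.

(** The value of the tail of a disjoint union is dominated through [crm_moment_seq_le] by its
    measure under [c P0], which tends to [0]. *)
Let nu_sigma_additive l : semi_sigma_additive (crm_moment_measure l).
Proof.
move=> F mF tF mUF; rewrite nuE//.
rewrite (_ : (fun n => _) = EFin \o (fun n => \sum_(0 <= i < n) u (F i) l)); last first.
  by apply/funext => n; rewrite /= -sumEFin; apply: eq_bigr => i _; rewrite nuE.
apply/cvg_EFin; first exact: nearW.
pose tl n := \bigcup_i F (n + i)%N.
have mtl n : measurable (tl n) by apply: bigcup_measurable.
have tlS n : tl n = F n `|` tl n.+1.
  apply/seteqP; split => [x [[|i] _ h]|x [h|[i _ h]]].
  - by left; rewrite addn0 in h.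
  - by right; exists i => //; rewrite addSnnS.
  - by exists 0%N => //; rewrite addn0.
  - by exists i.+1 => //; rewrite -addSnnS.
have tlD n : F n `&` tl n.+1 = set0.
  apply/seteqP; split => // x [Fn [i _ Fi]]; have := tF n (n.+1 + i)%N Logic.I Logic.I.
  by move=> /(_ (ex_intro _ x (conj Fn Fi))) e; have := leq_addr i n.+1; rewrite -e ltnn.
have tl0 : tl 0%N = \bigcup_i F i by [].
have key n k : \sum_(0 <= i < n) u (F i) k + u (tl n) k = u (\bigcup_i F i) k.
  elim: n => [|n IH]; first by rewrite big_nil add0r.
  rewrite big_nat_recr//= -addrA -(crm_moment_seqU c_gt0 gamma1 gamma2 canon12 indep12)//.
  by rewrite -tlS.
have lim_sh : \sum_(0 <= i < n) sh (F i) @[n --> \oo] --> sh (\bigcup_i F i).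
  have := @measure_semi_sigma_additive _ _ _ P0 F mF tF mUF.
  rewrite (_ : (fun n => _) = EFin \o (fun n => \sum_(0 <= i < n) fine (P0 (F i)))); last first.
    apply/funext => n; rewrite /= -sumEFin; apply: eq_bigr => i _.
    by rewrite fineK// fin_num_measure.
  move=> h0; have h : \sum_(0 <= i < n) fine (P0 (F i)) @[n --> \oo] --> fine (P0 (\bigcup_n F n)).
    have h1 : (EFin \o (fun n => \sum_(0 <= i < n) fine (P0 (F i)))) n @[n --> \oo] -->
        (fine (P0 (\bigcup_n F n)))%:E.
      by rewrite fineK; [exact: h0|exact: fin_num_measure].
    exact: (fine_cvg h1).
  rewrite (_ : (fun n => _) = (fun n => c * \sum_(0 <= i < n) fine (P0 (F i)))); last first.
    by apply/funext => n; rewrite mulr_sumr.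
  by apply: cvgMl_tmp; exact: h.
apply/cvgrPdist_le => e e0.
have /cvgrPdist_le/(_ e e0) := lim_sh; apply: filterS => n hn.
have -> : u (\bigcup_i F i) l - \sum_(0 <= i < n) u (F i) l = u (tl n) l.
  by rewrite -(key n l) addrAC subrr add0r.
rewrite ger0_norm ?crm_moment_seq_ge0//; apply: le_trans (crm_moment_seq_le l (mtl n)) _.
apply: le_trans hn; rewrite -[sh (\bigcup_i F i)](key n 0%N) addrAC subrr add0r.
exact: ler_norm.
Qed.

Let nu_fin l A : measurable A -> crm_moment_measure l A \is a fin_num.
Proof. by move=> mA; rewrite nuE. Qed.

Let ch l : {charge set (borel X) -> \bar R} :=
  HB.pack (crm_moment_measure l) (isCharge.Build _ _ _ (crm_moment_measure l) (nu0 l)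
    (@nu_fin l) (@nu_sigma_additive l)).

Lemma crm_moment_density l : exists q : borel X -> R, [/\ measurable_fun setT q,
  P0.-integrable setT (EFin \o q) &
  forall A, measurable A -> (\int[P0]_(x in A) (q x)%:E)%E = (u A l)%:E].
Proof.
have dom : ch l `<< P0.
  apply/null_content_dominatesP => A mA A0.
  by rewrite /= nuE// crm_moment_seq_null.
have ir := Radon_Nikodym_integrable dom.
have fr x : Radon_Nikodym (ch l) P0 x \is a fin_num by exact: Radon_Nikodym_fin_num.
have qE : EFin \o (fine \o Radon_Nikodym (ch l) P0) = Radon_Nikodym (ch l) P0.
  by apply/funext => x /=; rewrite fineK.
exists (fine \o Radon_Nikodym (ch l) P0); split.
- by apply/measurable_EFinP; rewrite qE; exact: measurable_int ir.
- by rewrite qE.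
move=> A mA; transitivity (\int[P0]_(x in A) Radon_Nikodym (ch l) P0 x)%E.
  by apply: eq_integral => x _ /=; rewrite fineK.
by rewrite -Radon_Nikodym_integral//= nuE.
Qed.

(** Over the set where [g < 0], the integral of [|g|] is at most [0], so [g] vanishes almost
    everywhere on it, a contradiction pointwise. *)
Lemma ae_ge0_of_integral (g : borel X -> R) : measurable_fun setT g ->
  P0.-integrable setT (EFin \o g) ->
  (forall A, measurable A -> (0 <= \int[P0]_(x in A) (g x)%:E)%E) ->
  {ae P0, forall x, 0 <= g x}.
Proof.
move=> mg ig g0; pose N := g @^-1` [set` `]-oo, 0[].
have mN : measurable N by rewrite -[N]setTI; exact: mg.
have Ng x : N x -> g x < 0 by rewrite /N /= in_itv.
have iN : P0.-integrable N (EFin \o g) by apply: integrableS ig.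
have e : (\int[P0]_(x in N) `|(g x)%:E| = 0)%E.
  have -> : (\int[P0]_(x in N) `|(g x)%:E| = - \int[P0]_(x in N) (g x)%:E)%E.
    rewrite -integralN/=; last by apply: integrable_add_def.
    apply: eq_integral => x; rewrite inE => /Ng gx /=.
    by rewrite ltr0_norm.
  apply/eqP; rewrite eq_le; apply/andP; split; last first.
    rewrite -integralN/=; last by apply: integrable_add_def.
    by apply: integral_ge0 => x /Ng gx; rewrite lee_fin oppr_ge0 ltW.
  by rewrite leeNl oppe0; exact: g0.
have /ae_eq_integral_abs h := e.
have {h} : ae_eq P0 N (EFin \o g) (cst 0%E).
  by apply: h => //; apply/measurable_EFinP; exact: measurable_funTS.
apply: filterS => x h; rewrite leNgt; apply/negP => gx.
have gx0 : g x = 0 by apply: EFin_inj; apply: h; rewrite /N /= in_itv.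
by rewrite gx0 ltxx in gx.
Qed.

(** Complete monotonicity consists of countably many inequalities between densities, each valid
    almost everywhere, hence all at once outside a null set. *)
Lemma crm_moment_kernel : exists q : nat -> borel X -> R, [/\
  forall l, measurable_fun setT (q l),
  forall x, completely_monotone (q ^~ x), forall x, q 0%N x = 1 &
  forall A l, measurable A -> c * fine (\int[P0]_(x in A) (q l x)%:E)%E = u A l].
Proof.
pose q0 l := sval (cid (crm_moment_density l)).
have hq l : [/\ measurable_fun setT (q0 l), P0.-integrable setT (EFin \o q0 l) &
    forall A, measurable A -> (\int[P0]_(x in A) (q0 l x)%:E)%E = (u A l)%:E].
  exact: svalP (cid (crm_moment_density l)).
pose D j k x := iter j (@fdiff R) (fun l => q0 l x) k.
have hD j k : [/\ measurable_fun setT (D j k), P0.-integrable setT (EFin \o D j k) &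
    forall A, measurable A -> (\int[P0]_(x in A) (D j k x)%:E)%E =
      (iter j (@fdiff R) (u A) k)%:E].
  elim: j k => [|j IH] k; first exact: hq.
  have [m1 i1 e1] := IH k; have [m2 i2 e2] := IH k.+1; split.
  - exact: measurable_funB.
  - by apply: (@integrableB _ _ _ P0 setT measurableT (EFin \o D j k) (EFin \o D j k.+1)).
  move=> A mA; rewrite iterS /fdiff EFinB -e1// -e2//.
  rewrite -integralB_EFin//; by apply: integrableS; [exact: measurableT|exact: mA| |].
have D0 j k : {ae P0, forall x, 0 <= D j k x}.
  have [m1 i1 e1] := hD j k; apply: ae_ge0_of_integral => // A mA.
  by rewrite e1// lee_fin crm_moment_seq_cm.
have q0c : {ae P0, forall x, q0 0%N x = c}.
  have [m1 i1 e1] := hq 0%N.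
  have ic : P0.-integrable setT (EFin \o (fun=> c)) by exact: finite_measure_integrable_cst.
  have icA k A : measurable A -> P0.-integrable A (EFin \o (fun=> k)).
    by move=> mA; apply: integrableS (finite_measure_integrable_cst P0 k measurableT).
  have e2 A : measurable A -> (\int[P0]_(x in A) c%:E = (u A 0%N)%:E)%E.
    by move=> mA; rewrite integral_cst//= /shape EFinM fineK// fin_num_measure.
  have h1 : {ae P0, forall x, 0 <= q0 0%N x - c}.
    apply: ae_ge0_of_integral.
    - exact: measurable_funB.
    - by apply: (@integrableB _ _ _ P0 setT measurableT (EFin \o q0 0%N) (EFin \o (fun=> c))).
    move=> A mA; under eq_integral do rewrite EFinB.
    rewrite integralB_EFin//; [|by apply: integrableS i1|exact: icA].
    by rewrite e1// e2// subee.
  have h2 : {ae P0, forall x, 0 <= c - q0 0%N x}.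
    apply: ae_ge0_of_integral.
    - exact: measurable_funB.
    - by apply: (@integrableB _ _ _ P0 setT measurableT (EFin \o (fun=> c)) (EFin \o q0 0%N)).
    move=> A mA; under eq_integral do rewrite EFinB.
    rewrite integralB_EFin//; [|exact: icA|by apply: integrableS i1].
    by rewrite e1// e2// subee.
  by apply: filterS2 h1 h2 => x; rewrite !subr_ge0 => h1' h2'; apply/eqP; rewrite eq_le h1' h2'.
pose S := [set x | (forall j k, 0 <= D j k x) /\ q0 0%N x = c].
have mS : measurable S.
  have -> : S = (\bigcap_j \bigcap_k (D j k @^-1` [set` `[0, +oo[])) `&` (q0 0%N @^-1` [set c]).
    apply/seteqP; split => [x [h1 h2]|x [h1 h2]].
      by split => // j _ k _; rewrite /= in_itv/= andbT.
    by split => // j k; have := h1 j Logic.I k Logic.I; rewrite /= in_itv/= andbT.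
  apply: measurableI.
    apply: bigcap_measurable => // j _; apply: bigcap_measurable => // k _.
    by have [m1 _ _] := hD j k; rewrite -[_ @^-1` _]setTI; exact: m1.
  by have [m1 _ _] := hq 0%N; rewrite -[_ @^-1` _]setTI; exact: m1.
have aeS : {ae P0, forall x, S x}.
  have h : {ae P0, forall x, forall j k, 0 <= D j k x}.
    by apply/ae_foralln => j; apply/ae_foralln => k; exact: D0.
  by apply: filterS2 h q0c.
(* Outside [S] the constant sequence [1], the moments of the Dirac mass at [1], keeps the pointwise
   properties; division by [c] makes the moment of order [0] equal to [1]. *)
exists (fun l x => if x \in S then q0 l x / c else 1); split.
- move=> l; have [m1 _ _] := hq l; apply: measurable_fun_ifT.
  + by apply: (measurable_fun_bool true); rewrite setTI (_ : _ @^-1` _ = S)//;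
      apply/seteqP; split => x /=; [exact: set_mem|exact: mem_set].
  + by apply: measurable_funM.
  + exact: measurable_cst.
- move=> x; have [xS|xS] := boolP (x \in S); last exact: completely_monotone_const.
  move=> j k; rewrite (_ : (fun l => _) = (fun l => c^-1 * q0 l x)); last first.
    by apply/funext => l; rewrite mulrC.
  rewrite iter_fdiffZ mulr_ge0 ?invr_ge0 ?(ltW c_gt0)//.
  by move: xS; rewrite inE => -[h _]; exact: h.
- by move=> x; case: ifPn => //; rewrite inE => -[_ ->]; rewrite divff// gt_eqF.
move=> A l mA; have [m1 i1 e1] := hq l.
have -> : (\int[P0]_(x in A) (if x \in S then q0 l x / c else 1)%:E =
    \int[P0]_(x in A) (c^-1%:E * (q0 l x)%:E))%E.
  apply: ae_eq_integral => //.
  - apply/measurable_EFinP; apply: measurable_funTS; apply: measurable_fun_ifT.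
    + by apply: (measurable_fun_bool true); rewrite setTI (_ : _ @^-1` _ = S)//;
        apply/seteqP; split => x /=; [exact: set_mem|exact: mem_set].
    + by apply: measurable_funM.
    + exact: measurable_cst.
  - apply: measurable_funTS; apply: (@emeasurable_funM _ _ _ setT (fun=> c^-1%:E) (fun x => (q0 l x)%:E)) => //.
    exact/measurable_EFinP.
  - by apply: filterS aeS => x xS _; rewrite mem_set// mulrC EFinM.
rewrite integralZl//; last by apply: integrableS i1.
by rewrite e1//= mulrA mulfV ?mul1r// gt_eqF.
Qed.

End necessity_monotone.

(** * The Hausdorff moment problem, with measurable dependence on a parameter *)

Section riemann.
Context d (T : measurableType d) (R : realType) (P : probability T R) (V : T -> R).
Hypotheses (mV : measurable_fun setT V)
  (VP : forall t, 0 <= t <= 1 -> P [set x | V x <= t] = t%:E).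

Lemma monotone_finite_moments (g : R -> R) : {homo g : x y / x <= y} ->
  (forall v, 0 <= g v <= 1) -> finite_moments P (fun x => g (V x)).
Proof.
move=> gh g01; apply: (@finite_moments_le _ _ _ P _ (fun=> 1)); last exact: finite_moments_cst.
  by apply: (measurableT_comp (f := g)) => //; exact: nondecreasing_measurable.
by move=> x; have /andP[g0 g1] := g01 (V x); rewrite ger0_norm.
Qed.

(** On equal pieces [V] lies between consecutive points [i / (m + 1)]; on the first and last piece,
    where one bound on [V] is missing, [0 <= g <= 1] replaces it. *)
Lemma riemann_sum_bounds (g : R -> R) m : {homo g : x y / x <= y} ->
  (forall v, 0 <= g v <= 1) ->
  (\sum_(i < m) g (i.+1%:R / m.+1%:R)) / m.+1%:R <= \int[P]_x g (V x) <=
  (\sum_(i < m) g (i.+1%:R / m.+1%:R)) / m.+1%:R + m.+1%:R^-1.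
Proof.
move=> gh g01.
have UP t : 0 <= t -> (t%:E <= P [set: T])%E -> P (setT `&` [set x | V x <= t]) = t%:E.
  by move=> t0; rewrite probability_setT lee_fin setTI => t1; apply: VP; rewrite t0.
have [B [mB tB UB PB ordB]] := uniform_partition m measurableT mV UP.
rewrite probability_setT /= in PB ordB.
have fB i : finite_moments P (fun x => \1_(B i) x : R).
  by have := @finite_moments_indic _ _ _ P _ _ id (B i) (@measurable_id _ _ _) (mB i).
have EB i : \int[P]_x (\1_(B i) x : R) = m.+1%:R^-1.
  by rewrite /Rintegral integral_indic// setIT PB mul1r.
have exB x : exists i, B i x.
  by have : setT x by []; rewrite -UB => -[i _ Bi]; exists i.
have pick (b : nat -> R) x i : B i x -> \sum_(j < m.+1) b j * (\1_(B j) x : R) = b i.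
  move=> Bi; rewrite (bigD1 i)//= indicE mem_set// mulr1 big1 ?addr0// => j ji.
  rewrite indicE memNset ?mulr0// => Bj; move/eqP: ji; apply.
  by apply: tB => //; exists x.
have Eb (b : nat -> R) : \int[P]_x (\sum_(j < m.+1) b j * (\1_(B j) x : R)) = (\sum_(j < m.+1) b j) / m.+1%:R.
  rewrite Ex_sum; last by move=> j _; exact: finite_momentsZ.
  by rewrite mulr_suml; apply: eq_bigr => j _; rewrite ExZ// EB.
have fb (b : nat -> R) : finite_moments P (fun x => \sum_(j < m.+1) b j * (\1_(B j) x : R)).
  by apply: finite_moments_sum => j _; exact: finite_momentsZ.
have fg := monotone_finite_moments gh g01.
pose lo i := if i == 0%N then 0 else g (i%:R / m.+1%:R).
pose hi i := if i == m then 1 else g (i.+1%:R / m.+1%:R).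
apply/andP; split.
  apply: (@le_trans _ _ (\int[P]_x (\sum_(j < m.+1) lo j * (\1_(B j) x : R)))).
    by rewrite Eb big_ord_recl /= add0r.
  apply: le_Ex => // x; have [i Bi] := exB x; rewrite (pick _ _ _ Bi) /lo.
  have [h _] := ordB i x Bi; case: ifPn => [_|i0]; first by have /andP[] := g01 (V x).
  by apply: gh; apply: ltW; have := h i0; rewrite mul1r.
apply: (@le_trans _ _ (\int[P]_x (\sum_(j < m.+1) hi j * (\1_(B j) x : R)))); last first.
  rewrite Eb big_ord_recr /= /hi eqxx mulrDl mul1r lerD2r ler_wpM2r ?invr_ge0//.
  by apply: ler_sum => i _; rewrite ltn_eqF.
apply: le_Ex => // x; have [i Bi] := exB x; rewrite (pick _ _ _ Bi) /hi.
have [_ h] := ordB i x Bi; case: ifPn => [_|im]; first by have /andP[] := g01 (V x).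
by apply: gh; have := h im; rewrite mul1r.
Qed.

(** The number of partial sums below [V] equals [k] with probability [w k]: a quantile
    representation of the weights [w]. *)
Lemma step_law (f : nat -> R) (w : nat -> R) n : (forall k, 0 <= w k) ->
  \sum_(k < n.+1) w k = 1 ->
  \int[P]_x f (\sum_(k < n) ((\sum_(j < k.+1) w j)%R < V x)%R)%N = \sum_(k < n.+1) f k * w k.
Proof.
move=> w0 w1; pose W k := \sum_(j < k) w j.
have Wh k l : (k <= l)%N -> W k <= W l.
  move=> kl; rewrite /W -(subnK kl) addnC; elim: (l - k)%N => [|i IH]; first by rewrite addn0.
  by rewrite addnS big_ord_recr /= (le_trans IH)// lerDl.
have W01 k : (k <= n.+1)%N -> 0 <= W k <= 1.
  move=> kn; rewrite -w1 (Wh k n.+1 kn) andbT; apply: sumr_ge0 => j _; exact: w0.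
(* The comparisons are decreasing in [k], so a function of their number telescopes into a
   combination of single indicators; Abel summation undoes this after integration. *)
have count (b : nat -> bool) m : (forall k l, (k <= l)%N -> b l -> b k) ->
    f (\sum_(k < m) b k)%N = f 0%N + \sum_(k < m) (f k.+1 - f k) * (b k)%:R.
  move=> bh; elim: m => [|m IH]; first by rewrite !big_ord0 addr0.
  rewrite !big_ord_recr /=; case bm: (b m); last by rewrite addn0 mulr0 addr0.
  have e k : (k <= m)%N -> b k by move=> km; apply: bh bm.
  have s k : (k <= m)%N -> (\sum_(i < k) b i)%N = k.
    elim: k => [|k IHk] km; first by rewrite big_ord0.
    by rewrite big_ord_recr /= IHk ?(ltnW km)// (e k (ltnW km)) addn1.
  by rewrite addrA -IH s// addn1 mulr1 addrC subrK.
pose D k : set T := [set x | W k.+1 < V x].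
have PD k : (k < n)%N -> \int[P]_x (\1_(D k) x : R) = 1 - W k.+1.
  move=> kn; have mS : measurable [set x | V x <= W k.+1].
    rewrite -[X in measurable X]setTI (_ : [set x | _] = V @^-1` [set` `]-oo, W k.+1]]); first exact: mV.
    by apply/seteqP; split => x /=; rewrite in_itv.
  have -> : D k = ~` [set x | V x <= W k.+1].
    by apply/seteqP; split => x /=; rewrite /D /= ltNge => /negP.
  rewrite /Rintegral integral_indic//; last exact: measurableC.
  have e : P (~` [set x | V x <= W k.+1]%R) = (1 - P [set x | (V x <= W k.+1)%R])%E by exact: probability_setC.
  rewrite setIT; transitivity (fine (1 - P [set x | (V x <= W k.+1)%R])%E); first by congr fine; exact: e.
  by rewrite (VP (W01 k.+1 (leqW kn))).
have mD k : measurable (D k).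
  rewrite -[D k]setTI (_ : D k = V @^-1` [set` `]W k.+1, +oo[]); first exact: mV.
  by apply/seteqP; split => x /=; rewrite /D /= in_itv/= andbT.
have fD k : finite_moments P (fun x => \1_(D k) x : R).
  by have := @finite_moments_indic _ _ _ P _ _ id (D k) (@measurable_id _ _ _) (mD k).
transitivity (\int[P]_x (f 0%N + \sum_(k < n) (f k.+1 - f k) * (\1_(D k) x : R))).
  apply: eq_Ex => x; rewrite (count (fun k => W k.+1 < V x)).
    congr (_ + _); apply: eq_bigr => k _; congr (_ * _); rewrite indicE.
    by congr ((nat_of_bool _)%:R); apply/idP/idP; rewrite inE.
  by move=> k l kl; apply: le_lt_trans; apply: Wh.
rewrite ExD; [|exact: finite_moments_cst|by apply: finite_moments_sum => k _; exact: finite_momentsZ].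
rewrite Ex_cst Ex_sum; last by move=> k _; exact: finite_momentsZ.
have abel m : f 0%N + \sum_(k < m) (f k.+1 - f k) * (1 - W k.+1) =
    \sum_(k < m) f k * w k + f m * (1 - W m).
  elim: m => [|m IH]; first by rewrite !big_ord0 /W big_ord0 subr0 mulr1 add0r addr0.
  rewrite big_ord_recr addrA IH big_ord_recr /= /W !big_ord_recr /=; ring.
transitivity (f 0%N + \sum_(k < n) (f k.+1 - f k) * (1 - W k.+1)).
  by congr (_ + _); apply: eq_bigr => k _; rewrite ExZ// PD.
rewrite abel [RHS]big_ord_recr /=; congr (_ + _ * _).
by rewrite -w1 big_ord_recr /= /W addrAC subrr add0r.
Qed.

End riemann.

(** * Bernstein weights of a completely monotone sequence *)

Section bernstein.
Context (R : realType) (u : nat -> R).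
Hypotheses (ucm : completely_monotone u) (u0 : u 0%N = 1).

(** For moments this is the integral of [s^l = s^l (s + (1 - s))^m]. *)
Lemma fdiff_binomial m l :
  u l = \sum_(i < m.+1) 'C(m, i)%:R * iter (m - i) (@fdiff R) u (l + i)%N.
Proof.
elim: m l => [|m IH] l; first by rewrite big_ord1 bin0 mul1r addn0.
have splitk k : iter (m - k) (@fdiff R) u (l + k)%N =
    iter (m - k).+1 (@fdiff R) u (l + k)%N + iter (m - k) (@fdiff R) u (l + k).+1.
  by rewrite iterS /fdiff subrK.
rewrite IH; under eq_bigr => i _ do rewrite splitk mulrDr.
rewrite big_split /= [RHS]big_ord_recl /= ?subn0 ?addn0 ?bin0.
rewrite [X in _ = _ + X](eq_bigr (fun i : 'I_m.+1 =>
    'C(m, i.+1)%:R * iter (m - i) (@fdiff R) u (l + i).+1 +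
    'C(m, i)%:R * iter (m - i) (@fdiff R) u (l + i).+1)); last first.
  by move=> i _; rewrite /bump /= add1n binS natrD mulrDl subSS addnS.
rewrite big_split /= addrA; congr (_ + _).
rewrite [LHS]big_ord_recl /= ?subn0 ?addn0 ?bin0; congr (_ + _).
rewrite [RHS]big_ord_recr /= bin_small// mul0r addr0.
apply: eq_bigr => i _; rewrite /bump /= add1n addnS.
by rewrite -iterS -subSn// subSS.
Qed.

(** For the moments of a law on [[0,1]], the integral of the Bernstein polynomial of degree [n] and
    index [k]. *)
Definition bernstein_weight n k : R := 'C(n, k)%:R * iter (n - k) (@fdiff R) u k.

Lemma bernstein_weight_ge0 n k : 0 <= bernstein_weight n k.
Proof. by rewrite mulr_ge0. Qed.

Lemma bernstein_weight_sum n : \sum_(k < n.+1) bernstein_weight n k = 1.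
Proof. by rewrite -u0 (fdiff_binomial n 0). Qed.

(** Factorial moments are exact, as for a binomial law mixed over its parameter. *)
Lemma bernstein_factorial_moment n l : (l <= n)%N ->
  \sum_(k < n.+1) bernstein_weight n k * (k ^_ l)%:R = u l * (n ^_ l)%:R.
Proof.
move=> ln; rewrite (fdiff_binomial (n - l) l) mulr_suml.
rewrite -(big_mkord xpredT (fun k => bernstein_weight n k * (k ^_ l)%:R)).
rewrite (big_cat_nat _ (n := l))//=; last by rewrite ltnW.
rewrite big_nat big1 ?add0r => [|k /andP[_ kl]]; last by rewrite ffact_small// mulr0.
rewrite -{1}[l]add0n big_addn subSn// big_mkord; apply: eq_bigr => i _.
have il : (i <= n - l)%N by rewrite -ltnS.
have iln : (l + i <= n)%N by rewrite -leq_subRL.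
have pos : (0 < i`! * (n - (l + i))`!)%N by rewrite muln_gt0 !fact_gt0.
have e1 := bin_fact iln; have e2 := ffact_fact (leq_addr i l); rewrite addKn in e2.
have e3 := bin_fact il; have e4 := ffact_fact ln.
have e5 : (n - l - i = n - (l + i))%N by rewrite subnDA.
rewrite e5 in e3.
have id : ('C(n, l + i) * (l + i) ^_ l = 'C(n - l, i) * n ^_ l)%N.
  apply/eqP; rewrite -(eqn_pmul2r pos); apply/eqP.
  transitivity n`!; first by rewrite -e1 -e2 !mulnA.
  by rewrite -e4 -e3 mulnCA -mulnA.
rewrite /bernstein_weight [(i + l)%N]addnC -e5.
transitivity (iter (n - l - i) (@fdiff R) u (l + i)%N * ('C(n, l + i) * (l + i) ^_ l)%:R).
  by rewrite natrM; ring.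
by rewrite id natrM; ring.
Qed.

(** From [l] to [l + 1] the two terms are multiplied by [(k - l) / (n - l)] and by [k / n], which
    differ by at most [L / (n - L)]. The fixed [L] makes the increment the same at every step. *)
Lemma factorial_ratio_bound n k L l : (L < n)%N -> (k <= n)%N -> (l <= L)%N ->
  `|(k ^_ l)%:R / (n ^_ l)%:R - (k%:R / n%:R) ^+ l| <= l%:R * (L%:R / (n - L)%:R) :> R.
Proof.
move=> Ln kn; have n0 : 0 < n%:R :> R by rewrite ltr0n (leq_ltn_trans _ Ln).
have nL0 : 0 < (n - L)%:R :> R by rewrite ltr0n subn_gt0.
have x0 : 0 <= k%:R / n%:R :> R by rewrite divr_ge0.
have x1 : k%:R / n%:R <= 1 :> R by rewrite ler_pdivrMr// mul1r ler_nat.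
elim: l => [|l IH] lL; first by rewrite !ffactn0 divr1 expr0 subrr normr0 mul0r.
have {}IH := IH (ltnW lL); set b := L%:R / (n - L)%:R in IH *.
have b0 : 0 <= b by rewrite divr_ge0// ltW.
have ln : (l < n)%N by apply: leq_trans Ln; apply: leqW.
have nl0 : 0 < (n - l)%:R :> R by rewrite ltr0n subn_gt0.
have ff0 : (n ^_ l)%:R != 0 :> R by rewrite pnatr_eq0 -lt0n ffact_gt0 ltnW.
rewrite !ffactnSr !natrM exprSr.
set r := (k ^_ l)%:R / (n ^_ l)%:R in IH *; set x := k%:R / n%:R in x0 x1 IH *.
have -> : (k ^_ l)%:R * (k - l)%:R / ((n ^_ l)%:R * (n - l)%:R) = r * ((k - l)%:R / (n - l)%:R).
  by rewrite /r; field; rewrite ff0 gt_eqF.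
set y := (k - l)%:R / (n - l)%:R.
have y0 : 0 <= y by rewrite divr_ge0.
(* For [k < l] the natural subtraction [k - l] truncates, but there the factorial ratio is already
   [0]. *)
have [kl|lk] := ltnP k l.
  have r0 : r = 0 by rewrite /r ffact_small// mul0r.
  rewrite r0 mul0r sub0r normrN; apply: (@le_trans _ _ (`|x ^+ l|)).
    by rewrite normrM ler_piMr// ger0_norm.
  move: IH; rewrite r0 sub0r normrN => /le_trans; apply.
  by rewrite ler_wpM2r// ler_nat.
have y1 : y <= 1 by rewrite ler_pdivrMr// mul1r ler_nat leq_sub2r.
have xy : `|x - y| <= b.
  have -> : x - y = l%:R * (n - k)%:R / (n%:R * (n - l)%:R).
    have nl : n%:R - l%:R != 0 :> R by rewrite -natrB ?(ltnW ln)// gt_eqF.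
    have nn : n%:R != 0 :> R by rewrite gt_eqF.
    by rewrite /x /y !natrB// ?(ltnW ln)//; field; rewrite nl nn.
  rewrite ger0_norm ?divr_ge0 ?mulr_ge0//.
  apply: (@le_trans _ _ (l%:R / (n - l)%:R)).
    rewrite -[X in _ <= X](_ : l%:R * n%:R / (n%:R * (n - l)%:R) = _); last first.
      by field; rewrite !gt_eqF.
    apply: ler_wpM2r; first by rewrite invr_ge0 mulr_ge0.
    by rewrite -!natrM ler_nat leq_mul2l leq_subr orbT.
  rewrite /b ler_pdivrMr// mulrAC ler_pdivlMr// -!natrM ler_nat.
  by apply: leq_mul; [exact: ltnW|rewrite leq_sub2l// ltnW].
have -> : r * y - x ^+ l * x = (r - x ^+ l) * y - x ^+ l * (x - y) by ring.
apply: le_trans (ler_normB _ _) _; have -> : l.+1%:R * b = l%:R * b + b by rewrite -natr1 mulrDl mul1r.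
apply: lerD.
  by rewrite normrM (ger0_norm y0); apply: le_trans IH; rewrite ler_piMr.
rewrite normrM ger0_norm ?exprn_ge0//; apply: le_trans xy.
by rewrite ler_piMl// exprn_ile1.
Qed.

Lemma bernstein_moment_cvg l :
  \sum_(k < n.+1) (k%:R / n%:R) ^+ l * bernstein_weight n k @[n --> \oo] --> u l.
Proof.
pose b n : R := l%:R * (l%:R / (n - l)%:R).
have bc : b n @[n --> \oo] --> (0 : R).
  rewrite -(cvg_shiftn l.+1) /b.
  rewrite (_ : (fun n => _) = (fun n => (l%:R * l%:R) * n.+1%:R^-1)); last first.
    by apply/funext => n; rewrite mulrA addnS subSn ?leq_addl// addnK.
  have h : (l%:R * l%:R) * n.+1%:R^-1 @[n --> \oo] --> (l%:R * l%:R) * (0 : R).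
    by apply: cvgMl_tmp; exact: cvg_harmonic.
  by rewrite mulr0 in h.
apply/cvgrPdist_le => e e0.
have /cvgrPdist_le/(_ e e0) := bc.
move=> h; near=> n.
have ln : (l < n)%N by near: n; exact: nbhs_infty_gt.
have hn : `|0 - b n| <= e by near: n.
have ff0 : (n ^_ l)%:R != 0 :> R by rewrite pnatr_eq0 -lt0n ffact_gt0 ltnW.
have -> : u l = \sum_(k < n.+1) ((k ^_ l)%:R / (n ^_ l)%:R) * bernstein_weight n k.
  apply: (mulIf ff0); rewrite -bernstein_factorial_moment ?(ltnW ln)// mulr_suml.
  by apply: eq_bigr => k _; field.
rewrite -sumrB; apply: le_trans (ler_norm_sum _ _ _) _.
apply: (@le_trans _ _ (\sum_(k < n.+1) b n * bernstein_weight n k)).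
  apply: ler_sum => k _; rewrite -mulrBl normrM (ger0_norm (bernstein_weight_ge0 _ _)).
  rewrite ler_wpM2r ?bernstein_weight_ge0//.
  by apply: factorial_ratio_bound => //; rewrite -ltnS.
rewrite -mulr_sumr bernstein_weight_sum mulr1.
by apply: le_trans hn; rewrite sub0r normrN ler_norm.
Unshelve. all: by end_near.
Qed.

End bernstein.

Section hausdorff.
Context d (T : measurableType d) (R : realType) (P : probability T R) (V : T -> R).
Hypotheses (mV : measurable_fun setT V)
  (VP : forall t, 0 <= t <= 1 -> P [set x | V x <= t] = t%:E).
Context (u : nat -> R).
Hypotheses (ucm : completely_monotone u) (u0 : u 0%N = 1).

Let W n k := \sum_(j < k) bernstein_weight u n j.
Let Xn n (v : R) : R := (\sum_(k < n) (W n k.+1 < v)%R)%N%:R / n%:R.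

Let Xn01 n v : 0 <= Xn n v <= 1.
Proof.
rewrite /Xn divr_ge0//=; case: n => [|n]; first by rewrite invr0 mulr0.
rewrite ler_pdivrMr// mul1r ler_nat -[leqRHS]card_ord -sum1_card leq_sum// => k _.
exact: leq_b1.
Qed.

Let Xn_homo n : {homo Xn n : x y / x <= y}.
Proof.
move=> x y xy; rewrite /Xn ler_wpM2r ?invr_ge0// ler_nat leq_sum// => k _.
by case h: (_ < x)%R => //; rewrite (lt_le_trans h xy).
Qed.

(* [Xn n (V x)] has the Bernstein law of order [n]; being monotone functions of [V], these have
   pointwise limits along an ultrafilter, which need no subsequence extraction, and Riemann sums
   control the integral of the limit. *)
Lemma moment_variable_exists : exists Y : R -> R, [/\ {homo Y : x y / x <= y},
  forall v, 0 <= Y v <= 1 & forall l, \int[P]_x (Y (V x) ^+ l) = u l].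
Proof.
have [U [Uu UU]] := ultraFilterLemma (@eventually_filter).
have PU : ProperFilter U by apply: ultra_proper.
have lim v : exists y : R, 0 <= y <= 1 /\ Xn n v @[n --> U] --> y.
  have h := @segment_compact R 0 1 (fmap (Xn ^~ v) U).
  have hU : U ((Xn ^~ v) @^-1` [set` `[0, 1]]).
    by apply: filterE => n; rewrite /= in_itv /=; exact: Xn01.
  have [y [y01 hy]] := h _ hU; exists y; split; first by rewrite /= in_itv/= in y01.
  move=> N yN; have [//|UN] := in_ultra_setVsetC (Xn ^~ v @^-1` N) Uu.
  by have [z [zN Nz]] := hy (~` N) N UN yN.
pose Y v := sval (cid (lim v)).
have YP v : 0 <= Y v <= 1 /\ Xn n v @[n --> U] --> Y v by exact: svalP (cid (lim v)).
have Yh : {homo Y : x y / x <= y}.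
  move=> x y xy; have [_ hx] := YP x; have [_ hy] := YP y.
  rewrite -(cvg_lim (@Rhausdorff R) hx) -(cvg_lim (@Rhausdorff R) hy).
  apply: ler_lim; [by apply/cvg_ex; eexists; exact: hx|by apply/cvg_ex; eexists; exact: hy|].
  by apply: filterE => n; exact: Xn_homo.
have pw (Z : R -> R) l : {homo Z : x y / x <= y} -> (forall v, 0 <= Z v <= 1) ->
    {homo (fun v => Z v ^+ l) : x y / x <= y} /\ forall v, 0 <= Z v ^+ l <= 1.
  move=> Zh Z01; split => [x y xy|v].
    have /andP[a _] := Z01 x; have /andP[b _] := Z01 y.
    by rewrite lerXn2r ?nnegrE//; exact: Zh.
  by have /andP[a b] := Z01 v; rewrite exprn_ge0//= exprn_ile1.
exists Y; split => // [v|l]; first by have [] := YP v.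
have Y01 v : 0 <= Y v <= 1 by have [] := YP v.
pose S (Z : R -> R) m := (\sum_(i < m) Z (i.+1%:R / m.+1%:R) ^+ l) / m.+1%:R.
have SE (Z : R -> R) m : {homo Z : x y / x <= y} -> (forall v, 0 <= Z v <= 1) ->
    S Z m <= \int[P]_x (Z (V x) ^+ l) <= S Z m + m.+1%:R^-1.
  move=> Zh Z01; have [h1 h2] := pw Z l Zh Z01.
  exact: (riemann_sum_bounds mV VP m h1 h2).
have Mn : \int[P]_x (Xn n (V x) ^+ l) @[n --> U] --> u l.
  have h := @bernstein_moment_cvg _ _ ucm u0 l.
  rewrite (_ : (fun n => \int[P]_x (Xn n (V x) ^+ l)) =
     (fun n => \sum_(k < n.+1) (k%:R / n%:R) ^+ l * bernstein_weight u n k)).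
    by move=> N /h hN; exact: UU.
  apply/funext => n.
  have := step_law mV VP (fun k => (k%:R / n%:R) ^+ l) (fun k => bernstein_weight_ge0 ucm n k)
    (bernstein_weight_sum u0 n).
  by move=> <-.
have SU m : S (Xn n) m @[n --> U] --> S Y m.
  have hi (i : 'I_m) : Xn n (i.+1%:R / m.+1%:R) ^+ l @[n --> U] --> Y (i.+1%:R / m.+1%:R) ^+ l.
    have [_ h] := YP (i.+1%:R / m.+1%:R).
    elim: l {pw Mn SE S} => [|k IH]; first by under eq_cvg do rewrite expr0; exact: cvg_cst.
    by under eq_cvg do rewrite exprS; rewrite exprS; exact: cvgM.
  by apply: cvgMr_tmp; apply: cvg_big => //; exact: add_continuous.
(* The Riemann bounds hold for all [n] with the same error [1 / (m + 1)], so they pass to the limit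
   along [U] at fixed [m]. *)
have bnd m : S Y m <= u l <= S Y m + m.+1%:R^-1.
  have c1 := cvg_lim (@Rhausdorff R) (SU m); have c2 := cvg_lim (@Rhausdorff R) Mn.
  have SU' : S (Xn n) m + m.+1%:R^-1 @[n --> U] --> S Y m + m.+1%:R^-1.
    by apply: cvgD; [exact: SU|exact: cvg_cst].
  apply/andP; split.
    rewrite -c1 -c2; apply: ler_lim.
    - by apply/cvg_ex; eexists; exact: SU.
    - by apply/cvg_ex; eexists; exact: Mn.
    - by apply: filterE => n; have /andP[] := SE (Xn n) m (@Xn_homo n) (Xn01 n).
  rewrite -(cvg_lim (@Rhausdorff R) SU') -c2; apply: ler_lim.
  - by apply/cvg_ex; eexists; exact: Mn.
  - by apply/cvg_ex; eexists; exact: SU'.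
  - by apply: filterE => n; have /andP[] := SE (Xn n) m (@Xn_homo n) (Xn01 n).
have diff m : `|\int[P]_x (Y (V x) ^+ l) - u l| <= m.+1%:R^-1.
  have /andP[a1 a2] := bnd m; have /andP[b1 b2] := SE Y m Yh Y01.
  move: a1 a2 b1 b2; move: (m.+1%:R^-1) (S Y m) (\int[P]_x (Y (V x) ^+ l)) => e1 e2 e3.
  by move=> a1 a2 b1 b2; rewrite ler_norml; apply/andP; split; lra.
apply/eqP; rewrite -subr_eq0 -normr_le0; apply/ler_addgt0Pr => e e0; rewrite add0r.
have : \forall k \near \oo, k.+1%:R^-1 < e :> R.
  by apply: (cvgr_lt (0 : R)) => //; exact: cvg_harmonic.
by move=> [N _ /(_ N (leqnn N))] /ltW; exact: le_trans.
Qed.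

End hausdorff.

Section unit_interval_valued.
Context d (T : measurableType d) (R : realType).
Local Notation I01 := (borel (unit_itv R)).

(** Open sets of the unit interval are traces of open sets of the line; [W] is the union of all
    intervals whose trace lies in [U]. *)
Lemma measurable_to_itv (f : T -> I01) :
  measurable_fun setT (fun x => sval (f x) : R) -> measurable_fun setT f.
Proof.
move=> mf; apply: (@measurability _ _ T I01 setT f (@open (unit_itv R)) erefl) => _ [U oU <-]; rewrite setTI.
pose W : set R := \bigcup_(p in [set p : R * R | forall z : unit_itv R, `|p.1 - sval z| < p.2 -> U z])
  [set y | `|p.1 - y| < p.2].
have oW : open W.
  apply: bigcup_open => p _; have -> : [set y | `|p.1 - y| < p.2] = ball p.1 p.2 by [].
  exact: ball_open.
have -> : f @^-1` U = (fun x => sval (f x) : R) @^-1` W.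
  apply/seteqP; split => x /=.
    move=> Ufx; have := oU; rewrite openE => /(_ _ Ufx) /nbhs_ballP[e /= e0 he].
    exists (sval (f x), e) => /=; last by rewrite subrr normr0.
    by move=> z hz; apply: he; rewrite -metricType_numDomainType.ball_mdistE.
  by move=> [p hp hx]; exact: hp.
by rewrite -[_ @^-1` _]setTI; apply: mf => //; exact: open_measurable.
Qed.

End unit_interval_valued.

Section unit_interval_sets.
Context (R : realType).
Local Notation I01 := (borel (unit_itv R)).

Definition itv_le (r : R) : set I01 := [set s | sval s <= r].

Lemma measurable_itv_le r : measurable (itv_le r).
Proof.
rewrite -[itv_le r]setTI (_ : itv_le r = (fun x : I01 => sval x : R) @^-1` [set` `]-oo, r]]).
  exact: measurable_sval_itv.
by apply/seteqP; split => x /=; rewrite in_itv.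
Qed.

Lemma itv_le_generate : (@measurable _ I01) = <<s [set itv_le r | r in [set: R]] >>.
Proof.
apply/seteqP; split => [U mU|]; last first.
  apply: smallest_sub; first exact: sigma_algebra_measurable.
  by move=> _ [r _ <-]; exact: measurable_itv_le.
(* On the same points with the smaller sigma-algebra [T'], the identity into the Borel space is
   measurable by [measurable_to_itv]. *)
pose T' := g_sigma_algebraType [set itv_le r | r in [set: R]].
have h : measurable_fun [set: T'] (fun x : T' => sval (x : I01) : R).
  apply: (measurability (@RGenOInfty.G R)); first exact: RGenOInfty.measurableE.
  move=> _ [_ [r ->] <-]; rewrite setTI (_ : _ @^-1` _ = ~` (itv_le r : set T')).
    by apply: measurableC; apply: sub_sigma_algebra; exists r.
  by apply/seteqP; split => x; rewrite /itv_le /= in_itv/= andbT ltNge => /negP.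
have := @measurable_to_itv _ T' R (fun x : T' => x : I01) h measurableT U mU.
by rewrite setTI.
Qed.

Lemma itv_le_setI_closed : setI_closed [set itv_le r | r in [set: R]].
Proof.
move=> _ _ [r _ <-] [s _ <-]; exists (Num.min r s) => //.
by apply/seteqP; split => x; rewrite /itv_le /= le_min => /andP.
Qed.

End unit_interval_sets.

Section prob_kernel_of.
Context d d' (X : measurableType d) (Y : measurableType d') (R : realType)
  (m : X -> probability Y R).

Definition prob_kernel_of
  (mm : forall U, measurable U -> measurable_fun [set: X] (fun x => m x U)) :
  X -> {measure set Y -> \bar R} := fun x => m x.

Hypothesis mm : forall U, measurable U -> measurable_fun [set: X] (fun x => m x U).

HB.instance Definition _ := isKernel.Build _ _ X Y R (prob_kernel_of mm) mm.

Let prob_kernel_of_setT x : prob_kernel_of mm x [set: Y] = 1%E.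
Proof. exact: probability_setT. Qed.

HB.instance Definition _ :=
  Kernel_isProbability.Build _ _ X Y R (prob_kernel_of mm) prob_kernel_of_setT.

End prob_kernel_of.

(** * A measurable family of solutions of the moment problem *)

Section hausdorff_kernel.
Context d (T : measurableType d) (R : realType) (P : probability T R) (V : T -> R).
Hypotheses (mV : measurable_fun setT V)
  (VP : forall t, 0 <= t <= 1 -> P [set x | V x <= t] = t%:E).
Local Notation I01 := (borel (unit_itv R)).

Lemma hausdorff_moment (u : nat -> R) : completely_monotone u -> u 0%N = 1 ->
  exists m : probability I01 R, forall l, \int[m]_s ((sval s : R) ^+ l) = u l.
Proof.
move=> ucm u0; have [Y [Yh Y01 Yu]] := moment_variable_exists mV VP ucm u0.
pose f x : I01 := exist _ (Y (V x)) (Y01 (V x)).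
have mf : measurable_fun setT f.
  apply: measurable_to_itv => /=; apply: (measurableT_comp (f := Y)) => //.
  exact: nondecreasing_measurable.
pose F : {mfun T >-> I01} := HB.pack f (isMeasurableFun.Build _ _ _ _ f mf).
exists (distribution P F) => l; rewrite -Yu.
have ms : measurable_fun setT (fun s : I01 => ((sval s : R) ^+ l)%:E).
  by apply/measurable_EFinP; apply: measurable_funX; exact: measurable_sval_itv.
rewrite /Rintegral ge0_integral_pushforward//.
by move=> s _; rewrite lee_fin exprn_ge0//; have /andP[] := svalP s.
Qed.

Context d' (X : measurableType d') (q : nat -> X -> R).
Hypotheses (mq : forall l, measurable_fun setT (q l))
  (qcm : forall x, completely_monotone (q ^~ x)) (q0 : forall x, q 0%N x = 1).

(** The measures are chosen separately for each [x], so measurability in [x] is not built in; it is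
    recovered from that of the moments. *)
Let m x : probability I01 R := sval (cid (hausdorff_moment (qcm x) (q0 x))).
Let mE x l : \int[m x]_s ((sval s : R) ^+ l) = q l x.
Proof. exact: (svalP (cid (hausdorff_moment (qcm x) (q0 x)))) l. Qed.

(** A class of integrands closed under bounded limits by [good_lim]: it grows from powers to
    exponentials, then to [gumbel] and to rays. *)
Let good (h : R -> R) := [/\ measurable_fun setT h,
  (exists C, forall y, 0 <= y <= 1 -> `|h y| <= C) &
  measurable_fun setT (fun x => \int[m x]_s h (sval s))].

Let good_lim (h : nat -> R -> R) (g : R -> R) C : (forall n, good (h n)) ->
  (forall n y, 0 <= y <= 1 -> `|h n y| <= C) -> measurable_fun setT g ->
  (forall y, 0 <= y <= 1 -> h n y @[n --> \oo] --> g y) -> good g.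
Proof.
move=> gh hC mg hg; split => //.
  exists C => y y01; rewrite -(cvg_lim (@Rhausdorff R) (cvg_norm (hg y y01))).
  apply: limr_le; first by apply/cvg_ex; eexists; exact: cvg_norm (hg y y01).
  by apply: nearW => n; exact: hC.
apply: (@measurable_fun_cvg _ _ _ _ (fun n x => \int[m x]_s h n (sval s))) => [n|x _].
  by have [] := gh n.
have k : (m x).-integrable setT (EFin \o (fun s : I01 => g (sval s))) /\
    \int[m x]_s h n (sval s) @[n --> \oo] --> \int[m x]_s g (sval s).
  apply: (@Rintegral_dominated_cvg _ _ _ (m x) (fun n s => h n (sval s)) (fun s => g (sval s)) (fun=> C)).
  - by move=> n; have [mh _ _] := gh n; exact: measurableT_comp mh (@measurable_sval_itv R).
  - by move=> s; apply: hg; exact: sval_itv01.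
  - by move=> n s; apply: hC; exact: sval_itv01.
  - exact: finite_measure_integrable_cst.
exact: k.2.
Qed.

Let good_int h x : good h -> (m x).-integrable setT (EFin \o (fun s : I01 => h (sval s))).
Proof.
move=> [mh [C hC] _]; apply: (@integrable_dominated _ _ _ _ _ (fun=> C)).
- exact: measurableT_comp mh (@measurable_sval_itv R).
- by move=> s; apply: hC; exact: sval_itv01.
- exact: finite_measure_integrable_cst.
Qed.

Let goodZ k h : good h -> good (fun y => k * h y).
Proof.
move=> gh; have [mh [C hC] ih] := gh; split; first exact: measurable_funM.
  by exists (`|k| * C) => y y01; rewrite normrM ler_wpM2l// hC.
rewrite (_ : (fun _ => _) = (fun x => k * \int[m x]_s h (sval s))).
  exact: measurable_funM.
by apply/funext => x; rewrite RintegralZl//; exact: good_int.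
Qed.

Let good_sum n (h : nat -> R -> R) : (forall i, good (h i)) -> good (fun y => \sum_(i < n) h i y).
Proof.
move=> gh; split.
- by apply: measurable_sum => i; have [] := gh i.
- pose C i := sval (cid (let: And3 _ b _ := gh i in b)).
  have hC i y : 0 <= y <= 1 -> `|h i y| <= C i by exact: svalP (cid (let: And3 _ b _ := gh i in b)) y.
  exists (\sum_(i < n) C i) => y y01; apply: le_trans (ler_norm_sum _ _ _) _.
  by apply: ler_sum => i _; exact: hC.
rewrite (_ : (fun _ => _) = (fun x => \sum_(i < n) \int[m x]_s h i (sval s))).
  by apply: measurable_sum => i; have [] := gh i.
apply/funext => x.
by apply: (@Rintegral_sum _ _ _ (m x) _ (index_enum 'I_n) xpredT (fun i s => h i (sval s))) => i _; exact: good_int.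
Qed.

Let good_pow l : good (fun y => y ^+ l).
Proof.
split; [exact: exprn_measurable|exists 1 => y /andP[y0 y1]; by rewrite ger0_norm ?exprn_ge0// exprn_ile1|].
by under eq_fun do rewrite mE; exact: mq.
Qed.

Let expR_partial (z : R) n : `|\sum_(i < n) z ^+ i / i`!%:R| <= expR `|z|.
Proof.
apply: le_trans (ler_norm_sum _ _ _) _.
have -> : \sum_(i < n) `|z ^+ i / i`!%:R| = series (exp_coeff `|z|) n.
  rewrite /series /= big_mkord; apply: eq_bigr => i _.
  by rewrite /exp_coeff /= normrM normrX normfV (ger0_norm (ler0n _ _)).
rewrite /expR; apply: nondecreasing_cvgn_le; last exact: is_cvg_series_exp_coeff.
apply/nondecreasing_seqP => k; rewrite /series /= big_nat_recr//= lerDl.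
by rewrite /exp_coeff /= divr_ge0// exprn_ge0.
Qed.

Let expR_cvg (z : R) : \sum_(i < n) z ^+ i / i`!%:R @[n --> \oo] --> expR z.
Proof.
have := is_cvg_series_exp_coeff z; rewrite /expR.
rewrite (_ : (fun n => _) = series (exp_coeff z)) //.
by apply/funext => n; rewrite /series /= big_mkord; apply: eq_bigr.
Qed.

Let good_exp (k : R) : good (fun y => expR (k * y)).
Proof.
apply: (@good_lim (fun n y => \sum_(i < n) (k * y) ^+ i / i`!%:R) _ (expR `|k|)).
- move=> n; apply: (good_sum n (h := fun i y => (k * y) ^+ i / i`!%:R)) => i.
  have -> : (fun y => (k * y) ^+ i / i`!%:R) = (fun y => (k ^+ i / i`!%:R) * y ^+ i).
    by apply/funext => y; rewrite exprMn mulrAC.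
  by apply: goodZ; exact: good_pow.
- move=> n y /andP[y0 y1]; apply: le_trans (expR_partial _ _) _.
  by rewrite ler_expR normrM ler_piMr// ger0_norm.
- by apply: measurableT_comp => //; exact: measurable_funM.
- by move=> y _; exact: expR_cvg.
Qed.

Let good_dexp (k r : R) : good (fun y => expR (- expR (k * (y - r)))).
Proof.
apply: (@good_lim (fun n y => \sum_(i < n) (- expR (k * (y - r))) ^+ i / i`!%:R) _
   (expR (expR (`|k| * (1 + `|r|))))).
- move=> n; apply: (good_sum n (h := fun i y => (- expR (k * (y - r))) ^+ i / i`!%:R)) => i.
  have -> : (fun y => (- expR (k * (y - r))) ^+ i / i`!%:R) =
      (fun y => ((-1) ^+ i * expR (- (i%:R * k * r)) / i`!%:R) * expR ((i%:R * k) * y)).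
    apply/funext => y.
    transitivity ((-1) ^+ i * expR (i%:R * (k * (y - r))) / i`!%:R).
      by rewrite expRM_natl (exprNn (expR _)).
    have -> : expR (i%:R * (k * (y - r))) = expR (- (i%:R * k * r)) * expR (i%:R * k * y).
      by rewrite -expRD; congr expR; ring.
    by ring.
  by apply: goodZ; exact: good_exp.
- move=> n y /andP[y0 y1]; apply: le_trans (expR_partial _ _) _.
  rewrite ler_expR normrN ger0_norm ?expR_ge0// ler_expR.
  apply: le_trans (ler_norm _) _; rewrite normrM ler_wpM2l//.
  by apply: le_trans (ler_normB _ _) _; rewrite lerD2r ger0_norm.
- apply: measurableT_comp => //; apply: measurableT_comp => //; apply: measurableT_comp => //.
  by apply: measurable_funM => //; exact: measurable_funB.
- by move=> y _; exact: expR_cvg.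
Qed.

Let good_gumbel_lim r : good (gumbel_lim r).
Proof.
apply: (@good_lim (fun n => gumbel r n) _ 1).
- move=> n; rewrite (_ : gumbel r n = (fun y => expR (- expR (- n%:R * (y - r))))).
    exact: good_dexp.
  by apply/funext => y; rewrite /gumbel mulNr -mulrN opprB.
- by move=> n y _; rewrite ger0_norm ?expR_ge0// expRN_le1// expR_ge0.
- apply: (@measurable_fun_cvg _ _ _ _ (fun n => gumbel r n)) => [n|y _]; last exact: gumbel_cvg.
  apply: measurableT_comp => //; apply: measurableT_comp => //; apply: measurableT_comp => //.
  by apply: measurable_funM => //; exact: measurable_funB.
- by move=> y _; exact: gumbel_cvg.
Qed.

Let good_ray r : good (fun y => if r < y then 1 else 0).
Proof.
(* The thresholds tend to [r] from above, which gives the strict ray. *)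
apply: (@good_lim (fun n => gumbel_lim (r + n.+1%:R^-1)) _ 1).
- by move=> n; exact: good_gumbel_lim.
- move=> n y _; rewrite /gumbel_lim; case: ifP => _; first by rewrite normr1.
  case: ifP => _; last by rewrite normr0.
  by rewrite ger0_norm ?expR_ge0// expRN_le1.
- apply: measurable_fun_ifT; [|exact: measurable_cst|exact: measurable_cst].
  exact: measurable_fun_ltr.
move=> y _; case: ltP => [ry|yr].
  apply: (@near_eq_cvgn _ _ (fun=> 1)); last exact: cvg_cst.
  have : \forall k \near \oo, k.+1%:R^-1 < y - r :> R.
    by apply: (cvgr_lt (0 : R)); [exact: cvg_harmonic|rewrite subr_gt0].
  by apply: filterS => k hk; rewrite /gumbel_lim -ltrBrDl hk.
apply: (@near_eq_cvgn _ _ (fun=> 0)); last exact: cvg_cst.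
apply: nearW => k; rewrite /gumbel_lim.
have h : y < r + k.+1%:R^-1 by rewrite (le_lt_trans yr)// ltrDl invr_gt0.
by rewrite ltNge (ltW h)/= lt_eqF.
Qed.

Let m_itv_le r : measurable_fun setT (fun x => m x (itv_le r)).
Proof.
have [_ _ mr] := good_ray r.
have E x : m x (itv_le r) = (1 - \int[m x]_s (if r < sval s then 1 else 0))%:E.
  have mC : measurable (~` itv_le r : set I01) by apply: measurableC; exact: measurable_itv_le.
  have -> : \int[m x]_s (if r < sval s then 1 else 0) = fine (m x (~` itv_le r)).
    transitivity (fine (\int[m x]_s (\1_(~` itv_le r) s)%:E)%E); last by rewrite integral_indic// setIT.
    congr fine; apply: eq_integral => s _; rewrite indicE; congr EFin.
    have [h|h] := boolP (s \in _).
      by move: h; rewrite inE /itv_le /= => /negP; rewrite -ltNge => ->.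
    by move: h; rewrite notin_setE /itv_le /= => /contrapT h; rewrite ltNge h.
  have e : (m x (~` itv_le r) = 1 - m x (itv_le r))%E.
    exact: probability_setC (measurable_itv_le r).
  have f := fin_num_measure (m x) _ (measurable_itv_le r).
  rewrite EFinB fineK ?fin_num_measure// e oppeB ?fin_num_adde_defr//.
  by rewrite addeA subee// add0e.
rewrite (funext E); apply/measurable_EFinP; exact: measurable_funB.
Qed.

Let m_measurable U : measurable U -> measurable_fun setT (fun x => m x U).
Proof.
move=> mU; have := mU; rewrite {1}itv_le_generate => gU.
apply: (@dynkin_induction _ I01 [set itv_le r | r in [set: R]]
  (fun U => measurable_fun setT (fun x => m x U))) gU.
- exact: itv_le_generate.
- exact: itv_le_setI_closed.
- rewrite (_ : (fun x => _) = fun=> 1%E); first exact: measurable_cst.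
  by apply/funext => x; exact: probability_setT.
- by move=> _ [r _ <-]; exact: m_itv_le.
- move=> S mS hS; rewrite (_ : (fun x => _) = (fun x => 1 - m x S)%E).
    by apply: emeasurable_funB => //; exact: measurable_cst.
  by apply/funext => x; exact: probability_setC.
- move=> F mF tF hF; rewrite (_ : (fun x => _) = (fun x => \sum_(n <oo) m x (F n))%E).
    apply: ge0_emeasurable_sum => //.
  apply/funext => x; apply/esym/cvg_lim => //.
  by apply: measure_semi_sigma_additive => //; exact: bigcup_measurable.
Qed.

Lemma hausdorff_kernel : exists Q : R.-pker X ~> I01,
  forall l x, \int[Q x]_s ((sval s : R) ^+ l) = q l x.
Proof.
exists (prob_kernel_of m_measurable) => l x; exact: mE.
Qed.

End hausdorff_kernel.

(** * Existence of the Dirichlet process *)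

Section quantile_coupling.
Context (R : realType) (X : pmetricType R) (P0 : probability (borel X) R).
Hypotheses (sepX : separable_space X) (P0na : nonatomic P0).
Context (A : set (borel X)) (mA : measurable A) (PA0 : (0 < P0 A)%E)
  (G : probability (borel (unit_itv R)) R).
Local Notation I01 := (borel (unit_itv R)).

Let al := fine (P0 A).
Let alE : P0 A = al%:E. Proof. by rewrite fineK// fin_num_measure. Qed.
Let al0 : 0 < al. Proof. by rewrite -lte_fin -alE. Qed.
Let F r := fine (G (itv_le r)).
Let FE r : (F r)%:E = G (itv_le r).
Proof. by rewrite fineK// fin_num_measure//; exact: measurable_itv_le. Qed.
Let F_homo : {homo F : x y / x <= y}.
Proof.
move=> x y xy; rewrite -lee_fin !FE; apply: le_measure; rewrite ?inE; [exact: measurable_itv_le|exact: measurable_itv_le|].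
by move=> s; rewrite /itv_le /= => /le_trans; exact.
Qed.
Let F0 r : 0 <= F r. Proof. exact: fine_ge0. Qed.
Let F1 r : 1 <= r -> F r = 1.
Proof.
move=> r1; apply: EFin_inj; rewrite FE (_ : itv_le r = setT) ?probability_setT//.
apply/seteqP; split => // s _; rewrite /itv_le /=.
by have /andP[_ h] := svalP s; apply: le_trans h r1.
Qed.
Let F_right r : F (r + n.+1%:R^-1) @[n --> \oo] --> F r.
Proof.
have hom : {homo (fun n : nat => itv_le (r + n.+1%:R^-1) : set I01) : a b / (a <= b)%N >-> (b <= a)%O}.
  move=> a b ab; apply/subsetPset => s; rewrite /itv_le /= => /le_trans; apply.
  by rewrite lerD2l lef_pV2 ?posrE// ler_nat.
have I : \bigcap_n itv_le (r + n.+1%:R^-1) = itv_le r :> set I01.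
  apply/seteqP; split => s; rewrite /itv_le /=; last by move=> h n _ /=; rewrite (le_trans h)// lerDl.
  move=> h; rewrite leNgt; apply/negP => rs.
  have : \forall k \near \oo, k.+1%:R^-1 < sval s - r :> R.
    by apply: (cvgr_lt (0 : R)); [exact: cvg_harmonic|rewrite subr_gt0].
  move=> [N _ /(_ N (leqnn N))] /= hN; have := h N Logic.I.
  by rewrite /itv_le /= leNgt -ltrBrDl hN.
have fin0 : (G (itv_le (r + 1%:R^-1)) < +oo)%E.
  by rewrite ltey_eq fin_num_measure//; exact: measurable_itv_le.
have := @nonincreasing_cvg_mu _ _ _ G (fun n : nat => itv_le (r + n.+1%:R^-1)) fin0
  (fun n => measurable_itv_le _).
rewrite I => /(_ (measurable_itv_le _) hom) h0.
have h : G (itv_le (r + n.+1%:R^-1)) @[n --> \oo] --> (F r)%:E by rewrite FE; exact: h0.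
exact: (fine_cvg h).
Qed.

(** [g] is the quantile function of [G] applied to a variable that is uniform on [[0, P0(A)]] under
    [P0] restricted to [A]. *)
Lemma quantile_coupling : exists2 g : borel X -> I01, measurable_fun setT g &
  forall B, measurable B -> P0 (A `&` g @^-1` B) = (P0 A * G B)%E.
Proof.
have [V0 mV0 VP0] := uniform_exists sepX P0na mA.
(* Truncation at [al] puts [1] into every set [S x] below. *)
pose V x := Num.min (V0 x) al.
have mV : measurable_fun setT V by apply: measurable_minr => //; exact: measurable_cst.
have VP t : 0 <= t <= al -> P0 (A `&` [set x | V x <= t]) = t%:E.
  move=> /andP[t0]; rewrite le_eqVlt => /orP[/eqP ->|ta].
    rewrite -alE; congr (P0 _); apply/seteqP; split => [x []//|x Ax]; split => //=.
    by rewrite ge_min lexx orbT.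
  rewrite -VP0//; last by rewrite alE lee_fin ltW.
  have Vt x : (V x <= t) = (V0 x <= t) by rewrite /V ge_min [al <= t]leNgt ta orbF.
  by congr (P0 _); apply/seteqP; split => x [Ax /=] h; split => //=; move: h; rewrite Vt.
pose S x := [set s : R | 0 <= s <= 1 /\ V x <= al * F s].
have S1 x : S x 1 by split; rewrite ?ler01 ?lexx// F1// mulr1 ge_min lexx orbT.
have lbS x : lbound (S x) 0 by move=> s [/andP[]].
have hiS x : has_inf (S x) by split; [exists 1|exists 0].
pose q x := inf (S x).
have q01 x : 0 <= q x <= 1.
  apply/andP; split; first by apply: lb_le_inf; [exists 1|exact: lbS].
  by apply: ge_inf; [exists 0|exact: S1].
(* Right continuity of [F] makes [q x <= s] equivalent to a condition on [V x], whose law is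
   known. *)
have qle x s : 0 <= s -> s <= 1 -> (q x <= s) = (V x <= al * F s).
  move=> s0 s1; apply/idP/idP => h; last first.
    by apply: ge_inf; [exists 0|split => //; rewrite s0].
  have lim : al * F (s + n.+1%:R^-1) @[n --> \oo] --> al * F s.
    by apply: cvgMl_tmp; exact: F_right.
  rewrite -(cvg_lim (@Rhausdorff R) lim); apply: limr_ge; first by apply/cvg_ex; eexists; exact: lim.
  apply: nearW => n; have [s' [s'01 Vs'] s's] : exists2 s', S x s' & s' < s + n.+1%:R^-1.
    have e0 : 0 < s + n.+1%:R^-1 - q x by rewrite subr_gt0 (le_lt_trans h)// ltrDl invr_gt0.
    have [s' Ss' hs'] := inf_adherent e0 (hiS x); exists s' => //.
    by rewrite /q addrC subrK in hs'.
  apply: le_trans Vs' _; rewrite ler_wpM2l ?(ltW al0)//; apply: F_homo; exact: ltW.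
pose g x : I01 := exist _ (q x) (q01 x).
have gle s : g @^-1` itv_le s = if s < 0 then set0 else if 1 < s then setT else [set x | V x <= al * F s].
  case: ltP => [s0|s0].
    apply/seteqP; split => // x; rewrite /itv_le /= => h.
    by have /andP[h0 _] := q01 x; have := le_lt_trans (le_trans h0 h) s0; rewrite ltxx.
  case: ltP => [s1|s1].
    apply/seteqP; split => // x _; rewrite /itv_le /=.
    by have /andP[_ h1] := q01 x; apply: ltW; apply: le_lt_trans h1 s1.
  by apply/seteqP; split => x; rewrite /itv_le /= qle.
have mVs t : measurable [set x | V x <= t].
  rewrite -[X in measurable X]setTI (_ : [set x | _] = V @^-1` [set` `]-oo, t]]); first exact: mV.
  by apply/seteqP; split => x /=; rewrite in_itv.
have mg : measurable_fun setT g.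
  apply: (@measurability _ _ (borel X) I01 setT g [set itv_le r | r in [set: R]] (@itv_le_generate R)).
  move=> _ [_ [r _ <-] <-]; rewrite setTI gle.
  by case: ifP => // _; case: ifP.
exists g => // B mB.
have i0 (x : borel X) : 0 <= (\1_A x : R) by rewrite indicE ler0n.
have wE C : measurable C -> weighted_law P0 g (\1_A) C = P0 (A `&` g @^-1` C).
  move=> mC; rewrite /weighted_law integral_indic//.
  by rewrite -[_ @^-1` _]setTI; exact: mg.
have sE C : mscale (NngNum (ltW al0)) G C = (P0 A * G C)%E by rewrite /mscale /= alE.
rewrite -wE// -sE.
apply: (@measure_unique _ R I01 [set itv_le r | r in [set: R]] (fun=> itv_le 1)
  (@itv_le_generate R) (@itv_le_setI_closed R) _ _
  (weighted_law_measure P0 mg (measurable_indic mA) i0) (mscale (NngNum (ltW al0)) G)) => //.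
- by apply/seteqP; split => // s _; exists 0%N => //; rewrite /itv_le /=; have /andP[] := svalP s.
- move=> _ [r _ <-]; rewrite [RHS]sE [LHS]wE//; last exact: measurable_itv_le.
  rewrite gle; case: ltP => [r0|r0].
    rewrite setI0 measure0 (_ : itv_le r = set0) ?measure0 ?mule0//.
    apply/seteqP; split => // s; rewrite /itv_le /= => h.
    by have /andP[h0 _] := svalP s; have := le_lt_trans (le_trans h0 h) r0; rewrite ltxx.
  case: ltP => [r1|r1].
    by rewrite setIT -FE F1 ?mule1// ltW.
  rewrite VP ?mulr_ge0 ?(ltW al0)//=; last first.
    by rewrite ler_piMr ?(ltW al0)// -(F1 (lexx 1)) F_homo.
  by rewrite alE -FE -EFinM.
- move=> _; rewrite [X in (X < _)%E]wE; last exact: measurable_itv_le.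
  rewrite ltey_eq fin_num_measure//; apply: measurableI => //.
  by rewrite -[_ @^-1` _]setTI; apply: mg => //; exact: measurable_itv_le.
Qed.

End quantile_coupling.

Section pushed_kernel.
Context (R : realType) (X Y : pmetricType R) d (Omega : measurableType d)
  (mu : R.-ker Omega ~> borel X) (A : set (borel X)) (g : borel X -> borel Y).
Hypotheses (mA : measurable A).

Let H (w : Omega) (x : borel X) : R :=
  ((mu w [set: borel X] < +oo)%E)%:R * \1_A x.
Let H0 w x : 0 <= H w x. Proof. by rewrite /H mulr_ge0// indicE ler0n. Qed.
Let mH w : measurable_fun setT (H w).
Proof. by apply: measurable_funM; [exact: measurable_cst|exact: measurable_indic]. Qed.

(* The pushforward of [mu w] restricted to [A], set to [0] when the total mass is infinite. *)
Definition pushed_kernel (mg : measurable_fun setT g) (w : Omega) :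
  {measure set (borel Y) -> \bar R} := weighted_law_measure (mu w) mg (mH w) (H0 w).

Hypothesis mg : measurable_fun setT g.

Let mgB B : measurable B -> measurable (A `&` g @^-1` B).
Proof. by move=> mB; apply: measurableI => //; rewrite -[_ @^-1` _]setTI; exact: mg. Qed.

Lemma pushed_kernelE w B : measurable B -> pushed_kernel mg w B =
  if (mu w [set: borel X] < +oo)%E then mu w (A `&` g @^-1` B) else 0%E.
Proof.
move=> mB; rewrite /pushed_kernel /= /weighted_law /H; case: ifPn => h.
  under eq_integral do rewrite mul1r.
  by rewrite integral_indic// -[_ @^-1` _]setTI; exact: mg.
by rewrite integral0_eq// => x _; rewrite mul0r.
Qed.

Let pushed_kernel_measurable B : measurable B ->
  measurable_fun [set: Omega] (fun w => pushed_kernel mg w B).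
Proof.
move=> mB; rewrite (_ : (fun w => _) = (fun w => if (mu w [set: borel X] < +oo)%E then
    mu w (A `&` g @^-1` B) else 0%E)); last by apply/funext => w; exact: pushed_kernelE.
apply: measurable_fun_ifT; [|by apply: measurable_kernel; exact: mgB|exact: measurable_cst].
apply: (measurable_fun_lte (f := fun w => mu w setT) (g := fun=> +oo%E)) => //.
exact: measurable_kernel.
Qed.

HB.instance Definition _ := isKernel.Build _ _ Omega (borel Y) R (pushed_kernel mg)
  pushed_kernel_measurable.

Lemma integral_pushed_kernel w (f : borel Y -> \bar R) : (mu w [set: borel X] < +oo)%E ->
  measurable_fun setT f -> (forall y, 0 <= f y)%E ->
  (\int[pushed_kernel mg w]_y f y = \int[mu w]_x (f (g x) * (\1_A x)%:E))%E.
Proof.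
move=> fin mf f0.
have := @ge0_integral_comp_weight _ _ _ _ _ _ _ (mu w) (pushed_kernel mg w) g id
  (H w) (fun=> 1) mg (@measurable_id _ _ _) (mH w) (measurable_cst _) (H0 w) (fun=> ler01) _ f mf f0.
have e B : measurable B -> (\int[mu w]_(t in g @^-1` B) (H w t)%:E =
    \int[pushed_kernel mg w]_(t in id @^-1` B) 1%:E)%E.
  by move=> mB; rewrite integral_cst ?mul1e.
move=> /(_ e) h.
transitivity (\int[pushed_kernel mg w]_y (f y * 1%:E))%E; first by apply: eq_integral => y _; rewrite mule1.
by rewrite -h; apply: eq_integral => x _; rewrite /H fin mul1r.
Qed.

End pushed_kernel.

Section pushed_gamma.
Context (R : realType) (X Y : pmetricType R) (P0 : probability (borel X) R)
  d (Omega : measurableType d) (P : probability Omega R) (c : R)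
  (mu : R.-ker Omega ~> borel X).
Hypotheses (c_gt0 : 0 < c) (gmu : gamma_crm P c P0 mu).
Context (A : set (borel X)) (mA : measurable A) (g : borel X -> borel Y)
  (mg : measurable_fun setT g) (G : probability (borel Y) R).
Hypothesis gG : forall B, measurable B -> P0 (A `&` g @^-1` B) = (P0 A * G B)%E.

Let nu : R.-ker Omega ~> borel Y := pushed_kernel mu mA mg.

Let c0 : 0 <= c. Proof. exact: ltW. Qed.
Let fin : {ae P, forall w, (mu w [set: borel X] < +oo)%E}.
Proof. exact: (crm_finite_ae c0 gmu). Qed.
Let mgB B : measurable B -> measurable (A `&` g @^-1` B).
Proof. by move=> mB; apply: measurableI => //; rewrite -[_ @^-1` _]setTI; exact: mg. Qed.

Let nuE w B : measurable B ->
  nu w B = if (mu w [set: borel X] < +oo)%E then mu w (A `&` g @^-1` B) else 0%E.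
Proof. exact: pushed_kernelE. Qed.

Lemma integral_coupling (f : borel Y -> \bar R) : measurable_fun setT f -> (forall y, 0 <= f y)%E ->
  (\int[P0]_x (f (g x) * (\1_A x)%:E) = (fine (P0 A))%:E * \int[G]_y f y)%E.
Proof.
move=> mf f0; have i0 (x : borel X) : 0 <= (\1_A x : R) by rewrite indicE ler0n.
have a0 : 0 <= fine (P0 A) by exact: fine_ge0.
have := @ge0_integral_comp_weight _ _ _ _ _ _ _ P0 G g id
  (\1_A) (fun=> fine (P0 A)) mg (@measurable_id _ _ _) (measurable_indic mA) (measurable_cst _)
  i0 (fun=> a0) _ f mf f0.
have e B : measurable B -> (\int[P0]_(t in g @^-1` B) (\1_A t)%:E =
    \int[G]_(t in id @^-1` B) (fine (P0 A))%:E)%E.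
  move=> mB; have mgP : measurable (g @^-1` B) by rewrite -[_ @^-1` _]setTI; exact: mg.
  transitivity (P0 (A `&` g @^-1` B)); first by rewrite integral_indic.
  by rewrite gG// integral_cst// fineK// fin_num_measure.
move=> /(_ e) ->; rewrite -ge0_integralZl//; apply: eq_integral => y _; exact: muleC.
Qed.

(** Preimages of disjoint sets are disjoint, so independence is inherited; and since
    [ln (1 + f(g) 1_A) = 1_A ln (1 + f(g))], the Laplace functional is that of [mu] at
    [f(g) 1_A]. *)
Lemma pushed_gamma_crm : gamma_crm P (c * fine (P0 A)) G nu.
Proof.
have [[_ ind] lap] := gmu; split; first split.
- move=> w B mB _; rewrite nuE//; case: ifPn => // h.
  by apply: le_lt_trans h; apply: le_measure; rewrite ?inE//; exact: mgB.
- move=> k B mB tB C mC.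
  have tAB : trivIset [set: 'I_k] (fun i => A `&` g @^-1` B i).
    move=> i j _ _ [x [[_ hi] [_ hj]]]; apply: tB => //; by exists (g x).
  have := ind k (fun i => A `&` g @^-1` B i) (fun i => mgB (mB i)) tAB C mC.
  have mC' (m : R.-ker Omega ~> borel X) i : measurable ((fun w => m w (A `&` g @^-1` B i)) @^-1` C i).
    by rewrite -[_ @^-1` _]setTI; apply: measurable_kernel => //; exact: mgB.
  have mC2 i : measurable ((fun w => nu w (B i)) @^-1` C i).
    by rewrite -[_ @^-1` _]setTI; apply: measurable_kernel.
  have nu_ae : {ae P, forall w, forall i, nu w (B i) = mu w (A `&` g @^-1` B i)}.
    by apply: filterS fin => w h i; rewrite nuE// h.
  have e i : P ((fun w => mu w (A `&` g @^-1` B i)) @^-1` C i) = P ((fun w => nu w (B i)) @^-1` C i).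
    by apply: ae_eq_measure => //; apply: filterS nu_ae => w /(_ i) h; rewrite /preimage/mkset h.
  have e2 : P (\bigcap_(i in [set: 'I_k]) ((fun w => mu w (A `&` g @^-1` B i)) @^-1` C i)) =
            P (\bigcap_(i in [set: 'I_k]) ((fun w => nu w (B i)) @^-1` C i)).
    apply: ae_eq_measure.
    - by apply: fin_bigcap_measurable => //; exact: finite_finset.
    - by apply: fin_bigcap_measurable => //; exact: finite_finset.
    - by apply: filterS nu_ae => w h; split => hw i _; have := hw i Logic.I; rewrite /preimage/mkset h.
  by rewrite e2 => ->; apply: eq_bigr => i _; rewrite e.
move=> f mf f0 lf.
pose F x := f (g x) * \1_A x.
have mF : measurable_fun setT F.
  by apply: measurable_funM; [exact: measurableT_comp mf mg|exact: measurable_indic].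
have F0 x : 0 <= F x by rewrite /F mulr_ge0// indicE ler0n.
have mln : measurable_fun setT (fun y => (ln (1 + f y))%:E).
  by apply/measurable_EFinP; apply: measurableT_comp => //; exact: measurable_funD.
have ln0 y : (0 <= (ln (1 + f y))%:E)%E by rewrite lee_fin ln_ge0// lerDl.
have lF : (\int[P0]_x (ln (1 + F x))%:E = (fine (P0 A))%:E * \int[G]_y (ln (1 + f y))%:E)%E.
  rewrite -integral_coupling//; apply: eq_integral => x _; rewrite /F indicE.
  by case: (x \in A); rewrite ?mulr1 ?mule1// mulr0 mule0 addr0 ln1.
have finF : (\int[P0]_x (ln (1 + F x))%:E < +oo)%E.
  by rewrite lF lte_mul_pinfty// lee_fin fine_ge0.
rewrite EFinM -muleA -lF -(lap F mF F0 finF).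
have mi (m : R.-ker Omega ~> borel Y) : measurable_fun setT (fun w => (\int[m w]_x (f x)%:E)%E).
  apply: (@measurable_fun_integral_kernel _ _ _ _ _ (fun w => m w) _ (fun x => (f x)%:E)).
  - by move=> U mU; exact: measurable_kernel.
  - by move=> x; rewrite lee_fin.
  - exact/measurable_EFinP.
have miF : measurable_fun setT (fun w => (\int[mu w]_x (F x)%:E)%E).
  apply: (@measurable_fun_integral_kernel _ _ _ _ _ (fun w => mu w) _ (fun x => (F x)%:E)).
  - by move=> U mU; exact: measurable_kernel.
  - by move=> x; rewrite lee_fin.
  - exact/measurable_EFinP.
apply: ae_eq_integral => //.
- by apply: measurable_expeRN => // w; apply: integral_ge0 => x _; rewrite lee_fin.
- by apply: measurable_expeRN => // w; apply: integral_ge0 => x _; rewrite lee_fin.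
apply: filterS fin => w h _; congr (expeR (- _)%E).
by rewrite /nu /= integral_pushed_kernel//; exact/measurable_EFinP.
Qed.

End pushed_gamma.

Section dirichlet_existence.
Context (R : realType) (G : probability (borel (unit_itv R)) R) (a : R)
  d (Omega : measurableType d) (P : probability Omega R)
  (nu : R.-ker Omega ~> borel (unit_itv R)).
Hypotheses (a0 : 0 < a) (gnu : gamma_crm P a G nu).

(** [knormalize] falls back on [G] where the total mass is [0] or infinite, a null event. *)
Let p : R.-pker Omega ~> borel (unit_itv R) := knormalize nu G.

Lemma dirichlet_process_normalize : dirichlet_process P a G p.
Proof.
exists nu => //.
have sv01 (x : borel (unit_itv R)) : 0 <= (sval x : R) <= 1 by exact: sval_itv01.
apply: filterS (crm_mass_gt0 a0 gnu (@measurable_sval_itv R) sv01) => w m0 U mU.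
have fin : (nu w [set: borel (unit_itv R)] < +oo)%E.
  by move: m0; rewrite /fmass; case: ifPn => // _; rewrite ltxx.
have M0 : 0 < fine (nu w setT) by move: m0; rewrite /fmass fin.
rewrite /p /= /knormalize /mnormalize.
have -> : (nu w [set: borel (unit_itv R)] == 0%E) || (nu w [set: borel (unit_itv R)] == +oo%E) = false.
  apply/negbTE; rewrite negb_or; apply/andP; split; last by rewrite lt_eqF.
  by apply/eqP => h; move: M0; rewrite h ltxx.
rewrite EFinM fineK// ge0_fin_numE//; apply: le_lt_trans fin.
by apply: le_measure; rewrite ?inE.
Qed.

Lemma dirichlet_mean_exists : exists Z : {RV P >-> R}, dirichlet_mean a G Z /\
  forall n, fine ('E_P[fun w => (Z w ^+ n)%R])%E = \int[P]_w (kernel_mean p w ^+ n).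
Proof.
pose Z : {RV P >-> R} := HB.pack (kernel_mean p)
  (isMeasurableFun.Build _ _ _ _ (kernel_mean p) (measurable_kernel_mean p)).
exists Z; split; last by move=> n; rewrite unlock.
by exists d, Omega, P, p; split; [exact: dirichlet_process_normalize|].
Qed.

End dirichlet_existence.

Section necessity.
Context (R : realType) (X : pmetricType R) (P0 : probability (borel X) R)
  d (Omega : measurableType d) (P : probability Omega R) (c : R)
  (mu1 mu2 : R.-ker Omega ~> borel X).
Hypotheses (c_gt0 : 0 < c) (gamma1 : gamma_crm P c P0 mu1)
  (gamma2 : gamma_crm P c P0 mu2)
  (canon12 : in_canonical_correlation P c P0 mu1 mu2)
  (indep12 : independent_increments P mu1 mu2).
Hypotheses (sepX : separable_space X) (P0na : nonatomic P0).

Theorem kernel_of_independent_increments :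
  exists Q : R.-pker borel X ~> borel (unit_itv R),
    forall (A : set (borel X)) (mA : measurable A) (PA0 : (0 < P0 A)%E),
    exists (d' : measure_display) (T : measurableType d')
      (PT : probability T R) (Z : {RV PT >-> R}),
      dirichlet_mean (c * fine (P0 A)) (mixture Q mA PA0) Z /\
      canonical_coefficients P c P0 mu1 mu2 (fun _ : 'I_1 => A)
        (fun n => fine ('E_PT[fun w => (Z w ^+ n ord0)%R])%E).
Proof.
have [q [mq qcm q0 qE]] := crm_moment_kernel c_gt0 gamma1 gamma2 canon12 indep12 sepX P0na.
(* The uniform variable through which the moment problem is solved is taken on the space [X]
   itself. *)
have [V mV VP0] := uniform_exists sepX P0na (measurableT : measurable [set: borel X]).
have VP t : 0 <= t <= 1 -> P0 [set x | V x <= t] = t%:E.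
  move=> /andP[t0 t1]; rewrite -(VP0 t t0); first by rewrite setTI.
  by rewrite probability_setT lee_fin.
have [Q hQ] := hausdorff_kernel mV VP mq qcm q0.
exists Q => A mA PA0; set G := mixture Q mA PA0.
have a0 : 0 < c * fine (P0 A) by exact: (shape_gt0 c_gt0 PA0 mA).
have [g mg gG] := quantile_coupling sepX P0na mA PA0 G.
have gnu := pushed_gamma_crm c_gt0 gamma1 mA mg gG.
have [Z [dm ZE]] := dirichlet_mean_exists a0 gnu.
exists d, Omega, P, Z; split => //.
apply/(coefficients_crm_coef c_gt0 gamma1 gamma2 canon12 _ mA PA0) => n.
rewrite ffunE ZE.
have [ld _] := dirichlet_kernel_mean a0 (dirichlet_process_normalize a0 gnu).
(* Both sequences start at [1] and have the same cumulants, namely [c] times the moments of [Q]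
   integrated over [A]. *)
apply: (@logderiv_uniq _ (crm_moment_seq P0 P c mu1 mu2 A) (crm_coef P0 P c mu1 mu2 A)
  (fun n => \int[P]_w (kernel_mean (knormalize (pushed_kernel mu1 mA mg) G) w ^+ n) * risq (shape P0 c A) n)).
- by rewrite crm_coef_at0 risq0 mulr1 -[LHS](Ex_cst P); exact: eq_Ex.
- exact: crm_moment_seq_logderiv.
apply: eq_logderiv ld => l _.
rewrite -(qE A l mA) (mixture_moment c Q mA PA0 l); congr (_ * fine _).
by apply: eq_integral => x _; rewrite /kernel_moment hQ.
Qed.

End necessity.

Theorem theorem3 (R : realType) (X : completePMetricType R)
    (sepX : separable_space X) (c : R) (c_gt0 : 0 < c)
    (P0 : probability (borel X) R) (P0na : nonatomic P0)
    (d : measure_display) (Omega : measurableType d) (P : probability Omega R)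
    (mu1 mu2 : R.-ker Omega ~> borel X)
    (gamma1 : gamma_crm P c P0 mu1) (gamma2 : gamma_crm P c P0 mu2)
    (canon12 : in_canonical_correlation P c P0 mu1 mu2) :
  independent_increments P mu1 mu2 <->
  exists Q : R.-pker borel X ~> borel (unit_itv R),
    forall (A : set (borel X)) (mA : measurable A) (PA0 : (0 < P0 A)%E),
    exists (d' : measure_display) (T : measurableType d')
      (PT : probability T R) (Z : {RV PT >-> R}),
      dirichlet_mean (c * fine (P0 A)) (mixture Q mA PA0) Z /\
      canonical_coefficients P c P0 mu1 mu2 (fun _ : 'I_1 => A)
        (fun n => fine ('E_PT[fun w => (Z w ^+ n ord0)%R])%E).
Proof.
split=> [indep12|[Q hQ]].
  exact: (kernel_of_independent_increments c_gt0 gamma1 gamma2 canon12 indep12 sepX P0na).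
exact: (independent_increments_of_kernel c_gt0 gamma1 gamma2 canon12 sepX P0na hQ).
Qed.
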